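(* Let $(f_m)_{m\in\mathbb{N}}$ be a sequence of functions $f_m\in S$ with Taylor expansions $f_m(z)=\sum_{n=1}^{\infty}a_n^{(m)}z^n$, and let $\epsilon>0$ be arbitrary. Suppose that (i) $(f_m)$ converges locally uniformly in $\mathbb{D}$ to a function $f\in S$ as $m\to\infty$; (ii) $\alpha_m\to\alpha$ as $m\to\infty$, where $\alpha_m$ and $\alpha$ denote the Hayman indexes of $f_m$ and $f$ respectively. Then there exists a constant $N(\epsilon)$, depending only on $\epsilon$ (for the given sequence), such that \[ \frac{|a_n^{(m)}|}{n}<\epsilon+\sqrt{\alpha_m} \] whenever $m,n>N(\epsilon)$.
   Context: $\mathbb{D}$ is the open unit disk and $S$ is the class of schlicht functions, i.e. functions $f(z)=z+\sum_{n\ge2}a_nz^n$ analytic and univalent in $\mathbb{D}$. For $f\in S$ let $M_\infty(r,f)=\max\{|f(z)|:|z|=r\}$; the Hayman index of $f$ is $\alpha(f)=\lim_{r\to1^-}(1-r)^2M_\infty(r,f)$, which exists and satisfies $0\le\alpha(f)\le1$. *)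

(* Defs.v *)
From Stdlib Require Import Reals.
From Coquelicot Require Import Coquelicot.
Open Scope R_scope.

Definition in_disk (z : C) : Prop := Cmod z < 1.

Definition schlicht_coeffs (f : C -> C) (a : nat -> C) : Prop :=
  a 0%nat = 0%C /\ a 1%nat = 1%C /\
  (forall z : C, in_disk z -> is_series (fun n => (a n * pow_n z n)%C) (f z)) /\
  (forall z w : C, in_disk z -> in_disk w -> f z = f w -> z = w).

Definition schlicht (f : C -> C) : Prop := exists a, schlicht_coeffs f a.

Definition Minf (r : R) (f : C -> C) : R :=
  real (Lub_Rbar (fun y => exists z : C, Cmod z = r /\ y = Cmod (f z))).

Definition is_hayman_index (f : C -> C) (alpha : R) : Prop :=
  filterlim (fun r => (1 - r) ^ 2 * Minf r f) (at_left 1) (locally alpha).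

Definition loc_unif_conv_disk (fs : nat -> C -> C) (f : C -> C) : Prop :=
  forall z0 : C, in_disk z0 ->
    exists delta : R, 0 < delta /\
      (forall z, Cmod (z - z0)%C < delta -> in_disk z) /\
      (forall eps : R, 0 < eps -> exists N : nat, forall m : nat, (N <= m)%nat ->
         forall z, Cmod (z - z0)%C < delta -> Cmod (fs m z - f z)%C < eps).

(* Main.v *)
Require Import Defs.
From Stdlib Require Import Reals Lra Lia Psatz Arith ClassicalEpsilon.
From Coquelicot Require Import Coquelicot.
Open Scope R_scope.

(** Write [log (f z / z) = 2 (g_1 z + g_2 z^2 + ...)] and
    [M r = max |f|] on the circle of radius [r].  The second Lebedev-Milin
    inequality gives [|a_n| / n <= exp (sum_{k<n} (1 - k/n) (k |g_k|^2 - 1/k))].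

    If the Hayman index [alpha] is positive, let [xi] be a direction of maximal
    growth.  Expanding the square around [conj xi ^ k / k] splits the exponent
    into at most [sum k |g_k - conj xi ^ k / k|^2 <= (log (1/alpha)) / 2], by
    Bazilevich's inequality, and a Cesaro mean of [2 Re (g_k xi^k) - 2/k].  The
    Abel means of the latter are [log ((1-r)^2 |f (r xi)| / r)], which lie
    between [log alpha_m] and [log ((1-r)^2 M r / r)]; as these expressions
    decrease in [r] and converge locally uniformly, the Abel means are close to
    [log alpha] uniformly in [m], and a Tauberian theorem with constants
    depending only on Bazilevich's bound carries this over to the Cesaro means.
    The exponent is therefore about [(log alpha_m) / 2].

    If [alpha = 0], Grunsky's inequality at radius [rho = 1 - 1/(2n)] bounds
    [sum k |g_k|^2 rho^(2k)] by half of [log (R1 / rho)] for any [R1 > M rho],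
    so that the exponent is about [log ((1-rho)^2 M rho) / 2] and tends to
    [- infinity].

    Grunsky's inequality compares the logarithmic energies of charges placed at
    the points [f z_j / R] and [z_j], where the [z_j] are scaled roots of unity;
    the former is controlled because [- log (1 - s K)] is positive semidefinite
    for the kernel [K v w = (1 - |v|^2) (1 - |w|^2) / |1 - v conj w|^2].
    Bazilevich's inequality is the limit of Goluzin's inequality, a consequence
    of Grunsky's, at points tending to the boundary in the direction [xi]. *)

(** * Finite sums *)

(** Functions are coefficient sequences throughout. Logarithms, reciprocals and square roots are
    formal series, tied to values by [flog_ev] and [ev_finv]; circle integrals become averages over
    roots of unity, and the maximum principle becomes a coefficient estimate for a reciprocal. Only
    logarithms of moduli are taken, so no branch has to be chosen.

    The case split is forced: Bazilevich's bound is infinite when alpha = 0, while the argument for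
    alpha = 0 loses a constant factor and cannot give sqrt alpha. Uniformity in m comes from the
    order of choices: the Tauberian constants precede the function, and monotonicity in r lets a
    single radius, at which f_m is close to f, control all larger ones.

    The logarithmic energy is infinite on the diagonal. With N charges this is repaired by a term of
    size N^-3 on the side of the image points and by the factor 1 - N^-2 on the side of the roots of
    unity. The two diagonals then differ by O(log N), in total O(N log N), which disappears against
    the scale N^2 of Grunsky's form. *)

Fixpoint rsum (n : nat) (F : nat -> R) : R :=
  match n with O => 0 | S m => rsum m F + F m end.

Fixpoint csum (n : nat) (F : nat -> C) : C :=
  match n with O => RtoC 0 | S m => (csum m F + F m)%C end.

Lemma rsum_ext n F G : (forall i, (i < n)%nat -> F i = G i) -> rsum n F = rsum n G.
Proof.
induction n as [|n IH]; intros H; simpl; [easy|].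
rewrite IH, (H n); auto.
Qed.

Lemma csum_ext n F G : (forall i, (i < n)%nat -> F i = G i) -> csum n F = csum n G.
Proof.
induction n as [|n IH]; intros H; simpl; [easy|].
rewrite IH, (H n); auto.
Qed.

Lemma rsum_plus n F G : rsum n (fun i => F i + G i) = rsum n F + rsum n G.
Proof. induction n as [|n IH]; simpl; [ring|]. rewrite IH; ring. Qed.

Lemma csum_plus n F G : csum n (fun i => F i + G i)%C = (csum n F + csum n G)%C.
Proof. induction n as [|n IH]; simpl; [ring|]. rewrite IH; ring. Qed.

Lemma rsum_scal n c F : rsum n (fun i => c * F i) = c * rsum n F.
Proof. induction n as [|n IH]; simpl; [ring|]. rewrite IH; ring. Qed.

Lemma csum_scal n c F : csum n (fun i => c * F i)%C = (c * csum n F)%C.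
Proof. induction n as [|n IH]; simpl; [ring|]. rewrite IH; ring. Qed.

Lemma csum_scal_r n c F : csum n (fun i => F i * c)%C = (csum n F * c)%C.
Proof. induction n as [|n IH]; simpl; [ring|]. rewrite IH; ring. Qed.

Lemma rsum_minus n F G : rsum n (fun i => F i - G i) = rsum n F - rsum n G.
Proof. induction n as [|n IH]; simpl; [ring|]. rewrite IH; ring. Qed.

Lemma csum_minus n F G : csum n (fun i => F i - G i)%C = (csum n F - csum n G)%C.
Proof. induction n as [|n IH]; simpl; [ring|]. rewrite IH; ring. Qed.

Lemma rsum_0 n F : (forall i, (i < n)%nat -> F i = 0) -> rsum n F = 0.
Proof.
induction n as [|n IH]; intros H; simpl; [easy|].
rewrite IH, (H n); auto; ring.
Qed.

Lemma csum_0 n F : (forall i, (i < n)%nat -> F i = RtoC 0) -> csum n F = RtoC 0.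
Proof.
induction n as [|n IH]; intros H; simpl; [easy|].
rewrite IH, (H n); auto; ring.
Qed.

Lemma rsum_const n c : rsum n (fun _ => c) = INR n * c.
Proof. induction n as [|n IH]; simpl rsum; [simpl; ring|]. rewrite IH, S_INR; ring. Qed.

Lemma csum_const n c : csum n (fun _ => c) = (RtoC (INR n) * c)%C.
Proof.
induction n as [|n IH]; simpl csum; [simpl; ring|].
rewrite IH, S_INR, RtoC_plus; ring.
Qed.

Lemma rsum_le n F G : (forall i, (i < n)%nat -> F i <= G i) -> rsum n F <= rsum n G.
Proof.
induction n as [|n IH]; intros H; simpl; [lra|].
apply Rplus_le_compat; auto.
Qed.

Lemma rsum_ge0 n F : (forall i, (i < n)%nat -> 0 <= F i) -> 0 <= rsum n F.
Proof.
induction n as [|n IH]; intros H; simpl; [lra|].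
apply Rplus_le_le_0_compat; auto.
Qed.

Lemma rsum_incr n m F : (n <= m)%nat -> (forall i, 0 <= F i) -> rsum n F <= rsum m F.
Proof.
intros Hnm HF; induction Hnm as [|m Hnm IH]; simpl; [lra|].
specialize (HF m); lra.
Qed.

Lemma rsum_term n F i : (i < n)%nat -> (forall i, 0 <= F i) -> F i <= rsum n F.
Proof.
intros Hi HF; apply Rle_trans with (rsum (S i) F).
- simpl; pose proof (rsum_ge0 i F (fun j _ => HF j)); lra.
- apply rsum_incr; auto.
Qed.

Lemma rsum_abs n F : Rabs (rsum n F) <= rsum n (fun i => Rabs (F i)).
Proof.
induction n as [|n IH]; simpl; [rewrite Rabs_R0; lra|].
eapply Rle_trans; [apply Rabs_triang|]; lra.
Qed.

Lemma Cmod_csum n F : Cmod (csum n F) <= rsum n (fun i => Cmod (F i)).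
Proof.
induction n as [|n IH]; simpl; [rewrite Cmod_0; lra|].
eapply Rle_trans; [apply Cmod_triangle|]; lra.
Qed.

Lemma Re_plus x y : Re (x + y)%C = Re x + Re y. Proof. reflexivity. Qed.
Lemma Im_plus x y : Im (x + y)%C = Im x + Im y. Proof. reflexivity. Qed.
Lemma Re_minus x y : Re (x - y)%C = Re x - Re y. Proof. reflexivity. Qed.
Lemma Im_minus x y : Im (x - y)%C = Im x - Im y. Proof. reflexivity. Qed.
Lemma Re_mult x y : Re (x * y)%C = Re x * Re y - Im x * Im y. Proof. reflexivity. Qed.
Lemma Im_mult x y : Im (x * y)%C = Re x * Im y + Im x * Re y. Proof. reflexivity. Qed.
Lemma Re_scal (x : R) y : Re (x * y)%C = x * Re y.
Proof. rewrite Re_mult, re_RtoC, im_RtoC; ring. Qed.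
Lemma Im_scal (x : R) y : Im (x * y)%C = x * Im y.
Proof. rewrite Im_mult, re_RtoC, im_RtoC; ring. Qed.

Lemma C_eq (x y : C) : Re x = Re y -> Im x = Im y -> x = y.
Proof. destruct x, y; simpl; intros -> ->; reflexivity. Qed.

Lemma Re_csum n F : Re (csum n F) = rsum n (fun i => Re (F i)).
Proof. induction n as [|n IH]; cbn [csum rsum]; [easy|]. now rewrite Re_plus, IH. Qed.

Lemma Im_csum n F : Im (csum n F) = rsum n (fun i => Im (F i)).
Proof. induction n as [|n IH]; cbn [csum rsum]; [easy|]. now rewrite Im_plus, IH. Qed.

Lemma RtoC_rsum n F : RtoC (rsum n F) = csum n (fun i => RtoC (F i)).
Proof. induction n as [|n IH]; cbn [csum rsum]; [easy|]. now rewrite RtoC_plus, IH. Qed.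

Lemma Cconj_csum n F : Cconj (csum n F) = csum n (fun i => Cconj (F i)).
Proof.
induction n as [|n IH]; cbn [csum]; [apply C_eq; simpl; ring|].
now rewrite Cplus_conj, IH.
Qed.

Lemma rsum_swap n m F :
  rsum n (fun i => rsum m (fun j => F i j)) = rsum m (fun j => rsum n (fun i => F i j)).
Proof.
induction n as [|n IH]; simpl.
- symmetry; apply rsum_0; auto.
- rewrite IH; symmetry; apply rsum_plus.
Qed.

Lemma csum_swap n m F :
  csum n (fun i => csum m (fun j => F i j)) = csum m (fun j => csum n (fun i => F i j)).
Proof.
induction n as [|n IH]; simpl.
- symmetry; apply csum_0; auto.
- rewrite IH; symmetry; apply csum_plus.
Qed.

Lemma rsum_add n m F : rsum (n + m) F = rsum n F + rsum m (fun i => F (n + i)%nat).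
Proof.
induction m as [|m IH]; simpl.
- rewrite Nat.add_0_r; ring.
- rewrite Nat.add_succ_r; simpl; rewrite IH; ring.
Qed.

Lemma csum_add n m F : csum (n + m) F = (csum n F + csum m (fun i => F (n + i)%nat))%C.
Proof.
induction m as [|m IH]; simpl.
- rewrite Nat.add_0_r; ring.
- rewrite Nat.add_succ_r; simpl; rewrite IH; ring.
Qed.

Lemma rsum_first n F : rsum (S n) F = F 0%nat + rsum n (fun i => F (S i)).
Proof. change (S n) with (1 + n)%nat; rewrite rsum_add; simpl; ring. Qed.

Lemma csum_first n F : csum (S n) F = (F 0%nat + csum n (fun i => F (S i)))%C.
Proof. change (S n) with (1 + n)%nat; rewrite csum_add; simpl; ring. Qed.

Lemma csum_single n F i :
  (i < n)%nat -> (forall j, (j < n)%nat -> j <> i -> F j = RtoC 0) -> csum n F = F i.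
Proof.
induction n as [|n IH]; intros Hi H; [lia|]; simpl.
destruct (Nat.eq_dec i n) as [->|Hne].
- rewrite csum_0; [ring|]; intros j Hj; apply H; lia.
- rewrite (H n), IH; [ring|lia| |lia|lia]; intros; apply H; lia.
Qed.

Lemma csum_rev n F : csum (S n) F = csum (S n) (fun i => F (n - i)%nat).
Proof.
induction n as [|n IH]; [reflexivity|].
rewrite csum_first.
change (csum (S (S n)) (fun i => F (S n - i)%nat))
  with (csum (S n) (fun i => F (S n - i)%nat) + F (S n - S n)%nat)%C.
rewrite Nat.sub_diag, Cplus_comm; f_equal.
rewrite (csum_ext _ (fun i => F (S n - i)%nat) (fun i => F (S (n - i)))).
2:{ intros i Hi; f_equal; lia. }
clear IH; generalize dependent F; intros F.
set (G := fun i => F (S i)).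
change (csum (S n) G = csum (S n) (fun i => G (n - i)%nat)).
clearbody G; clear F; revert G.
induction n as [|n IH]; intros G; [reflexivity|].
rewrite csum_first.
change (csum (S (S n)) (fun i => G (S n - i)%nat))
  with (csum (S n) (fun i => G (S n - i)%nat) + G (S n - S n)%nat)%C.
rewrite Nat.sub_diag, Cplus_comm; f_equal.
rewrite IH; apply csum_ext; intros i Hi; f_equal; lia.
Qed.

Lemma csum_triangle n (H : nat -> nat -> C) :
  csum (S n) (fun i => csum (S i) (fun j => H j i))
  = csum (S n) (fun j => csum (S (n - j)) (fun l => H j (l + j)%nat)).
Proof.
induction n as [|n IH]; [reflexivity|].
change (csum (S (S n)) (fun i => csum (S i) (fun j => H j i)))
  with (csum (S n) (fun i => csum (S i) (fun j => H j i))
        + (csum (S n) (fun j => H j (S n)) + H (S n) (S n)))%C.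
rewrite IH.
change (csum (S (S n)) (fun j => csum (S (S n - j)) (fun l => H j (l + j)%nat)))
  with (csum (S n) (fun j => csum (S (S n - j)) (fun l => H j (l + j)%nat))
        + csum (S (S n - S n)) (fun l => H (S n) (l + S n)%nat))%C.
rewrite Nat.sub_diag, Cplus_assoc; f_equal.
- rewrite <- csum_plus; apply csum_ext; intros j Hj.
  replace (S n - j)%nat with (S (n - j)) by lia.
  change (csum (S (S (n - j))) (fun l => H j (l + j)%nat))
    with (csum (S (n - j)) (fun l => H j (l + j)%nat) + H j (S (n - j) + j)%nat)%C.
  do 2 f_equal; lia.
- simpl; ring.
Qed.

Lemma rsum_rsum_mul n m (F G : nat -> R) :
  rsum n (fun i => rsum m (fun j => F i * G j)) = rsum n F * rsum m G.
Proof.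
rewrite (rsum_ext _ _ (fun i => rsum m G * F i)).
2:{ intros; rewrite rsum_scal; ring. }
rewrite rsum_scal; ring.
Qed.

Lemma csum_csum_mul n m (F G : nat -> C) :
  csum n (fun i => csum m (fun j => F i * G j)%C) = (csum n F * csum m G)%C.
Proof.
rewrite (csum_ext _ _ (fun i => csum m G * F i)%C).
2:{ intros; rewrite csum_scal; ring. }
rewrite csum_scal; ring.
Qed.

Lemma rsum_blocks L N F :
  rsum (L * N) F = rsum L (fun l => rsum N (fun m => F (l * N + m)%nat)).
Proof.
induction L as [|L IH]; simpl; [easy|].
rewrite Nat.add_comm, rsum_add, IH; reflexivity.
Qed.

Lemma rsum_cauchy_schwarz n (F G : nat -> R) :
  (rsum n (fun i => F i * G i))^2 <= rsum n (fun i => F i ^ 2) * rsum n (fun i => G i ^ 2).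
Proof.
set (A := rsum n (fun i => F i ^ 2)); set (B := rsum n (fun i => G i ^ 2)).
set (D := rsum n (fun i => F i * G i)).
assert (HA : 0 <= A) by (apply rsum_ge0; intros; apply pow2_ge_0).
assert (Hq : forall t, 0 <= A * t^2 - 2 * t * D + B).
{ intros t.
  replace (A * t^2 - 2 * t * D + B) with (rsum n (fun i => (t * F i - G i)^2)).
  - apply rsum_ge0; intros; apply pow2_ge_0.
  - rewrite (rsum_ext _ _ (fun i => t^2 * F i ^ 2 + ((- 2 * t) * (F i * G i) + G i ^ 2)))
      by (intros; ring).
    rewrite !rsum_plus, !rsum_scal; fold A B D; ring. }
destruct (Req_dec A 0) as [H0|H0].
- assert (D = 0).
  { destruct (Req_dec D 0) as [|Hd]; [easy|exfalso].
    specialize (Hq ((B + 1) / (2 * D))). rewrite H0 in Hq.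
    replace (0 * ((B + 1) / (2 * D)) ^ 2 - 2 * ((B + 1) / (2 * D)) * D + B)
      with (-1) in Hq by (field; auto). lra. }
  rewrite H0, H; nra.
- specialize (Hq (D / A)).
  replace (A * (D / A) ^ 2 - 2 * (D / A) * D + B) with (B - D^2 / A) in Hq by (field; auto).
  apply Rmult_le_reg_l with (/ A); [apply Rinv_0_lt_compat; lra|].
  replace (/ A * (A * B)) with B by (field; auto).
  replace (/ A * D ^ 2) with (D^2 / A) by (field; auto). lra.
Qed.

(** * Formal power series *)

Definition conv (a b : nat -> C) (n : nat) : C :=
  csum (S n) (fun i => a i * b (n - i)%nat)%C.

Definition theta (a : nat -> C) (n : nat) : C := (RtoC (INR n) * a n)%C.

Definition delta0 (w : C) (n : nat) : C := match n with O => w | S _ => RtoC 0 end.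

Lemma conv_ext a b a' b' n :
  (forall i, (i <= n)%nat -> a i = a' i) -> (forall i, (i <= n)%nat -> b i = b' i) ->
  conv a b n = conv a' b' n.
Proof. intros Ha Hb; apply csum_ext; intros i Hi; rewrite Ha, Hb; auto; lia. Qed.

Lemma conv_comm a b n : conv a b n = conv b a n.
Proof.
unfold conv; rewrite csum_rev; apply csum_ext; intros i Hi.
replace (n - (n - i))%nat with i by lia; ring.
Qed.

Lemma conv_assoc a b c n : conv (conv a b) c n = conv a (conv b c) n.
Proof.
unfold conv.
rewrite (csum_ext _ _ (fun i => csum (S i) (fun j => a j * b (i - j)%nat * c (n - i)%nat)%C)).
2:{ intros i Hi; rewrite <- csum_scal_r; reflexivity. }
rewrite (csum_triangle n (fun j i => a j * b (i - j)%nat * c (n - i)%nat)%C).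
apply csum_ext; intros j Hj; rewrite <- csum_scal.
apply csum_ext; intros l Hl.
replace (l + j - j)%nat with l by lia.
replace (n - (l + j))%nat with (n - j - l)%nat by lia; ring.
Qed.

Lemma conv_plus_l a b c n : conv (fun i => a i + b i)%C c n = (conv a c n + conv b c n)%C.
Proof.
unfold conv; rewrite <- csum_plus; apply csum_ext; intros; ring.
Qed.

Lemma conv_minus_l a b c n : conv (fun i => a i - b i)%C c n = (conv a c n - conv b c n)%C.
Proof.
unfold conv; rewrite <- csum_minus; apply csum_ext; intros; ring.
Qed.

Lemma conv_scal_l w a c n : conv (fun i => w * a i)%C c n = (w * conv a c n)%C.
Proof.
unfold conv; rewrite <- csum_scal; apply csum_ext; intros; ring.
Qed.

Lemma conv_delta_l w a n : conv (delta0 w) a n = (w * a n)%C.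
Proof.
unfold conv; rewrite csum_first, csum_0; [simpl; rewrite Nat.sub_0_r; ring|].
intros; simpl; ring.
Qed.

Lemma theta_conv a b n : theta (conv a b) n = (conv (theta a) b n + conv a (theta b) n)%C.
Proof.
unfold theta, conv; rewrite <- csum_scal, <- csum_plus; apply csum_ext; intros i Hi.
replace (INR n) with (INR i + INR (n - i)) by (rewrite <- plus_INR; f_equal; lia).
rewrite RtoC_plus; ring.
Qed.

(** Course-of-values recursion: [tab F n] stores the entries below [n], so that a new entry may use
    all earlier ones. The fixpoint equation [cov_eq] holds once [F s n] reads [s] only below [n]. *)
Fixpoint tab (F : (nat -> C) -> nat -> C) (n : nat) : nat -> C :=
  match n with
  | O => fun _ => RtoC 0
  | S m => fun k => if Nat.eqb k m then F (tab F m) m else tab F m k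
  end.

Definition cov (F : (nat -> C) -> nat -> C) (n : nat) : C := tab F (S n) n.

Lemma tab_cov F n k : (k < n)%nat -> tab F n k = cov F k.
Proof.
induction n as [|n IH]; intros Hk; [lia|].
destruct (Nat.eq_dec k n) as [->|Hne]; [reflexivity|].
simpl; rewrite (proj2 (Nat.eqb_neq k n) Hne); apply IH; lia.
Qed.

Lemma cov_eq F n :
  (forall s t, (forall k, (k < n)%nat -> s k = t k) -> F s n = F t n) ->
  cov F n = F (cov F) n.
Proof.
intros HF; unfold cov at 1; simpl; rewrite Nat.eqb_refl.
apply HF; intros; now apply tab_cov.
Qed.

Definition finv (g : nat -> C) : nat -> C :=
  cov (fun b n => match n with
    | O => / g O
    | S m => - / g O * csum (S m) (fun k => g (S m - k)%nat * b k)
    end)%C.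

Lemma finv_0 g : finv g 0%nat = (/ g 0%nat)%C.
Proof. reflexivity. Qed.

Lemma finv_S g m :
  finv g (S m) = (- / g O * csum (S m) (fun k => g (S m - k)%nat * finv g k))%C.
Proof.
unfold finv at 1; rewrite cov_eq; [reflexivity|].
intros s t Hst; f_equal; apply csum_ext; intros k Hk; rewrite Hst; auto.
Qed.

Lemma conv_finv g n : g 0%nat <> RtoC 0 -> conv (finv g) g n = delta0 1 n.
Proof.
intros Hg; destruct n as [|m].
- unfold conv; simpl; rewrite finv_0; field; auto.
- unfold conv.
  change (csum (S (S m)) (fun i => finv g i * g (S m - i)%nat)%C)
    with (csum (S m) (fun i => finv g i * g (S m - i)%nat) + finv g (S m) * g (S m - S m)%nat)%C.
  rewrite Nat.sub_diag, finv_S.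
  rewrite (csum_ext _ (fun i => finv g i * g (S m - i)%nat)%C
             (fun k => g (S m - k)%nat * finv g k)%C) by (intros; ring).
  simpl delta0; field; auto.
Qed.

(* [theta l * g = theta g] says that [l] is the formal logarithm of [g / g 0]. *)
Definition is_flog (l g : nat -> C) : Prop :=
  l 0%nat = RtoC 0 /\ forall n, conv (theta l) g n = theta g n.

(** Divides z g'/g termwise by the index. At index 0 the convolution vanishes, so the value there is
    0 whatever [/ INR 0] is. *)
Definition flog (g : nat -> C) (n : nat) : C :=
  (RtoC (/ INR n) * conv (theta g) (finv g) n)%C.

Lemma theta_0 a : theta a 0%nat = RtoC 0.
Proof. unfold theta; simpl; ring. Qed.

Lemma INR_S_neq0 n : RtoC (INR (S n)) <> RtoC 0.
Proof. intros H; apply RtoC_inj in H; revert H; apply not_0_INR; lia. Qed.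

Lemma theta_flog g n : theta (flog g) n = conv (theta g) (finv g) n.
Proof.
destruct n as [|n].
- rewrite theta_0; unfold conv; simpl; rewrite theta_0; ring.
- unfold theta at 1, flog; rewrite RtoC_inv by (apply not_0_INR; lia).
  field; apply INR_S_neq0.
Qed.

Lemma conv_delta_r w a n : conv a (delta0 w) n = (w * a n)%C.
Proof. rewrite conv_comm; apply conv_delta_l. Qed.

Lemma flog_is_flog g : g 0%nat <> RtoC 0 -> is_flog (flog g) g.
Proof.
intros Hg; split.
- unfold flog, conv; simpl; rewrite theta_0; ring.
- intros n.
  rewrite (conv_ext _ g (conv (theta g) (finv g)) g) by (auto using theta_flog).
  rewrite conv_assoc, (conv_ext _ _ (theta g) (delta0 1)); auto using conv_finv.
  rewrite conv_delta_r; ring.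
Qed.

Lemma conv_last a b n :
  conv a b n = (csum n (fun i => a i * b (n - i)%nat) + a n * b 0%nat)%C.
Proof. unfold conv; simpl; rewrite Nat.sub_diag; reflexivity. Qed.

Lemma is_flog_unique l l' g :
  g 0%nat <> RtoC 0 -> is_flog l g -> is_flog l' g -> forall n, l n = l' n.
Proof.
intros Hg [H0 H] [H0' H'] n.
induction n as [n IH] using lt_wf_ind.
destruct n as [|n]; [congruence|].
specialize (H (S n)); rewrite <- H', !conv_last in H.
rewrite (csum_ext _ _ (fun i => theta l' i * g (S n - i)%nat)%C) in H.
2:{ intros i Hi; unfold theta; now rewrite IH. }
assert (E : (RtoC (INR (S n)) * g 0%nat * (l (S n) - l' (S n)))%C = RtoC 0).
{ unfold theta in H.
  set (A := csum (S n) _) in H.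
  replace (RtoC (INR (S n)) * g 0%nat * (l (S n) - l' (S n)))%C
    with ((A + RtoC (INR (S n)) * l (S n) * g 0%nat)
          - (A + RtoC (INR (S n)) * l' (S n) * g 0%nat))%C by ring.
  rewrite H; ring. }
assert (E' : (l (S n) - l' (S n))%C = RtoC 0).
{ replace (l (S n) - l' (S n))%C
    with (/ (RtoC (INR (S n)) * g 0%nat) * (RtoC (INR (S n)) * g 0%nat * (l (S n) - l' (S n))))%C.
  - rewrite E; ring.
  - field; split; auto using INR_S_neq0. }
replace (l (S n)) with ((l (S n) - l' (S n)) + l' (S n))%C by ring.
rewrite E'; ring.
Qed.

Lemma is_flog_conv l1 l2 g1 g2 :
  is_flog l1 g1 -> is_flog l2 g2 -> is_flog (fun n => l1 n + l2 n)%C (conv g1 g2).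
Proof.
intros [A1 B1] [A2 B2]; split; [rewrite A1, A2; ring|]; intros n.
rewrite (conv_ext _ _ (fun i => theta l1 i + theta l2 i)%C (conv g1 g2)); auto.
2:{ intros; unfold theta; ring. }
rewrite conv_plus_l, theta_conv; f_equal.
- rewrite <- conv_assoc; apply conv_ext; auto.
- rewrite (conv_ext (theta l2) _ (theta l2) (conv g2 g1)); auto using conv_comm.
  rewrite <- conv_assoc, (conv_ext _ g1 (theta g2) g1), conv_comm; auto.
Qed.

Lemma is_flog_scal w l g : is_flog l g -> is_flog l (fun n => w * g n)%C.
Proof.
intros [A B]; split; [easy|]; intros n.
rewrite conv_comm, conv_scal_l, conv_comm, B; unfold theta; ring.
Qed.

Lemma is_flog_ext l l' g g' :
  (forall n, l n = l' n) -> (forall n, g n = g' n) -> is_flog l g -> is_flog l' g'.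
Proof.
intros Hl Hg [A B]; split; [congruence|]; intros n.
rewrite <- (conv_ext (theta l) g); [rewrite B; unfold theta; now rewrite Hg| |]; auto.
intros; unfold theta; now rewrite Hl.
Qed.

(** The differential equation z e' = (z l') e, read at index m + 1. The same recursion drives the
    convergence proof [rad1_fexp] and the induction in [lebedev_milin]. *)
Definition fexp (l : nat -> C) : nat -> C :=
  cov (fun e n => match n with
    | O => 1
    | S m => RtoC (/ INR (S m)) * csum (S m) (fun k => theta l (S m - k)%nat * e k)
    end)%C.

Lemma fexp_0 l : fexp l 0%nat = RtoC 1.
Proof. reflexivity. Qed.

Lemma fexp_S l m :
  fexp l (S m)
  = (RtoC (/ INR (S m)) * csum (S m) (fun k => theta l (S m - k)%nat * fexp l k))%C.
Proof.
unfold fexp at 1; rewrite cov_eq; [reflexivity|].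
intros s t Hst; f_equal; apply csum_ext; intros k Hk; rewrite Hst; auto.
Qed.

Lemma fexp_is_flog l : l 0%nat = RtoC 0 -> is_flog l (fexp l).
Proof.
intros H0; split; [easy|]; intros [|m].
- unfold conv; simpl; rewrite !theta_0; ring.
- rewrite conv_comm, conv_last, theta_0; unfold theta at 2; rewrite fexp_S.
  rewrite (csum_ext _ (fun i => fexp l i * _)%C
             (fun k => theta l (S m - k)%nat * fexp l k)%C) by (intros; ring).
  rewrite RtoC_inv by (apply not_0_INR; lia).
  field; apply INR_S_neq0.
Qed.

Lemma is_flog_eq l g g' :
  g 0%nat = g' 0%nat -> is_flog l g -> is_flog l g' -> forall n, g n = g' n.
Proof.
intros H0 [Hl H] [_ H'] n.
induction n as [n IH] using lt_wf_ind.
destruct n as [|n]; [easy|].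
specialize (H (S n)); specialize (H' (S n)).
rewrite conv_comm, conv_last, theta_0 in H, H'.
rewrite (csum_ext _ _ (fun i => g' i * theta l (S n - i)%nat)%C) in H.
2:{ intros i Hi; now rewrite IH. }
set (A := csum _ _) in *.
unfold theta in H, H'.
assert (E : (RtoC (INR (S n)) * g (S n) = RtoC (INR (S n)) * g' (S n))%C).
{ rewrite <- H, <- H'; ring. }
replace (g (S n)) with (/ RtoC (INR (S n)) * (RtoC (INR (S n)) * g (S n)))%C
  by (field; apply INR_S_neq0).
rewrite E; field; apply INR_S_neq0.
Qed.

(** * Convergent power series *)

Lemma sum_n_rsum F n : sum_n F n = rsum (S n) F.
Proof.
induction n as [|n IH]; [rewrite sum_O; symmetry; apply Rplus_0_l|].
rewrite sum_Sn, IH; reflexivity.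
Qed.

Lemma is_series_rsum F l : is_series F l <-> is_lim_seq (fun n => rsum n F) l.
Proof.
rewrite is_lim_seq_incr_1; unfold is_series, is_lim_seq.
split; intros H; (eapply filterlim_ext; [|exact H]); intros n; simpl; now rewrite sum_n_rsum.
Qed.

Lemma ex_series_dom (F G : nat -> R) :
  (forall n, Rabs (F n) <= G n) -> ex_series G -> ex_series F.
Proof. intros H HG; apply (ex_series_le (K := R_AbsRing) (V := R_CompleteNormedModule) F G); auto. Qed.

Lemma rsum_le_Series F n : (forall i, 0 <= F i) -> ex_series F -> rsum n F <= Series F.
Proof.
intros HF [l Hl]; rewrite (is_series_unique _ _ Hl).
apply is_series_rsum in Hl.
apply (is_lim_seq_incr_compare (fun n => rsum n F)); auto.
intros k; simpl; specialize (HF k); lra.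
Qed.

Lemma ex_series_bounded F B :
  (forall i, 0 <= F i) -> (forall n, rsum n F <= B) -> ex_series F.
Proof.
intros HF HB.
destruct (ex_finite_lim_seq_incr (fun n => rsum n F) B) as [l Hl].
- intros n; simpl; specialize (HF n); lra.
- auto.
- exists l; now apply is_series_rsum.
Qed.

Lemma Series_le_bound F B :
  (forall i, 0 <= F i) -> (forall n, rsum n F <= B) -> Series F <= B.
Proof.
intros HF HB.
destruct (ex_series_bounded F B HF HB) as [l Hl].
rewrite (is_series_unique _ _ Hl); apply is_series_rsum in Hl.
apply (is_lim_seq_le (fun n => rsum n F) (fun _ => B) l B); auto using is_lim_seq_const.
Qed.

(** Convergence of a complex series by real and imaginary parts, which makes the results on real
    series available. *)
Definition cis (F : nat -> C) (l : C) : Prop :=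
  is_series (fun n => Re (F n)) (Re l) /\ is_series (fun n => Im (F n)) (Im l).

Lemma cis_ext F G l : (forall n, F n = G n) -> cis F l -> cis G l.
Proof.
intros H [A B]; split; (eapply is_series_ext; [|eassumption]); intros n; simpl; now rewrite H.
Qed.

Lemma Cmod_le_abs z : Cmod z <= Rabs (Re z) + Rabs (Im z).
Proof.
replace z with ((Re z, 0) + (0, Im z))%C at 1 by (apply C_eq; simpl; ring).
eapply Rle_trans; [apply Cmod_triangle|]; right.
f_equal; unfold Cmod; simpl; rewrite <- sqrt_Rsqr_abs; unfold Rsqr; f_equal; ring.
Qed.

Lemma im_le_Cmod z : Rabs (Im z) <= Cmod z.
Proof.
destruct z as [x y]; unfold Cmod; simpl.
rewrite <- sqrt_Rsqr_abs; apply sqrt_le_1_alt; unfold Rsqr; nra.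
Qed.

Lemma cis_lim F l : cis F l -> is_lim_seq (fun n => Cmod (csum n F - l)%C) 0.
Proof.
intros [H1 H2]; apply is_series_rsum in H1; apply is_series_rsum in H2.
apply (is_lim_seq_le_le (fun _ => 0) _
  (fun n => Rabs (rsum n (fun i => Re (F i)) - Re l) + Rabs (rsum n (fun i => Im (F i)) - Im l))).
- intros n; split; [apply Cmod_ge_0|].
  eapply Rle_trans; [apply Cmod_le_abs|].
  rewrite Re_minus, Im_minus, Re_csum, Im_csum; lra.
- apply is_lim_seq_const.
- replace (Finite 0) with (Rbar_plus 0 0) by (simpl; f_equal; ring).
  apply is_lim_seq_plus'.
  + replace 0 with (Rabs (Re l - Re l)) by (rewrite Rminus_diag, Rabs_R0; auto).
    apply (is_lim_seq_abs _ (Finite (Re l - Re l))), is_lim_seq_minus'; auto using is_lim_seq_const.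
  + replace 0 with (Rabs (Im l - Im l)) by (rewrite Rminus_diag, Rabs_R0; auto).
    apply (is_lim_seq_abs _ (Finite (Im l - Im l))), is_lim_seq_minus'; auto using is_lim_seq_const.
Qed.

Lemma cis_eps F l e : cis F l -> 0 < e ->
  exists N, forall n, (N <= n)%nat -> Cmod (csum n F - l)%C < e.
Proof.
intros H He; apply cis_lim in H.
apply is_lim_seq_spec in H; destruct (H (mkposreal e He)) as [N HN].
exists N; intros n Hn; specialize (HN n Hn); simpl in HN.
rewrite Rminus_0_r, Rabs_pos_eq in HN; auto using Cmod_ge_0.
Qed.

Lemma cis_Cmod_le F l B :
  cis F l -> (exists N, forall n, (N <= n)%nat -> Cmod (csum n F) <= B) -> Cmod l <= B.
Proof.
intros H [N HN]; apply le_epsilon; intros e He.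
destruct (cis_eps F l e H He) as [M HM].
specialize (HN (N + M)%nat ltac:(lia)); specialize (HM (N + M)%nat ltac:(lia)).
replace l with (csum (N + M) F - (csum (N + M) F - l))%C by ring.
eapply Rle_trans; [apply Cmod_triangle|]; rewrite Cmod_opp; lra.
Qed.

Lemma cis_plus F G l m : cis F l -> cis G m -> cis (fun n => F n + G n)%C (l + m)%C.
Proof. intros [A B] [A' B']; split; apply (is_series_plus (V := R_NormedModule)); auto. Qed.

Lemma cis_minus F G l m : cis F l -> cis G m -> cis (fun n => F n - G n)%C (l - m)%C.
Proof. intros [A B] [A' B']; split; apply (is_series_minus (V := R_NormedModule)); auto. Qed.

Lemma cis_scal w F l : cis F l -> cis (fun n => w * F n)%C (w * l)%C.
Proof.
intros [A B]; split.
- apply (is_series_minus (V := R_NormedModule) (fun n => Re w * Re (F n)) (fun n => Im w * Im (F n)));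
    apply (is_series_scal (K := R_AbsRing) (V := R_NormedModule)); auto.
- apply (is_series_plus (V := R_NormedModule) (fun n => Re w * Im (F n)) (fun n => Im w * Re (F n)));
    apply (is_series_scal (K := R_AbsRing) (V := R_NormedModule)); auto.
Qed.

Lemma cis_of_is_series (F : nat -> C) (l : C) :
  @is_series C_AbsRing C_NormedModule F l -> cis F l.
Proof.
intros H.
assert (HS : forall n, sum_n (G := C_AbelianMonoid) F n = csum (S n) F).
{ induction n as [|n IH]; [rewrite sum_O; symmetry; apply Cplus_0_l|].
  rewrite sum_Sn, IH; reflexivity. }
assert (H' := proj1 (filterlim_locally _ _) H).
split; apply (proj2 (filterlim_locally _ _)); intros e; destruct (H' e) as [N HN]; exists N;
  intros n Hn; specialize (HN n Hn).
- rewrite sum_n_rsum, <- Re_csum. rewrite HS in HN. apply HN.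
- rewrite sum_n_rsum, <- Im_csum. rewrite HS in HN. apply HN.
Qed.

Lemma pow_n_Cpow (z : C) n : @pow_n C_Ring z n = (z ^ n)%C.
Proof. induction n as [|n IH]; [reflexivity|]. simpl; rewrite IH; reflexivity. Qed.

(** Total evaluation: where the series diverges the value is the default of [Series]. It is the
    actual sum as soon as [summ a r] holds with |z| <= r, by [ev_cis]. *)
Definition ev (a : nat -> C) (z : C) : C :=
  (Series (fun n => Re (a n * z ^ n)%C), Series (fun n => Im (a n * z ^ n)%C)).

Definition summ (a : nat -> C) (r : R) : Prop := ex_series (fun n => Cmod (a n) * r ^ n).

Definition nrm (a : nat -> C) (r : R) : R := Series (fun n => Cmod (a n) * r ^ n).

Lemma ev_unique a z l : cis (fun n => a n * z ^ n)%C l -> ev a z = l.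
Proof. intros [A B]; apply C_eq; apply is_series_unique; auto. Qed.

Lemma Cmod_term a z r n : Cmod z <= r -> Cmod (a n * z ^ n)%C <= Cmod (a n) * r ^ n.
Proof.
intros Hz; rewrite Cmod_mult, Cmod_pow; apply Rmult_le_compat_l; auto using Cmod_ge_0.
apply pow_incr; split; auto using Cmod_ge_0.
Qed.

Lemma ev_cis a z r : summ a r -> Cmod z <= r -> cis (fun n => a n * z ^ n)%C (ev a z).
Proof.
intros Ha Hz; split; apply Series_correct; (eapply ex_series_dom; [|exact Ha]); intros n.
- eapply Rle_trans; [apply re_le_Cmod|]; now apply Cmod_term.
- eapply Rle_trans; [apply im_le_Cmod|]; now apply Cmod_term.
Qed.

Lemma summ_term_ge0 a r n : 0 <= r -> 0 <= Cmod (a n) * r ^ n.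
Proof. intros; apply Rmult_le_pos; auto using Cmod_ge_0, pow_le. Qed.

Lemma ev_tail a z r N : summ a r -> Cmod z <= r ->
  Cmod (ev a z - csum N (fun n => a n * z ^ n))%C
  <= nrm a r - rsum N (fun n => Cmod (a n) * r ^ n).
Proof.
intros Ha Hz.
assert (Hr : 0 <= r) by (eapply Rle_trans; [apply Cmod_ge_0|exact Hz]).
apply (cis_Cmod_le (fun n => if (n <? N)%nat then RtoC 0 else a n * z ^ n)%C).
- apply cis_ext with (fun n => a n * z^n - (if (n <? N)%nat then a n * z^n else RtoC 0))%C.
  { intros n; destruct (n <? N)%nat; ring. }
  apply cis_minus; [now apply ev_cis with r|].
  assert (E : forall n, (N <= n)%nat ->
    csum n (fun n => if (n <? N)%nat then a n * z^n else RtoC 0)%C = csum N (fun n => a n * z^n)%C).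
  { intros n Hn; replace n with (N + (n - N))%nat by lia.
    rewrite csum_add, (csum_0 (n - N)), Cplus_0_r.
    - apply csum_ext; intros i Hi; now rewrite (proj2 (Nat.ltb_lt i N) Hi).
    - intros i Hi; now rewrite (proj2 (Nat.ltb_ge (N + i) N) ltac:(lia)). }
  split; apply is_series_rsum.
  + apply (is_lim_seq_ext_loc (fun _ => Re (csum N (fun n => a n * z^n)%C)));
      [|apply is_lim_seq_const].
    exists N; intros n Hn; rewrite <- (E n Hn), Re_csum; reflexivity.
  + apply (is_lim_seq_ext_loc (fun _ => Im (csum N (fun n => a n * z^n)%C)));
      [|apply is_lim_seq_const].
    exists N; intros n Hn; rewrite <- (E n Hn), Im_csum; reflexivity.
- exists N; intros n Hn.
  eapply Rle_trans; [apply Cmod_csum|].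
  replace n with (N + (n - N))%nat by lia.
  rewrite rsum_add, rsum_0.
  2:{ intros i Hi; rewrite (proj2 (Nat.ltb_lt i N) Hi), Cmod_0; auto. }
  assert (Hb : rsum (N + (n - N)) (fun n => Cmod (a n) * r ^ n) <= nrm a r).
  { apply rsum_le_Series; auto. intros; now apply summ_term_ge0. }
  rewrite rsum_add in Hb.
  assert (rsum (n - N) (fun i => Cmod (if (N + i <? N)%nat then RtoC 0 else a (N+i)%nat * z^(N+i))%C)
          <= rsum (n - N) (fun i => Cmod (a (N + i)%nat) * r ^ (N + i))).
  { apply rsum_le; intros i Hi; rewrite (proj2 (Nat.ltb_ge (N + i) N) ltac:(lia)).
    now apply Cmod_term. }
  lra.
Qed.

Lemma ev_le_nrm a z r : summ a r -> Cmod z <= r -> Cmod (ev a z) <= nrm a r.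
Proof.
intros Ha Hz; pose proof (ev_tail a z r 0 Ha Hz) as H; simpl in H.
replace (ev a z - 0)%C with (ev a z) in H by ring; lra.
Qed.

Lemma nrm_ge0 a r : 0 <= r -> summ a r -> 0 <= nrm a r.
Proof.
intros Hr Ha; pose proof (ev_le_nrm a 0 r Ha); rewrite Cmod_0 in H.
eapply Rle_trans; [apply Cmod_ge_0|apply H; auto].
Qed.

Lemma nrm_rsum a r n : 0 <= r -> summ a r -> rsum n (fun n => Cmod (a n) * r ^ n) <= nrm a r.
Proof. intros Hr Ha; apply rsum_le_Series; auto; intros; now apply summ_term_ge0. Qed.

Lemma summ_coef a r n : 0 <= r -> summ a r -> Cmod (a n) * r ^ n <= nrm a r.
Proof.
intros Hr Ha; eapply Rle_trans; [|apply (nrm_rsum a r (S n)); auto].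
apply (rsum_term (S n) (fun n => Cmod (a n) * r^n)); [lia|]; intros; now apply summ_term_ge0.
Qed.

Lemma summ_dom a b r : 0 <= r -> (forall n, Cmod (a n) <= Cmod (b n)) -> summ b r -> summ a r.
Proof.
intros Hr H Hb; eapply ex_series_dom; [|exact Hb]; intros n.
rewrite Rabs_pos_eq by now apply summ_term_ge0.
apply Rmult_le_compat_r; auto using pow_le.
Qed.

Lemma summ_plus a b r : 0 <= r -> summ a r -> summ b r -> summ (fun n => a n + b n)%C r.
Proof.
intros Hr Ha Hb.
apply ex_series_dom with (fun n => Cmod (a n) * r ^ n + Cmod (b n) * r ^ n).
- intros n; rewrite Rabs_pos_eq by (now apply (summ_term_ge0 (fun n => a n + b n)%C)).
  rewrite <- Rmult_plus_distr_r; apply Rmult_le_compat_r; auto using pow_le, Cmod_triangle.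
- apply (ex_series_plus (V := R_NormedModule)); auto.
Qed.

Lemma summ_scal w a r : summ a r -> summ (fun n => w * a n)%C r.
Proof.
intros Ha; apply ex_series_ext with (fun n => Cmod w * (Cmod (a n) * r ^ n)).
- intros n; rewrite Cmod_mult; simpl; ring.
- now apply (ex_series_scal (K := R_AbsRing) (V := R_NormedModule)).
Qed.

Lemma summ_minus a b r : 0 <= r -> summ a r -> summ b r -> summ (fun n => a n - b n)%C r.
Proof.
intros Hr Ha Hb.
apply summ_dom with (fun n => a n + - RtoC 1 * b n)%C; auto.
- intros n; right; f_equal; ring.
- apply summ_plus, summ_scal; auto.
Qed.

Lemma ev_ext a b z : (forall n, a n = b n) -> ev a z = ev b z.
Proof. intros H; unfold ev; f_equal; apply Series_ext; intros; now rewrite H. Qed.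

Lemma ev_plus a b z r : summ a r -> summ b r -> Cmod z <= r ->
  ev (fun n => a n + b n)%C z = (ev a z + ev b z)%C.
Proof.
intros Ha Hb Hz; apply ev_unique.
apply cis_ext with (fun n => a n * z^n + b n * z^n)%C; [intros; ring|].
apply cis_plus; eapply ev_cis; eauto.
Qed.

Lemma ev_minus a b z r : summ a r -> summ b r -> Cmod z <= r ->
  ev (fun n => a n - b n)%C z = (ev a z - ev b z)%C.
Proof.
intros Ha Hb Hz; apply ev_unique.
apply cis_ext with (fun n => a n * z^n - b n * z^n)%C; [intros; ring|].
apply cis_minus; eapply ev_cis; eauto.
Qed.

Lemma ev_finite a z N : (forall n, (N <= n)%nat -> a n = RtoC 0) ->
  ev a z = csum N (fun n => a n * z ^ n)%C.
Proof.
intros H; apply ev_unique.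
assert (E : forall n, (N <= n)%nat -> csum n (fun n => a n * z^n)%C = csum N (fun n => a n * z^n)%C).
{ intros n Hn; replace n with (N + (n - N))%nat by lia.
  rewrite csum_add, (csum_0 (n - N)); [ring|]; intros; rewrite H by lia; ring. }
split; apply is_series_rsum.
+ apply (is_lim_seq_ext_loc (fun _ => Re (csum N (fun n => a n * z^n)%C))); [|apply is_lim_seq_const].
  exists N; intros n Hn; rewrite <- (E n Hn), Re_csum; reflexivity.
+ apply (is_lim_seq_ext_loc (fun _ => Im (csum N (fun n => a n * z^n)%C))); [|apply is_lim_seq_const].
  exists N; intros n Hn; rewrite <- (E n Hn), Im_csum; reflexivity.
Qed.

Lemma summ_finite a r N : (forall n, (N <= n)%nat -> a n = RtoC 0) -> summ a r.
Proof.
intros H; exists (rsum N (fun n => Cmod (a n) * r ^ n)); apply is_series_rsum.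
apply (is_lim_seq_ext_loc (fun _ => rsum N (fun n => Cmod (a n) * r^n))); [|apply is_lim_seq_const].
exists N; intros n Hn; replace n with (N + (n - N))%nat by lia.
rewrite rsum_add, (rsum_0 (n - N)); [ring|]; intros; rewrite H, Cmod_0 by lia; ring.
Qed.

Lemma ev_0 a : ev a 0 = a 0%nat.
Proof.
apply ev_unique.
apply cis_ext with (fun n => delta0 (a 0%nat) n * RtoC 1 ^ n)%C.
{ intros [|n]; simpl; ring. }
assert (H : cis (fun n => delta0 (a 0%nat) n * RtoC 1 ^ n)%C (ev (delta0 (a 0%nat)) 1)).
{ apply ev_cis with 1; [|rewrite Cmod_1; lra].
  apply summ_finite with 1%nat; intros [|n] Hn; [lia|reflexivity]. }
rewrite (ev_finite _ _ 1) in H.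
- simpl in H; replace (0 + a 0%nat * 1)%C with (a 0%nat) in H by ring; exact H.
- intros [|n] Hn; [lia|reflexivity].
Qed.

Lemma conv_pow a b z n :
  (conv a b n * z ^ n = conv (fun i => a i * z ^ i) (fun i => b i * z ^ i) n)%C.
Proof.
unfold conv; rewrite <- csum_scal_r; apply csum_ext; intros i Hi.
replace n with (i + (n - i))%nat at 2 by lia; rewrite Cpow_add_r; ring.
Qed.

Lemma sum_f_R0_rsum F n : sum_f_R0 F n = rsum (S n) F.
Proof. induction n as [|n IH]; simpl; [ring|]. now rewrite IH. Qed.

Lemma cis_conv F G l m :
  cis F l -> cis G m -> ex_series (fun n => Cmod (F n)) -> ex_series (fun n => Cmod (G n)) ->
  cis (conv F G) (l * m)%C.
Proof.
intros [A B] [A' B'] HF HG.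
assert (HaF : ex_series (fun n => Rabs (Re (F n)))).
{ eapply ex_series_dom; [|exact HF]; intros n; rewrite Rabs_Rabsolu; apply re_le_Cmod. }
assert (HbF : ex_series (fun n => Rabs (Im (F n)))).
{ eapply ex_series_dom; [|exact HF]; intros n; rewrite Rabs_Rabsolu; apply im_le_Cmod. }
assert (HaG : ex_series (fun n => Rabs (Re (G n)))).
{ eapply ex_series_dom; [|exact HG]; intros n; rewrite Rabs_Rabsolu; apply re_le_Cmod. }
assert (HbG : ex_series (fun n => Rabs (Im (G n)))).
{ eapply ex_series_dom; [|exact HG]; intros n; rewrite Rabs_Rabsolu; apply im_le_Cmod. }
split.
- eapply is_series_ext; [|apply (is_series_minus (V := R_NormedModule)
     _ _ _ _ (is_series_mult _ _ _ _ A A' HaF HaG) (is_series_mult _ _ _ _ B B' HbF HbG))].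
  intros n; simpl; rewrite !sum_f_R0_rsum; unfold conv; rewrite Re_csum.
  change (rsum (S n) (fun k => Re (F k) * Re (G (n - k)%nat))
    - rsum (S n) (fun k => Im (F k) * Im (G (n - k)%nat))
    = rsum (S n) (fun i => Re (F i * G (n - i)%nat)%C)).
  rewrite <- rsum_minus; reflexivity.
- eapply is_series_ext; [|apply (is_series_plus (V := R_NormedModule)
     _ _ _ _ (is_series_mult _ _ _ _ A B' HaF HbG) (is_series_mult _ _ _ _ B A' HbF HaG))].
  intros n; simpl; rewrite !sum_f_R0_rsum; unfold conv; rewrite Im_csum.
  change (rsum (S n) (fun k => Re (F k) * Im (G (n - k)%nat))
    + rsum (S n) (fun k => Im (F k) * Re (G (n - k)%nat))
    = rsum (S n) (fun i => Im (F i * G (n - i)%nat)%C)).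
  rewrite <- rsum_plus; reflexivity.
Qed.

Lemma ex_series_ev a z r : summ a r -> Cmod z <= r -> ex_series (fun n => Cmod (a n * z ^ n)%C).
Proof.
intros Ha Hz; eapply ex_series_dom; [|exact Ha]; intros n.
rewrite Rabs_pos_eq by apply Cmod_ge_0; now apply Cmod_term.
Qed.

Lemma ev_conv a b z r : summ a r -> summ b r -> Cmod z <= r ->
  ev (conv a b) z = (ev a z * ev b z)%C.
Proof.
intros Ha Hb Hz; apply ev_unique.
apply cis_ext with (conv (fun i => a i * z ^ i) (fun i => b i * z ^ i))%C;
  [intros; symmetry; apply conv_pow|].
apply cis_conv; eauto using ev_cis, ex_series_ev.
Qed.

(** The left side sums A i B j over the triangle i + j < N, the right side over the whole square. *)
Lemma rsum_conv_le (A B : nat -> R) N :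
  (forall i, 0 <= A i) -> (forall i, 0 <= B i) ->
  rsum N (fun n => rsum (S n) (fun i => A i * B (n - i)%nat)) <= rsum N A * rsum N B.
Proof.
intros HA HB; rewrite <- rsum_rsum_mul.
assert (E : forall M, rsum M (fun n => rsum (S n) (fun i => A i * B (n - i)%nat))
  = rsum M (fun i => rsum (M - i) (fun j => A i * B j))).
{ induction M as [|M IH]; [reflexivity|].
  change (rsum (S M) (fun n => rsum (S n) (fun i => A i * B (n - i)%nat)))
    with (rsum M (fun n => rsum (S n) (fun i => A i * B (n - i)%nat))
          + (rsum M (fun i => A i * B (M - i)%nat) + A M * B (M - M)%nat)).
  rewrite IH.
  change (rsum (S M) (fun i => rsum (S M - i) (fun j => A i * B j)))
    with (rsum M (fun i => rsum (S M - i) (fun j => A i * B j))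
          + rsum (S M - M) (fun j => A M * B j)).
  replace (S M - M)%nat with 1%nat by lia.
  rewrite (rsum_ext M (fun i => rsum (S M - i) (fun j => A i * B j))
             (fun i => rsum (M - i) (fun j => A i * B j) + A i * B (M - i)%nat)).
  2:{ intros i Hi; replace (S M - i)%nat with (S (M - i)) by lia; reflexivity. }
  rewrite rsum_plus, Nat.sub_diag; simpl; ring. }
rewrite E; apply rsum_le; intros i Hi; apply rsum_incr; [lia|].
intros; now apply Rmult_le_pos.
Qed.

Lemma conv_Cmod_le a b r n : 0 <= r ->
  Cmod (conv a b n) * r ^ n
  <= rsum (S n) (fun i => (Cmod (a i) * r ^ i) * (Cmod (b (n - i)%nat) * r ^ (n - i))).
Proof.
intros Hr; eapply Rle_trans.
- apply Rmult_le_compat_r; [now apply pow_le|apply Cmod_csum].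
- rewrite Rmult_comm, <- rsum_scal; right; apply rsum_ext; intros i Hi.
  rewrite Cmod_mult; replace n with (i + (n - i))%nat at 1 by lia; rewrite pow_add; ring.
Qed.

Lemma rsum_conv_Cmod a b r N : 0 <= r ->
  rsum N (fun n => Cmod (conv a b n) * r ^ n)
  <= rsum N (fun n => Cmod (a n) * r ^ n) * rsum N (fun n => Cmod (b n) * r ^ n).
Proof.
intros Hr; eapply Rle_trans; [apply rsum_le; intros; apply conv_Cmod_le; auto|].
apply (rsum_conv_le (fun n => Cmod (a n) * r ^ n) (fun n => Cmod (b n) * r ^ n));
  intros; now apply summ_term_ge0.
Qed.

Lemma summ_conv a b r : 0 <= r -> summ a r -> summ b r -> summ (conv a b) r.
Proof.
intros Hr Ha Hb; apply ex_series_bounded with (nrm a r * nrm b r).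
- intros; now apply summ_term_ge0.
- intros n; eapply Rle_trans; [now apply rsum_conv_Cmod|].
  apply Rmult_le_compat; auto using nrm_rsum; apply rsum_ge0; intros; now apply summ_term_ge0.
Qed.

(** Radius of convergence at least 1. Bounded terms on each smaller radius are what Cauchy estimates
    deliver; absolute summability follows on passing to a smaller radius ([rad1_summ]). *)
Definition rad1 (a : nat -> C) : Prop :=
  forall r, 0 < r < 1 -> exists M, forall n, Cmod (a n) * r ^ n <= M.

Lemma rad1_summ a r : rad1 a -> 0 <= r < 1 -> summ a r.
Proof.
intros Ha Hr; set (s := (1 + r) / 2).
destruct (Ha s) as [M HM]; [unfold s; lra|].
assert (Hq : 0 <= r / s < 1).
{ unfold s; split; [apply Rmult_le_pos; [lra|left; apply Rinv_0_lt_compat; lra]|].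
  apply Rmult_lt_reg_r with ((1 + r) / 2); [lra|].
  replace (r / ((1 + r) / 2) * ((1 + r) / 2)) with r by (field; lra); lra. }
apply ex_series_dom with (fun n => M * (r / s) ^ n).
- intros n; rewrite Rabs_pos_eq by (apply summ_term_ge0; lra).
  replace (Cmod (a n) * r ^ n) with (Cmod (a n) * s ^ n * (r / s) ^ n).
  + apply Rmult_le_compat_r; auto; apply pow_le; lra.
  + rewrite Rmult_assoc, <- Rpow_mult_distr; do 2 f_equal; unfold s; field; lra.
- apply (ex_series_scal (K := R_AbsRing) (V := R_NormedModule)).
  exists (/ (1 - r / s)); apply is_series_geom; rewrite Rabs_pos_eq; lra.
Qed.

Lemma summ_rad1 a : (forall r, 0 < r < 1 -> summ a r) -> rad1 a.
Proof.
intros H r Hr; exists (nrm a r); intros n; apply summ_coef; [lra|auto].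
Qed.

Lemma rad1_conv a b : rad1 a -> rad1 b -> rad1 (conv a b).
Proof.
intros Ha Hb; apply summ_rad1; intros r Hr; apply summ_conv; [lra| |]; apply rad1_summ; auto; lra.
Qed.

Lemma rad1_plus a b : rad1 a -> rad1 b -> rad1 (fun n => a n + b n)%C.
Proof.
intros Ha Hb; apply summ_rad1; intros r Hr; apply summ_plus; [lra| |]; apply rad1_summ; auto; lra.
Qed.

Lemma rad1_minus a b : rad1 a -> rad1 b -> rad1 (fun n => a n - b n)%C.
Proof.
intros Ha Hb; apply summ_rad1; intros r Hr; apply summ_minus; [lra| |]; apply rad1_summ; auto; lra.
Qed.

Lemma rad1_scal w a : rad1 a -> rad1 (fun n => w * a n)%C.
Proof.
intros Ha; apply summ_rad1; intros r Hr; apply summ_scal, rad1_summ; auto; lra.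
Qed.

Lemma rad1_finite a N : (forall n, (N <= n)%nat -> a n = RtoC 0) -> rad1 a.
Proof. intros H; apply summ_rad1; intros; now apply summ_finite with N. Qed.

Lemma pow_INR_bounded q : 0 <= q < 1 -> exists M, forall n, INR n * q ^ n <= M.
Proof.
intros Hq; exists (/ (1 - q)); intros n.
apply Rmult_le_reg_r with (1 - q); [lra|].
rewrite Rinv_l by lra.
(* n q^n is at most 1 + q + ... + q^(n-1), which is (1 - q^n) / (1 - q). *)
assert (H : INR n * q ^ n * (1 - q) <= 1 - q ^ n).
{ induction n as [|n IH]; [simpl; lra|].
  rewrite S_INR; simpl pow.
  assert (0 <= q ^ n) by (apply pow_le; lra).
  replace ((INR n + 1) * (q * q ^ n) * (1 - q)) with
    (q * (INR n * q ^ n * (1 - q)) + q * q ^ n * (1 - q)) by ring.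
  assert (q ^ n <= 1) by (rewrite <- (pow1 n); apply pow_incr; lra).
  apply Rle_trans with (q * (1 - q ^ n) + q * q ^ n * (1 - q)).
  - apply Rplus_le_compat_r, Rmult_le_compat_l; lra.
  - assert (0 <= (1 - q) * (1 - q * q ^ n)) by (apply Rmult_le_pos; nra); lra. }
assert (0 <= q ^ n) by (apply pow_le; lra); lra.
Qed.

Lemma rad1_theta a : rad1 a -> rad1 (theta a).
Proof.
intros Ha r Hr; set (s := (1 + r) / 2).
destruct (Ha s) as [M HM]; [unfold s; lra|].
assert (Hq : 0 <= r / s < 1).
{ unfold s; split; [apply Rmult_le_pos; [lra|left; apply Rinv_0_lt_compat; lra]|].
  apply Rmult_lt_reg_r with ((1 + r) / 2); [lra|].
  replace (r / ((1 + r) / 2) * ((1 + r) / 2)) with r by (field; lra); lra. }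
destruct (pow_INR_bounded (r / s) Hq) as [M' HM'].
assert (HM0 : 0 <= M).
{ eapply Rle_trans; [|apply (HM 0%nat)]; apply summ_term_ge0; unfold s; lra. }
exists (M * M'); intros n.
unfold theta; rewrite Cmod_mult, Cmod_R, Rabs_pos_eq by apply pos_INR.
replace (INR n * Cmod (a n) * r ^ n) with ((Cmod (a n) * s ^ n) * (INR n * (r / s) ^ n)).
- apply Rmult_le_compat; auto; [apply summ_term_ge0; unfold s; lra|].
  apply Rmult_le_pos; [apply pos_INR|apply pow_le; lra].
- replace (r ^ n) with (s ^ n * (r / s) ^ n); [ring|].
  rewrite <- Rpow_mult_distr; f_equal; unfold s; field; lra.
Qed.

(** * Roots of unity and Cauchy estimates *)

Definition eit (x : R) : C := (cos x, sin x).

Lemma eit_plus x y : eit (x + y) = (eit x * eit y)%C.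
Proof. apply C_eq; simpl; rewrite ?cos_plus, ?sin_plus; ring. Qed.

Lemma eit_0 : eit 0 = RtoC 1.
Proof. unfold eit; rewrite cos_0, sin_0; reflexivity. Qed.

Lemma eit_pow x n : (eit x ^ n)%C = eit (INR n * x).
Proof.
induction n as [|n IH]; [simpl; rewrite Rmult_0_l, eit_0; reflexivity|].
rewrite Cpow_S, IH, S_INR, <- eit_plus; f_equal; ring.
Qed.

Lemma Cmod_eit x : Cmod (eit x) = 1.
Proof.
unfold Cmod, eit; transitivity (sqrt 1); [f_equal; simpl|apply sqrt_1].
transitivity (Rsqr (sin x) + Rsqr (cos x)); [unfold Rsqr; ring|apply sin2_cos2].
Qed.

Lemma Cmod_sq z : RtoC (Cmod z ^ 2) = (z * Cconj z)%C.
Proof. apply Cmod2_conj. Qed.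

Definition om (N : nat) : C := eit (2 * PI / INR N).

Lemma Cmod_om N : Cmod (om N) = 1.
Proof. apply Cmod_eit. Qed.

Lemma om_N N : (0 < N)%nat -> (om N ^ N)%C = RtoC 1.
Proof.
intros HN; unfold om; rewrite eit_pow.
replace (INR N * (2 * PI / INR N)) with (2 * PI) by (field; apply not_0_INR; lia).
unfold eit; rewrite cos_2PI, sin_2PI; reflexivity.
Qed.

Lemma om_conj_r N : (om N * Cconj (om N))%C = RtoC 1.
Proof. rewrite <- Cmod_sq, Cmod_om; f_equal; ring. Qed.

Lemma om_pow_neq1 N d : (0 < d < N)%nat -> (om N ^ d)%C <> RtoC 1.
Proof.
intros Hd H; unfold om in H; rewrite eit_pow in H.
apply (f_equal Re) in H; simpl in H.
set (x := INR d * (2 * PI / INR N)) in H.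
assert (HN : 0 < INR N) by (apply lt_0_INR; lia).
assert (Hx : 0 < x / 2 < PI).
{ assert (Hd0 : 0 < INR d) by (apply lt_0_INR; lia).
  assert (HdN : INR d < INR N) by (apply lt_INR; lia).
  replace (x / 2) with (PI * (INR d / INR N)) by (unfold x; field; lra).
  assert (0 < INR d / INR N < 1).
  { split; [apply Rdiv_lt_0_compat; auto|].
    apply Rmult_lt_reg_r with (INR N); auto.
    unfold Rdiv; rewrite Rmult_assoc, Rinv_l; lra. }
  pose proof PI_RGT_0; nra. }
pose proof (sin_gt_0 (x / 2) (proj1 Hx) (proj2 Hx)) as Hs.
replace x with (2 * (x / 2)) in H by field.
rewrite cos_2a_sin in H; nra.
Qed.

Lemma geom_sum_C (u : C) N : ((1 - u) * csum N (fun j => u ^ j) = 1 - u ^ N)%C.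
Proof.
induction N as [|N IH]; cbn [csum]; [simpl; ring|].
rewrite Cmult_plus_distr_l, IH, Cpow_S; ring.
Qed.

Lemma geom_sum_0 (u : C) N : (u ^ N)%C = RtoC 1 -> u <> RtoC 1 -> csum N (fun j => u ^ j)%C = RtoC 0.
Proof.
intros H1 H2; pose proof (geom_sum_C u N) as H; rewrite H1 in H.
replace (csum N (fun j => u ^ j)%C) with (/ (1 - u) * ((1 - u) * csum N (fun j => u ^ j)))%C.
- rewrite H; ring.
- field; intros E; apply H2; replace u with (1 - (1 - u))%C by ring; rewrite E; ring.
Qed.

(** The sum is geometric, with a ratio u satisfying u^N = 1. The bounds p, q < N exclude aliasing: u
    = 1 only for p = q. *)
Lemma om_orth N p q : (p < N)%nat -> (q < N)%nat ->
  csum N (fun j => (om N ^ j) ^ p * Cconj (om N ^ j) ^ q)%C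
  = if Nat.eqb p q then RtoC (INR N) else RtoC 0.
Proof.
intros Hp Hq.
set (u := (om N ^ p * Cconj (om N) ^ q)%C).
rewrite (csum_ext _ _ (fun j => u ^ j)%C).
2:{ intros j Hj; unfold u; rewrite Cpow_mult_l, Cpow_conj, <- !Cpow_mult_r.
    rewrite (Nat.mul_comm p), (Nat.mul_comm q); reflexivity. }
assert (HcN : (Cconj (om N) ^ N)%C = RtoC 1).
{ rewrite <- Cpow_conj, om_N by lia; apply C_eq; simpl; ring. }
destruct (Nat.eqb_spec p q) as [<-|Hne].
- rewrite (csum_ext _ _ (fun _ => RtoC 1)).
  + rewrite csum_const; ring.
  + intros j _; unfold u; rewrite <- Cpow_mult_l, om_conj_r, !Cpow_1_l; reflexivity.
- apply geom_sum_0.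
  + unfold u; rewrite Cpow_mult_l, <- !Cpow_mult_r, (Nat.mul_comm p), (Nat.mul_comm q), !Cpow_mult_r.
    rewrite om_N, HcN, !Cpow_1_l by lia; ring.
  + intros Hu; unfold u in Hu.
    destruct (Nat.lt_ge_cases p q) as [Hpq|Hpq].
    * replace q with (p + (q - p))%nat in Hu by lia.
      rewrite Cpow_add_r, Cmult_assoc, <- Cpow_mult_l, om_conj_r, Cpow_1_l, Cmult_1_l in Hu.
      apply (om_pow_neq1 N (q - p)); [lia|].
      apply (f_equal Cconj) in Hu; rewrite Cpow_conj, Cconj_conj in Hu; rewrite Hu.
      apply C_eq; simpl; ring.
    * replace p with ((p - q) + q)%nat in Hu by lia.
      rewrite Cpow_add_r, <- Cmult_assoc, <- Cpow_mult_l, om_conj_r, Cpow_1_l, Cmult_1_r in Hu.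
      apply (om_pow_neq1 N (p - q)); [lia|exact Hu].
Qed.

Lemma Cmod_scal (r : R) z : 0 <= r -> Cmod (r * z)%C = r * Cmod z.
Proof. intros; rewrite Cmod_mult, Cmod_R, Rabs_pos_eq; auto. Qed.

Lemma Cmod_om_pow N j : Cmod (om N ^ j)%C = 1.
Proof. rewrite Cmod_pow, Cmod_om, pow1; reflexivity. Qed.

Lemma parseval_poly (a : nat -> C) (r : R) N : (0 < N)%nat ->
  rsum N (fun j => Cmod (csum N (fun n => a n * (r * om N ^ j) ^ n)%C) ^ 2)
  = INR N * rsum N (fun n => (Cmod (a n) * r ^ n) ^ 2).
Proof.
intros HN; apply RtoC_inj; rewrite RtoC_rsum.
rewrite (csum_ext _ _ (fun j => csum N (fun p => csum N (fun q =>
   (a p * r ^ p * Cconj (a q * r ^ q)) * ((om N ^ j) ^ p * Cconj (om N ^ j) ^ q))))%C).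
2:{ intros j _; rewrite Cmod_sq, Cconj_csum, <- csum_csum_mul.
    apply csum_ext; intros p _; apply csum_ext; intros q _.
    rewrite !Cmult_conj, !Cpow_mult_l, Cmult_conj, !Cpow_conj; ring. }
rewrite csum_swap, <- rsum_scal, RtoC_rsum; apply csum_ext; intros p Hp.
rewrite csum_swap.
rewrite (csum_ext _ _ (fun q => a p * r ^ p * Cconj (a q * r ^ q)
          * (if Nat.eqb p q then RtoC (INR N) else RtoC 0))%C).
2:{ intros q Hq; rewrite csum_scal, om_orth; auto. }
rewrite (csum_single _ _ p); auto.
- rewrite Nat.eqb_refl, <- Cmod_sq, Cmod_mult, Cmod_pow, Cmod_R, RtoC_mult.
  rewrite !Rpow_mult_distr, RPow_abs, pow2_abs; apply Cmult_comm.
- intros q Hq Hne; rewrite (proj2 (Nat.eqb_neq p q)); auto; ring.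
Qed.

Lemma is_lim_rtail a r : summ a r ->
  is_lim_seq (fun N => nrm a r - rsum N (fun n => Cmod (a n) * r ^ n)) 0.
Proof.
intros Ha; replace 0 with (nrm a r - nrm a r) by ring.
apply is_lim_seq_minus'; [apply is_lim_seq_const|].
apply is_series_rsum, Series_correct, Ha.
Qed.

(** Parseval is exact for polynomials of degree below M averaged over the M-th roots of unity.
    Truncating the series at M costs the tail [tau M], which tends to 0. *)
Lemma parseval_le b (r : R) m N : 0 <= r -> summ b r ->
  (forall z, Cmod z = r -> Cmod (ev b z) <= m) ->
  rsum N (fun n => (Cmod (b n) * r ^ n) ^ 2) <= m ^ 2.
Proof.
intros Hr Hb Hm.
set (tau := fun M => nrm b r - rsum M (fun n => Cmod (b n) * r ^ n)).
apply (is_lim_seq_le_loc (fun _ => rsum N (fun n => (Cmod (b n) * r ^ n) ^ 2))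
         (fun M => (m + tau M) ^ 2) (rsum N (fun n => (Cmod (b n) * r ^ n) ^ 2)) (m ^ 2)).
- exists (S N); intros M HM.
  assert (HM0 : 0 < INR M) by (apply lt_0_INR; lia).
  eapply Rle_trans; [apply (rsum_incr N M); [lia|intros; apply pow2_ge_0]|].
  apply Rmult_le_reg_l with (INR M); auto.
  rewrite <- parseval_poly by lia.
  rewrite <- rsum_const; apply rsum_le; intros j _; apply pow_incr; split; [apply Cmod_ge_0|].
  set (z := (r * om M ^ j)%C).
  assert (Hz : Cmod z = r) by (unfold z; rewrite Cmod_scal, Cmod_om_pow; auto; ring).
  replace (csum M (fun n => b n * z ^ n)%C)
    with (ev b z - (ev b z - csum M (fun n => b n * z ^ n)))%C by ring.
  eapply Rle_trans; [apply Cmod_triangle|]; rewrite Cmod_opp.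
  apply Rplus_le_compat; [auto|apply ev_tail; auto; lra].
- apply is_lim_seq_const.
- replace (m ^ 2) with ((m + 0) * ((m + 0) * 1)) by ring; simpl.
  assert (H : is_lim_seq (fun M => m + tau M) (m + 0)).
  { apply is_lim_seq_plus'; [apply is_lim_seq_const|now apply is_lim_rtail]. }
  apply is_lim_seq_mult'; auto; apply is_lim_seq_mult'; auto; apply is_lim_seq_const.
Qed.

Lemma cauchy_estimate b (r : R) m n : 0 <= r -> summ b r ->
  (forall z, Cmod z = r -> Cmod (ev b z) <= m) -> Cmod (b n) * r ^ n <= m.
Proof.
intros Hr Hb Hm.
assert (Hm0 : 0 <= m).
{ eapply Rle_trans; [apply (Cmod_ge_0 (ev b r))|apply Hm].
  now rewrite Cmod_R, Rabs_pos_eq. }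
apply Rsqr_incr_0_var; auto; rewrite !Rsqr_pow2.
eapply Rle_trans; [|apply (parseval_le b r m (S n)); auto].
apply (rsum_term (S n) (fun n => (Cmod (b n) * r ^ n) ^ 2)); [lia|intros; apply pow2_ge_0].
Qed.

(** * Reciprocals and logarithms of zero-free power series *)

Lemma pow_sub1_le s n : 1 <= s -> s ^ n - 1 <= INR n * (s - 1) * s ^ n.
Proof.
intros Hs; induction n as [|n IH]; [simpl; lra|].
rewrite S_INR; simpl pow.
assert (1 <= s ^ n) by now apply pow_R1_Rle.
assert (0 <= INR n) by apply pos_INR.
assert (s * (s ^ n - 1) <= s * (INR n * (s - 1) * s ^ n)) by (apply Rmult_le_compat_l; lra).
assert ((s - 1) * 1 <= (s - 1) * (s * s ^ n)).
{ apply Rmult_le_compat_l; [lra|]. nra. }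
nra.
Qed.

(** * Convergence of a reciprocal on a disk where the series is bounded away from zero *)

Section Reciprocal.

Variables (g : nat -> C) (rho mu : R).
Hypotheses (Hrad : rad1 g) (Hrho : 0 < rho < 1) (Hmu : 0 < mu).
Hypothesis Hg : forall z, Cmod z <= rho -> mu <= Cmod (ev g z).

Let b := finv g.

Lemma recip_g0 : g 0%nat <> RtoC 0.
Proof.
intros H; specialize (Hg 0); rewrite ev_0, H, Cmod_0 in Hg; lra.
Qed.

Lemma recip_ev r z : 0 <= r <= rho -> summ b r -> Cmod z <= r -> (ev b z * ev g z)%C = RtoC 1.
Proof.
intros Hr Hb Hz; rewrite <- (ev_conv b g z r); auto.
2:{ apply rad1_summ; auto; lra. }
rewrite (ev_ext _ (delta0 1)) by (intros; apply conv_finv, recip_g0).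
rewrite (ev_finite _ _ 1); [simpl; ring|]; intros [|n] Hn; [lia|reflexivity].
Qed.

Lemma recip_Cmod r z : 0 <= r <= rho -> summ b r -> Cmod z <= r ->
  Cmod (ev b z) = / Cmod (ev g z).
Proof.
intros Hr Hb Hz.
assert (Hz0 : 0 < Cmod (ev g z)) by (eapply Rlt_le_trans; [exact Hmu|apply Hg; lra]).
apply Rmult_eq_reg_r with (Cmod (ev g z)); [|lra].
rewrite <- Cmod_mult, (recip_ev r), Cmod_1, Rinv_l; auto; lra.
Qed.

(* Parseval on [|z| = r] costs only [1 / y] in the l^1 norm on the circle of
   radius [r (1 - y^2)], while rescaling gains a factor [1 + O(y)]: this is why
   the region of convergence grows by a uniform factor. *)
Lemma recip_step : exists kappa, 1 < kappa /\
  forall r r', 0 < r -> summ b r -> r <= r' <= kappa * r -> r' <= rho -> summ b r'.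
Proof.
set (L := nrm (theta g) rho + 1).
assert (HL : 1 <= L).
{ unfold L; pose proof (nrm_ge0 (theta g) rho) as H.
  assert (summ (theta g) rho) by (apply rad1_summ; [now apply rad1_theta|lra]).
  specialize (H ltac:(lra) ltac:(auto)); lra. }
(* With this c, the bound 1/(mu y) for [b] times the bound c y L for the rescaling error is 1/2; y
   <= c/2 keeps [kappa] above 1. *)
set (c := mu / (2 * L)).
assert (Hc : 0 < c) by (apply Rdiv_lt_0_compat; lra).
set (y := Rmin c 1 / 2).
assert (Hy : 0 < y <= / 2 /\ y <= c / 2).
{ unfold y; pose proof (Rmin_l c 1); pose proof (Rmin_r c 1).
  pose proof (Rmin_glb_lt c 1 0 Hc ltac:(lra)); lra. }
exists ((1 - y ^ 2) * (1 + c * y)); split.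
{ assert (0 < y * (c - y - c * y ^ 2)); [|nra].
  apply Rmult_lt_0_compat; [lra|].
  assert (y ^ 2 <= / 4) by nra.
  assert (c * y ^ 2 <= c * / 4) by (apply Rmult_le_compat_l; lra). lra. }
intros r r' Hr Hb Hr' Hr'rho.
set (q := 1 - y ^ 2).
assert (Hq : 0 < q < 1) by (unfold q; nra).
(* Cauchy-Schwarz between the terms of Parseval, where the reciprocal is at most 1/mu on the circle,
   and the sequence q^n, whose square sum is at most 1/y^2. *)
assert (HB : forall N, rsum N (fun n => Cmod (b n) * (r * q) ^ n) <= / (mu * y)).
{ intros N; apply Rsqr_incr_0_var.
  2:{ left; apply Rinv_0_lt_compat; nra. }
  rewrite !Rsqr_pow2.
  rewrite (rsum_ext _ _ (fun n => (Cmod (b n) * r ^ n) * q ^ n)).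
  2:{ intros; rewrite Rpow_mult_distr; ring. }
  eapply Rle_trans; [apply (rsum_cauchy_schwarz N (fun n => Cmod (b n) * r ^ n) (fun n => q ^ n))|].
  replace ((/ (mu * y)) ^ 2) with ((/ mu) ^ 2 * / y ^ 2) by (field; lra).
  apply Rmult_le_compat.
  - apply rsum_ge0; intros; apply pow2_ge_0.
  - apply rsum_ge0; intros; apply pow2_ge_0.
  - apply parseval_le; auto; [lra|]; intros z Hz; rewrite (recip_Cmod r) by (auto; lra).
    apply Rinv_le_contravar; auto; apply Hg; lra.
  - assert (Hgeo : rsum N (fun i => (q ^ i) ^ 2) * (1 - q ^ 2) = 1 - (q ^ 2) ^ N).
    { clear; induction N as [|N IH]; cbn [rsum]; [simpl; ring|].
      rewrite Rmult_plus_distr_r, IH, <- !pow_mult, (Nat.mul_comm N 2).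
      replace (2 * S N)%nat with (2 + 2 * N)%nat by lia; rewrite pow_add; ring. }
    assert (Hqy : y ^ 2 <= 1 - q ^ 2).
    { assert (0 <= y ^ 2 <= 1) by nra; unfold q; set (w := y ^ 2) in *; nra. }
    assert (0 <= (q ^ 2) ^ N) by (apply pow_le; nra).
    apply Rmult_le_reg_r with (y ^ 2); [nra|]. rewrite Rinv_l by nra.
    apply Rle_trans with (rsum N (fun i => (q ^ i) ^ 2) * (1 - q ^ 2)); [|lra].
    apply Rmult_le_compat_l; auto; apply rsum_ge0; intros; apply pow2_ge_0. }
set (s := r' / (r * q)).
assert (Hrq : 0 < r * q) by nra.
assert (Hs : 1 <= s <= 1 + c * y).
{ unfold s; split.
  - apply Rmult_le_reg_r with (r * q); auto; unfold Rdiv; rewrite Rmult_assoc, Rinv_l by lra; nra.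
  - apply Rmult_le_reg_r with (r * q); auto; unfold Rdiv; rewrite Rmult_assoc, Rinv_l by lra.
    fold q in Hr'; nra. }
assert (Hsr : s * (r * q) = r') by (unfold s; field; lra).
set (bs := fun n => (b n * RtoC (s ^ n))%C); set (gs := fun n => (g n * RtoC (s ^ n))%C).
set (D := fun n => (gs n - g n)%C).
assert (HD : forall N, rsum N (fun n => Cmod (D n) * (r * q) ^ n) <= (s - 1) * L).
{ intros N; apply Rle_trans with ((s - 1) * rsum N (fun n => Cmod (theta g n) * rho ^ n)).
  - rewrite <- rsum_scal; apply rsum_le; intros n _.
    unfold D, gs, theta; replace (g n * RtoC (s ^ n) - g n)%C with (RtoC (s ^ n - 1) * g n)%C
      by (rewrite RtoC_minus; ring).
    assert (1 <= s ^ n) by (apply pow_R1_Rle; lra).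
    rewrite !Cmod_scal by (try apply pos_INR; lra).
    apply Rle_trans with (INR n * (s - 1) * s ^ n * Cmod (g n) * (r * q) ^ n).
    + apply Rmult_le_compat_r; [apply pow_le; lra|].
      apply Rmult_le_compat_r; [apply Cmod_ge_0|]; apply pow_sub1_le; lra.
    + replace (INR n * (s - 1) * s ^ n * Cmod (g n) * (r * q) ^ n)
        with ((s - 1) * (INR n * Cmod (g n) * (s ^ n * (r * q) ^ n))) by ring.
      rewrite <- Rpow_mult_distr, Hsr; apply Rmult_le_compat_l; [lra|].
      apply Rmult_le_compat_l; [apply Rmult_le_pos; [apply pos_INR|apply Cmod_ge_0]|].
      apply pow_incr; lra.
  - apply Rmult_le_compat_l; [lra|]; unfold L.
    pose proof (nrm_rsum (theta g) rho N) as H.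
    assert (summ (theta g) rho) by (apply rad1_summ; [now apply rad1_theta|lra]).
    specialize (H ltac:(lra) ltac:(auto)); lra. }
(* Resolvent identity: [gs] is [g] rescaled by s, [bs] is its reciprocal and D = gs - g, so the
   product b D bs equals b - bs. *)
assert (Hbs : forall n, bs n = (b n - conv (conv b D) bs n)%C).
{ intros n.
  assert (Hinv : forall k, conv b g k = delta0 1 k) by (intros; apply conv_finv, recip_g0).
  assert (Hinvs : forall k, conv gs bs k = delta0 1 k).
  { intros k; unfold conv, gs, bs.
    rewrite (csum_ext _ _ (fun i => s ^ k * (g i * b (k - i)%nat))%C).
    - rewrite csum_scal; change (csum (S k) (fun i => g i * b (k - i)%nat)%C) with (conv g b k).
      rewrite conv_comm, Hinv; destruct k; simpl; ring.
    - intros i Hi; replace k with (i + (k - i))%nat at 3 by lia.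
      rewrite RtoC_pow, Cpow_add_r, <- !RtoC_pow; ring. }
  assert (E : conv (conv b D) bs n = (b n - bs n)%C).
  { rewrite conv_assoc, (conv_ext b _ b (fun k => delta0 1 k - conv g bs k)%C); auto.
    2:{ intros i _; unfold D; rewrite conv_minus_l, Hinvs; auto. }
    rewrite conv_comm, conv_minus_l, conv_delta_l, conv_comm, <- conv_assoc.
    rewrite (conv_ext _ bs (delta0 1) bs), conv_delta_l; auto; ring. }
  rewrite E; ring. }
apply ex_series_bounded with (2 * / (mu * y)).
{ intros; apply summ_term_ge0; lra. }
intros N.
set (X := rsum N (fun n => Cmod (bs n) * (r * q) ^ n)).
replace (rsum N (fun n => Cmod (b n) * r' ^ n)) with X.
2:{ apply rsum_ext; intros n _; unfold bs; rewrite Cmod_mult, Cmod_R, Rabs_pos_eq by (apply pow_le; lra).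
    rewrite <- Hsr, (Rpow_mult_distr s); ring. }
assert (HX0 : 0 <= X) by (apply rsum_ge0; intros; apply summ_term_ge0; lra).
(* The error term is at most half of X, so X is bounded uniformly in N. *)
assert (HX : X <= / (mu * y) + / 2 * X).
{ apply Rle_trans with (rsum N (fun n => Cmod (b n) * (r * q) ^ n)
     + rsum N (fun n => Cmod (conv (conv b D) bs n) * (r * q) ^ n)).
  - rewrite <- rsum_plus; apply rsum_le; intros n _; rewrite <- Rmult_plus_distr_r.
    apply Rmult_le_compat_r; [apply pow_le; lra|]; rewrite Hbs at 1.
    eapply Rle_trans; [apply Cmod_triangle|]; rewrite Cmod_opp; lra.
  - apply Rplus_le_compat; auto.
    eapply Rle_trans; [apply rsum_conv_Cmod; lra|]; fold X.
    apply Rmult_le_compat_r; auto.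
    eapply Rle_trans; [apply rsum_conv_Cmod; lra|].
    apply Rle_trans with (/ (mu * y) * ((s - 1) * L)).
    + apply Rmult_le_compat; auto; apply rsum_ge0; intros; apply summ_term_ge0; lra.
    + apply Rle_trans with (/ (mu * y) * (c * y * L)).
      * apply Rmult_le_compat_l; [left; apply Rinv_0_lt_compat; nra|].
        apply Rmult_le_compat_r; lra.
      * right; unfold c; field; lra. }
lra.
Qed.

(** Neumann series: on a small circle the part G of g without constant term has norm at most |g 0| /
    2, so that (g 0) b = 1 - G b bounds b. *)
Lemma recip_start : exists r, 0 < r <= rho /\ summ b r.
Proof.
pose proof recip_g0 as Hg0; apply Cmod_gt_0 in Hg0.
set (m := nrm g rho).
assert (Hsg : summ g rho) by (apply rad1_summ; auto; lra).
assert (Hm : 0 <= m) by (apply nrm_ge0; auto; lra).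
set (t := Rmin 1 (Cmod (g 0%nat) / (2 * (m + 1)))).
assert (Ht : 0 < t <= 1 /\ t * m <= Cmod (g 0%nat) / 2).
{ assert (0 < Cmod (g 0%nat) / (2 * (m + 1))) by (apply Rdiv_lt_0_compat; lra).
  split; [split; [apply Rmin_glb_lt; lra|apply Rmin_l]|].
  apply Rle_trans with (Cmod (g 0%nat) / (2 * (m + 1)) * (m + 1)); [|right; field; lra].
  apply Rmult_le_compat; try lra; [left; apply Rmin_glb_lt; lra|apply Rmin_r]. }
exists (t * rho); split; [nra|].
set (r := t * rho); assert (Hr : 0 <= r) by (unfold r; nra).
set (G := fun n => match n with O => RtoC 0 | S _ => g n end).
assert (HG : forall N, rsum N (fun n => Cmod (G n) * r ^ n) <= Cmod (g 0%nat) / 2).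
{ intros N; apply Rle_trans with (t * rsum N (fun n => Cmod (g n) * rho ^ n)).
  - rewrite <- rsum_scal; apply rsum_le; intros [|n] _; simpl G.
    + rewrite Cmod_0; simpl; pose proof (Cmod_ge_0 (g 0%nat)); nra.
    + unfold r; rewrite Rpow_mult_distr.
      assert (t ^ S n <= t).
      { simpl; rewrite <- (Rmult_1_r t) at 3; apply Rmult_le_compat_l; [lra|].
        rewrite <- (pow1 n); apply pow_incr; lra. }
      assert (0 <= Cmod (g (S n)) * rho ^ S n) by (apply summ_term_ge0; lra).
      replace (Cmod (g (S n)) * (t ^ S n * rho ^ S n))
        with (t ^ S n * (Cmod (g (S n)) * rho ^ S n)) by ring.
      now apply Rmult_le_compat_r.
  - eapply Rle_trans; [|apply Ht]; apply Rmult_le_compat_l; [lra|].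
    apply nrm_rsum; auto; lra. }
apply ex_series_bounded with (2 / Cmod (g 0%nat)).
{ intros; now apply summ_term_ge0. }
intros N; set (X := rsum N (fun n => Cmod (b n) * r ^ n)).
assert (HX0 : 0 <= X) by (apply rsum_ge0; intros; now apply summ_term_ge0).
assert (HX : Cmod (g 0%nat) * X <= 1 + Cmod (g 0%nat) / 2 * X).
{ apply Rle_trans with (rsum N (fun n => Cmod (delta0 1 n) * r ^ n)
     + rsum N (fun n => Cmod (conv G b n) * r ^ n)).
  - unfold X; rewrite <- rsum_scal, <- rsum_plus; apply rsum_le; intros n _.
    rewrite <- Rmult_assoc, <- Rmult_plus_distr_r; apply Rmult_le_compat_r; [now apply pow_le|].
    rewrite <- Cmod_mult.
    replace (g 0%nat * b n)%C with (delta0 1 n - conv G b n)%C.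
    + eapply Rle_trans; [apply Cmod_triangle|]; rewrite Cmod_opp; lra.
    + rewrite <- (conv_finv g n recip_g0), (conv_comm _ g).
      change (finv g) with b.
      rewrite (conv_ext g b (fun i => delta0 (g 0%nat) i + G i)%C b); auto.
      * rewrite conv_plus_l, conv_delta_l; ring.
      * intros [|i] _; simpl; ring.
  - apply Rplus_le_compat.
    + destruct N as [|N]; [simpl; lra|].
      rewrite rsum_first, rsum_0; [simpl; rewrite Cmod_1; lra|].
      intros; simpl; rewrite Cmod_0; ring.
    + eapply Rle_trans; [now apply rsum_conv_Cmod|]; fold X.
      apply Rmult_le_compat_r; auto. }
apply Rmult_le_reg_l with (Cmod (g 0%nat)); auto.
replace (Cmod (g 0%nat) * (2 / Cmod (g 0%nat))) with 2 by (field; lra); lra.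
Qed.

(** [kappa] does not depend on the radius, so finitely many steps lead from the starting radius to
    [rho]. *)
Lemma recip_summ : summ b rho.
Proof.
destruct recip_step as (kappa & Hk & Hstep).
destruct recip_start as (r0 & Hr0 & Hs0).
assert (H : forall n, summ b (Rmin (r0 * kappa ^ n) rho)).
{ induction n as [|n IH].
  - simpl; rewrite Rmult_1_r, Rmin_left; auto; lra.
  - assert (1 <= kappa ^ n) by (apply pow_R1_Rle; lra).
    assert (Hp : 0 < Rmin (r0 * kappa ^ n) rho) by (apply Rmin_glb_lt; nra).
    apply (Hstep (Rmin (r0 * kappa ^ n) rho)); auto; [|apply Rmin_r].
    split; [apply Rle_min_compat_r, Rmult_le_compat_l; [lra|simpl; nra]|].
    unfold Rmin at 2; destruct (Rle_dec (r0 * kappa ^ n) rho).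
    + eapply Rle_trans; [apply Rmin_l|]; simpl; right; ring.
    + eapply Rle_trans; [apply Rmin_r|].
      rewrite <- (Rmult_1_l rho) at 1; apply Rmult_le_compat_r; lra. }
destruct (Pow_x_infinity kappa ltac:(rewrite Rabs_pos_eq by lra; lra) (rho / r0)) as [N HN].
specialize (HN N ltac:(lia)); rewrite Rabs_pos_eq in HN by (apply pow_le; lra).
specialize (H N); rewrite Rmin_right in H; auto.
apply Rmult_le_reg_l with (/ r0); [apply Rinv_0_lt_compat; lra|].
rewrite <- Rmult_assoc, Rinv_l by lra; unfold Rdiv in HN; lra.
Qed.

End Reciprocal.

(** The maximum principle for 1/g: the bound [mu] on the disk enters only qualitatively, to make the
    reciprocal converge, while the estimate obtained depends on the values on the circle alone. *)
Lemma finv_bound g rho mu mu' : rad1 g -> 0 < rho < 1 -> 0 < mu -> 0 < mu' ->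
  (forall z, Cmod z <= rho -> mu <= Cmod (ev g z)) ->
  (forall z, Cmod z = rho -> mu' <= Cmod (ev g z)) ->
  forall n, Cmod (finv g n) * rho ^ n <= / mu'.
Proof.
intros Hrad Hrho Hmu Hmu' Hg Hg' n.
pose proof (recip_summ g rho mu Hrad Hrho Hmu Hg) as Hs.
apply cauchy_estimate; auto; [lra|]; intros z Hz.
rewrite (recip_Cmod g rho mu) with (r := rho); auto; try lra.
apply Rinv_le_contravar; auto.
Qed.

(** * Compactness and continuity *)

Lemma inv_INR_S_pos n : 0 < / INR (S n).
Proof. apply Rinv_0_lt_compat, lt_0_INR; lia. Qed.

Lemma inv_INR_S_le n m : (n <= m)%nat -> / INR (S m) <= / INR (S n).
Proof. intros H; apply Rinv_le_contravar; [apply lt_0_INR; lia|apply le_INR; lia]. Qed.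

Lemma inv_INR_S_lt e : 0 < e -> exists N, forall n, (N <= n)%nat -> / INR (S n) < e.
Proof.
intros He; destruct (archimed_cor1 e He) as (N & HN & HN0).
exists N; intros n Hn; eapply Rle_lt_trans; [|exact HN].
apply Rinv_le_contravar; [now apply lt_0_INR|apply le_INR; lia].
Qed.

(** The index map satisfies n <= phi n but need not be monotone; together with the explicit rate
    this is enough for the limits taken along it. *)
Lemma BW_R (x : nat -> R) B : (forall n, Rabs (x n) <= B) ->
  exists (phi : nat -> nat) l,
    forall n, (n <= phi n)%nat /\ Rabs (x (phi n) - l) < / INR (S n).
Proof.
intros HB.
destruct (Bolzano_Weierstrass x (fun c => - B <= c <= B) (compact_P3 _ _)) as [l Hl].
{ intros n; specialize (HB n); apply Rabs_le_between; auto. }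
assert (H : forall n, exists p, (n <= p)%nat /\ Rabs (x p - l) < / INR (S n)).
{ intros n.
  apply (Hl (disc l (mkposreal _ (inv_INR_S_pos n))) n).
  exists (mkposreal _ (inv_INR_S_pos n)); intros y Hy; exact Hy. }
exists (fun n => proj1_sig (constructive_indefinite_description _ (H n))), l.
intros n; exact (proj2_sig (constructive_indefinite_description _ (H n))).
Qed.

Lemma BW_C (z : nat -> C) B : (forall n, Cmod (z n) <= B) ->
  exists (phi : nat -> nat) l,
    forall n, (n <= phi n)%nat /\ Cmod (z (phi n) - l)%C < 2 * / INR (S n).
Proof.
intros HB.
destruct (BW_R (fun n => Re (z n)) B) as (p1 & x & H1).
{ intros n; eapply Rle_trans; [apply re_le_Cmod|auto]. }
destruct (BW_R (fun n => Im (z (p1 n))) B) as (p2 & y & H2).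
{ intros n; eapply Rle_trans; [apply im_le_Cmod|auto]. }
exists (fun n => p1 (p2 n)), (x, y); intros n.
destruct (H2 n) as [A2 B2]; destruct (H1 (p2 n)) as [A1 B1].
split; [lia|].
eapply Rle_lt_trans; [apply Cmod_le_abs|].
rewrite Re_minus, Im_minus; unfold Re at 2, Im at 2, fst, snd.
pose proof (inv_INR_S_le _ _ A2); lra.
Qed.

Lemma Cpow_diff_le (z w : C) r n : Cmod z <= r -> Cmod w <= r ->
  r * Cmod (z ^ n - w ^ n)%C <= INR n * r ^ n * Cmod (z - w)%C.
Proof.
intros Hz Hw; assert (Hr : 0 <= r) by (eapply Rle_trans; [apply Cmod_ge_0|exact Hz]).
induction n as [|n IH].
- simpl; replace (1 - 1)%C with (RtoC 0) by ring; rewrite Cmod_0; lra.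
- rewrite !Cpow_S, S_INR.
  replace (z * z ^ n - w * w ^ n)%C with (z * (z ^ n - w ^ n) + (z - w) * w ^ n)%C by ring.
  eapply Rle_trans; [apply Rmult_le_compat_l, Cmod_triangle; auto|].
  rewrite !Cmod_mult, Cmod_pow.
  pose proof (Cmod_ge_0 (z - w)%C); pose proof (Cmod_ge_0 (z ^ n - w ^ n)%C).
  pose proof (Cmod_ge_0 w).
  assert (Cmod w ^ n <= r ^ n) by (apply pow_incr; auto).
  assert (0 <= r ^ n) by now apply pow_le.
  assert (Cmod z * (r * Cmod (z ^ n - w ^ n)%C) <= r * (INR n * r ^ n * Cmod (z - w)%C)).
  { apply Rmult_le_compat; auto using Cmod_ge_0; apply Rmult_le_pos; auto. }
  assert (r * Cmod (z - w)%C * Cmod w ^ n <= r * Cmod (z - w)%C * r ^ n).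
  { apply Rmult_le_compat_l; auto; apply Rmult_le_pos; auto. }
  simpl; lra.
Qed.

Lemma ev_lip a z w r : 0 <= r -> summ a r -> summ (theta a) r -> Cmod z <= r -> Cmod w <= r ->
  r * Cmod (ev a z - ev a w)%C <= nrm (theta a) r * Cmod (z - w)%C.
Proof.
intros Hr Ha Hta Hz Hw.
rewrite <- Cmod_scal by auto.
apply (cis_Cmod_le (fun n => r * (a n * z ^ n - a n * w ^ n))%C).
- apply cis_scal, cis_minus; now apply ev_cis with r.
- exists 0%nat; intros n _.
  eapply Rle_trans; [apply Cmod_csum|].
  apply Rle_trans with (Cmod (z - w)%C * rsum n (fun n => Cmod (theta a n) * r ^ n)).
  + rewrite <- rsum_scal; apply rsum_le; intros i _.
    replace (a i * z ^ i - a i * w ^ i)%C with (a i * (z ^ i - w ^ i))%C by ring.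
    rewrite Cmod_scal by auto; rewrite Cmod_mult.
    unfold theta; rewrite Cmod_scal by apply pos_INR.
    pose proof (Cpow_diff_le z w r i Hz Hw) as H; pose proof (Cmod_ge_0 (a i)).
    assert (Cmod (a i) * (r * Cmod (z ^ i - w ^ i)%C)
            <= Cmod (a i) * (INR i * r ^ i * Cmod (z - w)%C)) by now apply Rmult_le_compat_l.
    lra.
  + rewrite Rmult_comm; apply Rmult_le_compat_r; auto using Cmod_ge_0, nrm_rsum.
Qed.

(** Otherwise |F| < 1/(n+1) at some point of D for each n, and by the Lipschitz bound F vanishes at
    a limit point of these points, which lies in D. *)
Lemma lower_bound_compact (F : C -> C) (D : C -> Prop) B L :
  (forall z, D z -> Cmod z <= B) ->
  (forall z w, D z -> D w -> Cmod (F z - F w)%C <= L * Cmod (z - w)%C) ->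
  (forall (u : nat -> C) l, (forall n, D (u n)) ->
     (forall n, Cmod (u n - l)%C < 2 * / INR (S n)) -> D l) ->
  (forall z, D z -> F z <> RtoC 0) ->
  exists mu, 0 < mu /\ forall z, D z -> mu <= Cmod (F z).
Proof.
intros HB HL Hcl HF.
destruct (excluded_middle_informative (exists mu, 0 < mu /\ forall z, D z -> mu <= Cmod (F z)))
  as [|Hno]; auto; exfalso.
assert (H : forall n, exists z, D z /\ Cmod (F z) < / INR (S n)).
{ intros n; apply NNPP; intros Hn; apply Hno; exists (/ INR (S n)); split;
    [apply inv_INR_S_pos|]; intros z Hz; apply Rnot_lt_le; intros Hlt; apply Hn; eauto. }
set (u := fun n => proj1_sig (constructive_indefinite_description _ (H n))).
assert (Hu : forall n, D (u n) /\ Cmod (F (u n)) < / INR (S n)).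
{ intros n; exact (proj2_sig (constructive_indefinite_description _ (H n))). }
destruct (BW_C u B) as (phi & l & Hl).
{ intros n; apply HB, Hu. }
assert (Dl : D l).
{ apply (Hcl (fun n => u (phi n))); intros n; [apply Hu|apply Hl]. }
apply (HF l Dl), Cmod_eq_0, Rle_antisym; [|apply Cmod_ge_0].
apply le_epsilon; intros e He; rewrite Rplus_0_l.
destruct (inv_INR_S_lt (e / (1 + 2 * Rabs L))) as [N HN].
{ apply Rdiv_lt_0_compat; auto; pose proof (Rabs_pos L); lra. }
destruct (Hl N) as [A1 B1]; destruct (Hu (phi N)) as [A2 B2].
replace (F l) with (F (u (phi N)) - (F (u (phi N)) - F l))%C by ring.
eapply Rle_trans; [apply Cmod_triangle|]; rewrite Cmod_opp.
specialize (HL _ _ A2 Dl); specialize (HN N ltac:(lia)).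
pose proof (inv_INR_S_le _ _ A1); pose proof (Rle_abs L); pose proof (Rabs_pos L).
pose proof (Cmod_ge_0 (u (phi N) - l)%C).
apply Rle_trans with (/ INR (S N) * (1 + 2 * Rabs L)).
- assert (L * Cmod (u (phi N) - l)%C <= Rabs L * (2 * / INR (S N))).
  { apply Rle_trans with (Rabs L * Cmod (u (phi N) - l)%C);
      [now apply Rmult_le_compat_r|apply Rmult_le_compat_l; lra]. }
  lra.
- apply Rlt_le in HN; apply (Rmult_le_compat_r (1 + 2 * Rabs L)) in HN; [|lra].
  unfold Rdiv in HN; rewrite Rmult_assoc, Rinv_l in HN by lra; lra.
Qed.

Lemma Cmod_lim_le (u : nat -> C) l r : (forall n, Cmod (u n) <= r) ->
  (forall n, Cmod (u n - l)%C < 2 * / INR (S n)) -> Cmod l <= r.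
Proof.
intros Hu Hl; apply le_epsilon; intros e He.
destruct (inv_INR_S_lt (e / 2)) as [N HN]; [lra|].
specialize (HN N ltac:(lia)); specialize (Hl N); specialize (Hu N).
replace l with (u N - (u N - l))%C by ring.
eapply Rle_trans; [apply Cmod_triangle|]; rewrite Cmod_opp; lra.
Qed.

Lemma Cmod_lim_ge (u : nat -> C) l r : (forall n, r <= Cmod (u n)) ->
  (forall n, Cmod (u n - l)%C < 2 * / INR (S n)) -> r <= Cmod l.
Proof.
intros Hu Hl; apply le_epsilon; intros e He.
destruct (inv_INR_S_lt (e / 2)) as [N HN]; [lra|].
specialize (HN N ltac:(lia)); specialize (Hl N); specialize (Hu N).
pose proof (Cmod_triangle (u N - l) l)%C as H.
replace (u N - l + l)%C with (u N) in H by ring; lra.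
Qed.

Lemma ev_lip_rad1 a r : rad1 a -> 0 < r < 1 -> exists L, 0 <= L /\
  forall z w, Cmod z <= r -> Cmod w <= r -> Cmod (ev a z - ev a w)%C <= L * Cmod (z - w)%C.
Proof.
intros Ha Hr.
assert (Hs : summ a r) by (apply rad1_summ; auto; lra).
assert (Hts : summ (theta a) r) by (apply rad1_summ; [now apply rad1_theta|lra]).
exists (nrm (theta a) r / r); split.
- apply Rmult_le_pos; [apply nrm_ge0; auto; lra|left; apply Rinv_0_lt_compat; lra].
- intros z w Hz Hw; apply Rmult_le_reg_l with r; [lra|].
  eapply Rle_trans; [apply ev_lip; auto; lra|]; right; field; lra.
Qed.

Lemma ev_lower_disk g r : rad1 g -> 0 < r < 1 ->
  (forall z, Cmod z <= r -> ev g z <> RtoC 0) ->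
  exists mu, 0 < mu /\ forall z, Cmod z <= r -> mu <= Cmod (ev g z).
Proof.
intros Hg Hr Hz; destruct (ev_lip_rad1 g r Hg Hr) as (L & HL & Hlip).
apply (lower_bound_compact (ev g) (fun z => Cmod z <= r) r L); auto.
intros u l; apply Cmod_lim_le.
Qed.

Lemma ev_lower_circle g r : rad1 g -> 0 < r < 1 ->
  (forall z, Cmod z = r -> ev g z <> RtoC 0) ->
  exists mu, 0 < mu /\ forall z, Cmod z = r -> mu <= Cmod (ev g z).
Proof.
intros Hg Hr Hz; destruct (ev_lip_rad1 g r Hg Hr) as (L & HL & Hlip).
apply (lower_bound_compact (ev g) (fun z => Cmod z = r) r L); auto.
- intros; lra.
- intros z w Hz1 Hw1; apply Hlip; lra.
- intros u l Hu Hl; apply Rle_antisym;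
    [apply (Cmod_lim_le u)|apply (Cmod_lim_ge u)]; auto; intros; rewrite Hu; lra.
Qed.

(** * Zero-free series: reciprocal and logarithm on the whole unit disk *)

Definition zero_free (g : nat -> C) : Prop := forall z, Cmod z < 1 -> ev g z <> RtoC 0.

Lemma zero_free_0 g : zero_free g -> g 0%nat <> RtoC 0.
Proof. intros H E; apply (H 0); [rewrite Cmod_0; lra|]. now rewrite ev_0. Qed.

Lemma finv_rad1 g : rad1 g -> zero_free g -> rad1 (finv g).
Proof.
intros Hg Hz; apply summ_rad1; intros r Hr.
destruct (ev_lower_disk g r Hg Hr) as (mu & Hmu & H).
- intros z Hzr; apply Hz; lra.
- now apply (recip_summ g r mu).
Qed.

Lemma ev_finv g z : rad1 g -> zero_free g -> Cmod z < 1 -> (ev (finv g) z * ev g z)%C = RtoC 1.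
Proof.
intros Hg Hz H.
set (r := (1 + Cmod z) / 2); pose proof (Cmod_ge_0 z).
assert (Hr : 0 < r < 1) by (unfold r; lra).
destruct (ev_lower_disk g r Hg Hr) as (mu & Hmu & Hl).
- intros w Hw; apply Hz; lra.
- apply (recip_ev g r mu Hg Hr Hmu Hl r); [lra| |unfold r; lra].
  apply rad1_summ; [now apply finv_rad1|lra].
Qed.

Lemma flog_rad1 g : rad1 g -> zero_free g -> rad1 (flog g).
Proof.
intros Hg Hz.
assert (H : rad1 (conv (theta g) (finv g))).
{ apply rad1_conv; [now apply rad1_theta|now apply finv_rad1]. }
intros r Hr; destruct (H r Hr) as [M HM]; exists M; intros n.
eapply Rle_trans; [|apply (HM n)].
apply Rmult_le_compat_r; [apply pow_le; lra|].
unfold flog; destruct n as [|n].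
- replace (conv (theta g) (finv g) 0%nat) with (RtoC 0).
  + rewrite Cmult_0_r; lra.
  + unfold conv; simpl; rewrite theta_0; ring.
- pose proof (inv_INR_S_pos n); rewrite Cmod_scal by lra.
  rewrite <- Rmult_1_l; apply Rmult_le_compat_r; [apply Cmod_ge_0|].
  rewrite <- Rinv_1; apply Rinv_le_contravar; [lra|].
  rewrite S_INR; pose proof (pos_INR n); lra.
Qed.

Lemma theta_summ_real (c : nat -> R) R0 M : 1 < R0 -> (forall n, Rabs (c n) * R0 ^ n <= M) ->
  forall t, 0 <= t <= 1 ->
    is_derive (PSeries c) t (PSeries (PS_derive c) t) /\
    t * PSeries (PS_derive c) t = Series (fun n => INR n * c n * t ^ n).
Proof.
intros HR HM t Ht; split.
- apply is_derive_PSeries.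
  apply Rbar_lt_le_trans with R0; [simpl; rewrite Rabs_pos_eq; lra|].
  apply (proj1 (CV_radius_bounded c)); exists M; intros n.
  rewrite Rabs_mult, (Rabs_pos_eq (R0 ^ n)); auto; apply pow_le; lra.
- rewrite <- PSeries_incr_1; apply Series_ext; intros [|n]; simpl; [unfold zero; simpl; ring|].
  unfold PS_derive; simpl; ring.
Qed.

(** The restriction to the ray through z is given by real power series in t whose radius of
    convergence exceeds 1, so termwise differentiation is allowed up to t = 1. *)
Lemma ev_radial_derive a z : rad1 a -> Cmod z < 1 ->
  exists D : R -> C, forall t, 0 <= t <= 1 ->
    is_derive (fun t : R => Re (ev a (t * z)%C)) t (Re (D t)) /\
    is_derive (fun t : R => Im (ev a (t * z)%C)) t (Im (D t)) /\
    (t * D t)%C = ev (theta a) (t * z)%C.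
Proof.
intros Ha Hz; pose proof (Cmod_ge_0 z) as Hz0.
set (s := (1 + Cmod z) / 2).
destruct (Ha s) as [M HM]; [unfold s; lra|].
set (u := fun n => (a n * z ^ n)%C).
assert (HR : exists R0, 1 < R0 /\ forall n, Cmod (u n) * R0 ^ n <= M).
(* The summand (1 - |z|)/4 keeps the denominator positive at z = 0 and still below s. *)
{ exists (Rmin 2 (s / (Cmod z + (1 - Cmod z) / 4))); split.
  - apply Rmin_glb_lt; [lra|].
    apply Rmult_lt_reg_r with (Cmod z + (1 - Cmod z) / 4); [lra|].
    replace (s / (Cmod z + (1 - Cmod z) / 4) * (Cmod z + (1 - Cmod z) / 4)) with s by (field; lra).
    unfold s; lra.
  - intros n; eapply Rle_trans; [|apply (HM n)].
    unfold u; rewrite Cmod_mult, Cmod_pow, Rmult_assoc, <- Rpow_mult_distr.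
    apply Rmult_le_compat_l; [apply Cmod_ge_0|]; apply pow_incr; split.
    + apply Rmult_le_pos; auto; apply Rmin_glb; [lra|].
      apply Rlt_le, Rdiv_lt_0_compat; unfold s; lra.
    + apply Rle_trans with (Cmod z * (s / (Cmod z + (1 - Cmod z) / 4))).
      * apply Rmult_le_compat_l; auto; apply Rmin_r.
      * apply Rle_trans with ((Cmod z + (1 - Cmod z) / 4) * (s / (Cmod z + (1 - Cmod z) / 4))).
        -- apply Rmult_le_compat_r; [apply Rlt_le, Rdiv_lt_0_compat; unfold s; lra|lra].
        -- right; field; lra. }
destruct HR as (R0 & HR0 & HRM).
set (c1 := fun n => Re (u n)); set (c2 := fun n => Im (u n)).
assert (H1 : forall n, Rabs (c1 n) * R0 ^ n <= M).
{ intros n; eapply Rle_trans; [|apply (HRM n)]; apply Rmult_le_compat_r;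
    [apply pow_le; lra|apply re_le_Cmod]. }
assert (H2 : forall n, Rabs (c2 n) * R0 ^ n <= M).
{ intros n; eapply Rle_trans; [|apply (HRM n)]; apply Rmult_le_compat_r;
    [apply pow_le; lra|apply im_le_Cmod]. }
exists (fun t => (PSeries (PS_derive c1) t, PSeries (PS_derive c2) t)).
assert (Hpow : forall (t : R) n, (a n * (t * z) ^ n)%C = (RtoC (t ^ n) * u n)%C).
{ intros t n; unfold u; rewrite Cpow_mult_l, <- RtoC_pow; ring. }
intros t Ht.
destruct (theta_summ_real c1 R0 M HR0 H1 t Ht) as [A1 B1].
destruct (theta_summ_real c2 R0 M HR0 H2 t Ht) as [A2 B2].
split; [|split].
- eapply is_derive_ext; [|exact A1]; intros x; apply Series_ext; intros n.
  rewrite Hpow, Re_scal; apply Rmult_comm.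
- eapply is_derive_ext; [|exact A2]; intros x; apply Series_ext; intros n.
  rewrite Hpow, Im_scal; apply Rmult_comm.
- assert (Ht2 : forall n, (theta a n * (t * z) ^ n)%C = (RtoC (INR n * t ^ n) * u n)%C).
  { intros n; unfold theta; rewrite RtoC_mult, <- Cmult_assoc, Hpow; ring. }
  apply C_eq.
  + rewrite Re_scal; transitivity (t * PSeries (PS_derive c1) t); [reflexivity|].
    rewrite B1; apply Series_ext; intros n; rewrite Ht2, Re_scal; unfold c1; ring.
  + rewrite Im_scal; transitivity (t * PSeries (PS_derive c2) t); [reflexivity|].
    rewrite B2; apply Series_ext; intros n; rewrite Ht2, Im_scal; unfold c2; ring.
Qed.

Lemma mvt f df a b : a < b -> (forall x, a <= x <= b -> is_derive f x (df x)) ->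
  exists c, a < c < b /\ f b - f a = df c * (b - a).
Proof.
intros Hab H; destruct (MVT_cor2 f df a b Hab) as (c & Hc & Hcc).
- intros x Hx; apply is_derive_Reals; auto.
- exists c; auto.
Qed.

Lemma Cmod_sq_Re_Im z : Cmod z ^ 2 = Re z ^ 2 + Im z ^ 2.
Proof. apply Cmod2_alt. Qed.

Lemma is_derive_ln_Cmod_sq (X Y : R -> R) (t x' y' : R) :
  0 < X t ^ 2 + Y t ^ 2 -> is_derive X t x' -> is_derive Y t y' ->
  is_derive (fun t => ln (X t ^ 2 + Y t ^ 2)) t
    (2 * (X t * x' + Y t * y') / (X t ^ 2 + Y t ^ 2)).
Proof.
intros Hp HX HY.
assert (Hex : ex_derive X t) by (exists x'; auto).
assert (Hey : ex_derive Y t) by (exists y'; auto).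
auto_derive.
- repeat split; auto.
- change (fun x : R => X x) with X; change (fun x : R => Y x) with Y.
  rewrite (is_derive_unique _ _ _ HX), (is_derive_unique _ _ _ HY); field; lra.
Qed.

(** Along the segment from 0 to z the difference of the two sides has derivative zero, because
    [theta (flog g)] times g is [theta g]. Taking logarithms of squared moduli avoids any choice of
    branch. *)
Lemma flog_ev g z : rad1 g -> zero_free g -> Cmod z < 1 ->
  ln (Cmod (ev g z) ^ 2) = ln (Cmod (g 0%nat) ^ 2) + 2 * Re (ev (flog g) z).
Proof.
intros Hg Hzf Hz.
destruct (ev_radial_derive g z Hg Hz) as (D & HD).
destruct (ev_radial_derive (flog g) z (flog_rad1 g Hg Hzf) Hz) as (E & HE).
set (X := fun t : R => Re (ev g (t * z)%C)); set (Y := fun t : R => Im (ev g (t * z)%C)).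
assert (Htz : forall t, 0 <= t <= 1 -> Cmod (t * z)%C < 1).
{ intros t Ht; rewrite Cmod_scal by lra; pose proof (Cmod_ge_0 z); nra. }
assert (Hpos : forall t, 0 <= t <= 1 -> 0 < X t ^ 2 + Y t ^ 2).
{ intros t Ht; unfold X, Y; rewrite <- Cmod_sq_Re_Im; apply pow_lt, Cmod_gt_0, Hzf; auto. }
set (F := fun t : R => ln (X t ^ 2 + Y t ^ 2) - 2 * Re (ev (flog g) (t * z)%C)).
destruct (mvt F (fun t => 2 * (X t * Re (D t) + Y t * Im (D t)) / (X t ^ 2 + Y t ^ 2)
                          - 2 * Re (E t)) 0 1 ltac:(lra)) as (c & Hc & HF).
{ intros t Ht; destruct (HD t Ht) as (A1 & A2 & _); destruct (HE t Ht) as (B1 & _ & _).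
  apply (is_derive_minus (K := R_AbsRing) (V := R_NormedModule)).
  - apply is_derive_ln_Cmod_sq; auto.
  - apply (is_derive_scal (fun t : R => Re (ev (flog g) (t * z)%C))); auto. }
assert (Hc0 : 0 <= c <= 1) by lra.
destruct (HD c Hc0) as (_ & _ & A); destruct (HE c Hc0) as (_ & _ & B).
set (G := ev g (c * z)%C) in *.
assert (Hth : (ev (theta (flog g)) (c * z) * G)%C = ev (theta g) (c * z)%C).
{ unfold G; set (r := Cmod (c * z)%C); pose proof (Cmod_ge_0 (c * z)%C).
  specialize (Htz c Hc0); fold r in Htz, H.
  rewrite <- (ev_conv _ _ _ r); try lra; try (unfold r; lra).
  - apply ev_ext, flog_is_flog, zero_free_0, Hzf.
  - apply rad1_summ; [apply rad1_theta, flog_rad1; auto|lra].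
  - apply rad1_summ; auto; lra. }
rewrite <- A, <- B in Hth.
assert (Hth' : (E c * G)%C = D c).
{ assert (Hne : RtoC c <> RtoC 0) by (intros K; apply RtoC_inj in K; lra).
  replace (D c) with (/ c * (c * D c))%C by (field; auto).
  rewrite <- Hth; field; auto. }
assert (Hd : 2 * (X c * Re (D c) + Y c * Im (D c)) / (X c ^ 2 + Y c ^ 2) - 2 * Re (E c) = 0).
{ specialize (Hpos c Hc0); rewrite <- Hth', Re_mult, Im_mult.
  change (Re G) with (X c); change (Im G) with (Y c); field; lra. }
rewrite Hd in HF; unfold F, X, Y in HF.
rewrite !Cmult_1_l, !Cmult_0_l, <- !Cmod_sq_Re_Im, !ev_0 in HF.
replace (Re (flog g 0%nat)) with 0 in HF; [lra|].
rewrite (proj1 (flog_is_flog g (zero_free_0 g Hzf))); reflexivity.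
Qed.

(** * The difference quotient of a univalent function *)

Lemma series_geo x M : 0 <= x < 1 -> ex_series (fun n => M * x ^ n) /\ Series (fun n => M * x ^ n) = M / (1 - x).
Proof.
intros Hx; assert (H : is_series (fun n => x ^ n) (/ (1 - x))).
{ apply is_series_geom; rewrite Rabs_pos_eq; lra. }
split.
- apply (ex_series_scal (K := R_AbsRing) (V := R_NormedModule)); eexists; eauto.
- rewrite Series_scal_l; unfold Rdiv; f_equal; now apply is_series_unique.
Qed.

Lemma ratio_lt1 r s : 0 <= r < s -> 0 <= r / s < 1.
Proof.
intros H; split.
- apply Rmult_le_pos; [lra|left; apply Rinv_0_lt_compat; lra].
- apply Rmult_lt_reg_r with s; [lra|]; unfold Rdiv; rewrite Rmult_assoc, Rinv_l; lra.
Qed.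

Lemma geo_le b r s M n : 0 <= r < s -> Cmod (b n) * s ^ n <= M ->
  Cmod (b n) * r ^ n <= M * (r / s) ^ n.
Proof.
intros Hr H; replace (Cmod (b n) * r ^ n) with (Cmod (b n) * s ^ n * (r / s) ^ n).
- apply Rmult_le_compat_r; auto; apply pow_le; apply (ratio_lt1 r s); lra.
- rewrite Rmult_assoc, <- Rpow_mult_distr; do 2 f_equal; field; lra.
Qed.

Lemma geo_summ b r s M : 0 <= r < s -> (forall n, Cmod (b n) * s ^ n <= M) -> summ b r.
Proof.
intros Hr H; apply ex_series_dom with (fun n => M * (r / s) ^ n).
- intros n; rewrite Rabs_pos_eq by (apply summ_term_ge0; lra); now apply geo_le.
- apply series_geo, ratio_lt1; lra.
Qed.

Lemma geo_tail b z r s M T : 0 <= r < s -> (forall n, Cmod (b n) * s ^ n <= M) -> Cmod z <= r ->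
  Cmod (ev b z - csum T (fun n => b n * z ^ n))%C <= M * (r / s) ^ T / (1 - r / s).
Proof.
intros Hr H Hz; pose proof (geo_summ b r s M Hr H) as Hs.
pose proof (ratio_lt1 r s Hr) as Hx.
eapply Rle_trans; [apply ev_tail; eauto|].
apply Rplus_le_reg_r with (rsum T (fun n => Cmod (b n) * r ^ n)).
replace (nrm b r - rsum T (fun n => Cmod (b n) * r ^ n) + rsum T (fun n => Cmod (b n) * r ^ n))
  with (nrm b r) by ring.
apply Series_le_bound; [intros; apply summ_term_ge0; lra|]; intros N.
apply Rle_trans with (rsum (T + N) (fun n => Cmod (b n) * r ^ n)).
{ apply rsum_incr; [lia|intros; apply summ_term_ge0; lra]. }
rewrite rsum_add, Rplus_comm; apply Rplus_le_compat_r.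
assert (HM : 0 <= M).
{ eapply Rle_trans; [|apply (H 0%nat)]; apply summ_term_ge0; lra. }
apply Rle_trans with (rsum N (fun i => (M * (r / s) ^ T) * (r / s) ^ i)).
- apply rsum_le; intros i _; eapply Rle_trans; [apply (geo_le b r s M); auto|].
  rewrite pow_add; right; ring.
- assert (HMx : 0 <= M * (r / s) ^ T) by (apply Rmult_le_pos; auto; apply pow_le; lra).
  destruct (series_geo (r / s) (M * (r / s) ^ T) Hx) as [A B].
  rewrite <- B; apply rsum_le_Series; auto.
  intros i; apply Rmult_le_pos; auto; apply pow_le; lra.
Qed.

Lemma geo_ev b z r s M : 0 <= r < s -> (forall n, Cmod (b n) * s ^ n <= M) -> Cmod z <= r ->
  Cmod (ev b z) <= M / (1 - r / s).
Proof.
intros Hr H Hz; pose proof (geo_tail b z r s M 0 Hr H Hz) as H0; simpl in H0.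
replace (ev b z - 0)%C with (ev b z) in H0 by ring.
now rewrite Rmult_1_r in H0.
Qed.

(** The factor S' depends on r and s only. This makes the Lipschitz constant of [quot] in one
    variable uniform in the other. *)
Lemma geo_theta r s : 0 <= r < s -> exists S', forall b M, (forall n, Cmod (b n) * s ^ n <= M) ->
  summ b r /\ summ (theta b) r /\ nrm (theta b) r <= M * S'.
Proof.
intros Hr; set (t := (r + s) / 2).
assert (Hrt : 0 <= r < t) by (unfold t; lra). assert (Hts : 0 <= t < s) by (unfold t; lra).
destruct (pow_INR_bounded (t / s) (ratio_lt1 t s Hts)) as [K HK].
exists (K / (1 - r / t)); intros b M H.
assert (HM : 0 <= M).
{ eapply Rle_trans; [|apply (H 0%nat)]; apply summ_term_ge0; lra. }
assert (Hth : forall n, Cmod (theta b n) * t ^ n <= M * K).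
{ intros n; unfold theta; rewrite Cmod_scal by apply pos_INR.
  apply Rle_trans with (M * (INR n * (t / s) ^ n)).
  - pose proof (geo_le b t s M n Hts (H n)); pose proof (pos_INR n).
    assert (INR n * (Cmod (b n) * t ^ n) <= INR n * (M * (t / s) ^ n)) by now apply Rmult_le_compat_l.
    lra.
  - now apply Rmult_le_compat_l. }
split; [now apply geo_summ with s M|].
split; [now apply geo_summ with t (M * K)|].
apply Series_le_bound; [intros; apply summ_term_ge0; lra|]; intros N.
destruct (series_geo (r / t) (M * K) (ratio_lt1 r t Hrt)) as [A B].
replace (M * (K / (1 - r / t))) with (M * K / (1 - r / t)) by (unfold Rdiv; ring).
rewrite <- B.
eapply Rle_trans; [apply rsum_le; intros; apply (geo_le (theta b) r t (M * K)); auto|].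
apply rsum_le_Series; auto.
intros i; apply Rmult_le_pos; [|apply pow_le; apply ratio_lt1; auto].
eapply Rle_trans; [|apply (Hth 0%nat)]; apply summ_term_ge0; lra.
Qed.

Definition univ (a : nat -> C) : Prop :=
  a 0%nat = RtoC 0 /\ a 1%nat = RtoC 1 /\ rad1 a /\
  forall z w, Cmod z < 1 -> Cmod w < 1 -> ev a z = ev a w -> z = w.

Lemma is_lim_seq_0_bounded (u : nat -> R) : is_lim_seq u 0 -> exists M, forall n, Rabs (u n) <= M.
Proof.
intros H; apply is_lim_seq_spec in H; destruct (H (mkposreal 1 Rlt_0_1)) as [N HN].
exists (rsum N (fun n => Rabs (u n)) + 1); intros n.
destruct (Nat.lt_ge_cases n N) as [Hn|Hn].
- pose proof (rsum_term N (fun n => Rabs (u n)) n Hn (fun _ => Rabs_pos _)); simpl in *; lra.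
- specialize (HN n Hn); simpl in HN; rewrite Rminus_0_r in HN.
  pose proof (rsum_ge0 N (fun n => Rabs (u n)) (fun _ _ => Rabs_pos _)); lra.
Qed.

Lemma schlicht_coeffs_univ f a : schlicht_coeffs f a ->
  univ a /\ forall z, Cmod z < 1 -> f z = ev a z.
Proof.
intros (H0 & H1 & Hs & Hinj).
assert (Hc : forall z, Cmod z < 1 -> cis (fun n => a n * z ^ n)%C (f z)).
{ intros z Hz; apply cis_ext with (fun n => a n * @pow_n C_Ring z n)%C.
  - intros n; now rewrite pow_n_Cpow.
  - now apply cis_of_is_series, Hs. }
assert (Hf : forall z, Cmod z < 1 -> f z = ev a z).
{ intros z Hz; symmetry; now apply ev_unique, Hc. }
split; [|exact Hf].
split; [exact H0|split; [exact H1|split]].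
- intros r Hr; destruct (Hc (RtoC r)) as [A B].
  { rewrite Cmod_R, Rabs_pos_eq; lra. }
  destruct (is_lim_seq_0_bounded _ (ex_series_lim_0 _ (ex_intro _ _ A))) as [M1 HM1].
  destruct (is_lim_seq_0_bounded _ (ex_series_lim_0 _ (ex_intro _ _ B))) as [M2 HM2].
  exists (M1 + M2); intros n.
  replace (Cmod (a n) * r ^ n) with (Cmod (a n * RtoC r ^ n)%C).
  + eapply Rle_trans; [apply Cmod_le_abs|]; specialize (HM1 n); specialize (HM2 n); simpl in *; lra.
  + rewrite Cmod_mult, Cmod_pow, Cmod_R, Rabs_pos_eq; auto; lra.
- intros z w Hz Hw E; apply Hinj; auto; rewrite !Hf; auto.
Qed.

Lemma ev_shift a z r : summ a r -> 0 < r -> Cmod z <= r ->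
  summ (fun n => a (S n)) r /\ ev a z = (a 0%nat + z * ev (fun n => a (S n)) z)%C.
Proof.
intros Ha Hr Hz.
assert (Hs : summ (fun n => a (S n)) r).
{ apply ex_series_bounded with (nrm a r / r); [intros n; apply (summ_term_ge0 (fun n => a (S n))); lra|].
  intros n; apply Rmult_le_reg_l with r; auto.
  replace (r * (nrm a r / r)) with (nrm a r) by (field; lra).
  rewrite <- rsum_scal.
  eapply Rle_trans; [|apply (nrm_rsum a r (S n)); auto; lra].
  rewrite rsum_first; pose proof (summ_term_ge0 a r 0 ltac:(lra)).
  rewrite (rsum_ext n (fun i => r * _) (fun i => Cmod (a (S i)) * r ^ S i)); [simpl in *; lra|].
  intros; simpl; ring. }
split; auto.
apply ev_unique; pose proof (ev_cis _ z r Hs Hz) as [A B].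
assert (H : forall n, csum (S n) (fun n => a n * z ^ n)%C
   = (a 0%nat + z * csum n (fun n => a (S n) * z ^ n))%C).
{ intros n; rewrite csum_first, <- csum_scal; f_equal; [simpl; ring|].
  apply csum_ext; intros; rewrite Cpow_S; ring. }
pose proof (cis_scal z _ _ (ev_cis _ z r Hs Hz)) as [A' B'].
apply is_series_rsum in A'; apply is_series_rsum in B'.
split; apply is_series_rsum; apply is_lim_seq_incr_1.
- rewrite Re_plus.
  apply is_lim_seq_ext with (fun n => Re (a 0%nat) + rsum n (fun n => Re (z * (a (S n) * z ^ n))%C)).
  + intros n; rewrite <- !Re_csum, <- Re_plus, H, csum_scal; reflexivity.
  + apply is_lim_seq_plus'; auto using is_lim_seq_const.
- rewrite Im_plus.
  apply is_lim_seq_ext with (fun n => Im (a 0%nat) + rsum n (fun n => Im (z * (a (S n) * z ^ n))%C)).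
  + intros n; rewrite <- !Im_csum, <- Im_plus, H, csum_scal; reflexivity.
  + apply is_lim_seq_plus'; auto using is_lim_seq_const.
Qed.

(** (z^n - w^n)/(z - w) is the sum of z^i w^q over i + q = n - 1, so the coefficient of z^i w^q in
    the difference quotient is a (i + q + 1). In particular [shift a 0] represents f(z)/z when a 0 =
    0. *)
Definition shift (a : nat -> C) (i q : nat) : C := a (S (i + q)).

Lemma summ_shift a r i : 0 < r -> summ a r ->
  summ (shift a i) r /\ nrm (shift a i) r * r ^ i <= nrm a r / r.
Proof.
intros Hr Ha.
assert (H : forall n, rsum n (fun q => Cmod (shift a i q) * r ^ q) <= nrm a r / r / r ^ i).
{ intros n; apply Rmult_le_reg_l with (r * r ^ i); [apply Rmult_lt_0_compat; auto; now apply pow_lt|].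
  replace (r * r ^ i * (nrm a r / r / r ^ i)) with (nrm a r)
    by (field; repeat split; try apply pow_nonzero; lra).
  eapply Rle_trans; [|apply (nrm_rsum a r (S i + n)); auto; lra].
  rewrite rsum_add, <- rsum_scal.
  pose proof (rsum_ge0 (S i) (fun n => Cmod (a n) * r ^ n)
    ltac:(intros; apply summ_term_ge0; lra)) as H.
  rewrite (rsum_ext n _ (fun i0 => Cmod (a (S i + i0)%nat) * r ^ (S i + i0))); [lra|].
  intros; unfold shift; simpl; rewrite pow_add; ring. }
split.
- apply ex_series_bounded with (nrm a r / r / r ^ i); auto; intros; apply summ_term_ge0; lra.
- apply Rle_trans with (nrm a r / r / r ^ i * r ^ i).
  + apply Rmult_le_compat_r; [apply pow_le; lra|].
    apply Series_le_bound; auto; intros; apply summ_term_ge0; lra.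
  + right; field; repeat split; try apply pow_nonzero; lra.
Qed.

Lemma rad1_shift a i : rad1 a -> rad1 (shift a i).
Proof.
intros Ha; apply summ_rad1; intros r Hr; apply summ_shift; [lra|apply rad1_summ; auto; lra].
Qed.

(* Coefficients in [z] of [(f z - f w) / (z - w)]. *)
Definition ecoef (a : nat -> C) (w : C) (i : nat) : C := ev (shift a i) w.

Definition quot (a : nat -> C) (z w : C) : C := ev (ecoef a w) z.

Lemma ecoef_bound a r : rad1 a -> 0 < r < 1 ->
  exists M, 0 <= M /\ forall w i, Cmod w <= r -> Cmod (ecoef a w i) * r ^ i <= M.
Proof.
intros Ha Hr; assert (Hs : summ a r) by (apply rad1_summ; auto; lra).
exists (nrm a r / r); split.
- apply Rmult_le_pos; [apply nrm_ge0; auto; lra|left; apply Rinv_0_lt_compat; lra].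
- intros w i Hw; destruct (summ_shift a r i) as [A B]; [lra|auto|].
  eapply Rle_trans; [|exact B]; apply Rmult_le_compat_r; [apply pow_le; lra|].
  now apply ev_le_nrm.
Qed.

Lemma ecoef_rad1 a w : rad1 a -> Cmod w < 1 -> rad1 (ecoef a w).
Proof.
intros Ha Hw r Hr; pose proof (Cmod_ge_0 w).
assert (Hm : 0 < Rmax r (Cmod w) < 1).
{ split; [eapply Rlt_le_trans; [|apply Rmax_l]; lra|apply Rmax_lub_lt; lra]. }
destruct (ecoef_bound a (Rmax r (Cmod w)) Ha Hm) as (M & _ & HM).
exists M; intros i; eapply Rle_trans; [|apply (HM w i), Rmax_r].
apply Rmult_le_compat_l; [apply Cmod_ge_0|]; apply pow_incr; split; [lra|apply Rmax_l].
Qed.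

Definition lin (w : C) (n : nat) : C :=
  match n with O => (- w)%C | S O => RtoC 1 | _ => RtoC 0 end.

Lemma conv_lin w b n : conv (lin w) b n
  = match n with O => - w * b O | S m => b m - w * b (S m) end%C.
Proof.
destruct n as [|n]; unfold conv.
- simpl; ring.
- rewrite csum_first, csum_first, csum_0; [simpl lin; rewrite !Nat.sub_0_r; simpl; rewrite Nat.sub_0_r; ring|].
  intros; simpl; ring.
Qed.

Lemma ev_lin w z : ev (lin w) z = (z - w)%C.
Proof.
rewrite (ev_finite _ _ 2); [simpl; ring|]. intros [|[|n]] Hn; [lia|lia|reflexivity].
Qed.

Lemma rad1_lin w : rad1 (lin w).
Proof. apply rad1_finite with 2%nat; intros [|[|n]] Hn; [lia|lia|reflexivity]. Qed.

Lemma ecoef_S a w i : rad1 a -> Cmod w < 1 ->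
  ecoef a w i = (a (S i) + w * ecoef a w (S i))%C.
Proof.
intros Ha Hw; unfold ecoef; set (r := (1 + Cmod w) / 2); pose proof (Cmod_ge_0 w).
destruct (ev_shift (shift a i) w r) as [_ E]; [| unfold r; lra | unfold r; lra |].
- apply summ_shift; [unfold r; lra|apply rad1_summ; auto; unfold r; lra].
- rewrite E; f_equal; [unfold shift; f_equal; lia|]; f_equal; apply ev_ext.
  intros n; unfold shift; f_equal; lia.
Qed.

Lemma ecoef_0 a w : rad1 a -> Cmod w < 1 -> ev a w = (a 0%nat + w * ecoef a w 0)%C.
Proof.
intros Ha Hw; set (r := (1 + Cmod w) / 2); pose proof (Cmod_ge_0 w).
destruct (ev_shift a w r) as [_ E]; [| unfold r; lra | unfold r; lra |].
- apply rad1_summ; auto; unfold r; lra.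
- rewrite E; reflexivity.
Qed.

Lemma conv_lin_ecoef a w n : rad1 a -> Cmod w < 1 ->
  conv (lin w) (ecoef a w) n = (a n - delta0 (ev a w) n)%C.
Proof.
intros Ha Hw; rewrite conv_lin; destruct n as [|n].
- simpl; rewrite (ecoef_0 a w) by auto; ring.
- rewrite (ecoef_S a w n) by auto; simpl; ring.
Qed.

Lemma quot_eq a z w : rad1 a -> Cmod z < 1 -> Cmod w < 1 ->
  ((z - w) * quot a z w)%C = (ev a z - ev a w)%C.
Proof.
intros Ha Hz Hw; unfold quot; set (r := Cmod z); pose proof (Cmod_ge_0 z).
assert (Hd : forall n, (1 <= n)%nat -> delta0 (ev a w) n = RtoC 0) by (intros [|n] Hn; [lia|reflexivity]).
rewrite <- (ev_lin w z), <- (ev_conv _ _ _ r); try (unfold r; lra);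
  try (apply rad1_summ; auto using rad1_lin, ecoef_rad1; unfold r; lra).
rewrite (ev_ext _ _ _ (fun n => conv_lin_ecoef a w n Ha Hw)), (ev_minus _ _ _ r).
- f_equal; rewrite (ev_finite _ _ 1); [simpl; ring|auto].
- apply rad1_summ; auto; unfold r; lra.
- apply summ_finite with 1%nat; auto.
- unfold r; lra.
Qed.

Lemma Cminus_eq_0 (z w : C) : (z - w)%C = RtoC 0 -> z = w.
Proof. intros H; replace z with ((z - w) + w)%C by ring; rewrite H; ring. Qed.

Lemma Cmult_cancel (x y z : C) : x <> RtoC 0 -> (x * y)%C = (x * z)%C -> y = z.
Proof.
intros Hx H; replace y with (/ x * (x * y))%C by (field; auto).
rewrite H; field; auto.
Qed.

Lemma quot_sym a z w : rad1 a -> Cmod z < 1 -> Cmod w < 1 -> quot a z w = quot a w z.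
Proof.
intros Ha Hz Hw.
destruct (excluded_middle_informative (z = w)) as [->|Hne]; auto.
apply (Cmult_cancel (z - w)%C); [intros E; apply Hne, Cminus_eq_0, E|].
rewrite quot_eq by auto.
replace ((z - w) * quot a w z)%C with (- ((w - z) * quot a w z))%C by ring.
rewrite quot_eq by auto; ring.
Qed.

Lemma quot_lip a r : rad1 a -> 0 < r < 1 -> exists L, 0 <= L /\
  forall z z' w w', Cmod z <= r -> Cmod z' <= r -> Cmod w <= r -> Cmod w' <= r ->
    Cmod (quot a z w - quot a z' w')%C <= L * (Cmod (z - z')%C + Cmod (w - w')%C).
Proof.
intros Ha Hr; set (s := (1 + r) / 2).
destruct (ecoef_bound a s Ha) as (M & HM & Hb); [unfold s; lra|].
destruct (geo_theta r s) as [K HK]; [unfold s; lra|].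
set (L := Rabs (M * K) / r).
assert (HL : 0 <= L).
{ apply Rmult_le_pos; [apply Rabs_pos|left; apply Rinv_0_lt_compat; lra]. }
assert (H : forall z z' w, Cmod z <= r -> Cmod z' <= r -> Cmod w <= r ->
    Cmod (quot a z w - quot a z' w)%C <= L * Cmod (z - z')%C).
{ intros z z' w Hz Hz' Hw.
  destruct (HK (ecoef a w) M) as (A & B & D); [intros n; apply Hb; unfold s; lra|].
  apply Rmult_le_reg_l with r; [lra|].
  eapply Rle_trans; [apply ev_lip; auto; lra|].
  unfold L; replace (r * (Rabs (M * K) / r * Cmod (z - z')%C))
    with (Rabs (M * K) * Cmod (z - z')%C) by (field; lra).
  apply Rmult_le_compat_r; [apply Cmod_ge_0|].
  eapply Rle_trans; [exact D|apply Rle_abs]. }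
exists L; split; auto; intros z z' w w' Hz Hz' Hw Hw'.
replace (quot a z w - quot a z' w')%C
  with ((quot a z w - quot a z' w) + (quot a w z' - quot a w' z'))%C.
- eapply Rle_trans; [apply Cmod_triangle|].
  pose proof (H z z' w Hz Hz' Hw); pose proof (H w w' z' Hw Hw' Hz'); lra.
- rewrite (quot_sym a w z'), (quot_sym a w' z'); auto; try lra; ring.
Qed.

Lemma quot_offdiag a z w : univ a -> Cmod z < 1 -> Cmod w < 1 -> z <> w -> quot a z w <> RtoC 0.
Proof.
intros (_ & _ & Ha & Hinj) Hz Hw Hne E; apply Hne, Hinj; auto.
apply Cminus_eq_0; rewrite <- quot_eq, E; auto; ring.
Qed.

(** If the derivative vanished on a horizontal segment of length h starting at w, then over each of
    n equal pieces f would change by O(h^2 / n^2), hence by O(1/n) in all; f would take equal values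
    at the two ends. *)
Lemma quot_diag_dense a w d : univ a -> Cmod w < 1 -> 0 < d ->
  exists w', Cmod (w' - w)%C < d /\ Cmod w' < (1 + Cmod w) / 2 /\ quot a w' w' <> RtoC 0.
Proof.
intros Hu Hw Hd; destruct Hu as (_ & _ & Ha & Hinj).
apply NNPP; intros Hno.
pose proof (Cmod_ge_0 w) as Hw0.
set (r := (1 + Cmod w) / 2); assert (Hr : 0 < r < 1) by (unfold r; lra).
set (h := Rmin d ((1 - Cmod w) / 2) / 2).
assert (Hh : 0 < h /\ h < d /\ h < (1 - Cmod w) / 2).
{ pose proof (Rmin_l d ((1 - Cmod w) / 2)); pose proof (Rmin_r d ((1 - Cmod w) / 2)).
  pose proof (Rmin_glb_lt d ((1 - Cmod w) / 2) 0 Hd ltac:(lra)); unfold h; lra. }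
assert (Hin : forall t : R, 0 <= t <= h -> Cmod (w + t)%C < r /\ quot a (w + t) (w + t) = RtoC 0).
{ intros t Ht; assert (H1 : Cmod (w + t)%C < r).
  { eapply Rle_lt_trans; [apply Cmod_triangle|]; rewrite Cmod_R, Rabs_pos_eq by lra; unfold r; lra. }
  split; auto; apply NNPP; intros Hq; apply Hno; exists (w + t)%C; repeat split; auto.
  replace (w + t - w)%C with (RtoC t) by ring; rewrite Cmod_R, Rabs_pos_eq; lra. }
destruct (quot_lip a r Ha Hr) as (L & HL & Hlip).
assert (Hstep : forall n : nat, Cmod (ev a (w + h) - ev a w)%C <= L * h ^ 2 * / INR (S n)).
{ intros n; set (k := h / INR (S n)).
  assert (Hn : 0 < INR (S n)) by (apply lt_0_INR; lia).
  assert (Hk : 0 < k) by (apply Rdiv_lt_0_compat; lra).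
  assert (HkS : INR (S n) * k = h) by (unfold k; field; lra).
  assert (H : forall m, (m <= S n)%nat ->
    Cmod (ev a (w + RtoC (INR m * k)) - ev a w)%C <= INR m * (L * k ^ 2)).
  { induction m as [|m IH]; intros Hm.
    - simpl INR; rewrite !Rmult_0_l; replace (w + 0)%C with w by ring.
      replace (ev a w - ev a w)%C with (RtoC 0) by ring; rewrite Cmod_0; lra.
    - assert (Hm1 : INR m * k <= h).
      { rewrite <- HkS; apply Rmult_le_compat_r; [lra|apply le_INR; lia]. }
      assert (Hm2 : INR (S m) * k <= h).
      { rewrite <- HkS; apply Rmult_le_compat_r; [lra|apply le_INR; lia]. }
      pose proof (pos_INR m) as Hm0.
      destruct (Hin (INR m * k)) as [A1 B1]; [split; [apply Rmult_le_pos|]; lra|].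
      destruct (Hin (INR (S m) * k)) as [A2 B2]; [split; [apply Rmult_le_pos; [apply pos_INR|]|]; lra|].
      replace (ev a (w + RtoC (INR (S m) * k)) - ev a w)%C with
        ((ev a (w + RtoC (INR (S m) * k)) - ev a (w + RtoC (INR m * k)))
         + (ev a (w + RtoC (INR m * k)) - ev a w))%C by ring.
      eapply Rle_trans; [apply Cmod_triangle|].
      specialize (IH ltac:(lia)).
      rewrite <- quot_eq by (auto; lra).
      assert (Hdiff : (w + RtoC (INR (S m) * k) - (w + RtoC (INR m * k)))%C = RtoC k).
      { rewrite S_INR, !RtoC_mult, RtoC_plus; ring. }
      rewrite Hdiff, Cmod_scal by lra.
      pose proof (Hlip (w + RtoC (INR (S m) * k))%C (w + RtoC (INR m * k))%C
         (w + RtoC (INR m * k))%C (w + RtoC (INR m * k))%C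
         ltac:(lra) ltac:(lra) ltac:(lra) ltac:(lra)) as Hq.
      rewrite B1, Hdiff, Cmod_R, Rabs_pos_eq in Hq by lra.
      replace (w + RtoC (INR m * k) - (w + RtoC (INR m * k)))%C with (RtoC 0) in Hq by ring.
      rewrite Cmod_0, Rplus_0_r in Hq.
      match type of Hq with Cmod ?X <= _ => replace X with
        (quot a (w + RtoC (INR (S m) * k)) (w + RtoC (INR m * k)))%C in Hq by ring end.
      apply (Rmult_le_compat_l k) in Hq; [|lra]. rewrite S_INR in *; lra. }
  specialize (H (S n) ltac:(lia)); rewrite HkS in H.
  eapply Rle_trans; [exact H|]; unfold k; right; field; lra. }
assert (E : ev a (w + h)%C = ev a w).
{ apply Cminus_eq_0, Cmod_eq_0, Rle_antisym; [|apply Cmod_ge_0].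
  apply le_epsilon; intros e He; rewrite Rplus_0_l.
  destruct (inv_INR_S_lt (e / (L * h ^ 2 + 1))) as [N HN].
  { apply Rdiv_lt_0_compat; auto; assert (0 <= h ^ 2) by apply pow2_ge_0; nra. }
  specialize (HN N ltac:(lia)); eapply Rle_trans; [apply (Hstep N)|].
  assert (Hp : 0 <= L * h ^ 2) by (apply Rmult_le_pos; auto; apply pow2_ge_0).
  apply Rle_trans with ((L * h ^ 2 + 1) * (e / (L * h ^ 2 + 1))); [|right; field; lra].
  pose proof (inv_INR_S_pos N); apply Rmult_le_compat; lra. }
destruct (Hin h) as [A _]; [lra|].
apply Hinj in E; [|lra|lra].
assert (Hh0 : RtoC h = RtoC 0) by (replace (RtoC h) with ((w + h) - w)%C by ring; rewrite E; ring).
apply RtoC_inj in Hh0; lra.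
Qed.

(* If the derivative vanished at [w], the zero of [quot a _ w] at [w] would
   persist for nearby second arguments. *)
Lemma quot_diag a w : univ a -> Cmod w < 1 -> quot a w w <> RtoC 0.
Proof.
intros Hu Hw E; pose proof Hu as (_ & _ & Ha & _).
pose proof (Cmod_ge_0 w) as Hw0.
set (r := (1 + Cmod w) / 2); assert (Hr : 0 < r < 1) by (unfold r; lra).
destruct (ev_lower_circle (ecoef a w) r) as (mu & Hmu & Hl); auto.
{ now apply ecoef_rad1. }
{ intros z Hz; apply quot_offdiag; auto; [lra|]; intros ->; unfold r in Hz; lra. }
destruct (quot_lip a r Ha Hr) as (L & HL & Hlip).
pose proof (ratio_lt1 (Cmod w) r ltac:(unfold r; lra)) as Hx.
set (k := mu / 2 * (1 - Cmod w / r)).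
assert (Hk : 0 < k) by (apply Rmult_lt_0_compat; lra).
assert (Hkm : k <= mu / 2) by (unfold k; nra).
(* w' is so close to w that |quot w w'| <= k/2, while |quot z w'| >= mu/2 on the circle. The
   reciprocal of z -> quot z w' is then at most 1/k at z = w, so a product that should be 1 is at
   most 1/2. *)
destruct (quot_diag_dense a w (k / (2 * (L + 1)))) as (w' & H1 & H2 & H3); auto.
{ apply Rdiv_lt_0_compat; lra. }
fold r in H2.
assert (HLw : L * Cmod (w' - w)%C <= k / 2).
{ apply Rle_trans with ((L + 1) * (k / (2 * (L + 1)))); [|right; field; lra].
  apply Rmult_le_compat; auto using Cmod_ge_0; lra. }
assert (Hzf : zero_free (ecoef a w')).
{ intros z Hz; change (quot a z w' <> RtoC 0).
  destruct (excluded_middle_informative (z = w')) as [->|Hne]; auto.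
  apply quot_offdiag; auto; lra. }
assert (Hrad : rad1 (ecoef a w')) by (apply ecoef_rad1; auto; lra).
destruct (ev_lower_disk (ecoef a w') r Hrad Hr) as (m & Hm & Hlm).
{ intros z Hz; apply Hzf; lra. }
assert (Hcirc : forall z, Cmod z = r -> mu / 2 <= Cmod (ev (ecoef a w') z)).
{ intros z Hz; specialize (Hl z Hz).
  pose proof (Hlip z z w w' ltac:(lra) ltac:(lra) ltac:(unfold r; lra) ltac:(lra)) as Hd.
  replace (z - z)%C with (RtoC 0) in Hd by ring; rewrite Cmod_0, Rplus_0_l in Hd.
  replace (w - w')%C with (- (w' - w))%C in Hd by ring; rewrite Cmod_opp in Hd.
  unfold quot in Hd.
  pose proof (Cmod_triangle (ev (ecoef a w) z - ev (ecoef a w') z) (ev (ecoef a w') z))%C as Ht.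
  replace (ev (ecoef a w) z - ev (ecoef a w') z + ev (ecoef a w') z)%C
    with (ev (ecoef a w) z) in Ht by ring.
  lra. }
pose proof (finv_bound (ecoef a w') r m (mu / 2) Hrad Hr Hm ltac:(lra) Hlm Hcirc) as Hb.
pose proof (ev_finv (ecoef a w') w Hrad Hzf Hw) as Hone.
pose proof (geo_ev (finv (ecoef a w')) w (Cmod w) r _ ltac:(unfold r; lra) Hb ltac:(lra)) as Hbw.
apply (f_equal Cmod) in Hone; rewrite Cmod_mult, Cmod_1 in Hone.
assert (Hq : Cmod (ev (ecoef a w') w) <= k / 2).
{ pose proof (Hlip w w w' w ltac:(unfold r; lra) ltac:(unfold r; lra) ltac:(lra) ltac:(unfold r; lra)) as Hd.
  rewrite E in Hd; replace (w - w)%C with (RtoC 0) in Hd by ring.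
  rewrite Cmod_0, Rplus_0_l in Hd; unfold quot in Hd.
  replace (ev (ecoef a w') w - 0)%C with (ev (ecoef a w') w) in Hd by ring; lra. }
assert (Hfin : 1 <= / (mu / 2) / (1 - Cmod w / r) * (k / 2)).
{ eapply Rle_trans; [right; symmetry; exact Hone|].
  apply Rmult_le_compat; auto using Cmod_ge_0. }
replace (/ (mu / 2) / (1 - Cmod w / r) * (k / 2)) with (/ 2) in Hfin; [lra|].
unfold k; field; repeat split; try lra. unfold r; lra.
Qed.

Lemma ecoef_zero_free a w : univ a -> Cmod w < 1 -> zero_free (ecoef a w).
Proof.
intros Hu Hw z Hz; change (quot a z w <> RtoC 0).
destruct (excluded_middle_informative (z = w)) as [->|Hne].
- now apply quot_diag.
- now apply quot_offdiag.
Qed.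

(** For fixed w compactness in z suffices; the joint Lipschitz bound then allows a second
    compactness argument in w. *)
Lemma quot_lower a r : univ a -> 0 < r < 1 -> exists mu, 0 < mu /\
  forall z w, Cmod z <= r -> Cmod w <= r -> mu <= Cmod (quot a z w).
Proof.
intros Hu Hr; pose proof Hu as (_ & _ & Ha & _).
destruct (quot_lip a r Ha Hr) as (L & HL & Hlip).
assert (Hmin : forall w, Cmod w <= r ->
  exists mu, 0 < mu /\ forall z, Cmod z <= r -> mu <= Cmod (quot a z w)).
{ intros w Hw; apply (lower_bound_compact (fun z => quot a z w) (fun z => Cmod z <= r) r L); auto.
  - intros z z' Hz Hz'; eapply Rle_trans; [apply Hlip; auto|].
    replace (w - w)%C with (RtoC 0) by ring; rewrite Cmod_0; lra.
  - intros u l; apply Cmod_lim_le.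
  - intros z Hz; apply (ecoef_zero_free a w); auto; lra. }
apply NNPP; intros Hno.
assert (H : forall n, exists w, Cmod w <= r /\ exists z, Cmod z <= r /\ Cmod (quot a z w) < / INR (S n)).
{ intros n; apply NNPP; intros Hn; apply Hno; exists (/ INR (S n)); split; [apply inv_INR_S_pos|].
  intros z w Hz Hw; apply Rnot_lt_le; intros Hlt; apply Hn; eauto. }
set (u := fun n => proj1_sig (constructive_indefinite_description _ (H n))).
assert (Hu2 : forall n, Cmod (u n) <= r /\ exists z, Cmod z <= r /\ Cmod (quot a z (u n)) < / INR (S n)).
{ intros n; exact (proj2_sig (constructive_indefinite_description _ (H n))). }
destruct (BW_C u r) as (phi & l & Hl); [intros; apply Hu2|].
assert (Hlr : Cmod l <= r).
{ apply (Cmod_lim_le (fun n => u (phi n))); intros n; [apply Hu2|apply Hl]. }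
destruct (Hmin l Hlr) as (mu & Hmu & Hlow).
destruct (inv_INR_S_lt (mu / (1 + 2 * L))) as [N HN].
{ apply Rdiv_lt_0_compat; lra. }
specialize (HN N ltac:(lia)); destruct (Hl N) as [HphiN HlN].
destruct (Hu2 (phi N)) as (Hur & z & Hz & Hq).
specialize (Hlow z Hz).
pose proof (Hlip z z l (u (phi N)) Hz Hz Hlr Hur) as Hd.
replace (z - z)%C with (RtoC 0) in Hd by ring; rewrite Cmod_0, Rplus_0_l in Hd.
replace (l - u (phi N))%C with (- (u (phi N) - l))%C in Hd by ring; rewrite Cmod_opp in Hd.
pose proof (Cmod_triangle (quot a z l - quot a z (u (phi N))) (quot a z (u (phi N))))%C as Ht.
replace (quot a z l - quot a z (u (phi N)) + quot a z (u (phi N)))%C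
  with (quot a z l) in Ht by ring.
pose proof (inv_INR_S_le _ _ HphiN).
assert (L * Cmod (u (phi N) - l)%C <= L * (2 * / INR (S N))) by (apply Rmult_le_compat_l; lra).
apply (Rmult_lt_compat_r (1 + 2 * L)) in HN; [|lra].
unfold Rdiv in HN; rewrite Rmult_assoc, Rinv_l in HN by lra; lra.
Qed.

(** * Expansion of the logarithm of the difference quotient *)

(** Analytic functions of the second variable w. The coefficients in z of the logarithm of the
    quotient are finite sums of products of values of [ecoef] and [finv], so closure properties make
    each of them a power series in w. *)
Definition hol (F : C -> C) : Prop :=
  exists b, rad1 b /\ forall w, Cmod w < 1 -> F w = ev b w.

Lemma hol_ext F G : (forall w, Cmod w < 1 -> F w = G w) -> hol F -> hol G.
Proof. intros H (b & Hb & E); exists b; split; auto; intros; rewrite <- H; auto. Qed.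

Lemma hol_const c : hol (fun _ => c).
Proof.
assert (Hd : forall n, (1 <= n)%nat -> delta0 c n = RtoC 0) by (intros [|n] Hn; [lia|reflexivity]).
exists (delta0 c); split; [now apply rad1_finite with 1%nat|].
intros w _; rewrite (ev_finite _ _ 1); [simpl; ring|auto].
Qed.

Lemma hol_plus F G : hol F -> hol G -> hol (fun w => F w + G w)%C.
Proof.
intros (b & Hb & E) (c & Hc & E'); exists (fun n => b n + c n)%C; split; [now apply rad1_plus|].
intros w Hw; pose proof (Cmod_ge_0 w).
rewrite (ev_plus _ _ _ (Cmod w)), E, E'; auto; try lra; apply rad1_summ; auto; lra.
Qed.

Lemma hol_mult F G : hol F -> hol G -> hol (fun w => F w * G w)%C.
Proof.
intros (b & Hb & E) (c & Hc & E'); exists (conv b c); split; [now apply rad1_conv|].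
intros w Hw; pose proof (Cmod_ge_0 w).
rewrite (ev_conv _ _ _ (Cmod w)), E, E'; auto; try lra; apply rad1_summ; auto; lra.
Qed.

Lemma hol_csum n (F : nat -> C -> C) : (forall k, (k < n)%nat -> hol (F k)) ->
  hol (fun w => csum n (fun k => F k w)).
Proof.
induction n as [|n IH]; intros H; cbn [csum]; [apply hol_const|].
apply hol_plus; auto.
Qed.

Lemma hol_ecoef a i : rad1 a -> hol (fun w => ecoef a w i).
Proof. intros Ha; exists (shift a i); split; [now apply rad1_shift|reflexivity]. Qed.

Lemma shift0_zero_free a : univ a -> zero_free (shift a 0).
Proof.
intros Hu w Hw E; apply (ecoef_zero_free a w Hu Hw 0); [rewrite Cmod_0; lra|].
now rewrite ev_0.
Qed.

(** The recursion expresses all coefficients of the reciprocal through those of the quotient and the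
    reciprocal of its constant term, which is analytic because f(w)/w has no zero. *)
Lemma hol_finv_ecoef a n : univ a -> hol (fun w => finv (ecoef a w) n).
Proof.
intros Hu; pose proof Hu as (_ & _ & Ha & _).
assert (H0 : hol (fun w => finv (ecoef a w) 0)).
{ pose proof (rad1_shift a 0 Ha) as Hs; pose proof (shift0_zero_free a Hu) as Hz.
  exists (finv (shift a 0)); split; [now apply finv_rad1|].
  intros w Hw; rewrite finv_0.
  apply (Cmult_cancel (ecoef a w 0)); [now apply Hz|].
  rewrite (Cmult_comm _ (ev _ _)); unfold ecoef at 3; rewrite ev_finv; auto.
  field; now apply Hz. }
induction n as [n IH] using lt_wf_ind.
destruct n as [|n]; auto.
apply hol_ext with (fun w => (RtoC (-1) * finv (ecoef a w) 0)
  * csum (S n) (fun k => ecoef a w (S n - k)%nat * finv (ecoef a w) k))%C.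
- intros w Hw; rewrite finv_S, finv_0; f_equal.
  apply C_eq; simpl; ring.
- apply hol_mult; [apply hol_mult; auto using hol_const|].
  apply (hol_csum (S n) (fun k w => ecoef a w (S n - k)%nat * finv (ecoef a w) k)%C).
  intros k Hk; apply hol_mult; auto using hol_ecoef.
Qed.

Lemma hol_flog_ecoef a p : univ a -> hol (fun w => flog (ecoef a w) p).
Proof.
intros Hu; pose proof Hu as (_ & _ & Ha & _); unfold flog, conv, theta.
apply hol_mult; [apply hol_const|].
apply (hol_csum (S p) (fun i w => RtoC (INR i) * ecoef a w i * finv (ecoef a w) (p - i)%nat)%C).
intros i _; apply hol_mult; [|now apply hol_finv_ecoef].
apply hol_mult; auto using hol_const, hol_ecoef.
Qed.

(* Taylor coefficients of [log (f z / z)]. *)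
Definition lf (a : nat -> C) : nat -> C := flog (shift a 0).

(** [flog] drops the logarithm of the constant term f(w)/w. Row 0 of d restores it, as the series of
    log (f(w)/w). *)
Lemma dcoef_exists a : univ a -> exists d : nat -> nat -> C,
  (forall q, d 0%nat q = lf a q) /\
  (forall p, rad1 (d p)) /\
  (forall p w, (0 < p)%nat -> Cmod w < 1 -> flog (ecoef a w) p = ev (d p) w).
Proof.
intros Hu; pose proof Hu as (_ & _ & Ha & _).
set (ch := fun p => constructive_indefinite_description _ (hol_flog_ecoef a p Hu)).
exists (fun p => match p with O => lf a | S _ => proj1_sig (ch p) end).
split; [reflexivity|split].
- intros [|p].
  + apply flog_rad1; [now apply rad1_shift|now apply shift0_zero_free].
  + apply (proj2_sig (ch (S p))).
- intros [|p] w Hp Hw; [lia|]; apply (proj2_sig (ch (S p))); auto.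
Qed.

Lemma flog_ecoef_bound a r : univ a -> 0 < r < 1 -> exists M, 0 <= M /\
  forall w p, Cmod w <= r -> Cmod (flog (ecoef a w) p) * r ^ p <= M.
Proof.
intros Hu Hr; pose proof Hu as (_ & _ & Ha & _).
set (s := (1 + r) / 2); assert (Hs : 0 < s < 1) by (unfold s; lra).
assert (Hrs : 0 <= r < s) by (unfold s; lra).
destruct (ecoef_bound a s Ha Hs) as (M & HM & HE).
destruct (quot_lower a s Hu Hs) as (mu & Hmu & Hlow).
destruct (pow_INR_bounded (r / s) (ratio_lt1 r s Hrs)) as [K HK].
assert (HMm : 0 <= M * / mu) by (apply Rmult_le_pos; auto; left; now apply Rinv_0_lt_compat).
exists (M * / mu * (K + 1)); split.
{ apply Rmult_le_pos; auto; specialize (HK 0%nat); simpl in HK; lra. }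
intros w p Hw.
assert (Hws : Cmod w <= s) by lra.
assert (Hb : forall n, Cmod (finv (ecoef a w) n) * s ^ n <= / mu).
{ apply (finv_bound (ecoef a w) s mu mu); auto.
  - apply ecoef_rad1; auto; lra.
  - intros z Hz; now apply Hlow.
  - intros z Hz; apply Hlow; lra. }
destruct (Nat.eq_dec p 0) as [->|Hp].
{ unfold flog, conv; simpl; rewrite theta_0.
  replace (0 + 0 * finv (ecoef a w) 0)%C with (RtoC 0) by ring.
  rewrite Cmult_0_r, Cmod_0, Rmult_0_l; apply Rmult_le_pos; auto.
  specialize (HK 0%nat); simpl in HK; lra. }
assert (Hp0 : 0 < INR p) by (apply lt_0_INR; lia).
assert (Hconv : Cmod (flog (ecoef a w) p) * s ^ p <= (INR p + 1) * (M * / mu)).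
{ unfold flog; rewrite Cmod_scal by (left; now apply Rinv_0_lt_compat).
  rewrite Rmult_assoc.
  apply Rle_trans with (/ INR p * (INR p * ((INR p + 1) * (M * / mu)))).
  2:{ right; field; lra. }
  apply Rmult_le_compat_l; [left; now apply Rinv_0_lt_compat|].
  eapply Rle_trans; [apply conv_Cmod_le; lra|].
  rewrite <- S_INR.
  replace (INR p * (INR (S p) * (M * / mu))) with (INR (S p) * (INR p * (M * / mu))) by ring.
  rewrite <- rsum_const; apply rsum_le; intros i Hi.
  unfold theta; rewrite Cmod_scal by apply pos_INR.
  rewrite Rmult_assoc, Rmult_assoc.
  apply Rmult_le_compat; [apply pos_INR| |apply le_INR; lia|].
  - rewrite <- Rmult_assoc; apply Rmult_le_pos; apply summ_term_ge0; lra.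
  - rewrite <- Rmult_assoc; apply Rmult_le_compat; auto; apply summ_term_ge0; lra. }
pose proof (geo_le (flog (ecoef a w)) r s _ p Hrs Hconv) as H.
eapply Rle_trans; [exact H|].
replace ((INR p + 1) * (M * / mu) * (r / s) ^ p)
  with (M * / mu * (INR p * (r / s) ^ p + (r / s) ^ p)) by ring.
apply Rmult_le_compat_l; auto; apply Rplus_le_compat; auto.
rewrite <- (pow1 p); apply pow_incr; pose proof (ratio_lt1 r s Hrs); lra.
Qed.

Definition dsum (d : nat -> nat -> C) (z w : C) : C := ev (fun p => ev (d p) w) z.

Definition dpart (d : nat -> nat -> C) (T : nat) (z w : C) : C :=
  csum T (fun p => csum T (fun q => d p q * (z ^ p * w ^ q)))%C.

Lemma dsum_inner d r s M p w : 0 <= r < s -> (forall p q, Cmod (d p q) * s ^ (p + q) <= M) ->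
  Cmod w <= r -> Cmod (ev (d p) w) * s ^ p <= M / (1 - r / s).
Proof.
intros Hr Hd Hw.
assert (Hs : 0 < s ^ p) by (apply pow_lt; lra).
assert (H : forall q, Cmod (d p q) * s ^ q <= M * / s ^ p).
{ intros q; apply Rmult_le_reg_r with (s ^ p); auto.
  rewrite (Rmult_assoc M), Rinv_l by lra; specialize (Hd p q); rewrite pow_add in Hd; lra. }
pose proof (geo_ev (d p) w r s _ Hr H Hw).
apply Rle_trans with (M * / s ^ p / (1 - r / s) * s ^ p).
- apply Rmult_le_compat_r; lra.
- pose proof (ratio_lt1 r s Hr); right; field; repeat split; lra.
Qed.

(** Takes the place of Fubini: the iterated sum differs from its square partial sums by a geometric
    error, uniform in |z|, |w| <= r. Half of it comes from the outer tail, half from the inner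
    tails. *)
Lemma dsum_trunc d r s M z w T : 0 <= r < s -> (forall p q, Cmod (d p q) * s ^ (p + q) <= M) ->
  Cmod z <= r -> Cmod w <= r ->
  Cmod (dsum d z w - dpart d T z w)%C <= 2 * M * (r / s) ^ T / (1 - r / s) ^ 2.
Proof.
intros Hr Hd Hz Hw; pose proof (ratio_lt1 r s Hr) as Hx.
set (x := r / s) in *.
assert (HM : 0 <= M).
{ eapply Rle_trans; [|apply (Hd 0%nat 0%nat)]; simpl; pose proof (Cmod_ge_0 (d 0%nat 0%nat)); lra. }
assert (HxT : 0 <= x ^ T) by (apply pow_le; lra).
assert (H1 : Cmod (dsum d z w - csum T (fun p => ev (d p) w * z ^ p))%C <= M / (1 - x) * x ^ T / (1 - x)).
{ apply geo_tail; auto; intros p; now apply dsum_inner. }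
assert (H2 : Cmod (csum T (fun p => ev (d p) w * z ^ p) - dpart d T z w)%C
             <= M * x ^ T / (1 - x) ^ 2).
{ unfold dpart; rewrite <- csum_minus; eapply Rle_trans; [apply Cmod_csum|].
  apply Rle_trans with (rsum T (fun p => (M * x ^ T / (1 - x)) * x ^ p)).
  - apply rsum_le; intros p _.
    rewrite (csum_ext _ _ (fun q => z ^ p * (d p q * w ^ q))%C) by (intros; ring).
    rewrite csum_scal.
    replace (ev (d p) w * z ^ p - z ^ p * csum T (fun q => d p q * w ^ q))%C
      with (z ^ p * (ev (d p) w - csum T (fun q => d p q * w ^ q)))%C by ring.
    rewrite Cmod_mult, Cmod_pow.
    assert (Hs : 0 < s ^ p) by (apply pow_lt; lra).
    assert (H : forall q, Cmod (d p q) * s ^ q <= M * / s ^ p).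
    { intros q; apply Rmult_le_reg_r with (s ^ p); auto.
      rewrite (Rmult_assoc M), Rinv_l by lra; specialize (Hd p q); rewrite pow_add in Hd; lra. }
    pose proof (geo_tail (d p) w r s _ T Hr H Hw) as Ht; fold x in Ht.
    apply Rle_trans with (r ^ p * (M * / s ^ p * x ^ T / (1 - x))).
    + apply Rmult_le_compat; auto using Cmod_ge_0; [apply pow_le, Cmod_ge_0|].
      apply pow_incr; split; auto using Cmod_ge_0.
    + right; replace (x ^ p) with (r ^ p * / s ^ p)
        by (unfold x, Rdiv; rewrite Rpow_mult_distr, pow_inv; reflexivity).
      field; lra.
  - destruct (series_geo x (M * x ^ T / (1 - x)) Hx) as [A B].
    replace (M * x ^ T / (1 - x) ^ 2) with (M * x ^ T / (1 - x) / (1 - x)) by (field; lra).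
    rewrite <- B; apply rsum_le_Series; auto; intros i.
    apply Rmult_le_pos; [|apply pow_le; lra].
    apply Rmult_le_pos; [now apply Rmult_le_pos|left; apply Rinv_0_lt_compat; lra]. }
replace (dsum d z w - dpart d T z w)%C with
  ((dsum d z w - csum T (fun p => ev (d p) w * z ^ p))
   + (csum T (fun p => ev (d p) w * z ^ p) - dpart d T z w))%C by ring.
eapply Rle_trans; [apply Cmod_triangle|].
replace (2 * M * x ^ T / (1 - x) ^ 2)
  with (M / (1 - x) * x ^ T / (1 - x) + M * x ^ T / (1 - x) ^ 2) by (field; lra).
lra.
Qed.

Lemma is_lim_geo_err K x : 0 <= x < 1 -> is_lim_seq (fun T => K * x ^ T) 0.
Proof.
intros Hx; replace 0 with (K * 0) by ring.
apply (is_lim_seq_scal_l _ K 0), is_lim_seq_geom; rewrite Rabs_pos_eq; lra.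
Qed.

Lemma geo_small K x e : 0 <= x < 1 -> 0 < e -> exists N, forall T, (N <= T)%nat -> K * x ^ T < e.
Proof.
intros Hx He; pose proof (is_lim_geo_err K x Hx) as H.
apply is_lim_seq_spec in H; destruct (H (mkposreal e He)) as [N HN]; exists N.
intros T HT; specialize (HN T HT); simpl in HN; rewrite Rminus_0_r in HN.
eapply Rle_lt_trans; [apply Rle_abs|exact HN].
Qed.

Lemma C_eq_eps (x y : C) : (forall e, 0 < e -> Cmod (x - y)%C <= e) -> x = y.
Proof.
intros H; apply Cminus_eq_0, Cmod_eq_0, Rle_antisym; [|apply Cmod_ge_0].
apply le_epsilon; intros e He; rewrite Rplus_0_l; auto.
Qed.

Lemma dsum_swap d r s M z w : 0 <= r < s -> (forall p q, Cmod (d p q) * s ^ (p + q) <= M) ->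
  Cmod z <= r -> Cmod w <= r -> dsum d z w = dsum (fun p q => d q p) w z.
Proof.
intros Hr Hd Hz Hw; apply C_eq_eps; intros e He.
set (x := r / s); pose proof (ratio_lt1 r s Hr) as Hx; fold x in Hx.
destruct (geo_small (2 * M / (1 - x) ^ 2) x (e / 2) Hx ltac:(lra)) as [T HT].
specialize (HT T ltac:(lia)).
assert (Hd' : forall p q, Cmod (d q p) * s ^ (p + q) <= M) by (intros; rewrite Nat.add_comm; auto).
pose proof (dsum_trunc d r s M z w T Hr Hd Hz Hw) as H1.
pose proof (dsum_trunc (fun p q => d q p) r s M w z T Hr Hd' Hw Hz) as H2.
assert (E : dpart d T z w = dpart (fun p q => d q p) T w z).
{ unfold dpart; rewrite csum_swap; apply csum_ext; intros; apply csum_ext; intros; ring. }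
rewrite <- E in H2; fold x in H1, H2.
replace (2 * M * x ^ T / (1 - x) ^ 2) with (2 * M / (1 - x) ^ 2 * x ^ T) in H1, H2 by (field; lra).
replace (dsum d z w - dsum (fun p q => d q p) w z)%C with
  ((dsum d z w - dpart d T z w) - (dsum (fun p q => d q p) w z - dpart d T z w))%C by ring.
eapply Rle_trans; [apply Cmod_triangle|]; rewrite Cmod_opp; lra.
Qed.

Lemma ev_zero_coef b : rad1 b -> (forall z, Cmod z < 1 -> ev b z = RtoC 0) -> forall n, b n = RtoC 0.
Proof.
intros Hb H n; apply Cmod_eq_0, Rle_antisym; [|apply Cmod_ge_0].
assert (Hc : Cmod (b n) * (/ 2) ^ n <= 0).
{ apply cauchy_estimate; [lra|apply rad1_summ; auto; lra|].
  intros z Hz; rewrite H, Cmod_0; lra. }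
assert (0 < (/ 2) ^ n) by (apply pow_lt; lra); nra.
Qed.

(** On each ray the real part is a real power series that vanishes identically, so Re (b n z^n) = 0
    for every z; turning z^n by a quarter circle kills the imaginary part as well. The constant
    coefficient may be imaginary, hence n > 0. *)
Lemma ev_Re_zero_coef b : rad1 b -> (forall z, Cmod z < 1 -> Re (ev b z) = 0) ->
  forall n, (0 < n)%nat -> b n = RtoC 0.
Proof.
intros Hb H n Hn.
assert (Hz : forall z, Cmod z < 1 -> Re (b n * z ^ n)%C = 0).
{ intros z Hz; set (c := fun n => Re (b n * z ^ n)%C).
  assert (HP : forall t, Rabs t < 1 -> PSeries c t = 0).
  { intros t Ht; rewrite <- (H (t * z)%C).
    - apply Series_ext; intros k; unfold c.
      rewrite Cpow_mult_l, <- RtoC_pow.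
      replace (b k * (RtoC (t ^ k) * z ^ k))%C with (RtoC (t ^ k) * (b k * z ^ k))%C by ring.
      rewrite Re_scal; apply Rmult_comm.
    - rewrite Cmod_mult, Cmod_R; pose proof (Cmod_ge_0 z); pose proof (Rabs_pos t); nra. }
  assert (Hcv : Rbar_lt 0 (CV_radius c)).
  { set (r := (1 + Cmod z) / 2); pose proof (Cmod_ge_0 z).
    destruct (Hb r) as [M HM]; [unfold r; lra|].
    apply Rbar_lt_le_trans with 1; [simpl; lra|].
    apply (proj1 (CV_radius_bounded c)); exists M; intros k.
    rewrite pow1, Rmult_1_r; unfold c; eapply Rle_trans; [apply re_le_Cmod|].
    eapply Rle_trans; [|apply (HM k)]; apply Cmod_term; unfold r; lra. }
  pose proof (Derive_n_coef c n Hcv) as Hder.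
  assert (Hd0 : Derive_n (PSeries c) n 0 = 0).
  { rewrite (Derive_n_ext_loc _ (fun _ => 0)).
    - destruct n; [lia|apply Derive_n_const].
    - exists (mkposreal 1 Rlt_0_1); intros t Ht; apply HP.
      replace t with (t - 0) by ring; exact Ht. }
  rewrite Hd0 in Hder; symmetry in Hder; apply Rmult_integral in Hder.
  destruct Hder as [E|E]; [exact E|].
  exfalso; revert E; apply INR_fact_neq_0. }
assert (Hhalf : forall x, Re (b n * eit x)%C = 0).
{ intros x; set (z := (RtoC (/ 2) * eit (x / INR n))%C).
  assert (Hn0 : INR n <> 0) by (apply not_0_INR; lia).
  specialize (Hz z); unfold z in Hz.
  rewrite Cmod_mult, Cmod_R, Cmod_eit, Rabs_pos_eq in Hz by lra.
  specialize (Hz ltac:(lra)).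
  rewrite Cpow_mult_l, <- RtoC_pow, eit_pow in Hz.
  replace (INR n * (x / INR n)) with x in Hz by (field; auto).
  replace (b n * (RtoC ((/ 2) ^ n) * eit x))%C
    with (RtoC ((/ 2) ^ n) * (b n * eit x))%C in Hz by ring.
  rewrite Re_scal in Hz; apply Rmult_integral in Hz; destruct Hz as [E|E]; auto.
  exfalso; revert E; apply pow_nonzero; lra. }
apply C_eq.
- specialize (Hhalf 0); rewrite eit_0, Cmult_1_r in Hhalf; exact Hhalf.
- specialize (Hhalf (PI / 2)); unfold eit in Hhalf; rewrite cos_PI2, sin_PI2 in Hhalf.
  rewrite Re_mult in Hhalf; simpl in Hhalf; simpl; lra.
Qed.

Lemma ln_quot a d z w : univ a -> (forall q, d 0%nat q = lf a q) ->
  (forall p, rad1 (d p)) ->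
  (forall p w, (0 < p)%nat -> Cmod w < 1 -> flog (ecoef a w) p = ev (d p) w) ->
  Cmod z < 1 -> Cmod w < 1 -> ln (Cmod (quot a z w) ^ 2) = 2 * Re (dsum d z w).
Proof.
intros Hu H0 Hrad Hd Hz Hw; pose proof Hu as (_ & Ha1 & Ha & _).
pose proof (Cmod_ge_0 z).
pose proof (ecoef_rad1 a w Ha Hw) as He; pose proof (ecoef_zero_free a w Hu Hw) as Hzf.
unfold quot; rewrite flog_ev by auto.
unfold ecoef at 1; rewrite flog_ev; auto using rad1_shift, shift0_zero_free.
change (shift a 0 0%nat) with (a 1%nat); rewrite Ha1, Cmod_1, pow1, ln_1.
unfold dsum.
rewrite (ev_ext (fun p => ev (d p) w) (fun p => delta0 (ev (d 0%nat) w) p + flog (ecoef a w) p)%C).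
2:{ intros [|p]; simpl delta0.
    - rewrite (proj1 (flog_is_flog (ecoef a w) (zero_free_0 _ Hzf))); ring.
    - rewrite Hd by (auto; lia); ring. }
assert (Hdl : forall n, (1 <= n)%nat -> delta0 (ev (d 0%nat) w) n = RtoC 0)
  by (intros [|n] Hn; [lia|reflexivity]).
rewrite (ev_plus _ _ _ (Cmod z)); try lra.
- rewrite Re_plus, (ev_finite (delta0 _) _ 1); auto.
  simpl csum; replace (0 + ev (d 0%nat) w * 1)%C with (ev (d 0%nat) w) by ring.
  rewrite (ev_ext (d 0%nat) (lf a)) by auto; unfold lf; ring.
- apply summ_finite with 1%nat; auto.
- apply rad1_summ; [now apply flog_rad1|lra].
Qed.

Lemma log_quot_expansion a : univ a -> exists d : nat -> nat -> C,
  (forall q, d 0%nat q = lf a q) /\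
  (forall p q, d p q = d q p) /\
  (forall r, 0 < r < 1 -> exists M, forall p q, Cmod (d p q) * r ^ (p + q) <= M) /\
  (forall p w, (0 < p)%nat -> Cmod w < 1 -> flog (ecoef a w) p = ev (d p) w) /\
  (forall z w, Cmod z < 1 -> Cmod w < 1 -> ln (Cmod (quot a z w) ^ 2) = 2 * Re (dsum d z w)).
Proof.
intros Hu; pose proof Hu as (_ & _ & Ha & _).
destruct (dcoef_exists a Hu) as (d & H0 & Hrad & Hd).
assert (Hln := fun z w => ln_quot a d z w Hu H0 Hrad Hd).
assert (Hbd : forall r, 0 < r < 1 -> exists M, forall p q, Cmod (d p q) * r ^ (p + q) <= M).
{ intros r Hr.
  destruct (flog_ecoef_bound a r Hu Hr) as (M & HM & Hb).
  destruct (Hrad 0%nat r Hr) as [M0 HM0].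
  exists (Rmax M M0); intros [|p] q.
  - eapply Rle_trans; [apply HM0|apply Rmax_r].
  - eapply Rle_trans; [|apply Rmax_l].
    assert (Hs : 0 < r ^ S p) by (apply pow_lt; lra).
    apply Rle_trans with (M * / r ^ S p * r ^ S p); [|right; field; lra].
    rewrite (Nat.add_comm (S p)), pow_add, <- Rmult_assoc; apply Rmult_le_compat_r; [lra|].
    apply cauchy_estimate; [lra|apply rad1_summ; auto; lra|].
    intros w Hw; apply Rmult_le_reg_r with (r ^ S p); auto.
    rewrite Rmult_assoc, Rinv_l by lra; rewrite <- Hd by (try lia; lra).
    rewrite Rmult_1_r; apply Hb; lra. }
assert (Hsym : forall p q, (0 < p)%nat -> d p q = d q p).
{ intros p q Hp.
  assert (Hrad' : forall q, rad1 (fun p => d p q)).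
  { intros q0 r Hr; destruct (Hbd r Hr) as [M HM]; exists (M * / r ^ q0); intros n.
    assert (Hs : 0 < r ^ q0) by (apply pow_lt; lra).
    apply Rmult_le_reg_r with (r ^ q0); auto.
    rewrite (Rmult_assoc M), Rinv_l by lra; specialize (HM n q0); rewrite pow_add in HM; lra. }
  assert (Hin : forall d' w, (forall r, 0 < r < 1 -> exists M, forall p q, Cmod (d' p q) * r ^ (p + q) <= M)
     -> Cmod w < 1 -> rad1 (fun p => ev (d' p) w)).
  { intros d' w Hb Hw r Hr; set (t := Rmax r (Cmod w)).
    assert (Ht : 0 < t < 1).
    { unfold t; split; [eapply Rlt_le_trans; [|apply Rmax_l]; lra|apply Rmax_lub_lt; lra]. }
    set (s := (1 + t) / 2); destruct (Hb s) as [M HM]; [unfold s; lra|].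
    exists (M / (1 - t / s)); intros n.
    eapply Rle_trans; [|apply (dsum_inner d' t s M n w); auto; [unfold s; lra|apply Rmax_r]].
    apply Rmult_le_compat_l; [apply Cmod_ge_0|]; apply pow_incr; split; [lra|].
    pose proof (Rmax_l r (Cmod w)); fold t in H; unfold s; lra. }
  assert (Hbd' : forall r, 0 < r < 1 -> exists M, forall p q, Cmod (d q p) * r ^ (p + q) <= M).
  { intros r Hr; destruct (Hbd r Hr) as [M HM]; exists M; intros; rewrite Nat.add_comm; auto. }
  assert (E : forall w, Cmod w < 1 -> ev (d p) w = ev (fun q => d q p) w).
  { intros w Hw; apply Cminus_eq_0.
    apply (ev_Re_zero_coef (fun p => ev (d p) w - ev (fun q => d q p) w)%C); auto.
    - apply rad1_minus; [now apply Hin|apply (Hin (fun p q => d q p)); auto].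
    - intros z Hz; pose proof (Cmod_ge_0 z); pose proof (Cmod_ge_0 w).
      rewrite (ev_minus _ _ _ (Cmod z)); try lra.
      2:{ apply rad1_summ; [now apply Hin|lra]. }
      2:{ apply rad1_summ; [apply (Hin (fun p q => d q p)); auto|lra]. }
      change (Re (dsum d z w - dsum (fun p q => d q p) z w)%C = 0).
      set (t := Rmax (Cmod z) (Cmod w)).
      assert (Ht : 0 <= t < 1).
      { unfold t; split; [eapply Rle_trans; [|apply Rmax_l]; lra|apply Rmax_lub_lt; lra]. }
      set (s := (1 + t) / 2); destruct (Hbd s) as [M HM]; [unfold s; lra|].
      rewrite <- (dsum_swap d t s M w z); auto; [|unfold s; lra|apply Rmax_r|apply Rmax_l].
      pose proof (Hln z w Hz Hw) as A; pose proof (Hln w z Hw Hz) as B.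
      rewrite quot_sym in B by auto; rewrite Re_minus; lra. }
  apply Cminus_eq_0.
  apply (ev_zero_coef (fun q => d p q - d q p)%C); [apply rad1_minus; auto|].
  intros w Hw; pose proof (Cmod_ge_0 w).
  rewrite (ev_minus _ _ _ (Cmod w)); try lra; [|apply rad1_summ; auto; lra..].
  change (ev (d p) w - ev (fun q => d q p) w = RtoC 0)%C; rewrite E by auto; ring. }
exists d; split; [auto|split; [|split; [auto|split; auto]]].
intros [|p] [|q]; auto using Nat.lt_0_succ.
symmetry; apply Hsym; lia.
Qed.

(** * Positivity of the logarithmic energy *)

Lemma is_lim_seq_rsum n (F : nat -> nat -> R) (l : nat -> R) :
  (forall i, (i < n)%nat -> is_lim_seq (F i) (l i)) ->
  is_lim_seq (fun M => rsum n (fun i => F i M)) (rsum n l).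
Proof.
induction n as [|n IH]; intros H; cbn [rsum]; [apply is_lim_seq_const|].
apply is_lim_seq_plus'; auto.
Qed.

Definition psd (K : nat -> nat -> C) : Prop := forall n (x : nat -> C),
  0 <= Re (csum n (fun j => csum n (fun k => x j * Cconj (x k) * K j k)))%C.

Lemma psd_ext K K' : (forall j k, K j k = K' j k) -> psd K -> psd K'.
Proof.
intros H HK n x; specialize (HK n x).
erewrite csum_ext in HK; [exact HK|]; intros j _; apply csum_ext; intros k _; now rewrite H.
Qed.

Lemma psd_1 : psd (fun _ _ => RtoC 1).
Proof.
intros n x.
rewrite (csum_ext _ _ (fun j => csum n (fun k => x j * Cconj (x k)))%C).
- rewrite csum_csum_mul, <- Cconj_csum, <- Cmod_sq, re_RtoC; apply pow2_ge_0.
- intros j _; apply csum_ext; intros; ring.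
Qed.

Lemma psd_rank1 K (u : nat -> C) : psd K -> psd (fun j k => K j k * (u j * Cconj (u k)))%C.
Proof.
intros HK n x; specialize (HK n (fun j => x j * u j)%C).
erewrite csum_ext in HK; [exact HK|]; intros j _; apply csum_ext; intros k _.
rewrite Cmult_conj; ring.
Qed.

Lemma one_minus_neq0 (z : C) : Cmod z < 1 -> (1 - z)%C <> RtoC 0.
Proof.
intros Hz E; replace z with (RtoC 1) in Hz.
- rewrite Cmod_1 in Hz; lra.
- replace z with (1 - (1 - z))%C by ring; rewrite E; ring.
Qed.

Lemma Cmod_mult_conj_lt1 v w : Cmod v < 1 -> Cmod w < 1 -> Cmod (v * Cconj w)%C < 1.
Proof.
intros Hv Hw; rewrite Cmod_mult, Cmod_conj.
pose proof (Cmod_ge_0 v); pose proof (Cmod_ge_0 w); nra.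
Qed.

Lemma is_lim_Cpow_0 (c z : C) : Cmod z < 1 -> is_lim_seq (fun M => Re (c * z ^ M)%C) 0.
Proof.
intros Hz.
assert (H : is_lim_seq (fun M => Cmod c * Cmod z ^ M) 0).
{ apply is_lim_geo_err; split; auto using Cmod_ge_0. }
apply (is_lim_seq_le_le (fun M => - (Cmod c * Cmod z ^ M)) _ (fun M => Cmod c * Cmod z ^ M)).
- intros M; rewrite <- Cmod_pow, <- Cmod_mult; apply Rabs_le_between, re_le_Cmod.
- replace 0 with (- 0) by ring; now apply (is_lim_seq_opp _ 0).
- exact H.
Qed.

(** The geometric series writes the new kernel as the limit of sums over m of K with the charges x_j
    replaced by x_j v_j^m. *)
Lemma psd_geom K (v : nat -> C) : psd K -> (forall j, Cmod (v j) < 1) ->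
  psd (fun j k => K j k / (1 - v j * Cconj (v k)))%C.
Proof.
intros HK Hv n x.
set (c := fun j k => (x j * Cconj (x k) * (K j k / (1 - v j * Cconj (v k))))%C).
assert (Hne : forall j k, (1 - v j * Cconj (v k))%C <> RtoC 0).
{ intros; now apply one_minus_neq0, Cmod_mult_conj_lt1. }
set (Q := fun M => csum M (fun m => csum n (fun j => csum n (fun k =>
   (x j * v j ^ m) * Cconj (x k * v k ^ m) * K j k)))%C).
assert (HQ : forall M, 0 <= Re (Q M)).
{ intros M; unfold Q; rewrite Re_csum; apply rsum_ge0; intros m _.
  apply (HK n (fun j => x j * v j ^ m)%C). }
assert (EQ : forall M, Re (Q M) = rsum n (fun j => rsum n (fun k =>
   Re (c j k) - Re (c j k * (v j * Cconj (v k)) ^ M)%C))).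
{ intros M; unfold Q.
  rewrite csum_swap, Re_csum; apply rsum_ext; intros j _.
  rewrite csum_swap, Re_csum; apply rsum_ext; intros k _.
  rewrite (csum_ext _ _ (fun m => x j * Cconj (x k) * K j k * (v j * Cconj (v k)) ^ m)%C).
  2:{ intros m _; rewrite Cmult_conj, Cpow_conj, Cpow_mult_l; ring. }
  rewrite (csum_scal _ _ (fun m => (v j * Cconj (v k)) ^ m)%C).
  set (q := (v j * Cconj (v k))%C).
  replace (csum M (fun m => q ^ m)%C) with ((1 - q ^ M) / (1 - q))%C.
  2:{ rewrite <- geom_sum_C; field; apply Hne. }
  rewrite <- Re_minus; f_equal; unfold c; fold q; field; apply Hne. }
assert (Hl : is_lim_seq (fun M => Re (Q M)) (rsum n (fun j => rsum n (fun k => Re (c j k) - 0)))).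
{ eapply is_lim_seq_ext; [intros M; symmetry; apply EQ|].
  apply (is_lim_seq_rsum n (fun j M => rsum n (fun k => Re (c j k) - Re (c j k * (v j * Cconj (v k)) ^ M)%C))).
  intros j _.
  apply (is_lim_seq_rsum n (fun k M => Re (c j k) - Re (c j k * (v j * Cconj (v k)) ^ M)%C)).
  intros k _; apply is_lim_seq_minus'; [apply is_lim_seq_const|].
  apply is_lim_Cpow_0, Cmod_mult_conj_lt1; auto. }
apply (is_lim_seq_le (fun _ => 0) _ 0 _ HQ (is_lim_seq_const 0)) in Hl.
simpl in Hl; rewrite Re_csum.
erewrite rsum_ext; [exact Hl|]; intros j _; rewrite Re_csum; apply rsum_ext; intros k _;
  rewrite Rminus_0_r; reflexivity.
Qed.

(* [1 - disk_kernel v w] is the squared pseudohyperbolic distance of [v] and [w]. *)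
Definition disk_kernel (v w : C) : R :=
  (1 - Cmod v ^ 2) * (1 - Cmod w ^ 2) / Cmod (1 - v * Cconj w)%C ^ 2.

Lemma RtoC_disk_kernel v w : Cmod v < 1 -> Cmod w < 1 ->
  RtoC (disk_kernel v w) = (RtoC (1 - Cmod v ^ 2) * RtoC (1 - Cmod w ^ 2)
    / (1 - v * Cconj w) / (1 - Cconj v * w))%C.
Proof.
intros Hv Hw.
assert (H1 : (1 - v * Cconj w)%C <> RtoC 0) by now apply one_minus_neq0, Cmod_mult_conj_lt1.
assert (H2 : (1 - Cconj v * w)%C <> RtoC 0).
{ apply one_minus_neq0; rewrite Cmult_comm; now apply Cmod_mult_conj_lt1. }
unfold disk_kernel; rewrite RtoC_div, RtoC_mult, Cmod_sq.
- rewrite Cminus_conj, Cmult_conj, Cconj_conj.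
  replace (Cconj 1) with (RtoC 1) by (apply C_eq; simpl; ring); field; auto.
- apply pow_nonzero; apply Cmod_gt_0 in H1; lra.
Qed.

(** By [RtoC_disk_kernel] one more power multiplies by a rank-one kernel and divides by 1 - v_j conj
    v_k and by its conjugate; [psd_geom] handles the two quotients, once with v and once with conj
    v. *)
Lemma psd_disk_kernel_pow (v : nat -> C) p : (forall j, Cmod (v j) < 1) ->
  psd (fun j k => RtoC (disk_kernel (v j) (v k) ^ p)).
Proof.
intros Hv; induction p as [|p IH]; [exact psd_1|].
set (u := fun j => RtoC (1 - Cmod (v j) ^ 2)).
apply psd_ext with (fun j k => RtoC (disk_kernel (v j) (v k) ^ p) * (u j * Cconj (u k))
   / (1 - v j * Cconj (v k)) / (1 - Cconj (v j) * Cconj (Cconj (v k))))%C.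
- intros j k; rewrite Cconj_conj; simpl pow; rewrite RtoC_mult, RtoC_disk_kernel by auto.
  replace (Cconj (u k)) with (u k) by (unfold u; apply C_eq; simpl; ring).
  unfold u; unfold Cdiv; ring.
- apply (psd_geom (fun j k => RtoC (disk_kernel (v j) (v k) ^ p) * (u j * Cconj (u k))
   / (1 - v j * Cconj (v k)))%C (fun j => Cconj (v j))).
  + apply (psd_geom (fun j k => RtoC (disk_kernel (v j) (v k) ^ p) * (u j * Cconj (u k)))%C v); auto.
    now apply psd_rank1.
  + intros; now rewrite Cmod_conj.
Qed.

Lemma psd_real K (x : nat -> R) n : psd (fun j k => RtoC (K j k)) ->
  0 <= rsum n (fun j => rsum n (fun k => x j * x k * K j k)).
Proof.
intros H; specialize (H n (fun j => RtoC (x j))).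
rewrite Re_csum in H; erewrite rsum_ext; [exact H|]; intros j _; simpl.
rewrite Re_csum; apply rsum_ext; intros k _.
replace (Cconj (x k)) with (RtoC (x k)) by (apply C_eq; simpl; ring).
rewrite <- !RtoC_mult, re_RtoC; reflexivity.
Qed.

(* Taylor coefficients of [log (1 - z / w)]. *)
Definition lin_log (w : C) (n : nat) : C :=
  match n with O => RtoC 0 | S _ => (- (RtoC (/ INR n) * (/ w) ^ n))%C end.

Lemma theta_lin_log w n : theta (lin_log w) (S n) = (- (/ w) ^ S n)%C.
Proof.
unfold theta, lin_log.
replace (RtoC (INR (S n)) * - (RtoC (/ INR (S n)) * (/ w) ^ S n))%C
  with (- (RtoC (INR (S n)) * RtoC (/ INR (S n))) * (/ w) ^ S n)%C by ring.
rewrite <- RtoC_mult, Rinv_r by (apply not_0_INR; lia); ring.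
Qed.

Lemma is_flog_lin w : w <> RtoC 0 -> is_flog (lin_log w) (lin w).
Proof.
intros Hw; split; [reflexivity|]; intros n; rewrite conv_comm, conv_lin.
destruct n as [|[|n]].
- unfold theta; simpl; ring.
- rewrite theta_lin_log; unfold theta; simpl; field; auto.
- rewrite !theta_lin_log; unfold theta; simpl; field; auto.
Qed.

Lemma lin_1_zero_free : zero_free (lin 1).
Proof.
intros z Hz; rewrite ev_lin; intros E; apply (one_minus_neq0 z Hz).
replace (1 - z)%C with (- (z - 1))%C by ring; rewrite E; ring.
Qed.

Lemma ln_one_minus z : Cmod z < 1 ->
  ln (Cmod (1 - z)%C ^ 2) = 2 * Re (ev (lin_log 1) z).
Proof.
intros Hz; replace (1 - z)%C with (- ev (lin 1) z)%C by (rewrite ev_lin; ring).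
rewrite Cmod_opp, flog_ev; auto using rad1_lin, lin_1_zero_free.
simpl lin; rewrite Cmod_opp, Cmod_1, pow1, ln_1, Rplus_0_l.
do 2 f_equal; apply ev_ext; intros n.
assert (Hne : RtoC 1 <> RtoC 0) by (intros E; apply RtoC_inj in E; lra).
apply (is_flog_unique _ _ (lin 1)); [exact (zero_free_0 _ lin_1_zero_free)| |now apply is_flog_lin].
apply flog_is_flog, zero_free_0, lin_1_zero_free.
Qed.

Lemma lin_log_1 n : lin_log 1 (S n) = RtoC (- / INR (S n)).
Proof.
unfold lin_log.
assert (Hne : RtoC 1 <> RtoC 0) by (intros E; apply RtoC_inj in E; lra).
replace (/ 1)%C with (RtoC 1) by (field; auto); rewrite Cpow_1_l, RtoC_opp; ring.
Qed.

Lemma rad1_lin_log_1 : rad1 (lin_log 1).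
Proof.
intros r Hr; exists 1; intros [|n].
- simpl; rewrite Cmod_0; lra.
- rewrite lin_log_1, Cmod_R, Rabs_Ropp, Rabs_pos_eq by (left; apply inv_INR_S_pos).
  rewrite <- (Rmult_1_r 1); apply Rmult_le_compat; try (apply pow_le; lra);
    try (left; apply inv_INR_S_pos).
  + rewrite <- Rinv_1; apply Rinv_le_contravar; [lra|]; rewrite S_INR; pose proof (pos_INR n); lra.
  + rewrite <- (pow1 (S n)); apply pow_incr; lra.
Qed.

Lemma ln_one_minus_lim z : Cmod z < 1 ->
  is_lim_seq (fun M => - 2 * rsum M (fun n => / INR (S n) * Re (z ^ S n)%C)) (ln (Cmod (1 - z)%C ^ 2)).
Proof.
intros Hz; rewrite ln_one_minus by auto.
pose proof (Cmod_ge_0 z).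
assert (Hs : summ (lin_log 1) (Cmod z)) by (apply rad1_summ; [apply rad1_lin_log_1|lra]).
destruct (ev_cis _ z _ Hs (Rle_refl _)) as [A _].
apply is_series_rsum, is_lim_seq_incr_1 in A.
eapply is_lim_seq_ext; [|exact (is_lim_seq_scal_l _ 2 (Re (ev (lin_log 1) z)) A)].
intros M.
change (2 * rsum (S M) (fun n => Re (lin_log 1 n * z ^ n)%C)
  = - 2 * rsum M (fun n => / INR (S n) * Re (z ^ S n)%C)).
rewrite rsum_first, (rsum_ext M _ (fun n => - 1 * (/ INR (S n) * Re (z ^ S n)%C))).
- rewrite rsum_scal; simpl lin_log; rewrite Re_scal; ring.
- intros n _; rewrite lin_log_1, Re_scal; ring.
Qed.

Lemma disk_identity v w : Cmod (1 - v * Cconj w)%C ^ 2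
  = Cmod (v - w)%C ^ 2 + (1 - Cmod v ^ 2) * (1 - Cmod w ^ 2).
Proof. rewrite !Cmod_sq_Re_Im; destruct v as [a b], w as [c d]; simpl; ring. Qed.

Lemma Cmod_sq_lt1 v : Cmod v < 1 -> 0 < 1 - Cmod v ^ 2.
Proof. intros Hv; pose proof (Cmod_ge_0 v); nra. Qed.

Lemma disk_kernel_bounds v w : Cmod v < 1 -> Cmod w < 1 -> 0 <= disk_kernel v w <= 1.
Proof.
intros Hv Hw; unfold disk_kernel.
pose proof (Cmod_sq_lt1 v Hv); pose proof (Cmod_sq_lt1 w Hw).
assert (Hd : 0 < (1 - Cmod v ^ 2) * (1 - Cmod w ^ 2)) by now apply Rmult_lt_0_compat.
pose proof (pow2_ge_0 (Cmod (v - w)%C)); rewrite disk_identity.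
split; [apply Rlt_le, Rdiv_lt_0_compat; lra|].
apply Rmult_le_reg_r with (Cmod (v - w)%C ^ 2 + (1 - Cmod v ^ 2) * (1 - Cmod w ^ 2)); [lra|].
unfold Rdiv; rewrite Rmult_assoc, Rinv_l by lra; lra.
Qed.

(** By [disk_identity] the argument of the logarithm is |1 - v_j conj v_k|^2 times 1 - (1 - sigma)
    K_jk, with K the disk kernel. Both factors have a negative semidefinite logarithm, since - ln (1
    - x) has nonnegative Taylor coefficients. The term with sigma keeps the diagonal finite. *)
Lemma energy_disk n (x : nat -> R) (v : nat -> C) sigma :
  (forall j, Cmod (v j) < 1) -> 0 < sigma < 1 ->
  rsum n (fun j => rsum n (fun k => x j * x k *
    ln (Cmod (v j - v k)%C ^ 2 + sigma * ((1 - Cmod (v j) ^ 2) * (1 - Cmod (v k) ^ 2))))) <= 0.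
Proof.
intros Hv Hs.
set (A := fun j k => ln (Cmod (1 - v j * Cconj (v k))%C ^ 2)).
set (B := fun j k => ln (Cmod (1 - RtoC ((1 - sigma) * disk_kernel (v j) (v k)))%C ^ 2)).
assert (HA : rsum n (fun j => rsum n (fun k => x j * x k * A j k)) <= 0).
{ set (S := fun M j k => rsum M (fun m => / INR (S m) * Re ((v j * Cconj (v k)) ^ S m)%C)).
  assert (HS : forall M, 0 <= rsum n (fun j => rsum n (fun k => x j * x k * S M j k))).
  { intros M.
    replace (rsum n (fun j => rsum n (fun k => x j * x k * S M j k))) with
      (rsum M (fun m => / INR (Datatypes.S m) *
        rsum n (fun j => rsum n (fun k => x j * x k * Re ((v j * Cconj (v k)) ^ Datatypes.S m)%C)))).
    - apply rsum_ge0; intros m _; apply Rmult_le_pos; [left; apply inv_INR_S_pos|].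
      set (m' := Datatypes.S m).
      replace (rsum n _) with (Cmod (csum n (fun j => x j * v j ^ m')%C) ^ 2);
        [apply pow2_ge_0|].
      rewrite <- (re_RtoC (Cmod _ ^ 2)), Cmod_sq, Cconj_csum, <- csum_csum_mul, Re_csum.
      apply rsum_ext; intros j _; rewrite Re_csum; apply rsum_ext; intros k _.
      rewrite <- Re_scal; f_equal.
      rewrite Cmult_conj, Cpow_conj, Cpow_mult_l, RtoC_mult.
      replace (Cconj (x k)) with (RtoC (x k)) by (apply C_eq; simpl; ring); ring.
    - rewrite (rsum_ext M _ (fun m => rsum n (fun j => rsum n (fun k =>
         x j * x k * (/ INR (Datatypes.S m) * Re ((v j * Cconj (v k)) ^ Datatypes.S m)%C))))).
      2:{ intros m _; rewrite <- rsum_scal; apply rsum_ext; intros j _.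
          rewrite <- rsum_scal; apply rsum_ext; intros k _; ring. }
      rewrite rsum_swap; apply rsum_ext; intros j _.
      rewrite rsum_swap; apply rsum_ext; intros k _.
      unfold S; rewrite <- rsum_scal; reflexivity. }
  assert (Hl : is_lim_seq (fun M => rsum n (fun j => rsum n (fun k => x j * x k * (- 2 * S M j k))))
     (rsum n (fun j => rsum n (fun k => x j * x k * A j k)))).
  { apply (is_lim_seq_rsum n (fun j M => rsum n (fun k => x j * x k * (- 2 * S M j k)))).
    intros j _; apply (is_lim_seq_rsum n (fun k M => x j * x k * (- 2 * S M j k))).
    intros k _; apply (is_lim_seq_scal_l _ (x j * x k) (A j k)).
    apply ln_one_minus_lim, Cmod_mult_conj_lt1; auto. }
  apply (is_lim_seq_le _ (fun _ => 0) (Finite _) 0) in Hl; auto using is_lim_seq_const.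
  intros M; specialize (HS M).
  rewrite (rsum_ext n _ (fun j => - 2 * rsum n (fun k => x j * x k * S M j k))).
  - rewrite rsum_scal; lra.
  - intros j _; rewrite <- rsum_scal; apply rsum_ext; intros; ring. }
assert (HK : forall j k, 0 <= (1 - sigma) * disk_kernel (v j) (v k) < 1).
{ intros j k; destruct (disk_kernel_bounds (v j) (v k) (Hv j) (Hv k)); split.
  - apply Rmult_le_pos; lra.
  - nra. }
assert (HB : rsum n (fun j => rsum n (fun k => x j * x k * B j k)) <= 0).
{ set (S := fun M j k => rsum M (fun m => / INR (S m) * Re (RtoC ((1 - sigma) * disk_kernel (v j) (v k)) ^ S m)%C)).
  assert (HS : forall M, 0 <= rsum n (fun j => rsum n (fun k => x j * x k * S M j k))).
  { intros M.
    replace (rsum n (fun j => rsum n (fun k => x j * x k * S M j k))) with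
      (rsum M (fun m => (/ INR (Datatypes.S m) * (1 - sigma) ^ Datatypes.S m) *
        rsum n (fun j => rsum n (fun k => x j * x k * disk_kernel (v j) (v k) ^ Datatypes.S m)))).
    - apply rsum_ge0; intros m _; apply Rmult_le_pos.
      + apply Rmult_le_pos; [left; apply inv_INR_S_pos|apply pow_le; lra].
      + apply psd_real, psd_disk_kernel_pow, Hv.
    - rewrite (rsum_ext M _ (fun m => rsum n (fun j => rsum n (fun k =>
         x j * x k * (/ INR (Datatypes.S m) * ((1 - sigma) * disk_kernel (v j) (v k)) ^ Datatypes.S m))))).
      2:{ intros m _; rewrite <- rsum_scal; apply rsum_ext; intros j _.
          rewrite <- rsum_scal; apply rsum_ext; intros k _; rewrite Rpow_mult_distr; ring. }
      rewrite rsum_swap; apply rsum_ext; intros j _.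
      rewrite rsum_swap; apply rsum_ext; intros k _.
      unfold S; rewrite <- rsum_scal; apply rsum_ext; intros m _.
      rewrite <- RtoC_pow, re_RtoC; reflexivity. }
  assert (Hl : is_lim_seq (fun M => rsum n (fun j => rsum n (fun k => x j * x k * (- 2 * S M j k))))
     (rsum n (fun j => rsum n (fun k => x j * x k * B j k)))).
  { apply (is_lim_seq_rsum n (fun j M => rsum n (fun k => x j * x k * (- 2 * S M j k)))).
    intros j _; apply (is_lim_seq_rsum n (fun k M => x j * x k * (- 2 * S M j k))).
    intros k _; apply (is_lim_seq_scal_l _ (x j * x k) (B j k)).
    apply ln_one_minus_lim; rewrite Cmod_R, Rabs_pos_eq; apply HK. }
  apply (is_lim_seq_le _ (fun _ => 0) (Finite _) 0) in Hl; auto using is_lim_seq_const.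
  intros M; specialize (HS M).
  rewrite (rsum_ext n _ (fun j => - 2 * rsum n (fun k => x j * x k * S M j k))).
  - rewrite rsum_scal; lra.
  - intros j _; rewrite <- rsum_scal; apply rsum_ext; intros; ring. }
apply Rle_trans with (/ 2 * rsum n (fun j => rsum n (fun k => x j * x k * B j k))
   + rsum n (fun j => rsum n (fun k => x j * x k * A j k))); [|lra].
right; rewrite <- rsum_scal, <- rsum_plus; apply rsum_ext; intros j _.
rewrite <- rsum_scal, <- rsum_plus; apply rsum_ext; intros k _.
set (D := Cmod (1 - v j * Cconj (v k))%C ^ 2).
set (U := (1 - Cmod (v j) ^ 2) * (1 - Cmod (v k) ^ 2)).
assert (HU : 0 < U) by (apply Rmult_lt_0_compat; apply Cmod_sq_lt1; auto).
assert (HD : 0 < D).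
{ apply pow_lt, Cmod_gt_0, one_minus_neq0, Cmod_mult_conj_lt1; auto. }
assert (HBjk : B j k = 2 * ln (1 - (1 - sigma) * disk_kernel (v j) (v k))).
{ unfold B; rewrite <- RtoC_minus, Cmod_R, pow2_abs.
  specialize (HK j k); simpl; rewrite Rmult_1_r, ln_mult by lra; ring. }
rewrite HBjk; unfold A; fold D.
replace (/ 2 * (x j * x k * (2 * ln (1 - (1 - sigma) * disk_kernel (v j) (v k)))) + x j * x k * ln D)
  with (x j * x k * (ln (1 - (1 - sigma) * disk_kernel (v j) (v k)) + ln D)) by field.
f_equal; rewrite <- ln_mult; [|specialize (HK j k); lra|auto].
f_equal; unfold disk_kernel; fold D U.
pose proof (disk_identity (v j) (v k)) as Hid; fold D U in Hid.
replace (Cmod (v j - v k)%C ^ 2) with (D - U) by lra; field; lra.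
Qed.

(** * The Grunsky inequality *)

(** The powers u^i sum to 0, so the N differences u^i - 1 sum to - N, while each has modulus at most
    N |u - 1|. *)
Lemma chord_lower (u : C) N : (0 < N)%nat -> Cmod u = 1 -> (u ^ N)%C = RtoC 1 -> u <> RtoC 1 ->
  / INR N <= Cmod (1 - u)%C.
Proof.
intros HN Hu HuN Hu1; assert (HN0 : 0 < INR N) by now apply lt_0_INR.
assert (Hm : Cmod (1 - u)%C = Cmod (u - 1)%C).
{ replace (1 - u)%C with (- (u - 1))%C by ring; apply Cmod_opp. }
assert (H : INR N <= INR N * (INR N * Cmod (1 - u)%C)).
{ apply Rle_trans with (Cmod (csum N (fun i => u ^ i - 1))%C).
  - rewrite csum_minus, geom_sum_0, csum_const by auto.
    replace (0 - INR N * 1)%C with (- INR N)%C by ring.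
    rewrite Cmod_opp, Cmod_R, Rabs_pos_eq; lra.
  - eapply Rle_trans; [apply Cmod_csum|]; rewrite <- rsum_const; apply rsum_le; intros i Hi.
    pose proof (Cpow_diff_le u 1 1 i ltac:(lra) ltac:(rewrite Cmod_1; lra)) as H.
    rewrite Cpow_1_l, pow1, Hm in *; eapply Rle_trans; [rewrite Rmult_1_l in H; exact H|].
    rewrite Rmult_1_r; apply Rmult_le_compat_r; [apply Cmod_ge_0|]; apply le_INR; lia. }
apply Rmult_le_reg_l with (INR N); auto; rewrite Rinv_r by lra.
apply Rmult_le_reg_l with (INR N); lra.
Qed.

Lemma om_ratio N j k : (j < N)%nat -> (k < N)%nat -> j <> k ->
  / INR N <= Cmod (1 - om N ^ j * Cconj (om N ^ k))%C.
Proof.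
intros Hj Hk Hne; apply chord_lower; [lia| | |].
- rewrite Cmod_mult, Cmod_conj, !Cmod_om_pow; ring.
- rewrite Cpow_mult_l, <- Cpow_conj, <- !Cpow_mult_r, (Nat.mul_comm j), (Nat.mul_comm k), !Cpow_mult_r.
  rewrite om_N, !Cpow_1_l by lia; apply C_eq; simpl; ring.
- intros E.
  assert (Ekj : (om N ^ j)%C = (om N ^ k)%C).
  { transitivity ((om N ^ j * Cconj (om N ^ k)) * om N ^ k)%C; [|rewrite E; ring].
    rewrite <- Cmult_assoc, (Cmult_comm (Cconj _)), <- Cmod_sq, Cmod_om_pow, pow1; ring. }
  assert (Hz : forall i, (om N ^ i)%C <> RtoC 0).
  { intros i Hi; apply (f_equal Cmod) in Hi; rewrite Cmod_om_pow, Cmod_0 in Hi; lra. }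
  destruct (Nat.lt_ge_cases j k).
  + apply (om_pow_neq1 N (k - j)); [lia|]; apply (Cmult_cancel (om N ^ j)%C); auto.
    rewrite <- Cpow_add_r, Cmult_1_r; replace (j + (k - j))%nat with k by lia; auto.
  + apply (om_pow_neq1 N (j - k)); [lia|]; apply (Cmult_cancel (om N ^ k)%C); auto.
    rewrite <- Cpow_add_r, Cmult_1_r; replace (k + (j - k))%nat with j by lia; auto.
Qed.

Lemma ln_le_minus1 x : 0 < x -> ln x <= x - 1.
Proof.
intros Hx; pose proof (exp_ineq1_le (ln x)) as H; rewrite exp_ln in H; lra.
Qed.

Lemma ln_ge_inv x : 0 < x -> 1 - / x <= ln x.
Proof.
intros Hx; pose proof (ln_le_minus1 (/ x) (Rinv_0_lt_compat _ Hx)) as H.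
rewrite ln_Rinv in H; lra.
Qed.

Lemma Cmod_1_minus_scal (t : R) (u : C) : Cmod u = 1 ->
  Cmod (1 - t * u)%C ^ 2 = (1 - t) ^ 2 + t * Cmod (1 - u)%C ^ 2.
Proof.
intros Hu; assert (H : Re u ^ 2 + Im u ^ 2 = 1) by (rewrite <- Cmod_sq_Re_Im, Hu; ring).
rewrite !Cmod_sq_Re_Im, !Re_minus, !Im_minus, Re_scal, Im_scal, re_RtoC, im_RtoC.
replace ((1 - t * Re u) ^ 2 + (0 - t * Im u) ^ 2)
  with (1 - 2 * t * Re u + t ^ 2 * (Re u ^ 2 + Im u ^ 2)) by ring.
replace ((1 - Re u) ^ 2 + (0 - Im u) ^ 2) with (1 - 2 * Re u + (Re u ^ 2 + Im u ^ 2)) by ring.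
rewrite H; ring.
Qed.

(* Real charges at the [N]-th roots of unity with prescribed Fourier coefficients. *)
Definition charge (K : nat) (Y : nat -> C) (N j : nat) : R :=
  2 * Re (csum (S K) (fun n => Y n * Cconj (om N ^ j) ^ n))%C - Re (Y 0%nat).

Definition hat (x : nat -> R) (N p : nat) : C := csum N (fun j => x j * (om N ^ j) ^ p)%C.

Lemma RtoC_charge K Y N j : Im (Y 0%nat) = 0 ->
  RtoC (charge K Y N j) = (csum (S K) (fun n => Y n * Cconj (om N ^ j) ^ n)
    + csum K (fun n => Cconj (Y (S n)) * (om N ^ j) ^ S n))%C.
Proof.
intros H0; unfold charge.
set (A := csum (S K) _).
assert (HA : Cconj A = (Y 0%nat + csum K (fun n => Cconj (Y (S n)) * (om N ^ j) ^ S n))%C).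
{ unfold A; rewrite Cconj_csum, csum_first; f_equal.
  - change (Cconj (Y 0%nat * 1) = Y 0%nat)%C; rewrite Cmult_1_r.
    apply C_eq; [apply re_conj|rewrite im_conj, H0; ring].
  - apply csum_ext; intros n _; rewrite Cmult_conj, Cpow_conj, Cconj_conj; reflexivity. }
replace (csum K (fun n => Cconj (Y (S n)) * (om N ^ j) ^ S n))%C with (Cconj A - Y 0%nat)%C
  by (rewrite HA; ring).
apply C_eq; [rewrite re_RtoC, Re_plus, Re_minus, re_conj|rewrite im_RtoC, Im_plus, Im_minus, im_conj, H0]; ring.
Qed.

(** Orthogonality of characters. The conjugate terms that make the charge real sit at the
    frequencies N - K, ..., N - 1 modulo N, which p + K < N avoids. *)
Lemma hat_charge K Y N p : Im (Y 0%nat) = 0 -> (p + K < N)%nat ->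
  hat (charge K Y N) N p = if (p <=? K)%nat then (RtoC (INR N) * Y p)%C else RtoC 0.
Proof.
intros H0 Hp; unfold hat.
rewrite (csum_ext _ _ (fun j => csum (S K) (fun n => Y n * ((om N ^ j) ^ p * Cconj (om N ^ j) ^ n))
  + csum K (fun n => Cconj (Y (S n)) * ((om N ^ j) ^ (p + S n) * Cconj (om N ^ j) ^ 0)))%C).
2:{ intros j _; rewrite RtoC_charge, Cmult_plus_distr_r, <- !csum_scal_r by auto.
    f_equal; apply csum_ext; intros n _; rewrite ?Cpow_add_r; simpl (Cconj _ ^ 0)%C; ring. }
rewrite csum_plus, (csum_swap N K), (csum_0 K), Cplus_0_r.
2:{ intros n Hn; rewrite csum_scal, om_orth by lia.
    rewrite (proj2 (Nat.eqb_neq (p + S n) 0)) by lia; ring. }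
rewrite csum_swap.
rewrite (csum_ext _ _ (fun n => Y n * (if Nat.eqb p n then RtoC (INR N) else RtoC 0))%C).
2:{ intros n Hn; rewrite csum_scal, om_orth by lia; reflexivity. }
destruct (Nat.leb_spec p K) as [HpK|HpK].
- rewrite (csum_single _ _ p); [|lia|].
  + rewrite Nat.eqb_refl; ring.
  + intros n Hn Hne; rewrite (proj2 (Nat.eqb_neq p n)) by auto; ring.
- apply csum_0; intros n Hn; rewrite (proj2 (Nat.eqb_neq p n)) by lia; ring.
Qed.

Definition charge_max (K : nat) (Y : nat -> C) : R :=
  2 * rsum (S K) (fun n => Cmod (Y n)) + Cmod (Y 0%nat).

Lemma charge_le K Y N j : Rabs (charge K Y N j) <= charge_max K Y.
Proof.
unfold charge, charge_max, Rminus; eapply Rle_trans; [apply Rabs_triang|].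
rewrite Rabs_Ropp; apply Rplus_le_compat; [|apply re_le_Cmod].
rewrite Rabs_mult, (Rabs_pos_eq 2) by lra; apply Rmult_le_compat_l; [lra|].
eapply Rle_trans; [apply re_le_Cmod|]; eapply Rle_trans; [apply Cmod_csum|].
right; apply rsum_ext; intros n _.
rewrite Cmod_mult, Cmod_pow, Cmod_conj, Cmod_om_pow, pow1; ring.
Qed.

Lemma hat_le x N p M : (forall j, Rabs (x j) <= M) -> Cmod (hat x N p) <= INR N * M.
Proof.
intros H; unfold hat; eapply Rle_trans; [apply Cmod_csum|].
rewrite <- rsum_const; apply rsum_le; intros j _.
rewrite Cmod_mult, Cmod_R, Cmod_pow, Cmod_om_pow, pow1, Rmult_1_r; auto.
Qed.

Lemma hat_periodic x N l p : (0 < N)%nat -> hat x N (l * N + p) = hat x N p.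
Proof.
intros HN; apply csum_ext; intros j _; f_equal.
rewrite Cpow_add_r, (Nat.mul_comm l), Cpow_mult_r, <- (Cpow_mult_r _ j N), (Nat.mul_comm j).
rewrite (Cpow_mult_r _ N j), om_N, !Cpow_1_l by auto; ring.
Qed.

Lemma hat_parseval x N M : (0 < N)%nat -> (forall j, Rabs (x j) <= M) ->
  rsum N (fun p => Cmod (hat x N p) ^ 2) <= INR N ^ 2 * M ^ 2.
Proof.
intros HN H; assert (HN0 : 0 <= INR N) by apply pos_INR.
pose proof (parseval_poly (fun n => RtoC (x n)) 1 N HN) as HP.
rewrite (rsum_ext N (fun p => Cmod (hat x N p) ^ 2)
   (fun j => Cmod (csum N (fun n => x n * (1 * om N ^ j) ^ n)%C) ^ 2)).
2:{ intros p _; do 2 f_equal; apply csum_ext; intros j _; f_equal.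
    rewrite Cmult_1_l, <- !Cpow_mult_r; f_equal; apply Nat.mul_comm. }
rewrite HP; replace (INR N ^ 2 * M ^ 2) with (INR N * (INR N * M ^ 2)) by ring.
apply Rmult_le_compat_l; auto; rewrite <- rsum_const; apply rsum_le; intros n _.
rewrite pow1, Rmult_1_r, Cmod_R; apply pow_incr; split; auto using Rabs_pos.
Qed.

Lemma double_char_sum x N p q (c : C) :
  csum N (fun j => csum N (fun k => RtoC (x j * x k) * (c * ((om N ^ j) ^ p * (om N ^ k) ^ q))))%C
  = (c * (hat x N p * hat x N q))%C.
Proof.
unfold hat; rewrite <- csum_csum_mul, <- csum_scal; apply csum_ext; intros j _.
rewrite <- csum_scal; apply csum_ext; intros k _; rewrite RtoC_mult; ring.
Qed.

Lemma double_Re_sum x N n :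
  rsum N (fun j => rsum N (fun k => x j * x k * Re ((om N ^ j * Cconj (om N ^ k)) ^ n)%C))
  = Cmod (hat x N n) ^ 2.
Proof.
rewrite <- (re_RtoC (Cmod _ ^ 2)), Cmod_sq; unfold hat.
rewrite Cconj_csum, <- csum_csum_mul, Re_csum; apply rsum_ext; intros j _.
rewrite Re_csum; apply rsum_ext; intros k _; rewrite <- Re_scal; f_equal.
rewrite Cmult_conj, !Cpow_conj, Cpow_mult_l, RtoC_mult.
replace (Cconj (x k)) with (RtoC (x k)) by (apply C_eq; simpl; ring); ring.
Qed.

Lemma harmonic_geo_le t M : 0 <= t < 1 -> rsum M (fun n => / INR (S n) * t ^ S n) <= - ln (1 - t).
Proof.
intros Ht.
assert (Hz : Cmod (RtoC t) < 1) by (rewrite Cmod_R, Rabs_pos_eq; lra).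
pose proof (ln_one_minus_lim t Hz) as Hl.
rewrite <- RtoC_minus, Cmod_R, pow2_abs in Hl.
replace (ln ((1 - t) ^ 2)) with (- 2 * (- ln (1 - t))) in Hl.
2:{ simpl; rewrite Rmult_1_r, ln_mult by lra; ring. }
apply (is_lim_seq_scal_l _ (- / 2)) in Hl.
apply (is_lim_seq_ext _ (fun M => rsum M (fun n => / INR (S n) * t ^ S n))) in Hl.
- replace (Rbar_mult (- / 2) (-2 * - ln (1 - t))) with (Finite (- ln (1 - t))) in Hl
    by (simpl; f_equal; field).
  apply (is_lim_seq_incr_compare _ _ Hl).
  intros n; cbn [rsum]; rewrite <- (Rplus_0_r (rsum n _)) at 1; apply Rplus_le_compat_l.
  apply Rmult_le_pos; [left; apply inv_INR_S_pos|apply pow_le; lra].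
- intros n; rewrite (rsum_ext n (fun n => / INR (S n) * Re (t ^ S n)%C)
    (fun n => / INR (S n) * t ^ S n)); [field|].
  intros; rewrite <- RtoC_pow, re_RtoC; reflexivity.
Qed.

(** Expanding the logarithm turns the energy into twice the sum of t^n/n |hat n|^2. In units of N^2,
    the frequencies up to K give the main term and those from N - K to N - 1 an error K/(N - K);
    each later block of N frequencies is bounded by Parseval with weight t^l/(l N), and these
    weights add up to at most - ln (1 - t)/N. *)
Lemma energy_roots K Y N t : Im (Y 0%nat) = 0 -> (2 * K < N)%nat -> 0 <= t < 1 ->
  - rsum N (fun j => rsum N (fun k => charge K Y N j * charge K Y N k *
      ln (Cmod (1 - t * (om N ^ j * Cconj (om N ^ k)))%C ^ 2)))
  <= 2 * INR N ^ 2 * (rsum K (fun n => Cmod (Y (S n)) ^ 2 / INR (S n))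
       + charge_max K Y ^ 2 * (INR K / INR (N - K) - ln (1 - t) / INR N)).
Proof.
intros H0 HK Ht.
set (x := charge K Y N); set (M := charge_max K Y).
assert (Hx : forall j, Rabs (x j) <= M) by (intros; apply charge_le).
assert (HN : 0 < INR N) by (apply lt_0_INR; lia).
set (F := fun n => / INR (S n) * t ^ S n * Cmod (hat x N (S n)) ^ 2).
assert (HF : forall n, 0 <= F n).
{ intros n; apply Rmult_le_pos; [|apply pow2_ge_0]; apply Rmult_le_pos;
    [left; apply inv_INR_S_pos|apply pow_le; lra]. }
set (Bd := INR N ^ 2 * (rsum K (fun n => Cmod (Y (S n)) ^ 2 / INR (S n))
       + M ^ 2 * (INR K / INR (N - K) - ln (1 - t) / INR N))).
assert (Htn : forall n, 0 <= t ^ n <= 1).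
{ intros n; split; [apply pow_le; lra|rewrite <- (pow1 n); apply pow_incr; lra]. }
assert (HB : forall L, rsum L F <= Bd).
{ intros L.
  (* [F n] belongs to frequency n + 1; [G] restores the frequency as index, so that the blocks start
     at multiples of N. *)
  set (G := fun n => match n with O => 0 | S m => F m end).
  apply Rle_trans with (rsum (S L * N) G).
  { apply Rle_trans with (rsum (S L) G).
    - rewrite rsum_first; right; change (G 0%nat) with 0; rewrite Rplus_0_l; reflexivity.
    - apply rsum_incr; [nia|]; intros [|n]; simpl; auto; lra. }
  rewrite rsum_blocks, rsum_first.
  assert (HNK : 0 < INR (N - K)) by (apply lt_0_INR; lia).
  assert (Hb0 : rsum N (fun m => G (0 * N + m)%nat)
    <= INR N ^ 2 * (rsum K (fun n => Cmod (Y (S n)) ^ 2 / INR (S n)) + M ^ 2 * (INR K / INR (N - K)))).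
  { simpl (0 * N + _)%nat.
    replace N with (S K + (N - K - K - 1) + K)%nat at 1 by lia.
    rewrite !rsum_add, rsum_first, Rmult_plus_distr_l.
    rewrite (rsum_0 (N - K - K - 1)).
    2:{ intros i Hi; unfold G; replace (S K + i)%nat with (S (K + i)) by lia; unfold F.
        replace (S (K + i)) with (S K + i)%nat by lia.
        unfold x; rewrite hat_charge by (auto; lia).
        rewrite (proj2 (Nat.leb_gt (S K + i) K)) by lia; rewrite Cmod_0; ring. }
    apply Rplus_le_compat.
    - simpl G at 1; rewrite Rplus_0_l, Rplus_0_r, <- rsum_scal; apply rsum_le; intros n Hn.
      unfold G, F, x; rewrite hat_charge by (auto; lia).
      rewrite (proj2 (Nat.leb_le (S n) K)) by lia.
      rewrite Cmod_scal, Rpow_mult_distr by lra.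
      pose proof (inv_INR_S_pos n); destruct (Htn (S n)).
      assert (0 <= INR N ^ 2 * Cmod (Y (S n)) ^ 2) by (apply Rmult_le_pos; apply pow2_ge_0).
      apply Rle_trans with (/ INR (S n) * 1 * (INR N ^ 2 * Cmod (Y (S n)) ^ 2)).
      + apply Rmult_le_compat_r; auto; apply Rmult_le_compat_l; lra.
      + right; unfold Rdiv; ring.
    - apply Rle_trans with (INR K * (/ INR (N - K) * (INR N * M) ^ 2)).
      2:{ right; rewrite Rpow_mult_distr; unfold Rdiv; ring. }
      rewrite <- rsum_const; apply rsum_le; intros i Hi.
      replace (S K + (N - K - K - 1) + i)%nat with (S (N - K - 1 + i)) by lia; unfold G, F.
      destruct (Htn (S (N - K - 1 + i))).
      assert (HS : INR (N - K) <= INR (S (N - K - 1 + i))) by (apply le_INR; lia).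
      apply Rmult_le_compat.
      + apply Rmult_le_pos; auto; left; apply inv_INR_S_pos.
      + apply pow2_ge_0.
      + rewrite <- (Rmult_1_r (/ INR (N - K))); apply Rmult_le_compat; auto.
        * left; apply inv_INR_S_pos.
        * now apply Rinv_le_contravar.
      + apply pow_incr; split; [apply Cmod_ge_0|now apply hat_le]. }
  assert (Hbl : rsum L (fun l => rsum N (fun m => G (S l * N + m)%nat))
     <= INR N ^ 2 * M ^ 2 * (- ln (1 - t) / INR N)).
  { apply Rle_trans with (rsum L (fun l => (INR N * M ^ 2) * (/ INR (S l) * t ^ S l))).
    - apply rsum_le; intros l _.
      pose proof (inv_INR_S_pos l); destruct (Htn (S l)).
      assert (HlN : 0 < / (INR (S l) * INR N)).
      { apply Rinv_0_lt_compat, Rmult_lt_0_compat; auto; apply lt_0_INR; lia. }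
      apply Rle_trans with (/ (INR (S l) * INR N) * t ^ S l * rsum N (fun p => Cmod (hat x N p) ^ 2)).
      + rewrite <- rsum_scal; apply rsum_le; intros m Hm.
        assert (Hpos : exists n, (S l * N + m)%nat = S n) by (exists (S l * N + m - 1)%nat; nia).
        destruct Hpos as [n Hn]; rewrite Hn; unfold G, F; rewrite <- Hn, hat_periodic by lia.
        apply Rmult_le_compat_r; [apply pow2_ge_0|].
        destruct (Htn (S l * N + m)%nat).
        apply Rmult_le_compat; auto.
        * left; rewrite Hn; apply inv_INR_S_pos.
        * apply Rinv_le_contravar.
          -- apply Rmult_lt_0_compat; auto; apply lt_0_INR; lia.
          -- rewrite <- mult_INR; apply le_INR; lia.
        * replace (S l * N + m)%nat with (S l + (S l * N + m - S l))%nat by nia.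
          rewrite pow_add; rewrite <- (Rmult_1_r (t ^ S l)) at 2.
          apply Rmult_le_compat_l; auto; apply Htn.
      + apply Rle_trans with (/ (INR (S l) * INR N) * t ^ S l * (INR N ^ 2 * M ^ 2)).
        * apply Rmult_le_compat_l; [apply Rmult_le_pos; lra|].
          apply hat_parseval; auto; lia.
        * right; field; split; first [lra|apply not_0_INR; lia].
    - rewrite rsum_scal; pose proof (harmonic_geo_le t L Ht).
      apply Rle_trans with (INR N * M ^ 2 * - ln (1 - t)).
      + apply Rmult_le_compat_l; auto; apply Rmult_le_pos; [lra|apply pow2_ge_0].
      + right; field; lra. }
  unfold Bd; replace (INR N ^ 2 * (rsum K (fun n => Cmod (Y (S n)) ^ 2 / INR (S n))
       + M ^ 2 * (INR K / INR (N - K) - ln (1 - t) / INR N)))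
    with (INR N ^ 2 * (rsum K (fun n => Cmod (Y (S n)) ^ 2 / INR (S n)) + M ^ 2 * (INR K / INR (N - K)))
       + INR N ^ 2 * M ^ 2 * (- ln (1 - t) / INR N)) by (unfold Rdiv; ring).
  lra. }
set (u := fun j k => (om N ^ j * Cconj (om N ^ k))%C).
assert (Hu : forall j k, Cmod (t * u j k)%C < 1).
{ intros j k; unfold u; rewrite Cmod_scal, Cmod_mult, Cmod_conj, !Cmod_om_pow by lra; lra. }
set (S := fun L j k => rsum L (fun n => / INR (S n) * Re ((t * u j k) ^ S n)%C)).
assert (Hl : is_lim_seq (fun L => rsum N (fun j => rsum N (fun k => x j * x k * (- 2 * S L j k))))
   (rsum N (fun j => rsum N (fun k => x j * x k * ln (Cmod (1 - t * u j k)%C ^ 2))))).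
{ apply (is_lim_seq_rsum N (fun j L => rsum N (fun k => x j * x k * (- 2 * S L j k)))).
  intros j _; apply (is_lim_seq_rsum N (fun k L => x j * x k * (- 2 * S L j k))).
  intros k _; apply (is_lim_seq_scal_l _ (x j * x k) (ln (Cmod (1 - t * u j k)%C ^ 2))).
  apply ln_one_minus_lim, Hu. }
assert (HS : forall L, rsum N (fun j => rsum N (fun k => x j * x k * (- 2 * S L j k))) = - 2 * rsum L F).
{ intros L.
  rewrite (rsum_ext N _ (fun j => rsum L (fun n => rsum N (fun k =>
     - 2 * (/ INR (Datatypes.S n) * t ^ Datatypes.S n) * (x j * x k * Re (u j k ^ Datatypes.S n)%C))))).
  2:{ intros j _; rewrite rsum_swap; apply rsum_ext; intros k _; unfold S.
      rewrite <- !rsum_scal; apply rsum_ext; intros n _.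
      rewrite Cpow_mult_l, <- RtoC_pow, Re_scal; ring. }
  rewrite rsum_swap, <- rsum_scal; apply rsum_ext; intros n _.
  rewrite (rsum_ext N _ (fun j => - 2 * (/ INR (Datatypes.S n) * t ^ Datatypes.S n) *
     rsum N (fun k => x j * x k * Re (u j k ^ Datatypes.S n)%C))).
  2:{ intros j _; rewrite <- rsum_scal; reflexivity. }
  rewrite rsum_scal; unfold u; rewrite double_Re_sum; unfold F; ring. }
assert (Hfin : - 2 * Bd <= rsum N (fun j => rsum N (fun k => x j * x k * ln (Cmod (1 - t * u j k)%C ^ 2)))).
{ apply (is_lim_seq_le (fun _ => - 2 * Bd) _ (- 2 * Bd) (Finite _)) in Hl; auto using is_lim_seq_const.
  intros L; rewrite HS; specialize (HB L); lra. }
apply Ropp_le_contravar in Hfin; eapply Rle_trans; [exact Hfin|]; unfold Bd; right; ring.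
Qed.

Lemma rsum_indicator N j c : (j < N)%nat -> rsum N (fun k => if Nat.eqb j k then c else 0) = c.
Proof.
intros Hj; induction N as [|N IH]; [lia|]; cbn [rsum].
destruct (Nat.eqb_spec j N) as [->|Hne].
- rewrite rsum_0; [ring|]; intros i Hi; rewrite (proj2 (Nat.eqb_neq N i)); auto; lia.
- rewrite IH by lia; ring.
Qed.

Lemma ln_perturb A d : 0 < A -> 0 <= d -> 0 <= ln (A + d) - ln A <= d / A.
Proof.
intros HA Hd; rewrite <- ln_div by lra.
assert (Hq : 0 <= d / A) by (apply Rmult_le_pos; auto; left; now apply Rinv_0_lt_compat).
replace ((A + d) / A) with (1 + d / A) by (field; lra); split.
- rewrite <- ln_1; apply ln_le; lra.
- pose proof (ln_le_minus1 (1 + d / A) ltac:(lra)); lra.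
Qed.

Lemma ln_INR_ge0 N : (1 <= N)%nat -> 0 <= ln (INR N).
Proof. intros H; rewrite <- ln_1; apply ln_le; [lra|]. change 1 with (INR 1); now apply le_INR. Qed.

Lemma ln_sq x : 0 < x -> ln (x ^ 2) = 2 * ln x.
Proof. intros; simpl; rewrite Rmult_1_r, ln_mult by auto; ring. Qed.

(** * Comparison of the energies of the image points and of the roots of unity *)

Section Comparison.

Variables (a : nat -> C) (d : nat -> nat -> C) (rho R0 R1 : R).
Hypotheses (Hu : univ a) (Hrho : 0 < rho < 1) (HR : R0 < R1).
Hypothesis Hbd : forall r, 0 < r < 1 -> exists M, forall p q, Cmod (d p q) * r ^ (p + q) <= M.
Hypothesis Hln : forall z w, Cmod z < 1 -> Cmod w < 1 ->
  ln (Cmod (quot a z w) ^ 2) = 2 * Re (dsum d z w).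
Hypothesis Hmax : forall z, Cmod z = rho -> Cmod (ev a z) <= R0.

Let zr (N j : nat) : C := (rho * om N ^ j)%C.
Let tn (N : nat) : R := 1 - / INR N ^ 2.
(** [G] is the kernel of [energy_disk] at the image points, divided by R1 to lie inside the disk.
    [H] is the same logarithm factored through the difference quotient, |f z - f w|^2 = |quot z w|^2
    |z - w|^2, with the chord |1 - u| replaced by |1 - t u| for t = [tn N]. *)
Let G (N j k : nat) : R := ln (Cmod (ev a (zr N j) / R1 - ev a (zr N k) / R1)%C ^ 2
  + / INR N ^ 3 * ((1 - Cmod (ev a (zr N j) / R1)%C ^ 2) * (1 - Cmod (ev a (zr N k) / R1)%C ^ 2))).
Let H (N j k : nat) : R := 2 * Re (dsum d (zr N j) (zr N k)) + ln (rho ^ 2 / R1 ^ 2)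
  + ln (Cmod (1 - tn N * (om N ^ j * Cconj (om N ^ k)))%C ^ 2).

Lemma comparison_R1_pos : 0 <= R0 /\ 0 < R1.
Proof.
pose proof (Hmax rho ltac:(rewrite Cmod_R, Rabs_pos_eq; lra)); pose proof (Cmod_ge_0 (ev a rho)); lra.
Qed.

Lemma Cmod_zr N j : Cmod (zr N j) = rho.
Proof. unfold zr; rewrite Cmod_scal, Cmod_om_pow by lra; ring. Qed.

Lemma Cmod_scaled N j : Cmod (ev a (zr N j) / R1)%C <= R0 / R1.
Proof.
destruct comparison_R1_pos as [HR0 HR1].
rewrite Cmod_div, Cmod_R, (Rabs_pos_eq R1) by (try lra; intros E; apply RtoC_inj in E; lra).
apply Rmult_le_compat_r; [left; now apply Rinv_0_lt_compat|].
apply Hmax; rewrite Cmod_zr; lra.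
Qed.

Lemma scaled_gap N j : 0 < 1 - (R0 / R1) ^ 2 <= 1 - Cmod (ev a (zr N j) / R1)%C ^ 2.
Proof.
destruct comparison_R1_pos as [HR0 HR1]; pose proof (ratio_lt1 R0 R1 ltac:(lra)) as Hx.
split; [nra|].
apply Rplus_le_compat_l, Ropp_le_contravar, pow_incr; split; [apply Cmod_ge_0|apply Cmod_scaled].
Qed.

(** Distinct roots are at least 1/N apart, so the squared distance of the scaled image points is at
    least m/N^2, and a perturbation of size N^-3 moves its logarithm by O(1/N). Replacing 1 by 1 -
    N^-2 in the chord costs no more than O(1/N) either. *)
Lemma compare_offdiag : exists C0, 0 <= C0 /\ forall N j k, (2 <= N)%nat ->
  (j < N)%nat -> (k < N)%nat -> j <> k -> Rabs (G N j k - H N j k) <= C0 / INR N.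
Proof.
destruct comparison_R1_pos as [HR0 HR1]; pose proof Hu as (_ & _ & Ha & _).
destruct (quot_lower a rho Hu Hrho) as (mu & Hmu & Hlow).
set (m := mu ^ 2 * rho ^ 2 / R1 ^ 2).
assert (Hm : 0 < m).
{ unfold m; apply Rdiv_lt_0_compat; [apply Rmult_lt_0_compat|]; apply pow_lt; lra. }
exists (/ m + 2); split; [pose proof (Rinv_0_lt_compat m Hm); lra|].
intros N j k HN Hj Hk Hne.
assert (HN0 : 2 <= INR N) by (change 2 with (INR 2); now apply le_INR).
set (z := zr N j); set (w := zr N k).
assert (Hz : Cmod z = rho) by apply Cmod_zr. assert (Hw : Cmod w = rho) by apply Cmod_zr.
set (u := (om N ^ j * Cconj (om N ^ k))%C).
set (V := Cmod (1 - u)%C ^ 2).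
assert (HV : / INR N ^ 2 <= V).
{ rewrite <- pow_inv; apply pow_incr; split.
  - left; apply Rinv_0_lt_compat; lra.
  - now apply om_ratio. }
assert (HiN : 0 < / INR N ^ 2) by (apply Rinv_0_lt_compat, pow_lt; lra).
assert (Hdiff : Cmod (z - w)%C ^ 2 = rho ^ 2 * V).
{ unfold V; rewrite <- Rpow_mult_distr; f_equal.
  transitivity (Cmod (rho * om N ^ k * (u - 1))%C).
  - f_equal; unfold z, w, zr, u.
    transitivity (rho * (om N ^ j * (om N ^ k * Cconj (om N ^ k)) - om N ^ k))%C; [|ring].
    rewrite <- Cmod_sq, Cmod_om_pow, pow1; ring.
  - rewrite !Cmod_mult, Cmod_om_pow, Cmod_R, Rabs_pos_eq by lra.
    replace (u - 1)%C with (- (1 - u))%C by ring; rewrite Cmod_opp; ring. }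
set (Q := Cmod (quot a z w) ^ 2).
assert (HQ : mu ^ 2 <= Q) by (apply pow_incr; split; [lra|apply Hlow; lra]).
assert (Hmu2 : 0 < mu ^ 2) by now apply pow_lt.
assert (Hrho2 : 0 < rho ^ 2) by (apply pow_lt; lra).
assert (HR2 : 0 < R1 ^ 2) by now apply pow_lt.
set (A := Q * (rho ^ 2 / R1 ^ 2) * V).
assert (HA : Cmod (ev a z / R1 - ev a w / R1)%C ^ 2 = A).
{ assert (HRne : RtoC R1 <> RtoC 0) by (intros E; apply RtoC_inj in E; lra).
  replace (ev a z / R1 - ev a w / R1)%C with ((z - w) * quot a z w / R1)%C.
  - rewrite Cmod_div, Cmod_mult, Cmod_R, (Rabs_pos_eq R1) by (auto; lra).
    unfold Rdiv; rewrite !Rpow_mult_distr, Hdiff, pow_inv; unfold A, Q; field; lra.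
  - rewrite quot_eq by (auto; lra); field; auto. }
assert (HAm : m / INR N ^ 2 <= A).
{ replace (m / INR N ^ 2) with (mu ^ 2 * (rho ^ 2 / R1 ^ 2) * / INR N ^ 2) by (unfold m; field; lra).
  assert (0 < rho ^ 2 / R1 ^ 2) by now apply Rdiv_lt_0_compat.
  unfold A; apply Rmult_le_compat; [apply Rmult_le_pos; lra|lra| |exact HV].
  apply Rmult_le_compat_r; lra. }
assert (HA0 : 0 < A).
{ eapply Rlt_le_trans; [|exact HAm]; apply Rdiv_lt_0_compat; auto; apply pow_lt; lra. }
set (delta := / INR N ^ 3 * ((1 - Cmod (ev a z / R1)%C ^ 2) * (1 - Cmod (ev a w / R1)%C ^ 2))).
assert (Hdelta : 0 <= delta <= / INR N ^ 3).
{ assert (0 < / INR N ^ 3) by (apply Rinv_0_lt_compat, pow_lt; lra).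
  pose proof (scaled_gap N j) as [A1 A2]; pose proof (scaled_gap N k) as [B1 B2]; fold z in A2; fold w in B2.
  pose proof (pow2_ge_0 (Cmod (ev a z / R1)%C)); pose proof (pow2_ge_0 (Cmod (ev a w / R1)%C)).
  unfold delta; split; [apply Rmult_le_pos; [lra|apply Rmult_le_pos; lra]|].
  rewrite <- Rmult_1_r; apply Rmult_le_compat_l; [lra|].
  rewrite <- (Rmult_1_r 1); apply Rmult_le_compat; lra. }
assert (HG : 0 <= G N j k - ln A <= / m / INR N).
{ unfold G; fold z w; rewrite HA; fold delta.
  destruct (ln_perturb A delta HA0 (proj1 Hdelta)) as [E1 E2]; split; auto.
  eapply Rle_trans; [exact E2|].
  apply Rle_trans with (/ INR N ^ 3 / (m / INR N ^ 2)).
  - unfold Rdiv; apply Rmult_le_compat; try lra; [left; now apply Rinv_0_lt_compat|].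
    apply Rinv_le_contravar; auto; apply Rdiv_lt_0_compat; auto; apply pow_lt; lra.
  - right; field; lra. }
assert (HV0 : 0 < V) by lra.
set (tt := tn N).
assert (Htt : / 2 <= tt < 1 /\ 1 - tt = / INR N ^ 2).
{ unfold tt, tn; split; [|ring]; split; [|lra].
  assert (/ INR N ^ 2 <= / 4); [|lra].
  apply Rinv_le_contravar; [lra|]; nra. }
assert (HH : Rabs (H N j k - ln A) <= 2 / INR N).
{ unfold H; fold z w u tt; rewrite <- Hln by lra; fold Q.
  rewrite Cmod_1_minus_scal.
  2:{ unfold u; rewrite Cmod_mult, Cmod_conj, !Cmod_om_pow; ring. }
  assert (HQ0 : 0 < Q) by lra.
  assert (HrR : 0 < rho ^ 2 / R1 ^ 2) by now apply Rdiv_lt_0_compat.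
  pose proof (Rmult_lt_0_compat _ _ HQ0 HrR) as HQR.
  fold V; unfold A; rewrite ln_mult, (ln_mult Q) by assumption.
  replace ((1 - tt) ^ 2 + tt * V) with (V * (tt + (1 - tt) ^ 2 / V)) by (field; lra).
  assert (Hq : 0 <= (1 - tt) ^ 2 / V <= / INR N ^ 2).
  { split; [apply Rmult_le_pos; [apply pow2_ge_0|left; now apply Rinv_0_lt_compat]|].
    apply Rmult_le_reg_r with V; auto; unfold Rdiv; rewrite Rmult_assoc, Rinv_l, Rmult_1_r by lra.
    destruct Htt as [_ ->]; replace ((/ INR N ^ 2) ^ 2) with (/ INR N ^ 2 * / INR N ^ 2) by ring.
    apply Rmult_le_compat_l; lra. }
  rewrite ln_mult by lra.
  assert (HNN : / INR N ^ 2 <= / INR N).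
  { apply Rinv_le_contravar; [lra|]; nra. }
  pose proof (ln_le_minus1 (tt + (1 - tt) ^ 2 / V) ltac:(lra)) as Hup.
  assert (Hlo : 1 - / tt <= ln (tt + (1 - tt) ^ 2 / V)).
  { eapply Rle_trans; [apply ln_ge_inv; lra|apply ln_le; lra]. }
  assert (Hit : 1 - / tt >= - (2 * / INR N ^ 2)).
  { replace (1 - / tt) with (- ((1 - tt) * / tt)) by (field; lra).
    destruct Htt as [Ht1 ->]; apply Rle_ge, Ropp_le_contravar.
    rewrite (Rmult_comm 2); apply Rmult_le_compat_l; [lra|].
    rewrite <- (Rinv_inv 2); apply Rinv_le_contravar; lra. }
  unfold Rdiv at 3.
  apply Rabs_le; unfold Rdiv in *; lra. }
replace (G N j k - H N j k) with ((G N j k - ln A) - (H N j k - ln A)) by ring.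
eapply Rle_trans; [apply Rabs_triang|]; rewrite Rabs_Ropp, (Rabs_pos_eq (_ - ln A)) by lra.
replace ((/ m + 2) / INR N) with (/ m / INR N + 2 / INR N) by (unfold Rdiv; ring); lra.
Qed.

(** The diagonals are about - 3 ln N and - 4 ln N. They need not cancel: only N of the N^2 pairs are
    diagonal. *)
Lemma compare_diag : exists C0, 0 <= C0 /\ forall N j, (2 <= N)%nat ->
  Rabs (G N j j - H N j j) <= C0 * (1 + ln (INR N)).
Proof.
destruct comparison_R1_pos as [HR0 HR1].
set (s := (1 + rho) / 2).
destruct (Hbd s) as [M HM]; [unfold s; lra|].
set (u0 := 1 - (R0 / R1) ^ 2).
set (B := 2 * M / (1 - rho / s) ^ 2).
assert (HB : forall z, Cmod z <= rho -> Cmod (dsum d z z) <= B).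
{ intros z Hz; pose proof (dsum_trunc d rho s M z z 0 ltac:(unfold s; lra) HM Hz Hz) as Ht.
  unfold dpart in Ht; simpl in Ht; replace (dsum d z z - 0)%C with (dsum d z z) in Ht by ring.
  unfold B; simpl; rewrite Rmult_1_r in Ht; exact Ht. }
set (c1 := Rabs (ln u0)); set (c2 := Rabs (ln (rho ^ 2 / R1 ^ 2))).
assert (HB0 : 0 <= B).
{ eapply Rle_trans; [apply (Cmod_ge_0 (dsum d 0 0))|apply HB; rewrite Cmod_0; lra]. }
assert (Hc1 : 0 <= c1) by apply Rabs_pos. assert (Hc2 : 0 <= c2) by apply Rabs_pos.
exists (7 + 2 * c1 + c2 + 2 * B); split; [lra|].
intros N j HN.
assert (HN0 : 2 <= INR N) by (change 2 with (INR 2); now apply le_INR).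
pose proof (ln_INR_ge0 N ltac:(lia)) as HlN; set (l := ln (INR N)) in *.
set (z := zr N j); assert (Hz : Cmod z = rho) by apply Cmod_zr.
destruct (scaled_gap N j) as [Hg1 Hg2]; fold z in Hg2; fold u0 in Hg1, Hg2.
set (u := 1 - Cmod (ev a z / R1)%C ^ 2) in *.
assert (Hu1 : u <= 1) by (unfold u; pose proof (pow2_ge_0 (Cmod (ev a z / R1)%C)); lra).
assert (Hlu : Rabs (ln u) <= c1).
{ unfold c1; rewrite !Rabs_left1; [apply Ropp_le_contravar, ln_le; lra| |];
    rewrite <- ln_1; apply ln_le; lra. }
assert (HG : G N j j = - 3 * l + 2 * ln u).
{ unfold G; fold z u.
  replace (ev a z / R1 - ev a z / R1)%C with (RtoC 0) by ring; rewrite Cmod_0.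
  replace (0 ^ 2 + / INR N ^ 3 * (u * u)) with ((/ INR N) ^ 3 * u ^ 2) by (rewrite pow_inv; ring).
  assert (0 < / INR N) by (apply Rinv_0_lt_compat; lra).
  rewrite ln_mult, ln_sq, ln_pow, ln_Rinv by (try apply pow_lt; lra).
  fold l; simpl INR; ring. }
assert (HH : H N j j = 2 * Re (dsum d z z) + ln (rho ^ 2 / R1 ^ 2) - 4 * l).
{ unfold H; fold z.
  rewrite <- Cmod_sq, Cmod_om_pow, pow1, Cmult_1_r, <- RtoC_minus.
  replace (1 - tn N) with ((/ INR N) ^ 2) by (unfold tn; rewrite pow_inv; ring).
  assert (0 < / INR N) by (apply Rinv_0_lt_compat; lra).
  rewrite Cmod_R, pow2_abs, !ln_sq, ln_Rinv by (try apply pow_lt; lra).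
  fold l; ring. }
rewrite HG, HH.
pose proof (HB z ltac:(lra)) as HBz; pose proof (re_le_Cmod (dsum d z z)) as Hre.
assert (Hre' : Rabs (Re (dsum d z z)) <= B) by lra.
fold c2; pose proof (Rle_abs (ln (rho ^ 2 / R1 ^ 2))) as Hc2a.
pose proof (Rle_abs (- ln (rho ^ 2 / R1 ^ 2))) as Hc2b; rewrite Rabs_Ropp in Hc2b; fold c2 in Hc2a, Hc2b.
apply Rabs_le_between in Hre'; apply Rabs_le_between in Hlu.
assert (0 <= (2 * c1 + c2 + 2 * B) * l) by (apply Rmult_le_pos; lra).
apply Rabs_le; nra.
Qed.

Lemma compare_total : exists C0, 0 <= C0 /\ forall N x M, (2 <= N)%nat -> (forall j, Rabs (x j) <= M) ->
  rsum N (fun j => rsum N (fun k => x j * x k * H N j k)) <= M ^ 2 * C0 * INR N * (1 + ln (INR N)).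
Proof.
destruct comparison_R1_pos as [HR0 HR1].
destruct compare_offdiag as (C1 & HC1 & Hoff); destruct compare_diag as (C2 & HC2 & Hdiag).
exists (C1 + C2); split; [lra|]; intros N x M HN Hx.
assert (HN0 : 2 <= INR N) by (change 2 with (INR 2); now apply le_INR).
assert (HM : 0 <= M) by (eapply Rle_trans; [apply Rabs_pos|apply (Hx 0%nat)]).
pose proof (ln_INR_ge0 N ltac:(lia)) as HlN.
assert (HGle : rsum N (fun j => rsum N (fun k => x j * x k * G N j k)) <= 0).
{ apply (energy_disk N x (fun j => ev a (zr N j) / R1)%C (/ INR N ^ 3)).
  - intros j; eapply Rle_lt_trans; [apply Cmod_scaled|apply ratio_lt1; lra].
  - split; [apply Rinv_0_lt_compat, pow_lt; lra|].
    rewrite <- Rinv_1; apply Rinv_lt_contravar; [rewrite Rmult_1_l; apply pow_lt; lra|].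
    simpl; nra. }
apply Rle_trans with (rsum N (fun j => rsum N (fun k => x j * x k * G N j k))
  + rsum N (fun j => rsum N (fun k => M ^ 2 * (C1 / INR N
      + if Nat.eqb j k then C2 * (1 + ln (INR N)) else 0)))).
- rewrite <- rsum_plus; apply rsum_le; intros j Hj.
  rewrite <- rsum_plus; apply rsum_le; intros k Hk.
  replace (x j * x k * H N j k) with (x j * x k * G N j k + (x j * x k) * (H N j k - G N j k)) by ring.
  apply Rplus_le_compat_l; eapply Rle_trans; [apply Rle_abs|]; rewrite Rabs_mult.
  apply Rmult_le_compat; try apply Rabs_pos.
  + rewrite Rabs_mult; simpl; rewrite Rmult_1_r; apply Rmult_le_compat; auto using Rabs_pos.
  + rewrite Rabs_minus_sym.
    assert (HCN : 0 <= C1 / INR N) by (apply Rmult_le_pos; auto; left; apply Rinv_0_lt_compat; lra).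
    destruct (Nat.eqb_spec j k) as [->|Hne].
    * specialize (Hdiag N k HN); lra.
    * specialize (Hoff N j k HN Hj Hk Hne); lra.
- rewrite (rsum_ext N (fun j => rsum N (fun k => M ^ 2 * (C1 / INR N
      + if Nat.eqb j k then C2 * (1 + ln (INR N)) else 0)))
      (fun j => M ^ 2 * (C1 + C2 * (1 + ln (INR N))))).
  2:{ intros j Hj; rewrite rsum_scal, rsum_plus, rsum_const, rsum_indicator by auto; field; lra. }
  rewrite rsum_const.
  assert (HM2 : 0 <= INR N * M ^ 2) by (apply Rmult_le_pos; [lra|apply pow2_ge_0]).
  assert (INR N * M ^ 2 * (C1 + C2 * (1 + ln (INR N))) <= INR N * M ^ 2 * ((C1 + C2) * (1 + ln (INR N)))).
  { apply Rmult_le_compat_l; auto; nra. }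
  lra.
Qed.

Lemma double_dpart x N T :
  rsum N (fun j => rsum N (fun k => x j * x k * Re (dpart d T (zr N j) (zr N k))))
  = Re (csum T (fun p => csum T (fun q => d p q * RtoC (rho ^ (p + q)) * (hat x N p * hat x N q))%C)).
Proof.
rewrite (rsum_ext N _ (fun j => Re (csum N (fun k => csum T (fun p => csum T (fun q =>
   RtoC (x j * x k) * (d p q * RtoC (rho ^ (p + q)) * ((om N ^ j) ^ p * (om N ^ k) ^ q)))))%C))).
2:{ intros j _; rewrite Re_csum; apply rsum_ext; intros k _; rewrite <- Re_scal; f_equal.
    unfold dpart; rewrite <- csum_scal; apply csum_ext; intros p _.
    rewrite <- csum_scal; apply csum_ext; intros q _.
    replace (RtoC (rho ^ (p + q))) with (RtoC rho ^ p * RtoC rho ^ q)%C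
      by (rewrite RtoC_pow, Cpow_add_r; reflexivity).
    unfold zr; rewrite !Cpow_mult_l; ring. }
rewrite <- Re_csum; f_equal.
transitivity (csum N (fun j => csum T (fun p => csum T (fun q => csum N (fun k =>
   RtoC (x j * x k) * (d p q * RtoC (rho ^ (p + q)) * ((om N ^ j) ^ p * (om N ^ k) ^ q))))))%C).
{ apply csum_ext; intros j _; rewrite csum_swap; apply csum_ext; intros p _; apply csum_swap. }
rewrite csum_swap; apply csum_ext; intros p _.
rewrite csum_swap; apply csum_ext; intros q _; apply double_char_sum.
Qed.

Lemma csum_trunc2 K T (F : nat -> nat -> C) : (K <= T)%nat ->
  (forall p q, (p < T)%nat -> (q < T)%nat -> (K <= p)%nat \/ (K <= q)%nat -> F p q = RtoC 0) ->
  csum T (fun p => csum T (fun q => F p q)) = csum K (fun p => csum K (fun q => F p q)).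
Proof.
intros HK HF; replace T with (K + (T - K))%nat at 1 by lia.
rewrite csum_add, (csum_0 (T - K)), Cplus_0_r.
- apply csum_ext; intros p Hp; replace T with (K + (T - K))%nat at 1 by lia.
  rewrite csum_add, (csum_0 (T - K)); [ring|]; intros; apply HF; lia.
- intros p Hp; apply csum_0; intros; apply HF; lia.
Qed.

Lemma ln_over_small e : 0 < e -> exists N0, forall N, (N0 <= N)%nat -> (1 + ln (INR N)) / INR N < e.
Proof.
intros He.
destruct (archimed_cor1 (e / 4)) as (m & Hm & Hm0); [lra|].
assert (Hm1 : 0 < INR m) by now apply lt_0_INR.
exists (m * m)%nat; intros N HN.
assert (HNm : INR m * INR m <= INR N) by (rewrite <- mult_INR; now apply le_INR).
assert (HN0 : 0 < INR N) by nra.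
assert (Hs : INR m <= sqrt (INR N)).
{ rewrite <- (sqrt_square (INR m)) by lra; now apply sqrt_le_1_alt. }
assert (Hss : sqrt (INR N) * sqrt (INR N) = INR N) by (apply sqrt_sqrt; lra).
set (q := sqrt (INR N)) in *.
assert (Hm2 : 1 <= INR m) by (change 1 with (INR 1); apply le_INR; lia).
assert (Hl : ln (INR N) <= 2 * (q - 1)).
{ rewrite <- Hss, ln_mult by lra; pose proof (ln_le_minus1 q ltac:(lra)); lra. }
apply Rle_lt_trans with (2 / q).
- rewrite <- Hss; apply Rmult_le_reg_r with (q * q); [nra|].
  unfold Rdiv at 1; rewrite Rmult_assoc, Rinv_l, Rmult_1_r by nra.
  replace (2 / q * (q * q)) with (2 * q) by (field; lra). rewrite Hss; lra.
- assert (/ q <= / INR m) by (apply Rinv_le_contravar; lra).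
  unfold Rdiv in *; lra.
Qed.

(** For charges with Fourier coefficients Y, the double series in [H] gives 2 N^2 times the
    quadratic form, the constant ln (rho^2/R1^2) gives - 2 N^2 (Re Y 0)^2 ln (R1/rho), and
    [energy_roots] bounds the rest by the weighted norm of Y. The energy of [G] is at most 0; it
    remains to divide by 2 N^2 and let N grow. *)
Lemma grunsky_bounded K (Y : nat -> C) : Im (Y 0%nat) = 0 ->
  Re (csum (S K) (fun p => csum (S K) (fun q => d p q * RtoC (rho ^ (p + q)) * (Y p * Y q))%C))
  <= rsum K (fun n => Cmod (Y (S n)) ^ 2 / INR (S n)) + Re (Y 0%nat) ^ 2 * ln (R1 / rho).
Proof.
intros H0; destruct comparison_R1_pos as [HR0 HR1].
set (BB := Re _); set (SS := rsum K _); set (M := charge_max K Y).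
destruct compare_total as (C0 & HC0 & Hcmp).
set (s := (1 + rho) / 2).
destruct (Hbd s) as [MM HMM]; [unfold s; lra|].
pose proof (ratio_lt1 rho s ltac:(unfold s; lra)) as Hx; set (q0 := rho / s) in *.
apply le_epsilon; intros e He.
assert (HM2 : 0 <= M ^ 2) by apply pow2_ge_0.
(* Two errors of size M^2 e1 arise, one from truncating the double series and one from the
   energies. *)
set (e1 := e / (3 * (M ^ 2 + 1))).
assert (He1 : 0 < e1) by (apply Rdiv_lt_0_compat; lra).
assert (He1M : M ^ 2 * e1 <= e / 3).
{ unfold e1; apply Rmult_le_reg_r with (3 * (M ^ 2 + 1)); [lra|].
  replace (M ^ 2 * (e / (3 * (M ^ 2 + 1))) * (3 * (M ^ 2 + 1))) with (M ^ 2 * e) by (field; lra).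
  nra. }
destruct (geo_small (2 * MM / (1 - q0) ^ 2) q0 e1 Hx He1) as [T0 HT0].
set (T := (T0 + S K)%nat).
specialize (HT0 T ltac:(unfold T; lia)).
(* Aliasing contributes 2 K, the logarithm - ln (1 - t) = 2 ln N contributes 2, and the comparison
   of the kernels C0/2. *)
set (C3 := INR K * 2 + 2 + C0 / 2).
assert (HC3 : 0 < C3) by (unfold C3; pose proof (pos_INR K); lra).
destruct (ln_over_small (e1 / C3)) as [N0 HN0]; [apply Rdiv_lt_0_compat; auto|].
set (N := (N0 + T + 2 * K + 2)%nat).
specialize (HN0 N ltac:(unfold N; lia)).
assert (HN2 : (2 <= N)%nat) by (unfold N; lia).
assert (HNr : 2 <= INR N) by (change 2 with (INR 2); now apply le_INR).
set (x := charge K Y N).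
assert (Hxb : forall j, Rabs (x j) <= M) by (intros; apply charge_le).
specialize (Hcmp N x M HN2 Hxb).
pose proof (ln_INR_ge0 N ltac:(lia)) as HlN.
assert (HiN : 0 < / INR N ^ 2) by (apply Rinv_0_lt_compat, pow_lt; lra).
pose proof (energy_roots K Y N (tn N) H0 ltac:(unfold N; lia)) as Hroots.
assert (Htn : 0 <= tn N < 1).
{ unfold tn; split; [|lra].
  assert (/ INR N ^ 2 <= 1); [|lra].
  rewrite <- Rinv_1; apply Rinv_le_contravar; [lra|]; nra. }
specialize (Hroots Htn); fold x M SS in Hroots.
assert (Hlt : - ln (1 - tn N) = 2 * ln (INR N)).
{ unfold tn; replace (1 - (1 - / INR N ^ 2)) with (/ INR N ^ 2) by ring.
  rewrite ln_Rinv, ln_sq by (try apply pow_lt; lra); ring. }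
set (S1 := rsum N (fun j => rsum N (fun k => x j * x k * Re (dsum d (zr N j) (zr N k))))).
set (S3 := rsum N (fun j => rsum N (fun k => x j * x k *
   ln (Cmod (1 - tn N * (om N ^ j * Cconj (om N ^ k)))%C ^ 2)))) in *.
assert (Hhat0 : hat x N 0 = (RtoC (INR N) * Y 0%nat)%C).
{ unfold x; rewrite hat_charge by (auto; unfold N; lia); reflexivity. }
assert (Hsumx : rsum N x = INR N * Re (Y 0%nat)).
{ rewrite <- Re_scal, <- Hhat0; unfold hat; rewrite Re_csum; apply rsum_ext; intros j _.
  simpl (_ ^ 0)%C; rewrite Cmult_1_r, re_RtoC; reflexivity. }
assert (Hsplit : rsum N (fun j => rsum N (fun k => x j * x k * H N j k))
  = 2 * S1 + ln (rho ^ 2 / R1 ^ 2) * (INR N * Re (Y 0%nat)) ^ 2 + S3).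
{ rewrite <- Hsumx; replace (rsum N x ^ 2) with (rsum N x * rsum N x) by ring.
  rewrite <- rsum_rsum_mul.
  unfold S1, S3; rewrite <- !rsum_scal, <- !rsum_plus; apply rsum_ext; intros j _.
  rewrite <- !rsum_scal, <- !rsum_plus; apply rsum_ext; intros k _; unfold H; ring. }
assert (HS1 : INR N ^ 2 * BB - INR N ^ 2 * (M ^ 2 * e1) <= S1).
{ replace (INR N ^ 2 * BB) with
    (rsum N (fun j => rsum N (fun k => x j * x k * Re (dpart d T (zr N j) (zr N k))))).
  - replace (INR N ^ 2 * (M ^ 2 * e1)) with (rsum N (fun _ => rsum N (fun _ => M ^ 2 * e1)))
      by (rewrite !rsum_const; ring).
    unfold S1; rewrite <- rsum_minus; apply rsum_le; intros j _.
    rewrite <- rsum_minus; apply rsum_le; intros k _.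
    assert (Hd : Rabs (Re (dsum d (zr N j) (zr N k) - dpart d T (zr N j) (zr N k))%C) <= e1).
    { eapply Rle_trans; [apply re_le_Cmod|].
      eapply Rle_trans; [apply (dsum_trunc d rho s MM); auto; unfold s; try lra; rewrite Cmod_zr; lra|].
      fold s q0; replace (2 * MM * q0 ^ T / (1 - q0) ^ 2) with (2 * MM / (1 - q0) ^ 2 * q0 ^ T)
        by (unfold Rdiv; ring); lra. }
    rewrite Re_minus in Hd.
    assert (Hp : Rabs (x j * x k * (Re (dsum d (zr N j) (zr N k)) - Re (dpart d T (zr N j) (zr N k))))
       <= M ^ 2 * e1).
    { rewrite Rabs_mult; apply Rmult_le_compat; auto using Rabs_pos.
      rewrite Rabs_mult; simpl; rewrite Rmult_1_r; apply Rmult_le_compat; auto using Rabs_pos. }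
    apply Rabs_le_between in Hp; lra.
  - rewrite double_dpart; unfold BB.
    rewrite (csum_trunc2 (S K)).
    + rewrite <- Re_scal, RtoC_pow; f_equal.
      rewrite <- csum_scal; apply csum_ext; intros p Hp.
      rewrite <- csum_scal; apply csum_ext; intros q Hq.
      unfold x; rewrite !hat_charge by (auto; unfold N; lia).
      rewrite !(proj2 (Nat.leb_le _ _)) by lia; ring.
    + unfold T; lia.
    + intros p q Hp Hq Hpq; unfold x; rewrite !hat_charge by (auto; unfold N; lia).
      destruct Hpq as [Hc|Hc]; [rewrite (proj2 (Nat.leb_gt p K)) by lia|
        rewrite (proj2 (Nat.leb_gt q K)) by lia]; ring. }
assert (HlnR : ln (rho ^ 2 / R1 ^ 2) = - 2 * ln (R1 / rho)).
{ rewrite !ln_div, !ln_sq by (try apply pow_lt; lra); ring. }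
rewrite Hsplit, HlnR in Hcmp.
assert (HNK : INR K / INR (N - K) <= 2 * INR K / INR N).
{ assert (HNK0 : 0 < INR (N - K)) by (apply lt_0_INR; unfold N; lia).
  unfold Rdiv; rewrite (Rmult_comm 2), Rmult_assoc; apply Rmult_le_compat_l; [apply pos_INR|].
  replace (2 * / INR N) with (/ (INR N / 2)) by (field; lra).
  apply Rinv_le_contravar; [lra|].
  assert (INR N <= INR (2 * (N - K))) by (apply le_INR; unfold N; lia).
  rewrite mult_INR in H1; simpl (INR 2) in H1; lra. }
set (L := ln (INR N)) in *.
assert (Herr : INR K / INR (N - K) + 2 * L / INR N + C0 / 2 * ((1 + L) / INR N) <= e1).
{ apply Rle_trans with (C3 * ((1 + L) / INR N)).
  - unfold C3; rewrite !Rmult_plus_distr_r.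
    assert (Hi : 0 < / INR N) by (apply Rinv_0_lt_compat; lra).
    apply Rplus_le_compat_r, Rplus_le_compat.
    + eapply Rle_trans; [exact HNK|]; unfold Rdiv; pose proof (pos_INR K).
      assert (0 <= INR K * 2 * (L * / INR N)) by (apply Rmult_le_pos; [lra|apply Rmult_le_pos; lra]).
      lra.
    + unfold Rdiv; rewrite Rmult_assoc; apply Rmult_le_compat_l; [lra|].
      apply Rmult_le_compat_r; lra.
  - apply Rlt_le in HN0; apply (Rmult_le_compat_l C3) in HN0; [|lra].
    replace (C3 * (e1 / C3)) with e1 in HN0 by (field; lra); exact HN0. }
set (W := INR N ^ 2) in *.
assert (HW : 0 < W) by (apply pow_lt; lra).
assert (Hroots' : - S3 <= 2 * W * (SS + M ^ 2 * (INR K / INR (N - K) + 2 * L / INR N))).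
{ assert (Hlt' : ln (1 - tn N) = - (2 * L)) by lra; rewrite Hlt' in Hroots.
  eapply Rle_trans; [exact Hroots|]; right; unfold Rdiv; ring. }
assert (Hcmp' : M ^ 2 * C0 * INR N * (1 + L) = 2 * W * (M ^ 2 * (C0 / 2 * ((1 + L) / INR N)))).
{ unfold W; field; lra. }
rewrite Hcmp', Rpow_mult_distr in Hcmp; fold W in Hcmp.
assert (Hfin : 2 * W * BB <= 2 * W * (SS + Re (Y 0%nat) ^ 2 * ln (R1 / rho) + M ^ 2 * e1
   + M ^ 2 * (INR K / INR (N - K) + 2 * L / INR N + C0 / 2 * ((1 + L) / INR N)))) by lra.
apply Rmult_le_reg_l in Hfin; [|lra].
apply (Rmult_le_compat_l (M ^ 2)) in Herr; auto.
lra.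
Qed.

End Comparison.

(** * Grunsky inequalities on the full disk and Goluzin's inequality *)

Definition log_expansion (a : nat -> C) (d : nat -> nat -> C) : Prop :=
  (forall q, d 0%nat q = lf a q) /\
  (forall p q, d p q = d q p) /\
  (forall r, 0 < r < 1 -> exists M, forall p q, Cmod (d p q) * r ^ (p + q) <= M) /\
  (forall p w, (0 < p)%nat -> Cmod w < 1 -> flog (ecoef a w) p = ev (d p) w) /\
  (forall z w, Cmod z < 1 -> Cmod w < 1 -> ln (Cmod (quot a z w) ^ 2) = 2 * Re (dsum d z w)).

Lemma is_lim_seq_pow (u : nat -> R) (l : R) n : is_lim_seq u l -> is_lim_seq (fun m => u m ^ n) (l ^ n).
Proof.
intros H; induction n as [|n IH]; simpl; [apply is_lim_seq_const|].
now apply is_lim_seq_mult'.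
Qed.

Lemma is_lim_inv_INR : is_lim_seq (fun m => / INR (S m)) 0.
Proof.
apply is_lim_seq_spec; intros e; destruct (inv_INR_S_lt e (cond_pos e)) as [N HN].
exists N; intros n Hn; rewrite Rminus_0_r, Rabs_pos_eq; auto; left; apply inv_INR_S_pos.
Qed.

Lemma scale_to_1 A B n : (forall rho, 0 < rho < 1 -> A * rho ^ n <= B) -> A <= B.
Proof.
intros H.
assert (Hl : is_lim_seq (fun m => A * (1 - / INR (S (S m))) ^ n) (A * (1 - 0) ^ n)).
{ apply (is_lim_seq_scal_l _ A (Finite ((1 - 0) ^ n))), is_lim_seq_pow, is_lim_seq_minus'.
  - apply is_lim_seq_const.
  - apply (is_lim_seq_incr_1 (fun m => / INR (S m))), is_lim_inv_INR. }
rewrite Rminus_0_r, pow1, Rmult_1_r in Hl.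
apply (is_lim_seq_le _ (fun _ => B) A B) in Hl; auto using is_lim_seq_const.
intros m; apply H.
assert (H2 : 2 <= INR (S (S m))) by (rewrite !S_INR; pose proof (pos_INR m); lra).
assert (0 < / INR (S (S m)) <= / 2); [|lra].
split; [apply inv_INR_S_pos|apply Rinv_le_contravar; lra].
Qed.

Definition wnorm (K : nat) (X : nat -> C) : R := rsum K (fun n => Cmod (X n) ^ 2 / INR (S n)).

Definition bil (d : nat -> nat -> C) (K : nat) (X Y : nat -> C) : C :=
  csum K (fun p => csum K (fun q => d (S p) (S q) * (X p * Y q))%C).

Lemma nrm_bound a rho : univ a -> 0 < rho < 1 -> forall z, Cmod z <= rho -> Cmod (ev a z) <= nrm a rho.
Proof.
intros (_ & _ & Ha & _) Hr z Hz; apply ev_le_nrm; auto; apply rad1_summ; auto; lra.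
Qed.

(** A charge without constant term makes the bound R1 on f disappear, so rho may tend to 1. The
    weights rho^(p+q) are absorbed by dividing the charge at frequency n by rho^n, at the price of
    the factor rho^(2 K), which tends to 1. *)
Lemma grunsky_quadratic a d K X : univ a -> log_expansion a d -> Re (bil d K X X) <= wnorm K X.
Proof.
intros Hu (_ & _ & Hbd & _ & Hln).
apply (scale_to_1 _ _ (2 * K)); intros rho Hrho.
set (Y := fun n => match n with O => RtoC 0 | S m => (X m * RtoC (/ rho ^ S m))%C end).
pose proof (grunsky_bounded a d rho (nrm a rho) (nrm a rho + 1) Hu Hrho ltac:(lra) Hbd Hln
  (fun z Hz => nrm_bound a rho Hu Hrho z (Req_le _ _ Hz)) K Y eq_refl) as H.
rewrite csum_first, (csum_0 (S K)), Cplus_0_l in H.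
2:{ intros q _; simpl Y at 1; ring. }
simpl (Re (Y 0%nat)) in H; replace (0 ^ 2) with 0 in H by ring; rewrite Rmult_0_l, Rplus_0_r in H.
rewrite (csum_ext K _ (fun p => csum K (fun q => d (S p) (S q) * (X p * X q))%C)) in H.
2:{ intros p _; rewrite csum_first.
    replace (d (S p) 0%nat * RtoC (rho ^ (S p + 0)) * (Y (S p) * Y 0%nat))%C with (RtoC 0)
      by (simpl Y; ring).
    rewrite Cplus_0_l; apply csum_ext; intros q _; unfold Y.
    replace (d (S p) (S q) * RtoC (rho ^ (S p + S q)) * (X p * RtoC (/ rho ^ S p) * (X q * RtoC (/ rho ^ S q))))%C
      with (d (S p) (S q) * (X p * X q) * (RtoC (rho ^ (S p + S q)) * RtoC (/ rho ^ S p) * RtoC (/ rho ^ S q)))%C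
      by ring.
    rewrite <- !RtoC_mult, pow_add.
    replace (rho ^ S p * rho ^ S q * / rho ^ S p * / rho ^ S q) with 1; [ring|].
    field; split; apply pow_nonzero; lra. }
fold (bil d K X X) in H.
assert (HK : 0 < rho ^ (2 * K)) by (apply pow_lt; lra).
apply Rle_trans with (rsum K (fun n => Cmod (Y (S n)) ^ 2 / INR (S n)) * rho ^ (2 * K)).
{ apply Rmult_le_compat_r; lra. }
rewrite Rmult_comm; unfold wnorm; rewrite <- rsum_scal; apply rsum_le; intros n Hn.
unfold Rdiv; rewrite <- Rmult_assoc; apply Rmult_le_compat_r; [left; apply inv_INR_S_pos|].
unfold Y; rewrite Cmod_mult, Cmod_R, Rpow_mult_distr, pow2_abs, pow_inv.
replace (rho ^ (2 * K)) with ((rho ^ S n) ^ 2 * rho ^ (2 * (K - S n))).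
2:{ rewrite <- pow_mult, <- pow_add; f_equal; lia. }
assert (Hn0 : rho ^ S n <> 0) by (apply pow_nonzero; lra).
replace ((rho ^ S n) ^ 2 * rho ^ (2 * (K - S n)) * (Cmod (X n) ^ 2 * / (rho ^ S n) ^ 2))
  with (Cmod (X n) ^ 2 * rho ^ (2 * (K - S n))) by (field; auto).
rewrite <- (Rmult_1_r (Cmod (X n) ^ 2)) at 2; apply Rmult_le_compat_l; [apply pow2_ge_0|].
rewrite <- (pow1 (2 * (K - S n))); apply pow_incr; lra.
Qed.

Lemma bil_comb d K (u v : C) X Y : (forall p q, d p q = d q p) ->
  bil d K (fun n => u * X n + v * Y n)%C (fun n => u * X n + v * Y n)%C
  = (u * u * bil d K X X + 2 * u * v * bil d K X Y + v * v * bil d K Y Y)%C.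
Proof.
intros Hs.
assert (Hsw : bil d K Y X = bil d K X Y).
{ unfold bil; rewrite csum_swap; apply csum_ext; intros p _; apply csum_ext; intros q _.
  rewrite Hs; ring. }
transitivity (u * u * bil d K X X + u * v * bil d K X Y + u * v * bil d K Y X + v * v * bil d K Y Y)%C;
  [|rewrite Hsw; ring].
unfold bil; rewrite <- !csum_scal, <- !csum_plus; apply csum_ext; intros p _.
rewrite <- !csum_scal, <- !csum_plus; apply csum_ext; intros q _; ring.
Qed.

Lemma wnorm_parallelogram K X Y :
  wnorm K (fun n => 1 * X n + 1 * Y n)%C + wnorm K (fun n => Ci * X n + - Ci * Y n)%C
  = 2 * wnorm K X + 2 * wnorm K Y.
Proof.
unfold wnorm; rewrite <- !rsum_scal, <- !rsum_plus; apply rsum_ext; intros n _.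
unfold Rdiv; rewrite !Cmod_sq_Re_Im.
destruct (X n) as [x1 x2], (Y n) as [y1 y2]; simpl; ring.
Qed.

(** Polarisation with X + Y and i (X - Y): the factor i turns the second quadratic form into its
    negative, so adding the two inequalities leaves four times the real part of the bilinear
    form. *)
Lemma grunsky_bilinear a d K X Y : univ a -> log_expansion a d ->
  2 * Re (bil d K X Y) <= wnorm K X + wnorm K Y.
Proof.
intros Hu Hd.
pose proof (grunsky_quadratic a d K (fun n => 1 * X n + 1 * Y n)%C Hu Hd) as H1.
pose proof (grunsky_quadratic a d K (fun n => Ci * X n + - Ci * Y n)%C Hu Hd) as H2.
rewrite bil_comb in H1 by apply Hd; rewrite bil_comb in H2 by apply Hd.
replace (Ci * Ci * bil d K X X + 2 * Ci * - Ci * bil d K X Y + - Ci * - Ci * bil d K Y Y)%C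
  with (Ci * Ci * (bil d K X X - 2 * bil d K X Y + bil d K Y Y))%C in H2 by ring.
replace (Ci * Ci)%C with (RtoC (-1)) in H2 by (apply C_eq; simpl; ring).
rewrite Re_scal, Re_plus, Re_minus, Re_scal in H2.
replace (1 * 1 * bil d K X X + 2 * 1 * 1 * bil d K X Y + 1 * 1 * bil d K Y Y)%C
  with (bil d K X X + 2 * bil d K X Y + bil d K Y Y)%C in H1 by ring.
rewrite !Re_plus, Re_scal in H1.
pose proof (wnorm_parallelogram K X Y); lra.
Qed.

(** Duality: testing the bilinear inequality with Y p = (p + 1) conj (T p), where T is the image of
    X under the matrix, makes both the bilinear form and the norm of Y equal to the left side S, and
    2 S <= S + [wnorm K X] remains. *)
Lemma grunsky_strong a d K X : univ a -> log_expansion a d ->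
  rsum K (fun p => INR (S p) * Cmod (csum K (fun q => d (S p) (S q) * X q)%C) ^ 2) <= wnorm K X.
Proof.
intros Hu Hd.
set (T := fun p => csum K (fun q => d (S p) (S q) * X q)%C).
set (Y := fun p => (RtoC (INR (S p)) * Cconj (T p))%C).
set (S := rsum K _).
assert (HB : bil d K Y X = RtoC S).
{ unfold bil, S; rewrite RtoC_rsum; apply csum_ext; intros p _.
  rewrite RtoC_mult, Cmod_sq; unfold Y.
  transitivity (RtoC (INR (Datatypes.S p)) * Cconj (T p) * T p)%C; [|fold (T p); ring].
  unfold T at 3; rewrite <- csum_scal; apply csum_ext; intros q _; ring. }
assert (HN : wnorm K Y = S).
{ unfold wnorm, S; apply rsum_ext; intros p _; unfold Y.
  rewrite Cmod_scal, Cmod_conj by apply pos_INR; fold (T p).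
  field; apply not_0_INR; lia. }
pose proof (grunsky_bilinear a d K Y X Hu Hd) as H.
rewrite HB, re_RtoC, HN in H; lra.
Qed.

Lemma is_lim_Cmod (u : nat -> C) l : is_lim_seq (fun n => Cmod (u n - l)%C) 0 ->
  is_lim_seq (fun n => Cmod (u n)) (Cmod l).
Proof.
intros H.
apply (is_lim_seq_le_le (fun n => Cmod l - Cmod (u n - l)%C) _ (fun n => Cmod l + Cmod (u n - l)%C)).
- intros n.
  pose proof (Cmod_triangle (u n - l) l)%C as H1; replace (u n - l + l)%C with (u n) in H1 by ring.
  pose proof (Cmod_triangle (u n) (- (u n - l)))%C as H2; rewrite Cmod_opp in H2.
  replace (u n + - (u n - l))%C with l in H2 by ring; lra.
- replace (Cmod l) with (Cmod l - 0) at 1 by ring; apply is_lim_seq_minus'; auto using is_lim_seq_const.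
- replace (Cmod l) with (Cmod l + 0) at 1 by ring; apply is_lim_seq_plus'; auto using is_lim_seq_const.
Qed.

Lemma log_expansion_row a d p w : log_expansion a d -> Cmod w < 1 ->
  cis (fun q => d (S p) (S q) * w ^ S q)%C (flog (ecoef a w) (S p) - lf a (S p))%C.
Proof.
intros (H0 & Hs & Hbd & Hfl & _) Hw; pose proof (Cmod_ge_0 w).
assert (Hrad : rad1 (d (S p))).
{ intros r Hr; destruct (Hbd r Hr) as [M HM]; exists (M * / r ^ S p); intros n.
  assert (Hp : 0 < r ^ S p) by (apply pow_lt; lra).
  apply Rmult_le_reg_r with (r ^ S p); auto.
  rewrite (Rmult_assoc M), Rinv_l by lra; specialize (HM (S p) n); rewrite pow_add in HM; lra. }
set (r := (1 + Cmod w) / 2).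
assert (Hsm : summ (d (S p)) r) by (apply rad1_summ; auto; unfold r; lra).
destruct (ev_shift (d (S p)) w r Hsm ltac:(unfold r; lra) ltac:(unfold r; lra)) as [A B].
rewrite Hfl by (auto; lia); rewrite B, (Hs (S p) 0%nat), H0.
replace (lf a (S p) + w * ev (fun n => d (S p) (S n)) w - lf a (S p))%C
  with (w * ev (fun n => d (S p) (S n)) w)%C by ring.
apply cis_ext with (fun q => w * (d (S p) (S q) * w ^ q))%C; [intros; rewrite Cpow_S; ring|].
apply cis_scal, ev_cis with r; auto; unfold r; lra.
Qed.

(** [grunsky_strong] at the charge w^(q+1), whose norm is a partial sum of - ln (1 - |w|^2). As K
    grows, the row sums become the Taylor coefficients in z of the logarithm of the quotient, minus
    those for w = 0. *)
Lemma goluzin a d P w : univ a -> log_expansion a d -> Cmod w < 1 ->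
  rsum P (fun p => INR (S p) * Cmod (flog (ecoef a w) (S p) - lf a (S p))%C ^ 2)
  <= - ln (1 - Cmod w ^ 2).
Proof.
intros Hu Hd Hw; pose proof (Cmod_ge_0 w).
assert (Hl : is_lim_seq (fun K => rsum P (fun p => INR (S p) *
    Cmod (csum K (fun q => d (S p) (S q) * w ^ S q)%C) ^ 2))
  (rsum P (fun p => INR (S p) * Cmod (flog (ecoef a w) (S p) - lf a (S p))%C ^ 2))).
{ apply (is_lim_seq_rsum P (fun p K => INR (S p) * Cmod (csum K (fun q => d (S p) (S q) * w ^ S q)%C) ^ 2)).
  intros p _; apply (is_lim_seq_scal_l _ (INR (S p)) (Finite (_ ^ 2))), is_lim_seq_pow.
  apply is_lim_Cmod, cis_lim, log_expansion_row; auto. }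
apply (is_lim_seq_le_loc _ (fun _ => - ln (1 - Cmod w ^ 2)) (Finite _) (- ln (1 - Cmod w ^ 2))) in Hl;
  auto using is_lim_seq_const.
exists P; intros K HK.
apply Rle_trans with (rsum K (fun p => INR (S p) * Cmod (csum K (fun q => d (S p) (S q) * w ^ S q)%C) ^ 2)).
{ apply rsum_incr; auto; intros i; apply Rmult_le_pos; [apply pos_INR|apply pow2_ge_0]. }
eapply Rle_trans; [apply (grunsky_strong a d K (fun q => w ^ S q)%C); auto|].
eapply Rle_trans; [|apply (harmonic_geo_le (Cmod w ^ 2) K); split; [apply pow2_ge_0|]].
- right; apply rsum_ext; intros n _; rewrite Cmod_pow, <- !pow_mult, (Nat.mul_comm 2); unfold Rdiv; ring.
- pose proof (Cmod_sq_lt1 w Hw); lra.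
Qed.

Lemma Cmod_plus_sq x y : Cmod (x + y)%C ^ 2 = Cmod x ^ 2 + Cmod y ^ 2 + 2 * Re (x * Cconj y)%C.
Proof. rewrite !Cmod_sq_Re_Im; destruct x, y; simpl; ring. Qed.

(* Completing the square in Goluzin's inequality with [conj w ^ p / p]: the
   cross term sums to the value of the function at [w] itself. *)
Lemma bazilevich_finite a P w : univ a -> Cmod w < 1 ->
  rsum P (fun p => INR (S p) * Cmod (flog (ecoef a w) (S p) - lf a (S p)
     + RtoC (/ INR (S p)) * Cconj w ^ S p)%C ^ 2)
  <= - 2 * ln (1 - Cmod w ^ 2) + 2 * ln (Cmod (quot a w w)) - 4 * ln (Cmod (ecoef a w 0)).
Proof.
intros Hu Hw; pose proof Hu as (_ & Ha1 & Ha & _); pose proof (Cmod_ge_0 w) as Hw0.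
destruct (log_quot_expansion a Hu) as (d & Hd0 & Hd1 & Hd2 & Hd3 & Hd4).
assert (Hd : log_expansion a d) by (repeat split; auto).
pose proof (ecoef_rad1 a w Ha Hw) as He; pose proof (ecoef_zero_free a w Hu Hw) as Hzf.
pose proof (rad1_shift a 0 Ha) as Hs; pose proof (shift0_zero_free a Hu) as Hsz.
set (T := fun p => (flog (ecoef a w) (S p) - lf a (S p))%C).
set (V := fun p => (T p + RtoC (/ INR (S p)) * Cconj w ^ S p)%C).
set (E := fun P => rsum P (fun p => INR (S p) * Cmod (V p) ^ 2)).
assert (HV : forall P, E P <= - 2 * ln (1 - Cmod w ^ 2) + 2 * rsum P (fun p => Re (T p * w ^ S p)%C)).
{ intros Q; apply Rle_trans with (rsum Q (fun p => INR (S p) * Cmod (T p) ^ 2)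
   + rsum Q (fun p => / INR (S p) * (Cmod w ^ 2) ^ S p) + 2 * rsum Q (fun p => Re (T p * w ^ S p)%C)).
  - right; unfold E; rewrite <- rsum_scal, <- !rsum_plus; apply rsum_ext; intros p _.
    unfold V; rewrite Cmod_plus_sq.
    assert (Hp : INR (S p) <> 0) by (apply not_0_INR; lia).
    pose proof (inv_INR_S_pos p).
    rewrite Cmod_scal, Cmod_pow, Cmod_conj, Rpow_mult_distr by lra.
    replace (T p * Cconj (RtoC (/ INR (S p)) * Cconj w ^ S p))%C
      with (RtoC (/ INR (S p)) * (T p * w ^ S p))%C.
    + rewrite Re_scal, <- !pow_mult, (Nat.mul_comm 2); field; auto.
    + rewrite Cmult_conj, Cpow_conj, Cconj_conj.
      replace (Cconj (RtoC (/ INR (S p)))) with (RtoC (/ INR (S p))) by (apply C_eq; simpl; ring); ring.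
  - pose proof (goluzin a d Q w Hu Hd Hw) as H1.
    pose proof (harmonic_geo_le (Cmod w ^ 2) Q) as H2.
    pose proof (Cmod_sq_lt1 w Hw); pose proof (pow2_ge_0 (Cmod w)).
    specialize (H2 ltac:(lra)); unfold T at 1; lra. }
assert (Hlim : is_lim_seq (fun Q => rsum Q (fun p => Re (T p * w ^ S p)%C))
   (Re (ev (fun n => flog (ecoef a w) n - lf a n)%C w))).
{ assert (Hsum : summ (fun n => flog (ecoef a w) n - lf a n)%C (Cmod w)).
  { apply summ_minus; auto; apply rad1_summ; try lra; apply flog_rad1; auto. }
  destruct (ev_cis _ w _ Hsum (Rle_refl _)) as [A _].
  apply is_series_rsum, is_lim_seq_incr_1 in A.
  eapply is_lim_seq_ext; [|exact A]; intros Q; cbv beta.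
  rewrite rsum_first; unfold lf.
  rewrite (proj1 (flog_is_flog _ (zero_free_0 _ Hzf))), (proj1 (flog_is_flog _ (zero_free_0 _ Hsz))).
  replace ((0 - 0) * w ^ 0)%C with (RtoC 0) by (simpl; ring); simpl (Re 0).
  unfold T; rewrite Rplus_0_l; reflexivity. }
rewrite (ev_minus _ _ _ (Cmod w)) in Hlim; try lra;
  [|apply rad1_summ; [now apply flog_rad1|lra]|apply rad1_summ; [now apply flog_rad1|lra]].
assert (HE0 : 0 < Cmod (ecoef a w 0)) by (apply Cmod_gt_0, Hsz, Hw).
assert (HQ0 : 0 < Cmod (quot a w w)) by now apply Cmod_gt_0, quot_diag.
(* At z = w the quotient is f'(w), and its constant term in z is f(w)/w; this turns the cross term
   into 2 ln |f'(w)| - 4 ln |f(w)/w|. *)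
pose proof (flog_ev (ecoef a w) w He Hzf Hw) as HA; fold (quot a w w) in HA.
pose proof (flog_ev (shift a 0) w Hs Hsz Hw) as HB; fold (ecoef a w 0) in HB; fold (lf a) in HB.
change (shift a 0 0%nat) with (a 1%nat) in HB.
rewrite Ha1, Cmod_1, pow1, ln_1 in HB; rewrite !ln_sq in HA by auto; rewrite ln_sq in HB by auto.
assert (Hfin : is_lim_seq (fun Q => - 2 * ln (1 - Cmod w ^ 2) + 2 * rsum Q (fun p => Re (T p * w ^ S p)%C))
  (- 2 * ln (1 - Cmod w ^ 2) + 2 * Re (ev (flog (ecoef a w)) w - ev (lf a) w)%C)).
{ apply is_lim_seq_plus'; [apply is_lim_seq_const|].
  apply (is_lim_seq_scal_l _ 2 (Finite _)), Hlim. }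
apply (is_lim_seq_le_loc (fun _ => E P) _ (E P) (Finite _)) in Hfin; auto using is_lim_seq_const.
- cbn [Rbar_le] in Hfin; rewrite Re_minus in Hfin; unfold E, V, T in Hfin; lra.
- exists P; intros Q HQ; eapply Rle_trans; [|apply HV].
  apply rsum_incr; auto; intros; apply Rmult_le_pos; [apply pos_INR|apply pow2_ge_0].
Qed.

(** * The square-root transform and distortion *)

(** With e_k = |fexp l k| r^k, the recursion bounds n e_n by [S0] times any bound for the earlier
    terms. Once n >= S0 that bound is inherited. *)
Lemma rad1_fexp l : rad1 l -> l 0%nat = RtoC 0 -> rad1 (fexp l).
Proof.
intros Hl H0 r Hr.
assert (Hs : summ (theta l) r) by (apply rad1_summ; [now apply rad1_theta|lra]).
set (S0 := nrm (theta l) r).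
assert (HS0 : 0 <= S0) by (apply nrm_ge0; auto; lra).
destruct (archimed_cor1 (/ (S0 + 1))) as (N0 & HN0 & HN0').
{ apply Rinv_0_lt_compat; lra. }
assert (HN1 : S0 <= INR N0).
{ apply Rnot_lt_le; intros Hlt.
  assert (/ (S0 + 1) < / INR N0); [|lra].
  apply Rinv_lt_contravar; [|lra]; apply Rmult_lt_0_compat; [now apply lt_0_INR|lra]. }
set (e := fun n => Cmod (fexp l n) * r ^ n).
assert (He0 : forall n, 0 <= e n) by (intros; apply summ_term_ge0; lra).
set (A := rsum (S N0) e).
exists A; intros n; fold (e n).
induction n as [n IH] using lt_wf_ind.
destruct (Nat.lt_ge_cases n (S N0)) as [Hn|Hn]; [now apply rsum_term|].
destruct n as [|n]; [lia|].
assert (HnS : 0 < INR (S n)) by (apply lt_0_INR; lia).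
apply Rmult_le_reg_l with (INR (S n)); auto.
apply Rle_trans with (rsum (S n) (fun k => (Cmod (theta l (S n - k)%nat) * r ^ (S n - k)) * e k)).
- unfold e at 1; rewrite fexp_S.
  pose proof (inv_INR_S_pos n); rewrite Cmod_scal by lra.
  replace (INR (S n) * (/ INR (S n) * Cmod (csum (S n) (fun k => theta l (S n - k)%nat * fexp l k)%C) * r ^ S n))
    with (r ^ S n * Cmod (csum (S n) (fun k => theta l (S n - k)%nat * fexp l k)%C)) by (field; lra).
  eapply Rle_trans; [apply Rmult_le_compat_l; [apply pow_le; lra|apply Cmod_csum]|].
  rewrite <- rsum_scal; right; apply rsum_ext; intros k Hk.
  rewrite Cmod_mult; unfold e; replace (r ^ S n) with (r ^ (S n - k) * r ^ k); [ring|].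
  rewrite <- pow_add; f_equal; lia.
- apply Rle_trans with (rsum (S n) (fun k => A * (Cmod (theta l (S n - k)%nat) * r ^ (S n - k)))).
  + apply rsum_le; intros k Hk; rewrite Rmult_comm; apply Rmult_le_compat_r; auto.
    apply summ_term_ge0; lra.
  + rewrite rsum_scal, Rmult_comm.
    assert (HA : 0 <= A) by (apply rsum_ge0; auto).
    apply Rmult_le_compat_r; auto.
    apply Rle_trans with S0; [|eapply Rle_trans; [exact HN1|apply le_INR; lia]].
    apply Rle_trans with (rsum (S (S n)) (fun k => Cmod (theta l k) * r ^ k));
      [|apply nrm_rsum; auto; lra].
    set (F := fun k => Cmod (theta l k) * r ^ k).
    assert (HF : forall k, 0 <= F k) by (intros; apply summ_term_ge0; lra).
    assert (Hrev : forall m, rsum m (fun k => F (m - k)%nat) <= rsum (S m) F).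
    { induction m as [|m IHm]; [simpl; specialize (HF 0%nat); lra|].
      rewrite rsum_first, Nat.sub_0_r.
      change (rsum (S (S m)) F) with (rsum (S m) F + F (S m)).
      rewrite (rsum_ext m (fun i => F (S m - S i)%nat) (fun i => F (m - i)%nat)) by reflexivity.
      lra. }
    apply Hrev.
Qed.

(** Taylor coefficients of the square root of f(z)/z, as the exponential of half its logarithm. *)
Definition sqrtc (a : nat -> C) : nat -> C := fexp (fun n => RtoC (/ 2) * lf a n)%C.

Lemma lf_0 a : univ a -> lf a 0%nat = RtoC 0.
Proof.
intros Hu; apply flog_is_flog, zero_free_0, shift0_zero_free, Hu.
Qed.

Lemma rad1_lf a : univ a -> rad1 (lf a).
Proof.
intros Hu; apply flog_rad1; [apply rad1_shift, Hu|now apply shift0_zero_free].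
Qed.

Lemma sqrtc_conv a n : univ a -> conv (sqrtc a) (sqrtc a) n = a (S n).
Proof.
intros Hu; pose proof (lf_0 a Hu) as H0.
assert (H : is_flog (fun n => RtoC (/ 2) * lf a n)%C (sqrtc a)).
{ apply fexp_is_flog; rewrite H0; ring. }
change (a (S n)) with (shift a 0 n).
apply (is_flog_eq (lf a)).
- change (RtoC 0 + RtoC 1 * RtoC 1 = a 1%nat)%C; rewrite (proj1 (proj2 Hu)); ring.
- eapply is_flog_ext; [| |apply (is_flog_conv _ _ _ _ H H)].
  + intros k; transitivity (RtoC (/ 2 + / 2) * lf a k)%C; [rewrite RtoC_plus; ring|].
    replace (/ 2 + / 2) with 1 by field; ring.
  + reflexivity.
- apply flog_is_flog, zero_free_0, shift0_zero_free, Hu.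
Qed.

Lemma rad1_sqrtc a : univ a -> rad1 (sqrtc a).
Proof.
intros Hu; apply rad1_fexp; [apply rad1_scal, rad1_lf, Hu|]; rewrite lf_0 by auto; ring.
Qed.

Lemma ev_sqrtc_sq a z : univ a -> Cmod z < 1 -> (ev (sqrtc a) z * ev (sqrtc a) z)%C = ecoef a z 0.
Proof.
intros Hu Hz; pose proof (Cmod_ge_0 z).
rewrite <- (ev_conv _ _ _ (Cmod z)); try lra; try (apply rad1_summ; [now apply rad1_sqrtc|lra]).
apply ev_ext; intros n; now apply sqrtc_conv.
Qed.

(* Taylor coefficients of the odd univalent function [sqrt (f (z ^ 2))]. *)
Definition odd_sqrt (a : nat -> C) (n : nat) : C :=
  if Nat.odd n then sqrtc a (Nat.div2 n) else RtoC 0.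

Lemma odd_sqrt_even a k : odd_sqrt a (2 * k) = RtoC 0.
Proof.
unfold odd_sqrt; replace (Nat.odd (2 * k)) with false; auto.
symmetry; rewrite Nat.odd_mul; reflexivity.
Qed.

Lemma odd_sqrt_odd a k : odd_sqrt a (S (2 * k)) = sqrtc a k.
Proof.
unfold odd_sqrt; rewrite Nat.odd_succ, Nat.even_mul; simpl (Nat.even 2 || _)%bool.
rewrite Nat.div2_succ_double; reflexivity.
Qed.

Lemma rad1_odd_sqrt a : univ a -> rad1 (odd_sqrt a).
Proof.
intros Hu r Hr.
destruct (rad1_sqrtc a Hu (r ^ 2)) as [M HM]; [nra|].
assert (HM0 : 0 <= M).
{ eapply Rle_trans; [|apply (HM 0%nat)]; apply summ_term_ge0; nra. }
exists M; intros n; destruct (Nat.Even_or_Odd n) as [[k ->]|[k ->]].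
- rewrite odd_sqrt_even, Cmod_0; lra.
- rewrite Nat.add_1_r, odd_sqrt_odd.
  eapply Rle_trans; [|apply (HM k)].
  apply Rmult_le_compat_l; [apply Cmod_ge_0|]; rewrite <- pow_mult; simpl.
  assert (0 <= r ^ (k + (k + 0))) by (apply pow_le; lra); nra.
Qed.

Lemma ev_odd_sqrt a z : univ a -> Cmod z < 1 -> ev (odd_sqrt a) z = (z * ev (sqrtc a) (z * z))%C.
Proof.
intros Hu Hz; pose proof (Cmod_ge_0 z) as Hz0.
assert (Hzz : Cmod (z * z)%C < 1) by (rewrite Cmod_mult; nra).
assert (HA : cis (fun n => odd_sqrt a n * z ^ n)%C (ev (odd_sqrt a) z)).
{ apply ev_cis with (Cmod z); [apply rad1_summ; [now apply rad1_odd_sqrt|lra]|lra]. }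
assert (HB : cis (fun n => z * (sqrtc a n * (z * z) ^ n))%C (z * ev (sqrtc a) (z * z))%C).
{ apply cis_scal, ev_cis with (Cmod (z * z)%C); [|lra].
  apply rad1_summ; [now apply rad1_sqrtc|split; [apply Cmod_ge_0|auto]]. }
assert (HE : forall m, csum (2 * m) (fun n => odd_sqrt a n * z ^ n)%C
   = csum m (fun n => z * (sqrtc a n * (z * z) ^ n))%C).
{ induction m as [|m IH]; [reflexivity|].
  replace (2 * S m)%nat with (S (S (2 * m))) by lia.
  change (csum (S (S (2 * m))) (fun n => odd_sqrt a n * z ^ n)%C)
    with (csum (2 * m) (fun n => odd_sqrt a n * z ^ n) + odd_sqrt a (2 * m) * z ^ (2 * m)
          + odd_sqrt a (S (2 * m)) * z ^ S (2 * m))%C.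
  rewrite IH, odd_sqrt_even, odd_sqrt_odd, Cpow_S, Cpow_mult_r.
  cbn [csum]; replace (z ^ 2)%C with (z * z)%C by (simpl; ring); ring. }
apply C_eq_eps; intros e He.
destruct (cis_eps _ _ (e / 2) HA) as [N1 HN1]; [lra|].
destruct (cis_eps _ _ (e / 2) HB) as [N2 HN2]; [lra|].
set (m := (N1 + N2)%nat).
specialize (HN1 (2 * m)%nat ltac:(unfold m; lia)); specialize (HN2 m ltac:(unfold m; lia)).
rewrite HE in HN1.
set (X := csum m _) in *.
replace (ev (odd_sqrt a) z - z * ev (sqrtc a) (z * z))%C
  with (- (X - ev (odd_sqrt a) z) + (X - z * ev (sqrtc a) (z * z)))%C by ring.
eapply Rle_trans; [apply Cmod_triangle|]; rewrite Cmod_opp; lra.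
Qed.

Lemma ev_ecoef0 a z : univ a -> Cmod z < 1 -> ev a z = (z * ecoef a z 0)%C.
Proof. intros (H0 & _ & Ha & _) Hz; rewrite ecoef_0, H0 by auto; ring. Qed.

Lemma ev_odd_sqrt_sq a z : univ a -> Cmod z < 1 ->
  (ev (odd_sqrt a) z * ev (odd_sqrt a) z)%C = ev a (z * z)%C.
Proof.
intros Hu Hz; pose proof (Cmod_ge_0 z).
assert (Hzz : Cmod (z * z)%C < 1) by (rewrite Cmod_mult; nra).
rewrite ev_odd_sqrt, (ev_ecoef0 a (z * z)%C), <- ev_sqrtc_sq by auto; ring.
Qed.

Lemma ev_odd_sqrt_opp a z : univ a -> Cmod z < 1 -> ev (odd_sqrt a) (- z)%C = (- ev (odd_sqrt a) z)%C.
Proof.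
intros Hu Hz; rewrite !ev_odd_sqrt by (auto; now rewrite Cmod_opp).
replace (- z * - z)%C with (z * z)%C by ring; ring.
Qed.

Lemma Csq_eq (z w : C) : (z * z)%C = (w * w)%C -> z = w \/ z = (- w)%C.
Proof.
intros H; destruct (excluded_middle_informative (z = w)) as [|Hne]; [auto|right].
assert (E : (z + w)%C = RtoC 0).
{ apply (Cmult_cancel (z - w)%C); [intros E; apply Hne, Cminus_eq_0, E|].
  replace ((z - w) * (z + w))%C with (z * z - w * w)%C by ring; rewrite H; ring. }
replace z with ((z + w) - w)%C by ring; rewrite E; ring.
Qed.

Lemma odd_sqrt_univ a : univ a -> univ (odd_sqrt a).
Proof.
intros Hu; pose proof Hu as (Ha0 & _ & Ha & Hinj).
split; [reflexivity|split; [reflexivity|split; [now apply rad1_odd_sqrt|]]].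
intros z w Hz Hw E; pose proof (Cmod_ge_0 z); pose proof (Cmod_ge_0 w).
assert (Hzz : Cmod (z * z)%C < 1) by (rewrite Cmod_mult; nra).
assert (Hww : Cmod (w * w)%C < 1) by (rewrite Cmod_mult; nra).
assert (E2 : (z * z)%C = (w * w)%C).
{ apply Hinj; auto; rewrite <- !ev_odd_sqrt_sq, E by auto; reflexivity. }
destruct (Csq_eq z w E2) as [|Hopp]; auto.
assert (Hz0 : ev (odd_sqrt a) w = RtoC 0).
{ rewrite Hopp, ev_odd_sqrt_opp in E by auto.
  assert (E4 : (RtoC 2 * ev (odd_sqrt a) w)%C = RtoC 0).
  { replace (RtoC 2 * ev (odd_sqrt a) w)%C with (ev (odd_sqrt a) w - - ev (odd_sqrt a) w)%C by ring.
    rewrite E; ring. }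
  apply (Cmult_cancel (RtoC 2)); [intros K; apply RtoC_inj in K; lra|].
  rewrite E4; ring. }
assert (E3 : (w * w)%C = RtoC 0).
{ apply Hinj; auto; [rewrite Cmod_0; lra|].
  rewrite <- ev_odd_sqrt_sq, Hz0, ev_0, Ha0 by auto; ring. }
assert (w = RtoC 0).
{ apply Cmod_eq_0; apply (f_equal Cmod) in E3; rewrite Cmod_mult, Cmod_0 in E3; nra. }
rewrite Hopp, H1; ring.
Qed.

(** Continuity at w in quantitative form. It carries identities between difference quotients, proved
    off the diagonal by cancelling z - w, over to derivatives. *)
Lemma lip_eq (F G : C -> C) w r L : Cmod w < r ->
  (forall z, Cmod z <= r -> Cmod (F z - F w)%C <= L * Cmod (z - w)%C) ->
  (forall z, Cmod z <= r -> Cmod (G z - G w)%C <= L * Cmod (z - w)%C) ->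
  (forall z, Cmod z <= r -> z <> w -> F z = G z) -> F w = G w.
Proof.
intros Hw HF HG HE; apply C_eq_eps; intros e He.
set (h := Rmin (r - Cmod w) (e / (2 * (Rabs L + 1)))).
pose proof (Rabs_pos L) as HL; pose proof (Rle_abs L) as HL'.
assert (Hh : 0 < h).
{ apply Rmin_glb_lt; [lra|apply Rdiv_lt_0_compat; lra]. }
set (z := (w + RtoC h)%C).
assert (Hzw : (z - w)%C = RtoC h) by (unfold z; ring).
assert (Hz : Cmod z <= r).
{ unfold z; eapply Rle_trans; [apply Cmod_triangle|]; rewrite Cmod_R, Rabs_pos_eq by lra.
  pose proof (Rmin_l (r - Cmod w) (e / (2 * (Rabs L + 1)))); fold h in H; lra. }
assert (Hne : z <> w).
{ intros E; rewrite E in Hzw; assert (E0 : RtoC h = RtoC 0) by (rewrite <- Hzw; ring).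
  apply RtoC_inj in E0; lra. }
specialize (HF z Hz); specialize (HG z Hz); rewrite Hzw, Cmod_R, Rabs_pos_eq in HF, HG by lra.
rewrite (HE z Hz Hne) in HF.
replace (F w - G w)%C with (- (G z - F w) + (G z - G w))%C by ring.
eapply Rle_trans; [apply Cmod_triangle|]; rewrite Cmod_opp.
assert (Hhe : (Rabs L + 1) * h <= e / 2).
{ apply Rle_trans with ((Rabs L + 1) * (e / (2 * (Rabs L + 1)))); [|right; field; lra].
  apply Rmult_le_compat_l; [lra|apply Rmin_r]. }
assert (L * h <= Rabs L * h) by (apply Rmult_le_compat_r; lra); lra.
Qed.

Lemma quot_lip_fst a w : univ a -> Cmod w < 1 -> exists r L, Cmod w < r /\ r < 1 /\ 0 <= L /\
  (forall z z', Cmod z <= r -> Cmod z' <= r -> Cmod (quot a z w - quot a z' w)%C <= L * Cmod (z - z')%C) /\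
  (forall z z' w', Cmod z <= r -> Cmod z' <= r -> Cmod w' <= r ->
     Cmod (quot a z w' - quot a z' w')%C <= L * Cmod (z - z')%C).
Proof.
intros (_ & _ & Ha & _) Hw; pose proof (Cmod_ge_0 w).
destruct (quot_lip a ((1 + Cmod w) / 2) Ha ltac:(lra)) as (L & HL & Hlip).
assert (H2 : forall z z' w', Cmod z <= (1 + Cmod w) / 2 -> Cmod z' <= (1 + Cmod w) / 2 ->
  Cmod w' <= (1 + Cmod w) / 2 -> Cmod (quot a z w' - quot a z' w')%C <= L * Cmod (z - z')%C).
{ intros z z' w' Hz Hz' Hw'; specialize (Hlip z z' w' w' Hz Hz' Hw' Hw').
  replace (w' - w')%C with (RtoC 0) in Hlip by ring; rewrite Cmod_0, Rplus_0_r in Hlip; auto. }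
exists ((1 + Cmod w) / 2), L; repeat split; auto; try lra.
intros; apply H2; auto; lra.
Qed.

Lemma quot_odd a w : univ a -> Cmod w < 1 ->
  quot (odd_sqrt a) (- w) (- w) = quot (odd_sqrt a) w w.
Proof.
intros Hu Hw; pose proof (odd_sqrt_univ a Hu) as Hh; pose proof Hh as (_ & _ & Hhr & _).
destruct (quot_lip_fst _ w Hh Hw) as (r & L & H1 & H2 & HL & _ & Hlip).
apply (lip_eq (fun z => quot (odd_sqrt a) (- z) (- w))%C (fun z => quot (odd_sqrt a) z w) w r L); auto.
- intros z Hz; eapply Rle_trans; [apply Hlip; rewrite Cmod_opp; lra|].
  replace (- z - - w)%C with (- (z - w))%C by ring; rewrite Cmod_opp; lra.
- intros z Hz; apply Hlip; lra.
- intros z Hz Hne; apply (Cmult_cancel (z - w)%C); [intros E; apply Hne, Cminus_eq_0, E|].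
  rewrite quot_eq by (auto; lra).
  replace ((z - w) * quot (odd_sqrt a) (- z) (- w))%C
    with (- ((- z - - w) * quot (odd_sqrt a) (- z) (- w)))%C by ring.
  rewrite quot_eq by (auto; rewrite Cmod_opp; lra).
  rewrite !ev_odd_sqrt_opp by (auto; lra); ring.
Qed.

(** Differentiating f(w^2) = h(w)^2 for the odd function h gives 2 w f'(w^2) = 2 h(w) h'(w), and
    h(w) is w times the value of [sqrtc a] at w^2. Cancelling 2 w needs w nonzero. *)
Lemma quot_sqrt a w : univ a -> Cmod w < 1 -> w <> RtoC 0 ->
  quot a (w * w) (w * w) = (quot (odd_sqrt a) w w * ev (sqrtc a) (w * w))%C.
Proof.
intros Hu Hw Hw0; pose proof (odd_sqrt_univ a Hu) as Hh; pose proof Hh as (_ & _ & Hhr & _).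
pose proof Hu as (_ & _ & Ha & _); pose proof (Cmod_ge_0 w).
destruct (quot_lip_fst _ w Hh Hw) as (r & L & H1 & H2 & HL & Hlip & _).
assert (Hr : 0 < r < 1) by lra.
destruct (ev_lip_rad1 _ r Hhr Hr) as (L1 & HL1 & Hlip1).
destruct (quot_lip a r Ha Hr) as (L2 & HL2 & Hlip2).
destruct (ev_lip_rad1 _ r Ha Hr) as (L3 & _ & _).
assert (Hsq : forall z, Cmod z <= r -> Cmod (z * z)%C <= r).
{ intros z Hz; rewrite Cmod_mult; pose proof (Cmod_ge_0 z); nra. }
set (B1 := nrm (odd_sqrt a) r); set (B2 := Cmod (quot (odd_sqrt a) w w)).
assert (HB1 : 0 <= B1) by (apply nrm_ge0; [lra|apply rad1_summ; auto; lra]).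
assert (HB2 : 0 <= B2) by apply Cmod_ge_0.
set (Q := ev (odd_sqrt a)).
assert (HQ : forall z, Cmod z <= r -> Cmod (Q z) <= B1).
{ intros z Hz; apply ev_le_nrm; auto; apply rad1_summ; auto; lra. }
assert (HqB : forall z, Cmod z <= r -> Cmod (quot (odd_sqrt a) z w) <= B2 + 2 * L).
{ intros z Hz; pose proof (Hlip z w Hz ltac:(lra)) as H3.
  pose proof (Cmod_triangle (quot (odd_sqrt a) z w - quot (odd_sqrt a) w w) (quot (odd_sqrt a) w w))%C as H4.
  replace (quot (odd_sqrt a) z w - quot (odd_sqrt a) w w + quot (odd_sqrt a) w w)%C
    with (quot (odd_sqrt a) z w) in H4 by ring; fold B2 in H4.
  assert (Cmod (z - w)%C <= 2).
  { eapply Rle_trans; [apply Cmod_triangle|]; rewrite Cmod_opp; lra. }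
  assert (L * Cmod (z - w)%C <= L * 2) by (apply Rmult_le_compat_l; auto); lra. }
set (qb := quot a (w * w) (w * w)).
(* The sum of Lipschitz constants for the two sides, so that [lip_eq] applies with a single
   constant. *)
set (LL := (L * (2 * B1) + (B2 + 2 * L) * L1) + (2 * L2 * 2 + Cmod qb)).
assert (Hqb : 0 <= Cmod qb) by apply Cmod_ge_0.
assert (E : ((w + w) * quot a (w * w) (w * w))%C = (quot (odd_sqrt a) w w * (Q w + Q w))%C).
{ apply (lip_eq (fun z => (z + w) * quot a (z * z) (w * w))%C
           (fun z => quot (odd_sqrt a) z w * (Q z + Q w))%C w r LL); auto.
  - intros z Hz.
    replace ((z + w) * quot a (z * z) (w * w) - (w + w) * quot a (w * w) (w * w))%C
      with ((z + w) * (quot a (z * z) (w * w) - qb) + (z - w) * qb)%C by (unfold qb; ring).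
    eapply Rle_trans; [apply Cmod_triangle|]; rewrite !Cmod_mult.
    pose proof (Hlip2 (z * z)%C (w * w)%C (w * w)%C (w * w)%C (Hsq z Hz) (Hsq w ltac:(lra))
      (Hsq w ltac:(lra)) (Hsq w ltac:(lra))) as H3; fold qb in H3.
    replace (w * w - w * w)%C with (RtoC 0) in H3 by ring; rewrite Cmod_0, Rplus_0_r in H3.
    replace (z * z - w * w)%C with ((z + w) * (z - w))%C in H3 by ring; rewrite Cmod_mult in H3.
    pose proof (Cmod_ge_0 (z - w)%C) as H5; pose proof (Cmod_ge_0 (z + w)%C) as H6.
    assert (H4 : Cmod (z + w)%C <= 2) by (eapply Rle_trans; [apply Cmod_triangle|]; lra).
    assert (Cmod (z + w)%C * Cmod (quot a (z * z) (w * w) - qb)%C <= 2 * (L2 * (2 * Cmod (z - w)%C))).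
    { apply Rmult_le_compat; auto using Cmod_ge_0; eapply Rle_trans; [exact H3|].
      apply Rmult_le_compat_l; auto; apply Rmult_le_compat_r; auto. }
    unfold LL.
    assert (0 <= (L * (2 * B1) + (B2 + 2 * L) * L1) * Cmod (z - w)%C).
    { apply Rmult_le_pos; auto; apply Rplus_le_le_0_compat; apply Rmult_le_pos; lra. }
    lra.
  - intros z Hz.
    replace (quot (odd_sqrt a) z w * (Q z + Q w) - quot (odd_sqrt a) w w * (Q w + Q w))%C
      with ((quot (odd_sqrt a) z w - quot (odd_sqrt a) w w) * (Q w + Q w)
            + quot (odd_sqrt a) z w * (Q z - Q w))%C by ring.
    eapply Rle_trans; [apply Cmod_triangle|]; rewrite !Cmod_mult.
    pose proof (Hlip z w Hz ltac:(lra)) as H3; pose proof (Hlip1 z w Hz ltac:(lra)) as H4.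
    pose proof (Cmod_ge_0 (z - w)%C) as H5.
    assert (Cmod (quot (odd_sqrt a) z w - quot (odd_sqrt a) w w)%C * Cmod (Q w + Q w)%C
      <= (L * Cmod (z - w)%C) * (2 * B1)).
    { apply Rmult_le_compat; auto using Cmod_ge_0.
      eapply Rle_trans; [apply Cmod_triangle|]; pose proof (HQ w ltac:(lra)); lra. }
    assert (Cmod (quot (odd_sqrt a) z w) * Cmod (Q z - Q w)%C <= (B2 + 2 * L) * (L1 * Cmod (z - w)%C)).
    { apply Rmult_le_compat; auto using Cmod_ge_0. }
    unfold LL.
    assert (0 <= (2 * L2 * 2 + Cmod qb) * Cmod (z - w)%C) by (apply Rmult_le_pos; lra).
    lra.
  - intros z Hz Hne; apply (Cmult_cancel (z - w)%C); [intros E; apply Hne, Cminus_eq_0, E|].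
    replace ((z - w) * ((z + w) * quot a (z * z) (w * w)))%C
      with ((z * z - w * w) * quot a (z * z) (w * w))%C by ring.
    assert (Hzz := Hsq z Hz); assert (Hww := Hsq w ltac:(lra)).
    rewrite quot_eq by (auto; lra).
    replace ((z - w) * (quot (odd_sqrt a) z w * (Q z + Q w)))%C
      with (((z - w) * quot (odd_sqrt a) z w) * (Q z + Q w))%C by ring.
    rewrite quot_eq by (auto; lra).
    rewrite <- !ev_odd_sqrt_sq by (auto; lra); unfold Q; ring. }
assert (H2w : (RtoC 2 * w)%C <> RtoC 0).
{ intros K; apply Hw0; apply (Cmult_cancel (RtoC 2)); [intros K'; apply RtoC_inj in K'; lra|].
  rewrite K; ring. }
apply (Cmult_cancel (RtoC 2 * w)%C); auto; unfold qb.
replace (RtoC 2 * w * quot a (w * w) (w * w))%C with ((w + w) * quot a (w * w) (w * w))%C by ring.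
rewrite E; unfold Q; rewrite ev_odd_sqrt by auto; ring.
Qed.

Lemma Csqrt_exists (W : C) : exists w, (w * w)%C = W.
Proof.
set (R0 := Cmod W); pose proof (Cmod_ge_0 W) as HR; fold R0 in HR.
pose proof (re_le_Cmod W) as Hre; fold R0 in Hre; apply Rabs_le_between in Hre.
set (x := sqrt ((R0 + Re W) / 2)); set (y := sqrt ((R0 - Re W) / 2)).
assert (Hx : x * x = (R0 + Re W) / 2) by (apply sqrt_sqrt; lra).
assert (Hy : y * y = (R0 - Re W) / 2) by (apply sqrt_sqrt; lra).
assert (Hx0 : 0 <= x) by apply sqrt_pos. assert (Hy0 : 0 <= y) by apply sqrt_pos.
assert (Hxy : (2 * x * y) ^ 2 = Im W ^ 2).
{ pose proof (Cmod_sq_Re_Im W) as HW; fold R0 in HW.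
  replace ((2 * x * y) ^ 2) with (4 * (x * x) * (y * y)) by ring; rewrite Hx, Hy; nra. }
destruct (Rle_dec 0 (Im W)) as [Hi|Hi].
- exists (x, y); apply C_eq; simpl; [lra|].
  assert (2 * x * y = Im W).
  { apply Rsqr_inj; auto; [apply Rmult_le_pos; lra|]; rewrite !Rsqr_pow2; auto. }
  unfold Im in *; lra.
- exists (x, - y); apply C_eq; simpl; [lra|].
  assert (2 * x * y = - Im W).
  { apply Rsqr_inj; [apply Rmult_le_pos; lra|lra|]; rewrite !Rsqr_pow2, Hxy; ring. }
  unfold Im in *; lra.
Qed.

(** * Distortion from the odd part of the Grunsky form *)

Lemma odd_part_dpart d T w :
  csum T (fun p => csum T (fun q => d p q *
    ((if Nat.odd p then w ^ p else 0) * (if Nat.odd q then w ^ q else 0))))%C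
  = (RtoC (/ 4) * ((dpart d T w w - dpart d T (- w) w) - (dpart d T w (- w) - dpart d T (- w) (- w))))%C.
Proof.
assert (Ho : forall p, (if Nat.odd p then w ^ p else 0)%C = (RtoC (/ 2) * (w ^ p - (- w) ^ p))%C).
{ assert (Hp : forall p, ((- w) ^ p)%C = if Nat.odd p then (- w ^ p)%C else (w ^ p)%C).
  { induction p as [|p IH]; [simpl; ring|].
    rewrite !Cpow_S, IH, Nat.odd_succ, <- Nat.negb_odd; destruct (Nat.odd p); simpl; ring. }
  intros p; rewrite Hp; destruct (Nat.odd p); [|ring].
  transitivity (RtoC (/ 2 + / 2) * w ^ p)%C; [|rewrite RtoC_plus; ring].
  replace (/ 2 + / 2) with 1 by field; ring. }
unfold dpart; rewrite <- !csum_minus, <- csum_scal; apply csum_ext; intros p _.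
rewrite <- !csum_minus, <- csum_scal; apply csum_ext; intros q _.
rewrite !Ho; replace (RtoC (/ 4)) with (RtoC (/ 2) * RtoC (/ 2))%C
  by (rewrite <- RtoC_mult; f_equal; field); ring.
Qed.

Lemma odd_harmonic_lim t : 0 <= t < 1 ->
  is_lim_seq (fun M => rsum M (fun n => (if Nat.odd (S n) then t ^ S n else 0) / INR (S n)))
    (/ 2 * ln ((1 + t) / (1 - t))).
Proof.
intros Ht.
assert (H1 := ln_one_minus_lim (RtoC t) ltac:(rewrite Cmod_R, Rabs_pos_eq; lra)).
assert (H2 := ln_one_minus_lim (RtoC (- t)) ltac:(rewrite Cmod_R, Rabs_Ropp, Rabs_pos_eq; lra)).
rewrite <- RtoC_minus, Cmod_R, pow2_abs, ln_sq in H1 by lra.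
rewrite <- RtoC_minus, Cmod_R, pow2_abs, ln_sq in H2 by lra.
replace (/ 2 * ln ((1 + t) / (1 - t))) with (/ 4 * (2 * ln (1 - - t) - 2 * ln (1 - t))).
2:{ rewrite ln_div by lra; replace (1 - - t) with (1 + t) by ring; field. }
eapply is_lim_seq_ext; [|exact (is_lim_seq_scal_l _ (/ 4) (Finite _) (is_lim_seq_minus' _ _ _ _ H2 H1))].
intros M; cbv beta; rewrite <- !rsum_scal, <- rsum_minus, <- rsum_scal; apply rsum_ext; intros n _.
rewrite <- !RtoC_pow, !re_RtoC.
assert (Hp : forall p, (- t) ^ p = if Nat.odd p then - t ^ p else t ^ p).
{ induction p as [|p IH]; [simpl; ring|].
  rewrite <- !tech_pow_Rmult, IH, Nat.odd_succ, <- Nat.negb_odd; destruct (Nat.odd p); simpl; ring. }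
rewrite Hp; unfold Rdiv; destruct (Nat.odd (S n)); field; apply not_0_INR; lia.
Qed.

(** [grunsky_quadratic] at the charge w^n restricted to odd n. The alternating sum over the four
    choices of signs is four times the part of the double series with both indices odd, and the
    norms tend to half of ln ((1 + t)/(1 - t)) with t = |w|^2. *)
Lemma grunsky_odd h w : univ h -> Cmod w < 1 ->
  ln (Cmod (quot h w w)) - ln (Cmod (quot h (- w) w))
    - (ln (Cmod (quot h w (- w))) - ln (Cmod (quot h (- w) (- w))))
  <= 2 * ln ((1 + Cmod w ^ 2) / (1 - Cmod w ^ 2)).
Proof.
intros Hh Hw; pose proof (Cmod_ge_0 w) as Hw0.
assert (Hmw : Cmod (- w)%C < 1) by now rewrite Cmod_opp.
destruct (log_quot_expansion h Hh) as (d & Hd0 & Hd1 & Hd2 & Hd3 & Hd4).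
assert (Hd : log_expansion h d) by (repeat split; auto).
assert (Hln : forall u v, Cmod u < 1 -> Cmod v < 1 -> ln (Cmod (quot h u v)) = Re (dsum d u v)).
{ intros u v Hu Hv; specialize (Hd4 u v Hu Hv).
  rewrite ln_sq in Hd4; [lra|].
  apply Cmod_gt_0; apply (ecoef_zero_free h v Hh Hv u Hu). }
rewrite !Hln by auto; rewrite <- !Re_minus.
set (r := (1 + Cmod w) / 2); set (s := (1 + r) / 2).
destruct (Hd2 s) as [M HM]; [unfold s, r; lra|].
assert (Hrs : 0 <= Cmod w < s) by (unfold s, r; lra).
pose proof (ratio_lt1 (Cmod w) s Hrs) as Hx; set (x := Cmod w / s) in *.
set (Z := (dsum d w w - dsum d (- w) w - (dsum d w (- w) - dsum d (- w) (- w)))%C).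
set (ZT := fun T => (dpart d T w w - dpart d T (- w) w - (dpart d T w (- w) - dpart d T (- w) (- w)))%C).
assert (HZT : forall T, Cmod (ZT T - Z)%C <= 4 * (2 * M / (1 - x) ^ 2) * x ^ T).
{ intros T.
  assert (Hone : forall u v, Cmod u = Cmod w -> Cmod v = Cmod w ->
     Cmod (dpart d T u v - dsum d u v)%C <= 2 * M / (1 - x) ^ 2 * x ^ T).
  { intros u v Hu Hv; replace (dpart d T u v - dsum d u v)%C with (- (dsum d u v - dpart d T u v))%C by ring.
    rewrite Cmod_opp; eapply Rle_trans; [apply (dsum_trunc d (Cmod w) s M u v T Hrs HM); lra|].
    fold x; right; unfold Rdiv; ring. }
  pose proof (Hone w w eq_refl eq_refl) as A1.
  pose proof (Hone (- w)%C w (Cmod_opp w) eq_refl) as A2.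
  pose proof (Hone w (- w)%C eq_refl (Cmod_opp w)) as A3.
  pose proof (Hone (- w)%C (- w)%C (Cmod_opp w) (Cmod_opp w)) as A4.
  replace (ZT T - Z)%C with ((dpart d T w w - dsum d w w) + - (dpart d T (- w) w - dsum d (- w) w)
    + - (dpart d T w (- w) - dsum d w (- w)) + (dpart d T (- w) (- w) - dsum d (- w) (- w)))%C
    by (unfold ZT, Z; ring).
  eapply Rle_trans; [apply Cmod_triangle|].
  eapply Rle_trans; [apply Rplus_le_compat_r, Cmod_triangle|].
  eapply Rle_trans; [apply Rplus_le_compat_r, Rplus_le_compat_r, Cmod_triangle|].
  rewrite !Cmod_opp; lra. }
assert (HRe : is_lim_seq (fun T => Re (ZT (S T))) (Re Z)).
{ apply (is_lim_seq_incr_1 (fun T => Re (ZT T))).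
  apply (is_lim_seq_le_le (fun T => Re Z - 4 * (2 * M / (1 - x) ^ 2) * x ^ T) _
     (fun T => Re Z + 4 * (2 * M / (1 - x) ^ 2) * x ^ T)).
  - intros T; specialize (HZT T); pose proof (re_le_Cmod (ZT T - Z)%C) as H.
    rewrite Re_minus in H; assert (H' : Rabs (Re (ZT T) - Re Z) <= 4 * (2 * M / (1 - x) ^ 2) * x ^ T) by lra.
    apply Rabs_le_between in H'; lra.
  - replace (Re Z) with (Re Z - 0) at 1 by ring; apply is_lim_seq_minus';
      [apply is_lim_seq_const|now apply is_lim_geo_err].
  - replace (Re Z) with (Re Z + 0) at 1 by ring; apply is_lim_seq_plus';
      [apply is_lim_seq_const|now apply is_lim_geo_err]. }
assert (Ht : 0 <= Cmod w ^ 2 < 1) by (split; [apply pow2_ge_0|pose proof (Cmod_sq_lt1 w Hw); lra]).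
pose proof (odd_harmonic_lim (Cmod w ^ 2) Ht) as Hharm.
apply (is_lim_seq_scal_l _ 4) in Hharm; cbn [Rbar_mult] in Hharm.
assert (HK : forall K, Re (ZT (S K)) <=
  4 * rsum K (fun n => (if Nat.odd (S n) then (Cmod w ^ 2) ^ S n else 0) / INR (S n))).
{ intros K; set (X := fun n => if Nat.odd (S n) then (w ^ S n)%C else RtoC 0).
pose proof (grunsky_quadratic h d K X Hh Hd) as H.
assert (HB : (RtoC (/ 4) * ZT (S K))%C = bil d K X X).
{ unfold ZT; rewrite <- odd_part_dpart, csum_first.
  rewrite csum_0, Cplus_0_l.
  2:{ intros q _; change (Nat.odd 0) with false; cbv iota; ring. }
  unfold bil; apply csum_ext; intros p _; rewrite csum_first.
  change (Nat.odd 0) with false; cbv iota; rewrite Cmult_0_r, Cmult_0_r, Cplus_0_l; reflexivity. }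
rewrite <- HB, Re_scal in H.
apply Rle_trans with (4 * wnorm K X); [lra|].
apply Rmult_le_compat_l; [lra|]; right; apply rsum_ext; intros n _; unfold X.
destruct (Nat.odd (S n)).
- rewrite Cmod_pow, <- !pow_mult, (Nat.mul_comm 2); reflexivity.
- rewrite Cmod_0; unfold Rdiv; ring. }
pose proof (is_lim_seq_le _ _ (Finite _) (Finite _) HK HRe Hharm) as Hle.
cbn [Rbar_le] in Hle; lra.
Qed.

(** With W = w^2 and h the odd square-root transform, f'(W) = h'(w) c and f(W)/W = c^2, where c =
    h(w)/w. The mixed quotients of h at w and - w equal c because h is odd, so [grunsky_odd] bounds
    |h'(w)/c|, which is |W f'(W)/f(W)|. *)
Lemma distortion a W : univ a -> Cmod W < 1 ->
  Cmod (quot a W W) <= (1 + Cmod W) / (1 - Cmod W) * Cmod (ecoef a W 0).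
Proof.
intros Hu HW; pose proof Hu as (_ & Ha1 & _ & _); pose proof (Cmod_ge_0 W) as HW0.
destruct (excluded_middle_informative (W = RtoC 0)) as [->|HWne].
{ unfold quot; rewrite ev_0, Cmod_0; unfold Rdiv; rewrite Rplus_0_r, Rminus_0_r, Rinv_1; lra. }
destruct (Csqrt_exists W) as [w Hw].
assert (Hw1 : Cmod w < 1).
{ rewrite <- Hw, Cmod_mult in HW; pose proof (Cmod_ge_0 w); nra. }
assert (Hw0 : w <> RtoC 0) by (intros E; apply HWne; rewrite <- Hw, E; ring).
assert (Hmw : Cmod (- w)%C < 1) by now rewrite Cmod_opp.
pose proof (odd_sqrt_univ a Hu) as Hh; pose proof Hh as (_ & _ & Hhr & _).
set (h := odd_sqrt a) in *.
set (c := ev (sqrtc a) W).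
assert (Hq : quot h (- w) w = c).
{ apply (Cmult_cancel (RtoC 2 * w)%C).
  - intros K; apply Hw0; apply (Cmult_cancel (RtoC 2)); [intros K'; apply RtoC_inj in K'; lra|].
    rewrite K; ring.
  - replace (RtoC 2 * w * quot h (- w) w)%C with (- ((- w - w) * quot h (- w) w))%C by ring.
    rewrite quot_eq by auto; unfold h; rewrite ev_odd_sqrt_opp, ev_odd_sqrt, Hw by auto.
    unfold c; ring. }
assert (Hq' : quot h w (- w) = c) by (rewrite quot_sym; auto).
assert (Hc2 : (c * c)%C = ecoef a W 0) by now apply ev_sqrtc_sq.
assert (Hc0 : 0 < Cmod c).
{ rewrite <- Hq; apply Cmod_gt_0, quot_offdiag; auto; intros E; apply Hw0.
  apply (Cmult_cancel (RtoC 2)); [intros K'; apply RtoC_inj in K'; lra|].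
  replace (RtoC 2 * w)%C with (w - - w)%C by ring; rewrite E; ring. }
pose proof (grunsky_odd h w Hh Hw1) as Hg.
rewrite Hq, Hq' in Hg; unfold h in Hg; rewrite (quot_odd a w Hu Hw1) in Hg; fold h in Hg.
assert (Hww : Cmod w ^ 2 = Cmod W) by (rewrite <- Hw, Cmod_mult; ring).
rewrite Hww in Hg.
assert (HQ0 : 0 < Cmod (quot h w w)) by (apply Cmod_gt_0, quot_diag; auto).
rewrite <- Hc2, Cmod_mult.
rewrite <- Hw at 1 2; rewrite quot_sqrt, Hw, Cmod_mult by auto; fold h c.
rewrite <- Rmult_assoc; apply Rmult_le_compat_r; [lra|].
assert (Hpos : 0 < (1 + Cmod W) / (1 - Cmod W)) by (apply Rdiv_lt_0_compat; lra).
apply Rnot_lt_le; intros Hlt; apply ln_increasing in Hlt; [|now apply Rmult_lt_0_compat].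
rewrite ln_mult in Hlt by auto; lra.
Qed.

(** * Radial growth and the Hayman index *)

Lemma ev_line_derive a xi t0 : rad1 a -> Cmod xi = 1 -> 0 < t0 < 1 ->
  is_derive (fun t : R => Re (ev a (t * xi)%C)) t0 (Re (xi * quot a (t0 * xi) (t0 * xi))%C) /\
  is_derive (fun t : R => Im (ev a (t * xi)%C)) t0 (Im (xi * quot a (t0 * xi) (t0 * xi))%C).
Proof.
intros Ha Hxi Ht0; set (r := (1 + t0) / 2).
destruct (quot_lip a r Ha ltac:(unfold r; lra)) as (L & HL & Hlip).
set (q := quot a (t0 * xi) (t0 * xi)).
assert (Hmod : forall t : R, 0 <= t -> Cmod (t * xi)%C = t).
{ intros t Ht; rewrite Cmod_scal, Hxi by lra; ring. }
assert (Hh : forall h, h <> 0 -> Rabs h < Rmin t0 ((1 - t0) / 2) ->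
  Cmod ((ev a (RtoC (t0 + h) * xi) - ev a (t0 * xi)) / h - xi * q)%C <= L * Rabs h).
{ intros h Hh0 Hh.
  pose proof (Rmin_l t0 ((1 - t0) / 2)); pose proof (Rmin_r t0 ((1 - t0) / 2)).
  assert (Hb : - t0 < h < (1 - t0) / 2) by (apply Rabs_def2 in Hh; lra).
  assert (Hhc : RtoC h <> RtoC 0) by (intros E; apply RtoC_inj in E; auto).
  rewrite <- quot_eq by (auto; rewrite Hmod; lra).
  replace (RtoC (t0 + h) * xi - t0 * xi)%C with (h * xi)%C by (rewrite RtoC_plus; ring).
  replace (h * xi * quot a (RtoC (t0 + h) * xi) (t0 * xi) / h - xi * q)%C
    with (xi * (quot a (RtoC (t0 + h) * xi) (t0 * xi) - q))%C by (field; auto).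
  rewrite Cmod_mult, Hxi, Rmult_1_l.
  eapply Rle_trans; [apply Hlip; rewrite Hmod; unfold r; lra|].
  replace (RtoC (t0 + h) * xi - t0 * xi)%C with (h * xi)%C by (rewrite RtoC_plus; ring).
  replace (t0 * xi - t0 * xi)%C with (RtoC 0) by ring.
  rewrite Cmod_mult, Cmod_R, Hxi, Cmod_0; lra. }
assert (Hmin : 0 < Rmin t0 ((1 - t0) / 2)) by (apply Rmin_glb_lt; lra).
assert (Hdel : forall e, 0 < e -> 0 < Rmin (Rmin t0 ((1 - t0) / 2)) (e / (L + 1))).
{ intros e He; apply Rmin_glb_lt; auto; apply Rdiv_lt_0_compat; lra. }
assert (Hle : forall e h, 0 < e -> Rabs h < Rmin (Rmin t0 ((1 - t0) / 2)) (e / (L + 1)) -> h <> 0 ->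
  Cmod ((ev a (RtoC (t0 + h) * xi) - ev a (t0 * xi)) / h - xi * q)%C < e).
{ intros e h He Hlt Hh0.
  eapply Rle_lt_trans; [apply Hh; auto; eapply Rlt_le_trans; [exact Hlt|apply Rmin_l]|].
  assert (H1 : Rabs h < e / (L + 1)) by (eapply Rlt_le_trans; [exact Hlt|apply Rmin_r]).
  apply (Rmult_lt_compat_r (L + 1)) in H1; [|lra].
  unfold Rdiv in H1; rewrite Rmult_assoc, Rinv_l in H1 by lra.
  pose proof (Rabs_pos h); lra. }
assert (Hdiv : forall (h : R) (x y : C), h <> 0 ->
   Re ((x - y) / h)%C = (Re x - Re y) / h /\ Im ((x - y) / h)%C = (Im x - Im y) / h).
{ intros h x y Hh0; unfold Cdiv; rewrite <- RtoC_inv by auto.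
  rewrite (Cmult_comm (x - y)), Re_scal, Im_scal, Re_minus, Im_minus; split; unfold Rdiv; ring. }
split; apply is_derive_Reals; intros e He; exists (mkposreal _ (Hdel e He)); intros h Hh0 Hlt;
  simpl in Hlt; specialize (Hle e h He Hlt Hh0);
  destruct (Hdiv h (ev a (RtoC (t0 + h) * xi)) (ev a (t0 * xi)) Hh0)%C as [E1 E2].
- rewrite <- E1, <- Re_minus; eapply Rle_lt_trans; [apply re_le_Cmod|exact Hle].
- rewrite <- E2, <- Im_minus; eapply Rle_lt_trans; [apply im_le_Cmod|exact Hle].
Qed.

Lemma Re_conj_mult_le x y : Re x * Re y + Im x * Im y <= Cmod x * Cmod y.
Proof.
replace (Re x * Re y + Im x * Im y) with (Re (x * Cconj y)%C).
- eapply Rle_trans; [apply Rle_abs|]; eapply Rle_trans; [apply re_le_Cmod|].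
  rewrite Cmod_mult, Cmod_conj; lra.
- rewrite Re_mult, re_conj, im_conj; ring.
Qed.

(** By [distortion] the derivative of 2 ln |f(t xi)| is at most (2/t) (1 + t)/(1 - t) = 2/t + 4/(1 -
    t), and the derivatives of - 2 ln t and 4 ln (1 - t) cancel exactly this. *)
Lemma growth_mono a xi s t : univ a -> Cmod xi = 1 -> 0 < s <= t -> t < 1 ->
  (1 - t) ^ 2 * Cmod (ecoef a (t * xi)%C 0) <= (1 - s) ^ 2 * Cmod (ecoef a (s * xi)%C 0).
Proof.
intros Hu Hxi Hst Ht; pose proof Hu as (_ & _ & Ha & _).
destruct (Req_dec s t) as [->|Hne]; [lra|].
assert (Hmod : forall t : R, 0 <= t -> Cmod (t * xi)%C = t).
{ intros u Hu0; rewrite Cmod_scal, Hxi by lra; ring. }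
set (m := fun t : R => Cmod (ecoef a (t * xi)%C 0)).
assert (Hm : forall u, s <= u <= t -> 0 < m u).
{ intros u Hu0; apply Cmod_gt_0, (shift0_zero_free a Hu); rewrite Hmod; lra. }
set (X := fun t : R => Re (ev a (t * xi)%C)); set (Y := fun t : R => Im (ev a (t * xi)%C)).
assert (HXY : forall u, s <= u <= t -> X u ^ 2 + Y u ^ 2 = (u * m u) ^ 2).
{ intros u Hu0; unfold X, Y; rewrite <- Cmod_sq_Re_Im, ev_ecoef0 by (auto; rewrite Hmod; lra).
  rewrite Cmod_mult, Hmod by lra; reflexivity. }
assert (HXYpos : forall u, s <= u <= t -> 0 < X u ^ 2 + Y u ^ 2).
{ intros u Hu0; rewrite HXY by auto; apply pow_lt, Rmult_lt_0_compat; [lra|auto]. }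
set (D := fun u : R => (xi * quot a (u * xi) (u * xi))%C).
set (F := fun u => ln (X u ^ 2 + Y u ^ 2) - 2 * ln u + 4 * ln (1 - u)).
destruct (mvt F (fun u => 2 * (X u * Re (D u) + Y u * Im (D u)) / (X u ^ 2 + Y u ^ 2)
    - 2 * / u + 4 * - / (1 - u)) s t ltac:(lra)) as (c & Hc & HF).
{ intros u Hu0; destruct (ev_line_derive a xi u Ha Hxi ltac:(lra)) as [A1 A2].
  apply (is_derive_plus (K := R_AbsRing) (V := R_NormedModule)).
  - apply (is_derive_minus (K := R_AbsRing) (V := R_NormedModule)).
    + apply is_derive_ln_Cmod_sq; auto.
    + apply is_derive_scal, is_derive_ln; lra.
  - apply is_derive_scal; auto_derive; [lra|field; lra]. }
assert (Hneg : 2 * (X c * Re (D c) + Y c * Im (D c)) / (X c ^ 2 + Y c ^ 2)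
    - 2 * / c + 4 * - / (1 - c) <= 0).
{ assert (Hcst : s <= c <= t) by lra.
  pose proof (Hm c Hcst) as Hmc.
  assert (HD : Cmod (D c) <= (1 + c) / (1 - c) * m c).
  { unfold D; rewrite Cmod_mult, Hxi, Rmult_1_l.
    pose proof (distortion a (c * xi)%C Hu) as Hd; rewrite Hmod in Hd by lra; apply Hd; lra. }
  pose proof (Re_conj_mult_le (ev a (c * xi)%C) (D c)) as HR; fold (X c) (Y c) in HR.
  rewrite ev_ecoef0, Cmod_mult, Hmod in HR by (auto; try (rewrite Hmod); lra); fold (m c) in HR.
  rewrite HXY by auto.
  assert (H1 : 2 * (X c * Re (D c) + Y c * Im (D c)) / (c * m c) ^ 2
     <= 2 * (c * m c * ((1 + c) / (1 - c) * m c)) / (c * m c) ^ 2).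
  { apply Rmult_le_compat_r; [left; apply Rinv_0_lt_compat, pow_lt, Rmult_lt_0_compat; lra|].
    apply Rmult_le_compat_l; [lra|]; eapply Rle_trans; [exact HR|].
    apply Rmult_le_compat_l; [apply Rmult_le_pos; lra|auto]. }
  replace (2 * (c * m c * ((1 + c) / (1 - c) * m c)) / (c * m c) ^ 2)
    with (2 * / c + 4 * / (1 - c)) in H1 by (field; lra).
  lra. }
assert (HFle : F t <= F s) by nra.
unfold F in HFle; rewrite !HXY in HFle by lra.
pose proof (Hm t ltac:(lra)) as Hmt; pose proof (Hm s ltac:(lra)) as Hms.
rewrite !ln_sq, !ln_mult in HFle by (try apply Rmult_lt_0_compat; lra).
apply Rnot_lt_le; intros Hlt; apply ln_increasing in Hlt.
2:{ apply Rmult_lt_0_compat; [apply pow_lt; lra|exact Hms]. }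
change (Cmod (ecoef a (t * xi)%C 0)) with (m t) in Hlt.
change (Cmod (ecoef a (s * xi)%C 0)) with (m s) in Hlt.
rewrite !ln_mult, !ln_sq in Hlt by (try apply pow_lt; lra); lra.
Qed.

Lemma Minf_spec a f r : univ a -> (forall z, Cmod z < 1 -> f z = ev a z) -> 0 < r < 1 ->
  (forall z, Cmod z = r -> Cmod (f z) <= Minf r f) /\
  (forall B, (forall z, Cmod z = r -> Cmod (f z) <= B) -> Minf r f <= B) /\
  (forall e, 0 < e -> exists z, Cmod z = r /\ Minf r f - e < Cmod (f z)).
Proof.
intros (_ & _ & Ha & _) Hf Hr; unfold Minf.
set (E := fun y => exists z : C, Cmod z = r /\ y = Cmod (f z)).
pose proof (Lub_Rbar_correct E) as [Hub Hlub].
assert (Hs : summ a r) by (apply rad1_summ; auto; lra).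
assert (Hin : E (Cmod (f (RtoC r)))).
{ exists (RtoC r); split; auto; rewrite Cmod_R, Rabs_pos_eq; lra. }
assert (Hfin : exists x, Lub_Rbar E = Finite x).
{ destruct (Lub_Rbar E) as [x| |] eqn:HE; [eauto| |].
  - exfalso; apply (Hlub (nrm a r)); intros y (z & Hz & ->); simpl.
    rewrite Hf by lra; apply ev_le_nrm; auto; lra.
  - exfalso; exact (Hub _ Hin). }
destruct Hfin as [x Hx]; rewrite Hx in *; simpl real.
assert (H1 : forall z, Cmod z = r -> Cmod (f z) <= x).
{ intros z Hz; apply (Hub (Cmod (f z))); exists z; auto. }
assert (H2 : forall B, (forall z, Cmod z = r -> Cmod (f z) <= B) -> x <= B).
{ intros B HB; apply (Hlub B); intros y (z & Hz & ->); simpl; auto. }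
split; [|split]; auto.
intros e He; apply NNPP; intros Hno.
assert (x <= x - e); [|lra].
apply H2; intros z Hz; apply Rnot_lt_le; intros Hlt; apply Hno; eauto.
Qed.

Lemma unit_direction z r : 0 < r -> Cmod z = r -> exists xi, Cmod xi = 1 /\ z = (r * xi)%C.
Proof.
intros Hr Hz; assert (Hrc : RtoC r <> RtoC 0) by (intros E; apply RtoC_inj in E; lra).
exists (z / r)%C; split; [|field; auto].
rewrite Cmod_div, Cmod_R, Rabs_pos_eq, Hz by (auto; lra); field; lra.
Qed.

(** Dividing by r makes the quantity decreasing and keeps the Hayman index as its limit at 1. For
    the Koebe function it is constantly 1. *)
Definition growth (f : C -> C) (r : R) : R := (1 - r) ^ 2 * Minf r f / r.

Lemma growth_decreasing a f s t : univ a -> (forall z, Cmod z < 1 -> f z = ev a z) ->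
  0 < s <= t -> t < 1 -> growth f t <= growth f s.
Proof.
intros Hu Hf Hst Ht; unfold growth.
destruct (Minf_spec a f t Hu Hf ltac:(lra)) as (_ & Hlub & _).
destruct (Minf_spec a f s Hu Hf ltac:(lra)) as (Hub & _ & _).
assert (Ht2 : 0 < (1 - t) ^ 2) by (apply pow_lt; lra).
apply Rmult_le_reg_r with (t * / (1 - t) ^ 2).
{ apply Rmult_lt_0_compat; [lra|now apply Rinv_0_lt_compat]. }
replace ((1 - t) ^ 2 * Minf t f / t * (t * / (1 - t) ^ 2)) with (Minf t f) by (field; lra).
apply Hlub; intros z Hz.
destruct (unit_direction z t ltac:(lra) Hz) as (xi & Hxi & ->).
assert (Hmod : forall t : R, 0 <= t -> Cmod (t * xi)%C = t).
{ intros u Hu0; rewrite Cmod_scal, Hxi by lra; ring. }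
pose proof (growth_mono a xi s t Hu Hxi Hst Ht) as Hm.
specialize (Hub (s * xi)%C (Hmod s ltac:(lra))).
rewrite Hf, ev_ecoef0, Cmod_mult, Hmod in Hub by (auto; try rewrite Hmod; lra).
rewrite Hf, ev_ecoef0, Cmod_mult by (auto; lra); rewrite Hz.
set (A := Cmod (ecoef a (t * xi) 0)) in *; set (B := Cmod (ecoef a (s * xi) 0)) in *.
replace (t * A) with ((1 - t) ^ 2 * A * (t * / (1 - t) ^ 2)) by (field; lra).
apply Rmult_le_compat_r; [apply Rmult_le_pos; [lra|left; now apply Rinv_0_lt_compat]|].
eapply Rle_trans; [exact Hm|].
replace ((1 - s) ^ 2 * B) with ((1 - s) ^ 2 * (s * B) / s) by (field; lra).
apply Rmult_le_compat_r; [left; apply Rinv_0_lt_compat; lra|].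
apply Rmult_le_compat_l; [apply pow2_ge_0|exact Hub].
Qed.

Lemma hayman_eps f alpha e : is_hayman_index f alpha -> 0 < e ->
  exists d, 0 < d /\ forall r, 1 - d < r < 1 -> Rabs ((1 - r) ^ 2 * Minf r f - alpha) < e.
Proof.
intros H He; pose proof (proj1 (filterlim_locally _ _) H (mkposreal e He)) as [d Hd].
exists d; split; [apply cond_pos|]; intros r Hr.
apply (Hd r); [|lra].
change (Rabs (r - 1) < d); apply Rabs_def1; lra.
Qed.

Lemma radii_lim : is_lim_seq (fun n => 1 - / INR (S (S n))) 1.
Proof.
pose proof (proj1 (is_lim_seq_incr_1 (fun m => / INR (S m)) 0) is_lim_inv_INR) as H.
pose proof (is_lim_seq_minus' _ _ 1 0 (is_lim_seq_const 1) H) as H1.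
rewrite Rminus_0_r in H1; exact H1.
Qed.

Lemma radii_bounds n : / 2 <= 1 - / INR (S (S n)) < 1.
Proof.
assert (H2 : 2 <= INR (S (S n))) by (rewrite !S_INR; pose proof (pos_INR n); lra).
pose proof (inv_INR_S_pos (S n)).
assert (/ INR (S (S n)) <= / 2) by (apply Rinv_le_contravar; lra); lra.
Qed.

Lemma hayman_lim f alpha : is_hayman_index f alpha ->
  is_lim_seq (fun n => (1 - (1 - / INR (S (S n)))) ^ 2 * Minf (1 - / INR (S (S n))) f) alpha.
Proof.
intros H; apply is_lim_seq_spec; intros e.
destruct (hayman_eps f alpha e H (cond_pos e)) as (d & Hd & Hr).
destruct (inv_INR_S_lt d Hd) as [N HN]; exists N; intros n Hn; apply Hr.
specialize (HN (S n) ltac:(lia)); pose proof (inv_INR_S_pos (S n)); lra.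
Qed.

Lemma growth_lim f alpha : is_hayman_index f alpha ->
  is_lim_seq (fun n => growth f (1 - / INR (S (S n)))) alpha.
Proof.
intros H; unfold growth.
replace alpha with (alpha / 1) by field.
apply (is_lim_seq_div' _ (fun n => 1 - / INR (S (S n)))); auto using hayman_lim, radii_lim; lra.
Qed.

Lemma hayman_le_growth a f alpha s : univ a -> (forall z, Cmod z < 1 -> f z = ev a z) ->
  is_hayman_index f alpha -> 0 < s < 1 -> alpha <= growth f s.
Proof.
intros Hu Hf H Hs; pose proof (growth_lim f alpha H) as Hl.
apply (is_lim_seq_le_loc _ (fun _ => growth f s) alpha (growth f s)) in Hl; auto using is_lim_seq_const.
destruct (inv_INR_S_lt (1 - s)) as [N HN]; [lra|]; exists N; intros n Hn.
specialize (HN (S n) ltac:(lia)); pose proof (radii_bounds n).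
apply (growth_decreasing a); auto; lra.
Qed.

Lemma Minf_ge0 a f r : univ a -> (forall z, Cmod z < 1 -> f z = ev a z) -> 0 < r < 1 -> 0 <= Minf r f.
Proof.
intros Hu Hf Hr; destruct (Minf_spec a f r Hu Hf Hr) as (Hub & _ & _).
eapply Rle_trans; [apply (Cmod_ge_0 (f (RtoC r)))|apply Hub].
rewrite Cmod_R, Rabs_pos_eq; lra.
Qed.

Lemma hayman_ge0 a f alpha : univ a -> (forall z, Cmod z < 1 -> f z = ev a z) ->
  is_hayman_index f alpha -> 0 <= alpha.
Proof.
intros Hu Hf H; pose proof (hayman_lim f alpha H) as Hl.
apply (is_lim_seq_le (fun _ => 0) _ 0 alpha) in Hl; auto using is_lim_seq_const.
intros n; apply Rmult_le_pos; [apply pow2_ge_0|]; apply (Minf_ge0 a); auto.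
pose proof (radii_bounds n); lra.
Qed.

(** * The inequality of Bazilevich *)

Definition Clim (u : nat -> C) (l : C) : Prop := is_lim_seq (fun n => Cmod (u n - l)%C) 0.

Lemma Clim_le (u : nat -> C) l (v : nat -> R) : (forall n, Cmod (u n - l)%C <= v n) ->
  is_lim_seq v 0 -> Clim u l.
Proof.
intros H Hv; apply (is_lim_seq_le_le (fun _ => 0) _ v); auto using is_lim_seq_const.
intros n; split; auto using Cmod_ge_0.
Qed.

Lemma Clim_const l : Clim (fun _ => l) l.
Proof.
apply Clim_le with (fun _ => 0); auto using is_lim_seq_const; intros n.
replace (l - l)%C with (RtoC 0) by ring; rewrite Cmod_0; lra.
Qed.

Lemma Clim_ext u v l : (forall n, u n = v n) -> Clim u l -> Clim v l.
Proof. intros H; apply is_lim_seq_ext; intros n; now rewrite H. Qed.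

Lemma Clim_plus u v l m : Clim u l -> Clim v m -> Clim (fun n => u n + v n)%C (l + m)%C.
Proof.
intros Hu Hv; apply Clim_le with (fun n => Cmod (u n - l)%C + Cmod (v n - m)%C).
- intros n; replace (u n + v n - (l + m))%C with ((u n - l) + (v n - m))%C by ring.
  apply Cmod_triangle.
- replace 0 with (0 + 0) by ring; now apply is_lim_seq_plus'.
Qed.

Lemma Clim_mult u v l m : Clim u l -> Clim v m -> Clim (fun n => u n * v n)%C (l * m)%C.
Proof.
intros Hu Hv; apply Clim_le with
  (fun n => Cmod (u n) * Cmod (v n - m)%C + Cmod m * Cmod (u n - l)%C).
- intros n; replace (u n * v n - l * m)%C with (u n * (v n - m) + m * (u n - l))%C by ring.
  eapply Rle_trans; [apply Cmod_triangle|]; rewrite !Cmod_mult; lra.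
- replace 0 with (Cmod l * 0 + Cmod m * 0) by ring; apply is_lim_seq_plus'.
  + apply is_lim_seq_mult'; auto; now apply is_lim_Cmod.
  + now apply (is_lim_seq_scal_l _ (Cmod m) 0).
Qed.

Lemma Clim_pow u l k : Clim u l -> Clim (fun n => u n ^ k)%C (l ^ k)%C.
Proof.
intros H; induction k as [|k IH]; [exact (Clim_const (RtoC 1))|].
apply Clim_ext with (fun n => u n * u n ^ k)%C; [reflexivity|]; rewrite Cpow_S; now apply Clim_mult.
Qed.

Lemma Clim_conj u l : Clim u l -> Clim (fun n => Cconj (u n)) (Cconj l).
Proof.
intros H; eapply is_lim_seq_ext; [|exact H]; intros n; simpl.
now rewrite <- Cminus_conj, Cmod_conj.
Qed.

(** Writing the quotient as (f w - f z)/(w - z), its normalised logarithm is log (1 - f z/f w) - log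
    (1 - z/w). When w tends to the boundary and f w to infinity, only the second logarithm
    survives. *)
Lemma flog_ecoef_split a w n : univ a -> Cmod w < 1 -> w <> RtoC 0 ->
  flog (ecoef a w) n = (flog (fun k => delta0 (ev a w) k - a k)%C n - lin_log w n)%C.
Proof.
intros Hu Hw Hw0; pose proof Hu as (Ha0 & _ & Ha & _).
set (g := fun k => (delta0 (ev a w) k - a k)%C).
assert (Hne : ev a w <> RtoC 0).
{ intros E; apply Hw0; apply (proj2 (proj2 (proj2 Hu))); auto; [rewrite Cmod_0; lra|].
  rewrite ev_0, Ha0; auto. }
assert (Hg0 : g 0%nat <> RtoC 0).
{ unfold g; simpl; rewrite Ha0; replace (ev a w - 0)%C with (ev a w) by ring; auto. }
assert (H : is_flog (fun k => lin_log w k + flog (ecoef a w) k)%C g).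
{ eapply is_flog_ext; [reflexivity| |apply (is_flog_scal (- (1))%C _ (conv (lin w) (ecoef a w)))].
  - intros k; simpl; rewrite conv_lin_ecoef by auto; unfold g; ring.
  - apply is_flog_conv; [now apply is_flog_lin|].
    apply flog_is_flog, zero_free_0; now apply ecoef_zero_free. }
rewrite <- (is_flog_unique _ _ g Hg0 H (flog_is_flog g Hg0) n); ring.
Qed.

(** The coefficients of log (1 - f/W) are polynomials in 1/W without constant term. The constant is
    built by induction from the recursion of the logarithm. *)
Lemma flog_shifted_small a N : a 0%nat = RtoC 0 -> exists C0, 0 <= C0 /\ forall n W, (n < N)%nat ->
  1 <= Cmod W -> Cmod (flog (fun k => delta0 W k - a k)%C n) <= C0 / Cmod W.
Proof.
intros Ha0; induction N as [|N (C0 & HC0 & IH)]; [exists 0; split; [lra|intros; lia]|].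
set (C1 := INR N * Cmod (a N) + rsum N (fun k => INR k * C0 * Cmod (a (N - k)%nat))).
assert (HC1 : 0 <= C1).
{ apply Rplus_le_le_0_compat.
  - apply Rmult_le_pos; [apply pos_INR|apply Cmod_ge_0].
  - apply rsum_ge0; intros; repeat apply Rmult_le_pos; auto using pos_INR, Cmod_ge_0. }
exists (C0 + C1); split; [lra|]; intros n W Hn HW.
assert (HiW : 0 < / Cmod W) by (apply Rinv_0_lt_compat; lra).
destruct (Nat.eq_dec n N) as [->|Hne].
2:{ eapply Rle_trans; [apply IH; auto; lia|]; apply Rmult_le_compat_r; lra. }
set (g := fun k => (delta0 W k - a k)%C); set (l := flog g).
assert (HW0 : W <> RtoC 0) by (intros E; rewrite E, Cmod_0 in HW; lra).
assert (Hg0 : g 0%nat = W) by (unfold g; simpl; rewrite Ha0; ring).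
assert (Hfl : is_flog l g) by (apply flog_is_flog; rewrite Hg0; auto).
apply Rle_trans with (C1 / Cmod W); [|apply Rmult_le_compat_r; lra].
destruct N as [|N].
{ rewrite (proj1 Hfl), Cmod_0; apply Rmult_le_pos; lra. }
destruct Hfl as [Hl0 Hfl]; specialize (Hfl (S N)); rewrite conv_last, Hg0 in Hfl.
assert (Hgk : forall k, (k < S N)%nat -> g (S N - k)%nat = (- a (S N - k)%nat)%C).
{ intros k Hk; unfold g; destruct (S N - k)%nat eqn:E; [lia|]; simpl; ring. }
assert (HgN : g (S N) = (- a (S N))%C) by (unfold g; simpl; ring).
assert (Heq : (RtoC (INR (S N)) * l (S N) * W)%C
  = (- (RtoC (INR (S N)) * a (S N)) - csum (S N) (fun i => theta l i * g (S N - i)%nat))%C).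
{ transitivity (theta g (S N) - csum (S N) (fun i => theta l i * g (S N - i)%nat))%C.
  - rewrite <- Hfl; change (theta l (S N)) with (RtoC (INR (S N)) * l (S N))%C; ring.
  - unfold theta at 1; rewrite HgN; ring. }
apply (f_equal Cmod) in Heq; rewrite !Cmod_mult, Cmod_R, Rabs_pos_eq in Heq by apply pos_INR.
assert (Hb : INR (S N) * Cmod (l (S N)) * Cmod W <= C1).
{ rewrite Heq; eapply Rle_trans; [apply Cmod_triangle|]; rewrite !Cmod_opp.
  unfold C1; rewrite Cmod_mult, Cmod_R, Rabs_pos_eq by apply pos_INR.
  apply Rplus_le_compat_l; eapply Rle_trans; [apply Cmod_csum|].
  apply rsum_le; intros k Hk; rewrite Cmod_mult, Hgk, Cmod_opp by auto.
  apply Rmult_le_compat_r; [apply Cmod_ge_0|].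
  unfold theta; rewrite Cmod_scal by apply pos_INR; apply Rmult_le_compat_l; [apply pos_INR|].
  eapply Rle_trans; [apply (IH k W Hk HW)|].
  rewrite <- (Rmult_1_r C0) at 2; apply Rmult_le_compat_l; auto.
  rewrite <- Rinv_1; apply Rinv_le_contravar; lra. }
assert (HN1 : 1 <= INR (S N)) by (rewrite S_INR; pose proof (pos_INR N); lra).
pose proof (Cmod_ge_0 (l (S N))) as Hl1.
apply Rmult_le_reg_r with (Cmod W); [lra|].
replace (C1 / Cmod W * Cmod W) with C1 by (field; lra).
eapply Rle_trans; [|exact Hb]; apply Rmult_le_compat_r; [lra|].
rewrite <- (Rmult_1_l (Cmod (l (S N)))) at 1; apply Rmult_le_compat_r; auto.
Qed.

(** [distortion] at w eliminates the derivative f'(w), and the powers of 1 + |w| cancel. *)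
Lemma bazilevich_point a P w : univ a -> Cmod w < 1 ->
  rsum P (fun p => INR (S p) * Cmod (flog (ecoef a w) (S p) - lf a (S p)
     + RtoC (/ INR (S p)) * Cconj w ^ S p)%C ^ 2)
  <= - 2 * ln ((1 - Cmod w) ^ 2 * Cmod (ecoef a w 0)).
Proof.
intros Hu Hw; pose proof (Cmod_ge_0 w).
eapply Rle_trans; [now apply bazilevich_finite|].
assert (HE0 : 0 < Cmod (ecoef a w 0)) by now apply Cmod_gt_0, (shift0_zero_free a Hu).
assert (HQ0 : 0 < Cmod (quot a w w)) by now apply Cmod_gt_0, quot_diag.
assert (Hd : 0 < (1 + Cmod w) / (1 - Cmod w)) by (apply Rdiv_lt_0_compat; lra).
pose proof (ln_le _ _ HQ0 (distortion a w Hu Hw)) as Hl.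
rewrite ln_mult, ln_div in Hl by lra.
rewrite ln_mult, ln_sq by (try apply pow_lt; lra).
replace (1 - Cmod w ^ 2) with ((1 + Cmod w) * (1 - Cmod w)) by ring.
rewrite ln_mult by lra; lra.
Qed.

(** xi is a limit point of near-maximal points z_n with |z_n| tending to 1. Since alpha > 0,
    |f(z_n)| tends to infinity, the coefficients of the logarithm of the quotient tend to (conj
    xi)^p / p, and [bazilevich_point] passes to the limit. The coefficients are those of log (f
    z/z), twice the g_k, whence the bound - 2 ln alpha. *)
Lemma bazilevich a f alpha : univ a -> (forall z, Cmod z < 1 -> f z = ev a z) ->
  is_hayman_index f alpha -> 0 < alpha ->
  exists xi, Cmod xi = 1 /\
    (forall P, rsum P (fun p => INR (S p) * Cmod (lf a (S p)
       - RtoC (2 * / INR (S p)) * Cconj xi ^ S p)%C ^ 2) <= - 2 * ln alpha) /\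
    (forall t, 0 < t < 1 -> alpha <= (1 - t) ^ 2 * Cmod (ecoef a (t * xi)%C 0)).
Proof.
intros Hu Hf Hh Hal; pose proof Hu as (Ha0 & _ & Ha & _).
set (r := fun n => 1 - / INR (S (S n))).
assert (Hr : forall n, / 2 <= r n < 1) by apply radii_bounds.
(* The slack 1 in the near-maximum is harmless: it gets multiplied by (1 - r n)^2. *)
assert (Hz : forall n, exists z, Cmod z = r n /\ Minf (r n) f - 1 < Cmod (f z)).
{ intros n; specialize (Hr n); apply (Minf_spec a f (r n) Hu Hf); lra. }
set (z0 := fun n => proj1_sig (constructive_indefinite_description _ (Hz n))).
assert (Hz0 : forall n, Cmod (z0 n) = r n /\ Minf (r n) f - 1 < Cmod (f (z0 n))).
{ intros n; exact (proj2_sig (constructive_indefinite_description _ (Hz n))). }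
assert (HA0 : is_lim_seq (fun n => (1 - r n) ^ 2 * Cmod (f (z0 n)) / r n) alpha).
{ replace alpha with (alpha / 1) by field.
  apply (is_lim_seq_div' _ r); [|apply radii_lim|lra].
  apply (is_lim_seq_le_le (fun n => (1 - r n) ^ 2 * Minf (r n) f - (1 - r n) ^ 2) _
     (fun n => (1 - r n) ^ 2 * Minf (r n) f)).
  - intros n; destruct (Hz0 n) as [A B]; specialize (Hr n).
    pose proof (pow2_ge_0 (1 - r n)).
    destruct (Minf_spec a f (r n) Hu Hf ltac:(lra)) as (Hub & _ & _); specialize (Hub _ A).
    split; [|now apply Rmult_le_compat_l].
    replace ((1 - r n) ^ 2 * Minf (r n) f - (1 - r n) ^ 2) with ((1 - r n) ^ 2 * (Minf (r n) f - 1)) by ring.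
    apply Rmult_le_compat_l; lra.
  - replace alpha with (alpha - (1 - 1) ^ 2) by ring.
    apply is_lim_seq_minus'; [now apply hayman_lim|].
    apply is_lim_seq_pow, is_lim_seq_minus'; [apply is_lim_seq_const|apply radii_lim].
  - now apply hayman_lim. }
destruct (BW_C z0 1) as (phi & xi & Hphi).
{ intros n; destruct (Hz0 n) as [-> _]; specialize (Hr n); lra. }
set (z := fun n => z0 (phi n)); set (s := fun n => r (phi n)).
assert (Hphi_lim : forall u (l : R), is_lim_seq u l -> is_lim_seq (fun n => u (phi n)) l).
{ intros u l Hl; apply is_lim_seq_spec; intros e.
  apply is_lim_seq_spec in Hl; destruct (Hl e) as [N HN]; exists N; intros n Hn; apply HN.
  destruct (Hphi n); lia. }
assert (Hs : forall n, / 2 <= s n < 1) by (intros; apply Hr).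
assert (Hzs : forall n, Cmod (z n) = s n) by (intros; apply Hz0).
assert (Hslim : is_lim_seq s 1) by (apply (Hphi_lim r), radii_lim).
assert (HA : is_lim_seq (fun n => (1 - s n) ^ 2 * Cmod (f (z n)) / s n) alpha).
{ apply (Hphi_lim _ alpha HA0). }
assert (Hm : forall n, Cmod (f (z n)) = s n * Cmod (ecoef a (z n) 0)).
{ intros n; specialize (Hs n); rewrite Hf, ev_ecoef0, Cmod_mult, Hzs by (auto; rewrite Hzs; lra); auto. }
assert (HA' : is_lim_seq (fun n => (1 - s n) ^ 2 * Cmod (ecoef a (z n) 0)) alpha).
{ eapply is_lim_seq_ext; [|exact HA]; intros n; simpl; rewrite Hm; field; specialize (Hs n); lra. }
assert (Hzxi : Clim z xi).
{ apply Clim_le with (fun n => 2 * / INR (S n)).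
  - intros n; left; apply Hphi.
  - replace 0 with (2 * 0) by ring; apply (is_lim_seq_scal_l _ 2 0), is_lim_inv_INR. }
assert (Hxi : Cmod xi = 1).
{ pose proof (is_lim_Cmod z xi Hzxi) as H1.
  apply (is_lim_seq_ext _ s) in H1; [|auto].
  apply is_lim_seq_unique in H1; apply is_lim_seq_unique in Hslim.
  rewrite H1 in Hslim; injection Hslim; auto. }
exists xi; split; [auto|split].
- intros P.
  assert (Hfinf : is_lim_seq (fun n => / Cmod (f (z n))) 0).
  { apply is_lim_seq_ext with (fun n => (1 - s n) ^ 2 / s n / ((1 - s n) ^ 2 * Cmod (f (z n)) / s n)).
    - intros n; specialize (Hs n); rewrite Hm; field.
      assert (0 < Cmod (ecoef a (z n) 0)) by (apply Cmod_gt_0, (shift0_zero_free a Hu); rewrite Hzs; lra).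
      repeat split; lra.
    - replace 0 with ((1 - 1) ^ 2 / 1 / alpha) by (field; lra).
      apply is_lim_seq_div'; [|exact HA|lra].
      apply is_lim_seq_div'; [|exact Hslim|lra].
      apply is_lim_seq_pow, is_lim_seq_minus'; [apply is_lim_seq_const|exact Hslim]. }
  (* 1/z = conj z / |z|^2, and |z_n| tends to 1. *)
  assert (Hinv : Clim (fun n => / z n)%C (Cconj xi)).
  { apply Clim_le with (fun n => (1 - s n ^ 2) / s n + Cmod (z n - xi)%C).
    - intros n; specialize (Hs n); specialize (Hzs n).
      assert (Hzn : z n <> RtoC 0) by (intros E; rewrite E, Cmod_0 in Hzs; lra).
      replace (/ z n - Cconj xi)%C with ((/ z n * (1 - z n * Cconj (z n))) + (Cconj (z n) - Cconj xi))%C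
        by (field; auto).
      eapply Rle_trans; [apply Cmod_triangle|].
      rewrite <- Cminus_conj, Cmod_conj; apply Rplus_le_compat_r.
      rewrite <- Cmod_sq, Hzs, <- RtoC_minus, Cmod_mult, Cmod_inv, Cmod_R, Hzs, Rabs_pos_eq by (auto; nra).
      right; field; lra.
    - replace 0 with ((1 - 1 ^ 2) / 1 + 0) by field; apply is_lim_seq_plus'; [|exact Hzxi].
      apply is_lim_seq_div'; [|exact Hslim|lra].
      apply is_lim_seq_minus'; [apply is_lim_seq_const|now apply is_lim_seq_pow]. }
  destruct (flog_shifted_small a (S P) Ha0) as (C0 & HC0 & Hsmall).
  assert (Hfl : forall p, (p < P)%nat ->
     Clim (fun n => flog (ecoef a (z n)) (S p)) (RtoC (/ INR (S p)) * Cconj xi ^ S p)%C).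
  { intros p Hp.
    apply Clim_ext with (fun n => flog (fun k => delta0 (ev a (z n)) k - a k)%C (S p)
       + RtoC (/ INR (S p)) * (/ z n) ^ S p)%C.
    - intros n; specialize (Hs n); specialize (Hzs n).
      assert (Hzn : z n <> RtoC 0) by (intros E; rewrite E, Cmod_0 in Hzs; lra).
      rewrite flog_ecoef_split by (auto; lra); unfold lin_log; ring.
    - replace (RtoC (/ INR (S p)) * Cconj xi ^ S p)%C
        with (0 + RtoC (/ INR (S p)) * Cconj xi ^ S p)%C by ring.
      apply Clim_plus; [|apply Clim_mult; [apply Clim_const|now apply Clim_pow]].
      assert (Hbig : exists N, forall n, (N <= n)%nat -> 1 <= Cmod (f (z n))).
      { apply is_lim_seq_spec in Hfinf; destruct (Hfinf (mkposreal 1 Rlt_0_1)) as [N HN].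
        exists N; intros n Hn; specialize (HN n Hn); simpl in HN; rewrite Rminus_0_r in HN.
        pose proof (Rle_abs (/ Cmod (f (z n)))).
        assert (0 < Cmod (f (z n))).
        { rewrite Hm; specialize (Hs n); apply Rmult_lt_0_compat; [lra|].
          apply Cmod_gt_0, (shift0_zero_free a Hu); rewrite Hzs; lra. }
        apply Rnot_lt_le; intros Hlt.
        assert (/ 1 < / Cmod (f (z n))) by (apply Rinv_lt_contravar; lra).
        rewrite Rinv_1 in H1; lra. }
      destruct Hbig as [N HN].
      apply (is_lim_seq_le_le_loc (fun _ => 0) _ (fun n => C0 * / Cmod (f (z n)))).
      + exists N; intros n Hn; split; [apply Cmod_ge_0|]; cbv beta.
        replace (flog (fun k => delta0 (ev a (z n)) k - a k)%C (S p) - 0)%C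
          with (flog (fun k => delta0 (ev a (z n)) k - a k)%C (S p)) by ring.
        rewrite Hf by (rewrite Hzs; apply Hs); apply Hsmall; [lia|].
        rewrite <- Hf by (rewrite Hzs; apply Hs); auto.
      + apply is_lim_seq_const.
      + replace 0 with (C0 * 0) by ring; now apply (is_lim_seq_scal_l _ C0 0). }
  assert (HL : is_lim_seq (fun n => rsum P (fun p => INR (S p) * Cmod (flog (ecoef a (z n)) (S p) - lf a (S p)
     + RtoC (/ INR (S p)) * Cconj (z n) ^ S p)%C ^ 2))
    (rsum P (fun p => INR (S p) * Cmod (lf a (S p) - RtoC (2 * / INR (S p)) * Cconj xi ^ S p)%C ^ 2))).
  { apply (is_lim_seq_rsum P (fun p n => INR (S p) * Cmod (flog (ecoef a (z n)) (S p) - lf a (S p)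
     + RtoC (/ INR (S p)) * Cconj (z n) ^ S p)%C ^ 2)).
    intros p Hp; apply (is_lim_seq_scal_l _ (INR (S p)) (Finite (_ ^ 2))), is_lim_seq_pow.
    rewrite <- Cmod_opp.
    replace (- (lf a (S p) - RtoC (2 * / INR (S p)) * Cconj xi ^ S p))%C
      with ((RtoC (/ INR (S p)) * Cconj xi ^ S p + - lf a (S p)) + RtoC (/ INR (S p)) * Cconj xi ^ S p)%C.
    - apply is_lim_Cmod.
      apply (Clim_ext (fun n => (flog (ecoef a (z n)) (S p) + - lf a (S p))
         + RtoC (/ INR (S p)) * Cconj (z n) ^ S p)%C); [intros; ring|].
      apply Clim_plus.
      + apply Clim_plus; [now apply Hfl|apply Clim_const].
      + apply Clim_mult; [apply Clim_const|apply Clim_pow, Clim_conj, Hzxi].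
    - rewrite RtoC_mult; ring. }
  assert (HRt : is_lim_seq (fun n => - 2 * ln ((1 - s n) ^ 2 * Cmod (ecoef a (z n) 0))) (- 2 * ln alpha)).
  { apply (is_lim_seq_scal_l _ (- 2) (ln alpha)).
    apply (is_lim_seq_continuous ln); [|exact HA'].
    apply derivable_continuous_pt; exists (/ alpha); now apply derivable_pt_lim_ln. }
  assert (Hle : forall n, rsum P (fun p => INR (S p) * Cmod (flog (ecoef a (z n)) (S p) - lf a (S p)
     + RtoC (/ INR (S p)) * Cconj (z n) ^ S p)%C ^ 2) <= - 2 * ln ((1 - s n) ^ 2 * Cmod (ecoef a (z n) 0))).
  { intros n; rewrite <- Hzs; apply bazilevich_point; auto; rewrite Hzs; apply Hs. }
  exact (is_lim_seq_le _ _ (Finite _) (Finite _) Hle HL HRt).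
- intros t Ht.
  (* Monotonicity along the ray through z_n carries the lower bound from radius [s n] down to t; the
     unit directions [y n] then tend to xi. *)
  set (y := fun n => (z n / s n)%C).
  assert (Hy : forall n, Cmod (y n) = 1 /\ z n = (s n * y n)%C).
  { intros n; specialize (Hs n).
    assert (Hsc : RtoC (s n) <> RtoC 0) by (intros E; apply RtoC_inj in E; lra).
    unfold y; split; [|field; auto].
    rewrite Cmod_div, Cmod_R, Rabs_pos_eq, Hzs by (auto; lra); field; lra. }
  assert (Hylim : Clim (fun n => t * y n)%C (t * xi)%C).
  { apply Clim_mult; [apply Clim_const|].
    apply Clim_le with (fun n => (1 - s n) + Cmod (z n - xi)%C).
    - intros n; destruct (Hy n) as [Y1 Y2]; specialize (Hs n).
      replace (y n - xi)%C with (RtoC (1 - s n) * y n + (z n - xi))%C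
        by (rewrite Y2 at 1; rewrite RtoC_minus; ring).
      eapply Rle_trans; [apply Cmod_triangle|]; rewrite Cmod_scal, Y1 by lra; lra.
    - replace 0 with ((1 - 1) + 0) by ring; apply is_lim_seq_plus'; [|exact Hzxi].
      apply is_lim_seq_minus'; [apply is_lim_seq_const|exact Hslim]. }
  destruct (ev_lip_rad1 (shift a 0) t (rad1_shift a 0 Ha) Ht) as (L & HL & Hlip).
  assert (Hec : Clim (fun n => ecoef a (t * y n)%C 0) (ecoef a (t * xi)%C 0)).
  { apply Clim_le with (fun n => L * Cmod (t * y n - t * xi)%C).
    - intros n; destruct (Hy n) as [Y1 Y2]; apply Hlip; rewrite Cmod_scal by lra; [rewrite Y1|rewrite Hxi]; lra.
    - replace 0 with (L * 0) by ring; now apply (is_lim_seq_scal_l _ L 0). }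
  apply is_lim_Cmod in Hec.
  apply (is_lim_seq_scal_l _ ((1 - t) ^ 2)) in Hec; cbn [Rbar_mult] in Hec.
  assert (Hev : eventually (fun n => (1 - s n) ^ 2 * Cmod (ecoef a (z n) 0)
     <= (1 - t) ^ 2 * Cmod (ecoef a (t * y n)%C 0))).
  { apply is_lim_seq_spec in Hslim; destruct (Hslim (mkposreal (1 - t) ltac:(lra))) as [N HN].
    exists N; intros n Hn; specialize (HN n Hn); simpl in HN.
    destruct (Hy n) as [Y1 Y2]; specialize (Hs n); rewrite Y2.
    apply growth_mono; auto; [|lra]; apply Rabs_def2 in HN; lra. }
  exact (is_lim_seq_le_loc _ _ (Finite _) (Finite _) Hev HA' Hec).
Qed.

(** * The second Lebedev-Milin inequality *)

Lemma rsum_rev n F : rsum (S n) F = rsum (S n) (fun i => F (n - i)%nat).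
Proof. apply RtoC_inj; rewrite !RtoC_rsum; apply (csum_rev n (fun i => RtoC (F i))). Qed.

(** The weights are 1 - k/(n+1) for k = 1, ..., n, so this is 1/(n+1) times the sum over m <= n of
    the partial sums of k |g_k|^2 - 1/k up to m. *)
Definition milin (g : nat -> C) (n : nat) : R :=
  rsum n (fun k => (1 - INR (S k) / INR (S n)) * (INR (S k) * Cmod (g (S k)) ^ 2 - / INR (S k))).

Lemma milin_S g n : milin g (S n) = milin g n
  + (rsum (S n) (fun k => INR (S k) ^ 2 * Cmod (g (S k)) ^ 2) - INR (S n)) / (INR (S n) * INR (S (S n))).
Proof.
set (h := fun k => INR (S k) * Cmod (g (S k)) ^ 2 - / INR (S k)).
assert (Hk : forall k, INR (S k) <> 0) by (intros; apply not_0_INR; lia).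
assert (Hn1 : INR (S (S n)) = INR (S n) + 1) by apply S_INR.
pose proof (Hk n); pose proof (Hk (S n)).
assert (E : rsum (S n) (fun k => INR (S k) ^ 2 * Cmod (g (S k)) ^ 2) - INR (S n)
  = rsum (S n) (fun k => INR (S k) * h k)).
{ rewrite <- (Rmult_1_r (INR (S n))), <- (rsum_const (S n) 1), <- rsum_minus.
  apply rsum_ext; intros k _; unfold h; field; auto. }
rewrite E.
change (milin g (S n)) with (rsum (S n) (fun k => (1 - INR (S k) / INR (S (S n))) * h k)).
change (milin g n) with (rsum n (fun k => (1 - INR (S k) / INR (S n)) * h k)).
rewrite (rsum_ext (S n) _ (fun k => (1 - INR (S k) / INR (S n)) * h k
   + / (INR (S n) * INR (S (S n))) * (INR (S k) * h k))).
2:{ intros k _; unfold h; rewrite Hn1; field; rewrite <- Hn1; auto. }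
rewrite rsum_plus, rsum_scal.
change (rsum (S n) (fun k => (1 - INR (S k) / INR (S n)) * h k))
  with (rsum n (fun k => (1 - INR (S k) / INR (S n)) * h k) + (1 - INR (S n) / INR (S n)) * h n).
replace (1 - INR (S n) / INR (S n)) with 0 by (field; auto); unfold Rdiv; ring.
Qed.

(** The recursion of the exponential and Cauchy-Schwarz bound N^2 times the next square by A B. The
    sum B thus grows at most by the factor (1 + y) (N + 1)/N, with y the increment of [milin], and 1
    + y <= exp y closes the induction. *)
Lemma lebedev_milin g n : g 0%nat = RtoC 0 ->
  rsum (S n) (fun k => Cmod (fexp g k) ^ 2) <= INR (S n) * exp (milin g n).
Proof.
intros Hg0; induction n as [|n IH].
- unfold milin; simpl rsum; rewrite exp_0, fexp_0, Cmod_1; simpl; lra.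
- set (B := rsum (S n) (fun k => Cmod (fexp g k) ^ 2)) in *.
  set (A := rsum (S n) (fun k => INR (S k) ^ 2 * Cmod (g (S k)) ^ 2)).
  set (N := INR (S n)) in *.
  assert (HN : 0 < N) by (apply lt_0_INR; lia).
  assert (HN1 : INR (S (S n)) = N + 1) by apply S_INR.
  assert (HB : 0 <= B) by (apply rsum_ge0; intros; apply pow2_ge_0).
  change (B + Cmod (fexp g (S n)) ^ 2 <= INR (S (S n)) * exp (milin g (S n))).
  assert (He : N ^ 2 * Cmod (fexp g (S n)) ^ 2 <= A * B).
  { rewrite <- Rpow_mult_distr.
    assert (H1 : N * Cmod (fexp g (S n))
      <= rsum (S n) (fun k => Cmod (theta g (S n - k)%nat) * Cmod (fexp g k))).
    { rewrite fexp_S, Cmod_scal by (left; apply inv_INR_S_pos); fold N.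
      rewrite <- Rmult_assoc, Rinv_r, Rmult_1_l by lra.
      eapply Rle_trans; [apply Cmod_csum|]; right; apply rsum_ext; intros; apply Cmod_mult. }
    eapply Rle_trans.
    { apply pow_incr; split; [|exact H1]; apply Rmult_le_pos; [lra|apply Cmod_ge_0]. }
    eapply Rle_trans; [apply (rsum_cauchy_schwarz (S n) (fun k => Cmod (theta g (S n - k)%nat))
       (fun k => Cmod (fexp g k)))|].
    fold B; apply Rmult_le_compat_r; auto; right; unfold A; rewrite (rsum_rev n (fun k => INR (S k) ^ 2 * _)).
    apply rsum_ext; intros k Hk; replace (S n - k)%nat with (S (n - k)) by lia.
    unfold theta; rewrite Cmod_scal, Rpow_mult_distr by apply pos_INR; reflexivity. }
  assert (HBn : B + Cmod (fexp g (S n)) ^ 2 <= B * (1 + A / N ^ 2)).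
  { assert (HN2 : 0 < N ^ 2) by now apply pow_lt.
    apply (Rmult_le_compat_r (/ N ^ 2)) in He; [|left; now apply Rinv_0_lt_compat].
    replace (N ^ 2 * Cmod (fexp g (S n)) ^ 2 * / N ^ 2) with (Cmod (fexp g (S n)) ^ 2) in He by (field; lra).
    unfold Rdiv; lra. }
  rewrite milin_S, HN1; fold A N; set (y := (A - N) / (N * (N + 1))).
  assert (Hy : 1 + A / N ^ 2 = (N + 1) / N * (1 + y)) by (unfold y; field; lra).
  eapply Rle_trans; [exact HBn|]; rewrite Hy, exp_plus.
  pose proof (exp_ineq1_le y) as Hexp; pose proof (exp_pos (milin g n)).
  assert (0 < (N + 1) / N) by (apply Rdiv_lt_0_compat; lra).
  apply Rle_trans with (B * ((N + 1) / N * exp y)).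
  { apply Rmult_le_compat_l; auto; apply Rmult_le_compat_l; lra. }
  apply Rle_trans with (N * exp (milin g n) * ((N + 1) / N * exp y)).
  { apply Rmult_le_compat_r; auto; apply Rmult_le_pos; [lra|left; apply exp_pos]. }
  right; field; lra.
Qed.

(** f(z)/z is the square of the series [sqrtc a], so the coefficient is a convolution sum; 2 x y <=
    x^2 + y^2 and reversal of the index bound it by the sum of squares that [lebedev_milin]
    controls. *)
Lemma coef_le_milin a n : univ a ->
  Cmod (a (S n)) <= INR (S n) * exp (milin (fun k => RtoC (/ 2) * lf a k)%C n).
Proof.
intros Hu; rewrite <- sqrtc_conv by auto.
eapply Rle_trans; [|apply lebedev_milin; rewrite lf_0 by auto; ring].
fold (sqrtc a); unfold conv; eapply Rle_trans; [apply Cmod_csum|].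
set (F := fun k => Cmod (sqrtc a k) ^ 2).
apply Rle_trans with (rsum (S n) (fun k => / 2 * F k + / 2 * F (n - k)%nat)).
- apply rsum_le; intros k _; rewrite Cmod_mult; unfold F.
  pose proof (pow2_ge_0 (Cmod (sqrtc a k) - Cmod (sqrtc a (n - k)%nat))); lra.
- rewrite rsum_plus, !rsum_scal, <- (rsum_rev n F); unfold F; lra.
Qed.

(** * A Tauberian theorem *)

(* The expectation of [phi] under the binomial law with parameters [J] and [u]. *)
Fixpoint bern (J : nat) (phi : nat -> R) (u : R) : R :=
  match J with
  | O => phi 0%nat
  | S J => (1 - u) * bern J phi u + u * bern J (fun j => phi (S j)) u
  end.

Lemma bern_lin J phi psi c d u :
  bern J (fun j => c * phi j + d * psi j) u = c * bern J phi u + d * bern J psi u.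
Proof.
revert phi psi; induction J as [|J IH]; intros phi psi; simpl; [ring|].
rewrite IH, (IH (fun j => phi (S j)) (fun j => psi (S j))); ring.
Qed.

Lemma bern_const J c u : bern J (fun _ => c) u = c.
Proof. induction J as [|J IH]; simpl; [ring|]. rewrite IH; ring. Qed.

Lemma bern_ext J phi psi u : (forall j, phi j = psi j) -> bern J phi u = bern J psi u.
Proof.
revert phi psi; induction J as [|J IH]; intros phi psi H; simpl; auto.
rewrite (IH phi psi), (IH (fun j => phi (S j)) (fun j => psi (S j))); auto.
Qed.

Lemma bern_le J phi psi u : 0 <= u <= 1 -> (forall j, phi j <= psi j) -> bern J phi u <= bern J psi u.
Proof.
intros Hu; revert phi psi; induction J as [|J IH]; intros phi psi H; simpl; auto.
apply Rplus_le_compat; apply Rmult_le_compat_l; try lra; apply IH; auto.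
Qed.

Lemma bern_variance J c u : bern J (fun j => (INR j - c) ^ 2) u = INR J * u * (1 - u) + (INR J * u - c) ^ 2.
Proof.
revert c; induction J as [|J IH]; intros c; [simpl; ring|].
cbn [bern]; rewrite IH.
rewrite (bern_ext J (fun j => (INR (S j) - c) ^ 2) (fun j => (INR j - (c - 1)) ^ 2)).
- rewrite IH, S_INR; ring.
- intros j; rewrite S_INR; ring.
Qed.

Lemma bern_jensen J phi u : 0 <= u <= 1 -> bern J phi u ^ 2 <= bern J (fun j => phi j ^ 2) u.
Proof.
intros Hu; set (c := bern J phi u).
assert (H : 0 <= bern J (fun j => (phi j - c) ^ 2) u).
{ rewrite <- (bern_const J 0 u); apply bern_le; auto; intros; apply pow2_ge_0. }
rewrite (bern_ext J _ (fun j => 1 * phi j ^ 2 + 1 * (- 2 * c * phi j + c ^ 2 * 1))) in H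
  by (intros; ring).
rewrite bern_lin, (bern_lin J phi (fun _ => 1)), bern_const in H; fold c in H; lra.
Qed.

Lemma bern_at_0 J phi : bern J phi 0 = phi 0%nat.
Proof. revert phi; induction J as [|J IH]; intros; simpl; [easy|]. rewrite !IH; ring. Qed.

Lemma bern_at_1 J phi : bern J phi 1 = phi J.
Proof. revert phi; induction J as [|J IH]; intros; simpl; [easy|]. rewrite !IH; ring. Qed.

Lemma bern_poly J phi : exists p, forall u, bern J phi u = rsum (S J) (fun i => p i * u ^ i).
Proof.
revert phi; induction J as [|J IH]; intros phi.
- exists phi; intros u; simpl; ring.
- destruct (IH phi) as [p Hp]; destruct (IH (fun j => phi (S j))) as [q Hq].
  exists (fun i => (if (i <=? J)%nat then p i else 0) + match i with O => 0 | S i => q i - p i end).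
  intros u; cbn [bern]; rewrite Hp, Hq.
  rewrite (rsum_ext (S (S J)) _ (fun i => (if (i <=? J)%nat then p i else 0) * u ^ i
     + match i with O => 0 | S i => q i - p i end * u ^ i)) by (intros; ring).
  rewrite rsum_plus.
  rewrite (rsum_first (S J) (fun i => match i with O => 0 | S i => q i - p i end * u ^ i)).
  rewrite (rsum_ext (S J) (fun i => (q i - p i) * u ^ S i) (fun i => u * (q i * u ^ i) - u * (p i * u ^ i)))
    by (intros; simpl; ring).
  rewrite rsum_minus, !rsum_scal.
  change (rsum (S (S J)) (fun i => (if (i <=? J)%nat then p i else 0) * u ^ i))
    with (rsum (S J) (fun i => (if (i <=? J)%nat then p i else 0) * u ^ i)
          + (if (S J <=? J)%nat then p (S J) else 0) * u ^ S J).
  rewrite (proj2 (Nat.leb_gt (S J) J)) by lia.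
  rewrite (rsum_ext (S J) (fun i => (if (i <=? J)%nat then p i else 0) * u ^ i) (fun i => p i * u ^ i)).
  + ring.
  + intros i Hi; rewrite (proj2 (Nat.leb_le i J)) by lia; reflexivity.
Qed.

(* On [u = exp (- k / n)] this is the Cesaro weight [max (1 - k / n) 0]. *)
Definition ces (u : R) : R := 1 + ln (Rmax u (exp (- 1))).

Lemma ln_lip a b m : 0 < m -> m <= a -> m <= b -> Rabs (ln a - ln b) <= / m * Rabs (a - b).
Proof.
intros Hm Ha Hb.
assert (H : forall x y, m <= x -> m <= y -> ln x - ln y <= / m * Rabs (x - y)).
{ intros x y Hx Hy; rewrite <- ln_div by lra.
  assert (Hxy : 0 < x / y) by (apply Rdiv_lt_0_compat; lra).
  eapply Rle_trans; [apply ln_le_minus1; auto|].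
  replace (x / y - 1) with (/ y * (x - y)) by (field; lra).
  apply Rle_trans with (/ y * Rabs (x - y)).
  - apply Rmult_le_compat_l; [left; apply Rinv_0_lt_compat; lra|apply Rle_abs].
  - apply Rmult_le_compat_r; [apply Rabs_pos|apply Rinv_le_contravar; lra]. }
apply Rabs_le; split; [|auto].
specialize (H b a Hb Ha); rewrite Rabs_minus_sym in H; lra.
Qed.

Lemma ces_lip u v : Rabs (ces u - ces v) <= exp 1 * Rabs (u - v).
Proof.
unfold ces; replace (1 + ln (Rmax u (exp (-1))) - (1 + ln (Rmax v (exp (-1)))))
  with (ln (Rmax u (exp (-1))) - ln (Rmax v (exp (-1)))) by ring.
eapply Rle_trans; [apply (ln_lip _ _ (exp (- 1)))|].
- apply exp_pos.
- apply Rmax_r.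
- apply Rmax_r.
- rewrite <- exp_Ropp; replace (- (-1)) with 1 by ring; apply Rmult_le_compat_l; [left; apply exp_pos|].
  unfold Rmax; destruct (Rle_dec u (exp (-1))), (Rle_dec v (exp (-1)));
    unfold Rabs; repeat match goal with |- context [Rcase_abs ?y] => destruct (Rcase_abs y) end; lra.
Qed.

Lemma ces_0 : ces 0 = 0.
Proof.
unfold ces; rewrite Rmax_right by (left; apply exp_pos); rewrite ln_exp; ring.
Qed.

Lemma ces_1 : ces 1 = 1.
Proof.
unfold ces; rewrite Rmax_left; [rewrite ln_1; ring|].
rewrite <- exp_0; left; apply exp_increasing; lra.
Qed.

Lemma ces_exp t : ces (exp (- t)) = Rmax (1 - t) 0.
Proof.
unfold ces; destruct (Rle_dec t 1) as [H|H].
- rewrite (Rmax_left (exp (- t))), ln_exp, Rmax_left; try lra.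
  destruct (Req_dec t 1) as [->|]; [right; f_equal; ring|left; apply exp_increasing; lra].
- rewrite (Rmax_right (exp (- t))), ln_exp, Rmax_right; try lra.
  left; apply exp_increasing; lra.
Qed.

(** Bernstein approximation with the variance bound. The factor u (1 - u) matters at both ends: at u
    = exp (- k/n) the factor 1 - u is at most k/n, which offsets the 1/k in the Cauchy-Schwarz step
    of [tauberian], and u makes the sum over k converge. *)
Lemma bern_ces_error J u : (0 < J)%nat -> 0 <= u <= 1 ->
  (ces u - bern J (fun j => ces (INR j / INR J)) u) ^ 2 <= exp 1 ^ 2 * (u * (1 - u) / INR J).
Proof.
intros HJ Hu; assert (HJ0 : 0 < INR J) by now apply lt_0_INR.
replace (ces u - bern J (fun j => ces (INR j / INR J)) u)
  with (bern J (fun j => ces u - ces (INR j / INR J)) u).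
2:{ rewrite (bern_ext J _ (fun j => ces u * 1 + - 1 * ces (INR j / INR J))) by (intros; ring).
    rewrite (bern_lin J (fun _ => 1)), bern_const; ring. }
eapply Rle_trans; [now apply bern_jensen|].
apply Rle_trans with (bern J (fun j => (exp 1 / INR J) ^ 2 * (INR j - INR J * u) ^ 2 + 0 * 0) u).
- apply bern_le; auto; intros j.
  rewrite <- pow2_abs, Rmult_0_l, Rplus_0_r, <- Rpow_mult_distr.
  rewrite <- (pow2_abs (_ * _)); apply pow_incr; split; [apply Rabs_pos|].
  eapply Rle_trans; [apply ces_lip|]; rewrite Rabs_minus_sym.
  replace (INR j / INR J - u) with (/ INR J * (INR j - INR J * u)) by (field; lra).
  replace (exp 1 / INR J * (INR j - INR J * u)) with (exp 1 * (/ INR J * (INR j - INR J * u)))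
    by (field; lra).
  rewrite (Rabs_mult (exp 1)), (Rabs_pos_eq (exp 1)) by (left; apply exp_pos); lra.
- rewrite (bern_lin J (fun j => (INR j - INR J * u) ^ 2) (fun _ => 0)), bern_variance.
  right; field; lra.
Qed.

Lemma exp_le x y : x <= y -> exp x <= exp y.
Proof. intros [H| ->]; [left; now apply exp_increasing|lra]. Qed.

Lemma exp_pow x k : exp (INR k * x) = exp x ^ k.
Proof.
induction k as [|k IH]; [rewrite Rmult_0_l; apply exp_0|].
rewrite S_INR, Rmult_plus_distr_r, Rmult_1_l, exp_plus, IH; simpl; ring.
Qed.

Lemma geo_rsum_exp n P : (0 < n)%nat ->
  rsum P (fun k => exp (- / INR n) ^ S k) <= INR n.
Proof.
intros Hn; assert (Hn0 : 0 < INR n) by now apply lt_0_INR.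
set (x := / INR n); assert (Hx : 0 < x) by now apply Rinv_0_lt_compat.
set (q := exp (- x)).
assert (Hq : 0 < q) by apply exp_pos.
assert (Hq1 : x * q <= 1 - q).
{ pose proof (exp_ineq1_le x) as H; unfold q.
  assert (E : exp (- x) * exp x = 1) by (rewrite <- exp_plus, Rplus_opp_l, exp_0; auto).
  fold q in E; fold q; nra. }
assert (Hsum : (1 - q) * rsum P (fun k => q ^ S k) = q * (1 - q ^ P)).
{ induction P as [|P IH]; cbn [rsum]; [simpl; ring|].
  rewrite Rmult_plus_distr_l, IH; simpl; ring. }
assert (HqP : 0 <= q ^ P) by (apply pow_le; lra).
apply Rmult_le_reg_l with (x * q); [now apply Rmult_lt_0_compat|].
assert (H0 : 0 <= rsum P (fun k => q ^ S k)) by (apply rsum_ge0; intros; apply pow_le; lra).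
apply Rle_trans with (q * (1 - q ^ P)).
- rewrite <- Hsum; apply Rmult_le_compat_r; auto.
- replace (x * q * INR n) with q by (unfold x; field; lra); nra.
Qed.

(** The Bernstein polynomial of [ces] has no constant term and coefficients of sum 1, because [ces]
    is 0 at 0 and 1 at 1. At u = exp (- k/n) it therefore produces a combination of Abel means at
    the radii exp (- j/n), all close to L. The error of replacing the Cesaro weight by it is
    controlled through [Cb]. *)
Lemma tauberian Cb eps : 0 <= Cb -> 0 < eps -> exists J delta, 0 < delta /\
  forall (x A : nat -> R) (L : R) (n : nat), (0 < n)%nat ->
  (forall P, rsum P (fun k => INR (S k) * x k ^ 2) <= Cb) ->
  (forall j, (1 <= j <= J)%nat ->
     is_lim_seq (fun P => rsum P (fun k => x k * (exp (- / INR n) ^ j) ^ S k)) (A j) /\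
     Rabs (A j - L) <= delta) ->
  Rabs (rsum n (fun k => (1 - INR (S k) / INR n) * x k) - L) <= eps.
Proof.
intros HC Heps.
assert (He1 : 0 < exp 1) by apply exp_pos.
set (K := exp 1 ^ 2 * (Cb + 1)).
assert (HK : 0 < K) by (apply Rmult_lt_0_compat; [apply pow_lt|]; lra).
(* J makes the squared approximation error at most (eps/2)^2; [Cb + 1] instead of [Cb] keeps K
   positive. *)
destruct (archimed_cor1 ((eps / 2) ^ 2 / K)) as (J & HJ & HJ0).
{ apply Rdiv_lt_0_compat; auto; apply pow_lt; lra. }
assert (HJ1 : 0 < INR J) by now apply lt_0_INR.
assert (HKJ : K / INR J <= (eps / 2) ^ 2).
{ apply Rlt_le, (Rmult_le_compat_r K) in HJ; [|lra].
  replace ((eps / 2) ^ 2 / K * K) with ((eps / 2) ^ 2) in HJ by (field; lra).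
  unfold Rdiv at 1; lra. }
set (phi := fun j => ces (INR j / INR J)).
destruct (bern_poly J phi) as [p Hp].
assert (Hp0 : p 0%nat = 0).
{ pose proof (bern_at_0 J phi) as H; rewrite Hp, rsum_first, rsum_0 in H.
  - unfold phi in H; replace (INR 0 / INR J) with 0 in H by (simpl; field; lra).
    rewrite ces_0 in H; simpl in H; lra.
  - intros i _; simpl; ring. }
assert (Hp1 : rsum J (fun i => p (S i)) = 1).
{ pose proof (bern_at_1 J phi) as H; rewrite Hp, rsum_first, Hp0 in H.
  unfold phi in H; replace (INR J / INR J) with 1 in H by (field; lra); rewrite ces_1 in H.
  rewrite (rsum_ext J _ (fun i => p (S i))) in H; [lra|]; intros; rewrite pow1; ring. }
set (SP := rsum J (fun i => Rabs (p (S i)))).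
assert (HSP : 0 <= SP) by (apply rsum_ge0; intros; apply Rabs_pos).
exists J, (eps / (2 * (SP + 1))); split; [apply Rdiv_lt_0_compat; lra|].
intros x A L n Hn HCb HA.
assert (Hn0 : 0 < INR n) by now apply lt_0_INR.
set (q := exp (- / INR n)) in *; assert (Hq : 0 < q) by apply exp_pos.
assert (Hqk : forall k, 0 <= q ^ S k <= 1 /\ 1 - q ^ S k <= INR (S k) / INR n).
{ intros k; assert (Hexp : q ^ S k = exp (- (INR (S k) / INR n))).
  { unfold q; rewrite <- exp_pow; f_equal; field; lra. }
  assert (0 <= INR (S k) / INR n) by (apply Rmult_le_pos; [apply pos_INR|left; now apply Rinv_0_lt_compat]).
  split; [split; [apply pow_le; lra|]|].
  - rewrite Hexp, <- exp_0; destruct (Req_dec (INR (S k) / INR n) 0) as [->|]; [rewrite Ropp_0; lra|].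
    left; apply exp_increasing; lra.
  - rewrite Hexp; pose proof (exp_ineq1_le (- (INR (S k) / INR n))); lra. }
set (Ces := rsum n (fun k => (1 - INR (S k) / INR n) * x k)).
assert (HCes : forall P, (n <= P)%nat -> rsum P (fun k => x k * ces (q ^ S k)) = Ces).
{ intros P HP; replace P with (n + (P - n))%nat by lia; rewrite rsum_add, (rsum_0 (P - n)).
  - rewrite Rplus_0_r; apply rsum_ext; intros k Hk.
    unfold q; rewrite <- exp_pow; replace (INR (S k) * - / INR n) with (- (INR (S k) / INR n))
      by (field; lra).
    rewrite ces_exp, Rmax_left; [ring|].
    assert (INR (S k) / INR n <= 1); [|lra].
    apply Rmult_le_reg_r with (INR n); auto; unfold Rdiv; rewrite Rmult_assoc, Rinv_l, Rmult_1_r, Rmult_1_l by lra.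
    apply le_INR; lia.
  - intros k _; unfold q; rewrite <- exp_pow.
    replace (INR (S (n + k)) * - / INR n) with (- (INR (S (n + k)) / INR n)) by (field; lra).
    rewrite ces_exp, Rmax_right; [ring|].
    assert (1 <= INR (S (n + k)) / INR n); [|lra].
    apply Rmult_le_reg_r with (INR n); auto; unfold Rdiv; rewrite Rmult_assoc, Rinv_l, Rmult_1_r, Rmult_1_l by lra.
    apply le_INR; lia. }
set (PA := rsum J (fun i => p (S i) * A (S i))).
assert (Hlim : is_lim_seq (fun P => rsum P (fun k => x k * bern J phi (q ^ S k))) PA).
{ apply is_lim_seq_ext with (fun P => rsum J (fun i => p (S i) * rsum P (fun k => x k * (q ^ S i) ^ S k))).
  - intros P.
    rewrite (rsum_ext J _ (fun i => rsum P (fun k => p (S i) * (x k * (q ^ S i) ^ S k))))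
      by (intros; rewrite rsum_scal; reflexivity).
    rewrite rsum_swap; apply rsum_ext; intros k _.
    rewrite Hp, rsum_first, Hp0, Rmult_0_l, Rplus_0_l, <- rsum_scal; apply rsum_ext; intros i _.
    rewrite <- !pow_mult, (Nat.mul_comm (S i)); ring.
  - apply (is_lim_seq_rsum J (fun i P => p (S i) * rsum P (fun k => x k * (q ^ S i) ^ S k))).
    intros i Hi; apply (is_lim_seq_scal_l _ (p (S i)) (A (S i))), HA; lia. }
assert (Hclose : forall P, Rabs (rsum P (fun k => x k * ces (q ^ S k))
    - rsum P (fun k => x k * bern J phi (q ^ S k))) <= eps / 2).
{ intros P; rewrite <- rsum_minus.
  set (h := fun k => ces (q ^ S k) - bern J phi (q ^ S k)).
  (* Splitting off the square root of the index prepares Cauchy-Schwarz: the squares of one factor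
     sum to at most [Cb], those of the other to at most exp(1)^2 / J. *)
  rewrite (rsum_ext P _ (fun k => (sqrt (INR (S k)) * x k) * (/ sqrt (INR (S k)) * h k))).
  2:{ intros k _; unfold h; assert (0 < sqrt (INR (S k))) by (apply sqrt_lt_R0, lt_0_INR; lia).
      field; lra. }
  assert (Hsq : (rsum P (fun k => (sqrt (INR (S k)) * x k) * (/ sqrt (INR (S k)) * h k))) ^ 2 <= (eps / 2) ^ 2).
  { eapply Rle_trans; [apply rsum_cauchy_schwarz|].
    eapply Rle_trans; [|exact HKJ].
    apply Rle_trans with (Cb * (exp 1 ^ 2 / INR J)).
    - apply Rmult_le_compat.
      + apply rsum_ge0; intros; apply pow2_ge_0.
      + apply rsum_ge0; intros; apply pow2_ge_0.
      + eapply Rle_trans; [|apply (HCb P)]; right; apply rsum_ext; intros k _.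
        rewrite Rpow_mult_distr, pow2_sqrt by apply pos_INR; reflexivity.
      + apply Rle_trans with (exp 1 ^ 2 / INR J / INR n * rsum P (fun k => q ^ S k)).
        * rewrite <- rsum_scal; apply rsum_le; intros k _.
          rewrite Rpow_mult_distr, pow_inv, pow2_sqrt by apply pos_INR.
          destruct (Hqk k) as [H1 H2].
          assert (HSk : 0 < INR (S k)) by (apply lt_0_INR; lia).
          eapply Rle_trans.
          { apply Rmult_le_compat_l; [left; now apply Rinv_0_lt_compat|].
            unfold h, phi; apply bern_ces_error; auto. }
          apply Rle_trans with (/ INR (S k) * (exp 1 ^ 2 * (q ^ S k * (INR (S k) / INR n) / INR J))).
          -- apply Rmult_le_compat_l; [left; now apply Rinv_0_lt_compat|].
             apply Rmult_le_compat_l; [apply pow2_ge_0|].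
             apply Rmult_le_compat_r; [left; now apply Rinv_0_lt_compat|].
             apply Rmult_le_compat_l; lra.
          -- right; field; lra.
        * apply Rle_trans with (exp 1 ^ 2 / INR J / INR n * INR n); [|right; field; lra].
          apply Rmult_le_compat_l; [|now apply geo_rsum_exp].
          apply Rlt_le, Rdiv_lt_0_compat; auto; apply Rdiv_lt_0_compat; auto; now apply pow_lt.
    - unfold K, Rdiv; rewrite (Rmult_comm (exp 1 ^ 2) (Cb + 1)), Rmult_assoc.
      apply Rmult_le_compat_r; [|lra]; apply Rmult_le_pos; [apply pow2_ge_0|].
      left; now apply Rinv_0_lt_compat. }
  rewrite <- (Rabs_pos_eq (eps / 2)) by lra; apply Rsqr_le_abs_0; rewrite !Rsqr_pow2; exact Hsq. }
assert (HCP : Rabs (Ces - PA) <= eps / 2).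
{ assert (Hl2 : is_lim_seq (fun P => Rabs (Ces - rsum P (fun k => x k * bern J phi (q ^ S k)))) (Rabs (Ces - PA))).
  { apply (is_lim_seq_abs _ (Finite (Ces - PA))), is_lim_seq_minus'; auto using is_lim_seq_const. }
  apply (is_lim_seq_le_loc _ (fun _ => eps / 2) (Finite _) (eps / 2)) in Hl2; auto using is_lim_seq_const.
  exists n; intros P HP; rewrite <- (HCes P HP); apply Hclose. }
assert (HPL : Rabs (PA - L) <= eps / 2).
{ replace (PA - L) with (rsum J (fun i => p (S i) * (A (S i) - L))).
  - eapply Rle_trans; [apply rsum_abs|].
    apply Rle_trans with (rsum J (fun i => eps / (2 * (SP + 1)) * Rabs (p (S i)))).
    + apply rsum_le; intros i Hi; rewrite Rabs_mult, Rmult_comm; apply Rmult_le_compat_r; [apply Rabs_pos|].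
      apply HA; lia.
    + rewrite rsum_scal; fold SP; apply Rle_trans with (eps / (2 * (SP + 1)) * (SP + 1)); [|right; field; lra].
      apply Rmult_le_compat_l; [left; apply Rdiv_lt_0_compat|]; lra.
  - rewrite (rsum_ext J _ (fun i => p (S i) * A (S i) - L * p (S i))) by (intros; ring).
    rewrite rsum_minus, rsum_scal, Hp1; unfold PA; ring. }
replace (Ces - L) with ((Ces - PA) + (PA - L)) by ring.
eapply Rle_trans; [apply Rabs_triang|]; lra.
Qed.

(** * Uniform bounds along the sequence *)

(** A limit point of hypothetical bad points on the circle has a neighbourhood on which the
    convergence is uniform. *)
Lemma loc_unif_circle fs f r e : loc_unif_conv_disk fs f -> 0 < r < 1 -> 0 < e ->
  exists N, forall m, (N <= m)%nat -> forall z, Cmod z = r -> Cmod (fs m z - f z)%C < e.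
Proof.
intros Hc Hr He; apply NNPP; intros Hno.
assert (Hbad : forall N, exists p : nat * C, (N <= fst p)%nat /\ Cmod (snd p) = r /\
  e <= Cmod (fs (fst p) (snd p) - f (snd p))%C).
{ intros N; apply NNPP; intros H; apply Hno; exists N; intros m Hm z Hz.
  apply Rnot_le_lt; intros Hle; apply H; exists (m, z); auto. }
set (sel := fun N => proj1_sig (constructive_indefinite_description _ (Hbad N))).
assert (Hsel : forall N, (N <= fst (sel N))%nat /\ Cmod (snd (sel N)) = r /\
  e <= Cmod (fs (fst (sel N)) (snd (sel N)) - f (snd (sel N)))%C).
{ intros N; unfold sel; destruct (constructive_indefinite_description _ (Hbad N)); auto. }
destruct (BW_C (fun N => snd (sel N)) r) as (phi & l & Hphi).
{ intros n; destruct (Hsel n) as (_ & -> & _); lra. }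
assert (Hl : Cmod l <= r).
{ apply (Cmod_lim_le (fun n => snd (sel (phi n)))); [|apply Hphi].
  intros n; destruct (Hsel (phi n)) as (_ & -> & _); lra. }
destruct (Hc l) as (delta & Hdelta & _ & Hconv); [unfold in_disk; lra|].
destruct (Hconv e He) as [N1 HN1].
destruct (inv_INR_S_lt (delta / 2)) as [N2 HN2]; [lra|].
specialize (HN2 (N1 + N2)%nat ltac:(lia)); destruct (Hphi (N1 + N2)%nat) as [H1 H2].
destruct (Hsel (phi (N1 + N2)%nat)) as (H3 & _ & H5).
apply (Rle_not_lt _ _ H5), HN1; [lia|lra].
Qed.

(** [grunsky_bounded] with constant charge 1 and Y p = p rho^p conj (lf a p) / 2: the terms linear
    in Y give S0, the norm is S0/4, and the remaining quadratic form has real part at least - S0/4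
    by [grunsky_quadratic] at i X. What is left is S0/2 <= ln (R1/rho). *)
Lemma lf_energy a K rho R0 R1 : univ a -> 0 < rho < 1 -> R0 < R1 ->
  (forall z, Cmod z = rho -> Cmod (ev a z) <= R0) ->
  rsum K (fun p => INR (S p) * Cmod (lf a (S p)) ^ 2 * rho ^ (2 * S p)) <= 2 * ln (R1 / rho).
Proof.
intros Hu Hrho HR Hmax.
destruct (log_quot_expansion a Hu) as (d & Hd0 & Hsym & Hbd & Hrow & Hln).
assert (Hd : log_expansion a d) by (repeat split; auto).
set (W := fun p => (RtoC (/ 2 * INR p * rho ^ p) * Cconj (lf a p))%C).
set (Y := fun p => match p with O => RtoC 1 | S _ => W p end).
set (S0 := rsum K (fun p => INR (S p) * Cmod (lf a (S p)) ^ 2 * rho ^ (2 * S p))).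
set (X := fun p => (RtoC (rho ^ S p) * W (S p))%C).
pose proof (grunsky_bounded a d rho R0 R1 Hu Hrho HR Hbd Hln Hmax K Y eq_refl) as H1.
pose proof (grunsky_quadratic a d K (fun p => Ci * X p)%C Hu Hd) as H2.
assert (Hr0 : forall p, 0 <= rho ^ p) by (intros; apply pow_le; lra).
assert (HW : forall p, Cmod (W (S p)) ^ 2 / INR (S p)
   = / 4 * (INR (S p) * Cmod (lf a (S p)) ^ 2 * rho ^ (2 * S p))).
{ intros p; unfold W; rewrite Cmod_scal, Cmod_conj.
  2:{ apply Rmult_le_pos; auto; apply Rmult_le_pos; [lra|apply pos_INR]. }
  replace (2 * S p)%nat with (S p + S p)%nat by lia; rewrite pow_add.
  field; apply not_0_INR; lia. }
assert (HWs : rsum K (fun n => Cmod (Y (S n)) ^ 2 / INR (S n)) = / 4 * S0).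
{ unfold S0; rewrite <- rsum_scal; apply rsum_ext; intros p _; apply HW. }
assert (HX : wnorm K (fun p => Ci * X p)%C <= / 4 * S0).
{ rewrite <- HWs; apply rsum_le; intros p _; unfold X, Y.
  apply Rmult_le_compat_r; [left; apply inv_INR_S_pos|].
  apply pow_incr; split; [apply Cmod_ge_0|].
  rewrite Cmod_mult, Cmod_scal by auto.
  assert (HCi : Cmod Ci = 1) by (transitivity (sqrt 1); [unfold Cmod, Ci; f_equal; simpl; ring|apply sqrt_1]).
  rewrite HCi, Rmult_1_l; rewrite <- (Rmult_1_l (Cmod (W (S p)))) at 2.
  apply Rmult_le_compat_r; [apply Cmod_ge_0|].
  rewrite <- (pow1 (S p)); apply pow_incr; lra. }
assert (HB : bil d K (fun p => Ci * X p)%C (fun p => Ci * X p)%C = (- bil d K X X)%C).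
{ unfold bil; replace (- csum K (fun p => csum K (fun q => d (S p) (S q) * (X p * X q))))%C
    with (- RtoC 1 * csum K (fun p => csum K (fun q => d (S p) (S q) * (X p * X q))))%C by ring.
  rewrite <- csum_scal; apply csum_ext; intros p _; rewrite <- csum_scal; apply csum_ext; intros q _.
  assert (HCi : (Ci * Ci = - RtoC 1)%C) by (apply C_eq; simpl; ring).
  rewrite <- HCi; ring. }
set (L := csum K (fun p => lf a (S p) * (RtoC (rho ^ S p) * W (S p)))%C).
assert (HL : L = RtoC (/ 2 * S0)).
{ unfold L, S0; rewrite <- rsum_scal, RtoC_rsum; apply csum_ext; intros p _.
  unfold W; replace (2 * S p)%nat with (S p + S p)%nat by lia; rewrite pow_add.
  rewrite !RtoC_mult, Cmod_sq; ring. }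
assert (HQ : csum (S K) (fun p => csum (S K) (fun q => d p q * RtoC (rho ^ (p + q)) * (Y p * Y q)))%C
   = (L + L + bil d K X X)%C).
{ rewrite csum_first.
  rewrite (csum_first K (fun q => d 0%nat q * RtoC (rho ^ (0 + q)) * (Y 0%nat * Y q))%C).
  rewrite (csum_ext K (fun i => csum (S K) _)
    (fun p => lf a (S p) * (RtoC (rho ^ S p) * W (S p)) + csum K (fun q => d (S p) (S q) * (X p * X q)))%C).
  - rewrite csum_plus; fold (bil d K X X); fold L; rewrite Hd0, lf_0 by auto.
    rewrite (csum_ext K (fun i => d 0%nat (S i) * _ * _)%C
      (fun p => lf a (S p) * (RtoC (rho ^ S p) * W (S p)))%C); [fold L; ring|].
    intros p _; rewrite Hd0; simpl Y; simpl (0 + S p)%nat; ring.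
  - intros p _; rewrite csum_first; f_equal.
    + rewrite Hsym, Hd0, Nat.add_0_r; simpl Y; ring.
    + apply csum_ext; intros q _; unfold X; simpl Y; rewrite pow_add, RtoC_mult; ring. }
rewrite HQ, !Re_plus, HL, re_RtoC, HWs in H1.
rewrite HB, re_opp in H2.
change (Re (Y 0%nat)) with 1 in H1; lra.
Qed.

(** A Dini argument: closeness at the single radius r0 suffices, since [growth] decreases in r for
    every f_m. *)
Lemma growth_eventually fs a f b alpha c :
  (forall m, univ (a m) /\ forall z, Cmod z < 1 -> fs m z = ev (a m) z) ->
  univ b -> (forall z, Cmod z < 1 -> f z = ev b z) ->
  loc_unif_conv_disk fs f -> is_hayman_index f alpha -> alpha < c ->
  exists r0 N, 0 < r0 < 1 /\ forall m, (N <= m)%nat -> forall t, r0 <= t < 1 -> growth (fs m) t <= c.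
Proof.
intros Ha Hub Hf Hc Hh Hal.
pose proof (growth_lim f alpha Hh) as Hl.
apply is_lim_seq_spec in Hl; destruct (Hl (mkposreal ((c - alpha) / 2) ltac:(lra))) as [N0 HN0].
specialize (HN0 N0 (Nat.le_refl _)); simpl pos in HN0.
pose proof (radii_bounds N0) as Hr; set (r0 := 1 - / INR (S (S N0))) in *.
assert (Hg : growth f r0 < (c + alpha) / 2) by (apply Rabs_def2 in HN0; lra).
set (e := (c - alpha) / 2 * r0).
assert (He : 0 < e) by (apply Rmult_lt_0_compat; lra).
destruct (loc_unif_circle fs f r0 e Hc ltac:(lra) He) as [N HN].
exists r0, N; split; [lra|]; intros m Hm t Ht.
destruct (Ha m) as [Hum Hfm].
apply Rle_trans with (growth (fs m) r0); [apply (growth_decreasing (a m)); auto; lra|].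
assert (HM : Minf r0 (fs m) <= Minf r0 f + e).
{ apply (Minf_spec (a m) (fs m)); auto; [lra|]; intros z Hz.
  assert (Hfz : Cmod (f z) <= Minf r0 f) by (apply (Minf_spec b f); auto; lra).
  specialize (HN m Hm z Hz); pose proof (Cmod_triangle (fs m z - f z)%C (f z)) as Htri.
  replace (fs m z - f z + f z)%C with (fs m z) in Htri by ring; lra. }
assert (Hq : 0 <= (1 - r0) ^ 2 <= 1) by (split; [apply pow2_ge_0|nra]).
apply Rle_trans with (growth f r0 + (c - alpha) / 2); [|lra].
unfold growth; apply Rle_trans with ((1 - r0) ^ 2 * (Minf r0 f + e) / r0).
- apply Rmult_le_compat_r; [left; apply Rinv_0_lt_compat; lra|]; apply Rmult_le_compat_l; lra.
- unfold e; replace ((1 - r0) ^ 2 * (Minf r0 f + (c - alpha) / 2 * r0) / r0)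
    with ((1 - r0) ^ 2 * Minf r0 f / r0 + (1 - r0) ^ 2 * ((c - alpha) / 2)) by (field; lra).
  nra.
Qed.

(** * Coefficient bound when the growth is small *)

Lemma ln_le_harmonic k : ln (INR (S k)) <= rsum k (fun j => / INR (S j)).
Proof.
induction k as [|k IH]; [simpl; rewrite ln_1; lra|cbn [rsum]].
assert (H : 0 < INR (S k)) by (apply lt_0_INR; lia).
assert (H1 : 0 < INR (S (S k))) by (apply lt_0_INR; lia).
replace (INR (S (S k))) with (INR (S k) * (INR (S (S k)) / INR (S k))) by (field; lra).
rewrite ln_mult by (auto; now apply Rdiv_lt_0_compat).
pose proof (ln_le_minus1 (INR (S (S k)) / INR (S k)) ltac:(now apply Rdiv_lt_0_compat)) as H2.
replace (INR (S (S k)) / INR (S k) - 1) with (/ INR (S k)) in H2 by (rewrite (S_INR (S k)); field; lra).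
lra.
Qed.

Lemma bernoulli_ineq x k : 0 <= x <= 1 -> 1 - INR k * x <= (1 - x) ^ k.
Proof.
intros Hx; induction k as [|k IH]; [simpl; lra|].
rewrite S_INR; simpl pow; pose proof (pos_INR k).
apply Rle_trans with ((1 - x) * (1 - INR k * x)); [nra|].
apply Rmult_le_compat_l; lra.
Qed.

(** For the radius 1 - 1/(2 N), N = k + 1, Bernoulli's inequality gives 1 - j/N <= rho^(2 j), so the
    energy bound applies to the Cesaro weights. The energy contributes at most ln N + ln (8 eta)/2,
    the harmonic sum at most - ln N, and the terms 1/N at most 1. *)
Lemma coef_le_growth a f k eta : univ a -> (forall z, Cmod z < 1 -> f z = ev a z) ->
  0 < eta -> growth f (1 - / (2 * INR (S k))) <= eta ->
  Cmod (a (S k)) <= INR (S k) * exp (1 + / 2 * ln (8 * eta)).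
Proof.
intros Hu Hf Heta Hg.
assert (HN1 : 1 <= INR (S k)) by (rewrite S_INR; pose proof (pos_INR k); lra).
set (N := INR (S k)) in *.
assert (Hx : 0 < / (2 * N) <= / 2).
{ split; [apply Rinv_0_lt_compat; lra|apply Rinv_le_contravar; lra]. }
set (rho := 1 - / (2 * N)) in *.
assert (Hrho : 0 < rho < 1) by (unfold rho; lra).
destruct (Minf_spec a f rho Hu Hf Hrho) as (Hub & _ & _).
(* (1 - rho)^2 = 1/(4 N^2) gives the bound 4 N^2 eta rho; the factor is doubled to make the
   inequality strict. *)
assert (HR : Minf rho f < 8 * N ^ 2 * eta * rho).
{ assert (HM : Minf rho f <= 4 * N ^ 2 * eta * rho).
  { apply Rmult_le_reg_l with ((1 - rho) ^ 2 / rho).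
    - apply Rdiv_lt_0_compat; [apply pow_lt|]; lra.
    - replace ((1 - rho) ^ 2 / rho * (4 * N ^ 2 * eta * rho)) with eta.
      + unfold growth in Hg; eapply Rle_trans; [|exact Hg]; right; field; lra.
      + replace (1 - rho) with (/ (2 * N)) by (unfold rho; ring); field; lra. }
  assert (0 < N ^ 2 * eta * rho); [|lra].
  apply Rmult_lt_0_compat; [apply Rmult_lt_0_compat; auto; apply pow_lt|]; lra. }
pose proof (lf_energy a k rho (Minf rho f) (8 * N ^ 2 * eta * rho) Hu Hrho HR) as HE.
set (S0 := rsum k _) in HE.
assert (HS0 : S0 <= 2 * (2 * ln N + ln (8 * eta))).
{ replace (2 * ln N + ln (8 * eta)) with (ln (8 * N ^ 2 * eta * rho / rho)).
  - apply HE; intros z Hz; rewrite <- Hf by lra; auto.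
  - replace (8 * N ^ 2 * eta * rho / rho) with (N ^ 2 * (8 * eta)) by (field; lra).
    rewrite ln_mult, ln_sq; try lra; apply pow_lt; lra. }
eapply Rle_trans; [now apply coef_le_milin|].
fold N; apply Rmult_le_compat_l; [lra|].
assert (HM : milin (fun j => RtoC (/ 2) * lf a j)%C k
   <= rsum k (fun j => / 4 * (INR (S j) * Cmod (lf a (S j)) ^ 2 * rho ^ (2 * S j))
        - (/ INR (S j) - / N))).
{ apply rsum_le; intros j Hj; fold N; rewrite Cmod_scal by lra.
  assert (HSj : 0 < INR (S j)) by (apply lt_0_INR; lia).
  assert (HB : 1 - INR (S j) / N <= rho ^ (2 * S j)).
  { unfold rho; eapply Rle_trans; [|apply bernoulli_ineq; lra].
    rewrite mult_INR; simpl (INR 2); right; field; lra. }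
  replace ((1 - INR (S j) / N) * (INR (S j) * (/ 2 * Cmod (lf a (S j))) ^ 2 - / INR (S j)))
    with (/ 4 * (INR (S j) * Cmod (lf a (S j)) ^ 2 * (1 - INR (S j) / N)) - (/ INR (S j) - / N))
    by (field; lra).
  apply Rplus_le_compat_r, Rmult_le_compat_l; [lra|]; apply Rmult_le_compat_l; auto.
  apply Rmult_le_pos; [lra|apply pow2_ge_0]. }
rewrite rsum_minus, rsum_scal, rsum_minus, rsum_const in HM; fold S0 in HM.
pose proof (ln_le_harmonic k) as HH; fold N in HH.
assert (HkN : INR k * / N <= 1).
{ apply Rmult_le_reg_r with N; [lra|]; rewrite Rmult_assoc, Rinv_l, Rmult_1_r, Rmult_1_l by lra.
  apply le_INR; lia. }
apply exp_le; lra.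
Qed.

(** * Coefficient bound when the Hayman index is positive *)

Definition radial (a : nat -> C) (xi : C) (k : nat) : R :=
  Re (lf a (S k) * xi ^ S k)%C - 2 * / INR (S k).

Lemma radial_lim a xi t : univ a -> Cmod xi = 1 -> 0 < t < 1 ->
  is_lim_seq (fun P => rsum P (fun k => radial a xi k * t ^ S k))
    (ln ((1 - t) ^ 2 * Cmod (ecoef a (t * xi)%C 0))).
Proof.
intros Hu Hxi Ht; pose proof Hu as (_ & Ha1 & Hra & _).
assert (Hz : Cmod (t * xi)%C = t) by (rewrite Cmod_scal, Hxi by lra; ring).
assert (HE : 0 < Cmod (ecoef a (t * xi)%C 0)) by (apply Cmod_gt_0, (shift0_zero_free a Hu); lra).
assert (Hlog : Re (ev (lf a) (t * xi)%C) = ln (Cmod (ecoef a (t * xi)%C 0))).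
{ pose proof (flog_ev (shift a 0) (t * xi)%C (rad1_shift a 0 Hra) (shift0_zero_free a Hu) ltac:(lra)) as H.
  change (shift a 0 0) with (a 1%nat) in H; rewrite Ha1, Cmod_1, pow1, ln_1 in H.
  change (ev (shift a 0) (t * xi)%C) with (ecoef a (t * xi)%C 0) in H.
  rewrite ln_sq in H by auto; fold (lf a) in H; lra. }
assert (Hs : is_lim_seq (fun P => rsum P (fun k => Re (lf a (S k) * xi ^ S k)%C * t ^ S k))
    (ln (Cmod (ecoef a (t * xi)%C 0)))).
{ destruct (ev_cis (lf a) (t * xi)%C t) as [H _].
  - apply rad1_summ; [now apply rad1_lf|lra].
  - lra.
  - rewrite Hlog in H; apply is_series_rsum, is_lim_seq_incr_1 in H.
    eapply is_lim_seq_ext; [|exact H]; intros P; cbn beta.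
    rewrite rsum_first, lf_0 by auto.
    replace (Re (RtoC 0 * (t * xi) ^ 0)%C) with 0 by (simpl; ring); rewrite Rplus_0_l.
    apply rsum_ext; intros k _; rewrite Cpow_mult_l, <- RtoC_pow.
    replace (lf a (S k) * (RtoC (t ^ S k) * xi ^ S k))%C with (RtoC (t ^ S k) * (lf a (S k) * xi ^ S k))%C by ring.
    rewrite Re_scal; ring. }
assert (Hs2 := ln_one_minus_lim (RtoC t)).
replace (Cmod (1 - t)%C) with (1 - t) in Hs2.
2:{ rewrite <- RtoC_minus, Cmod_R, Rabs_pos_eq; lra. }
rewrite Cmod_R, Rabs_pos_eq in Hs2 by lra; specialize (Hs2 ltac:(lra)).
rewrite ln_mult by (auto; apply pow_lt; lra).
eapply is_lim_seq_ext; [|apply (is_lim_seq_plus' _ _ _ _ Hs2 Hs)].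
intros P; cbn beta; rewrite <- rsum_scal, <- rsum_plus; apply rsum_ext; intros k _.
unfold radial; rewrite <- RtoC_pow, re_RtoC; ring.
Qed.

Lemma radial_sq a xi k : Cmod xi = 1 ->
  radial a xi k ^ 2 <= Cmod (lf a (S k) - RtoC (2 * / INR (S k)) * Cconj xi ^ S k)%C ^ 2.
Proof.
intros Hxi; unfold radial; set (D := (_ - _ * Cconj xi ^ S k)%C).
assert (Hc : (Cconj xi ^ S k * xi ^ S k)%C = RtoC 1).
{ rewrite <- Cpow_mult_l, Cmult_comm, <- Cmod_sq, Hxi, pow1, Cpow_1_l; reflexivity. }
replace (Re (lf a (S k) * xi ^ S k)%C - 2 * / INR (S k)) with (Re (D * xi ^ S k)%C).
- rewrite <- (pow2_abs (Re _)); apply pow_incr; split; [apply Rabs_pos|].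
  eapply Rle_trans; [apply re_le_Cmod|]; rewrite Cmod_mult, Cmod_pow, Hxi, pow1; lra.
- replace (D * xi ^ S k)%C with (lf a (S k) * xi ^ S k - RtoC (2 * / INR (S k)) * (Cconj xi ^ S k * xi ^ S k))%C
    by (unfold D; ring).
  rewrite Hc, Re_minus, Re_scal, re_RtoC; ring.
Qed.

Lemma milin_le_radial a xi n B : Cmod xi = 1 ->
  (forall P, rsum P (fun p => INR (S p) * Cmod (lf a (S p)
     - RtoC (2 * / INR (S p)) * Cconj xi ^ S p)%C ^ 2) <= B) ->
  milin (fun k => RtoC (/ 2) * lf a k)%C n
  <= / 4 * B + rsum (S n) (fun k => (1 - INR (S k) / INR (S n)) * radial a xi k).
Proof.
intros Hxi HB; assert (HN : 0 < INR (S n)) by (apply lt_0_INR; lia).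
(* The term of index n + 1 has weight 0; it is included to match the form of [tauberian]. *)
cbn [rsum]; replace ((1 - INR (S n) / INR (S n)) * radial a xi n) with 0 by (field; lra).
rewrite Rplus_0_r; eapply Rle_trans; [|apply Rplus_le_compat_r, Rmult_le_compat_l, (HB n); lra].
rewrite <- rsum_scal, <- rsum_plus; apply rsum_le; intros k Hk.
set (D := Cmod (_ - _)%C ^ 2).
assert (HSk : 0 < INR (S k)) by (apply lt_0_INR; lia).
assert (HD : D = Cmod (lf a (S k)) ^ 2 - 4 * / INR (S k) * Re (lf a (S k) * xi ^ S k)%C
   + 4 * (/ INR (S k)) ^ 2).
{ unfold D; replace (lf a (S k) - RtoC (2 * / INR (S k)) * Cconj xi ^ S k)%C
    with (lf a (S k) + RtoC (- (2 * / INR (S k))) * Cconj xi ^ S k)%C by (rewrite RtoC_opp; ring).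
  rewrite Cmod_plus_sq, Cmod_mult, Cmod_pow, Cmod_conj, Hxi, pow1, Cmod_R, Rmult_1_r, pow2_abs.
  rewrite Cmult_conj, Cpow_conj, Cconj_conj.
  replace (Cconj (RtoC (- (2 * / INR (S k))))) with (RtoC (- (2 * / INR (S k)))) by (apply C_eq; simpl; ring).
  replace (lf a (S k) * (RtoC (- (2 * / INR (S k))) * xi ^ S k))%C
    with (RtoC (- (2 * / INR (S k))) * (lf a (S k) * xi ^ S k))%C by ring.
  rewrite Re_scal; ring. }
assert (Hw : 0 <= INR (S k) / INR (S n)) by (apply Rlt_le, Rdiv_lt_0_compat; auto).
assert (HD0 : 0 <= D) by apply pow2_ge_0.
rewrite Cmod_scal by lra.
replace (INR (S k) * (/ 2 * Cmod (lf a (S k))) ^ 2 - / INR (S k))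
  with (/ 4 * (INR (S k) * D) + radial a xi k) by (rewrite HD; unfold radial; field; lra).
assert (0 <= / 4 * (INR (S k) * D)) by (apply Rmult_le_pos; [lra|apply Rmult_le_pos; lra]).
nra.
Qed.

(** J and delta are fixed before the function, from C0 and tau alone; this is the source of the
    uniformity in m. The condition on n places all radii exp (- j/(n+1)) with 1 <= j <= J in [r0,
    1). *)
Lemma coef_le_positive C0 tau : 0 <= C0 -> 0 < tau -> exists J delta, 0 < delta /\
  forall a f alpha L n r0, univ a -> (forall z, Cmod z < 1 -> f z = ev a z) ->
  is_hayman_index f alpha -> 0 < alpha -> - 2 * ln alpha <= C0 -> Rabs (ln alpha - L) <= delta ->
  0 < r0 < 1 -> (forall t, r0 <= t < 1 -> ln (growth f t) <= L + delta) ->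
  INR J <= (1 - r0) * INR (S n) ->
  Cmod (a (S n)) <= INR (S n) * exp (/ 2 * ln alpha + tau).
Proof.
intros HC0 Htau; destruct (tauberian C0 (tau / 2) HC0 ltac:(lra)) as (J & delta0 & Hd0 & HT).
exists J, (Rmin delta0 (tau / 2)); split; [apply Rmin_glb_lt; lra|].
intros a f alpha L n r0 Hu Hf Hh Hal HlnC HL Hr0 Hg HJ.
pose proof (Rmin_l delta0 (tau / 2)); pose proof (Rmin_r delta0 (tau / 2)).
set (delta := Rmin delta0 (tau / 2)) in *.
destruct (bazilevich a f alpha Hu Hf Hh Hal) as (xi & Hxi & HB & Hrad).
assert (HN : 0 < INR (S n)) by (apply lt_0_INR; lia).
set (q := exp (- / INR (S n))).
specialize (HT (radial a xi)
  (fun j => ln ((1 - q ^ j) ^ 2 * Cmod (ecoef a (RtoC (q ^ j) * xi)%C 0))) L (S n) ltac:(lia)).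
assert (HCes : Rabs (rsum (S n) (fun k => (1 - INR (S k) / INR (S n)) * radial a xi k) - L) <= tau / 2).
{ apply HT.
  - intros P; eapply Rle_trans; [|exact HlnC]; eapply Rle_trans; [|apply (HB P)].
    apply rsum_le; intros k _; apply Rmult_le_compat_l; [apply pos_INR|now apply radial_sq].
  - intros j Hj; fold q.
    assert (Hq : q ^ j = exp (- (INR j / INR (S n)))).
    { unfold q; rewrite <- exp_pow; f_equal; field; lra. }
    assert (Hj1 : 1 <= INR j) by (apply (le_INR 1); lia).
    assert (HjJ : INR j <= INR J) by (apply le_INR; lia).
    assert (Hjn : 0 < INR j / INR (S n)) by (apply Rdiv_lt_0_compat; lra).
    assert (Ht : r0 <= q ^ j < 1).
    { rewrite Hq; split.
      - pose proof (exp_ineq1_le (- (INR j / INR (S n)))) as He.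
        assert (INR j / INR (S n) <= 1 - r0); [|lra].
        apply Rmult_le_reg_r with (INR (S n)); auto.
        unfold Rdiv; rewrite Rmult_assoc, Rinv_l, Rmult_1_r by lra; lra.
      - rewrite <- exp_0; apply exp_increasing; lra. }
    set (t := q ^ j) in *; split; [apply radial_lim; auto; lra|].
    specialize (Hrad t ltac:(lra)); specialize (Hg t Ht).
    set (G := (1 - t) ^ 2 * Cmod (ecoef a (t * xi)%C 0)) in *.
    assert (HGg : G <= growth f t).
    { unfold growth, G, Rdiv; rewrite Rmult_assoc; apply Rmult_le_compat_l; [apply pow2_ge_0|].
      assert (Hm : Cmod (t * xi)%C = t) by (rewrite Cmod_scal, Hxi by lra; ring).
      assert (HM : Cmod (f (t * xi)%C) <= Minf t f) by (apply (Minf_spec a f); auto; lra).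
      rewrite Hf, ev_ecoef0, Cmod_mult, Hm in HM by (auto; lra).
      apply Rmult_le_reg_l with t; [lra|].
      replace (t * (Minf t f * / t)) with (Minf t f) by (field; lra); exact HM. }
    pose proof (ln_le alpha G Hal Hrad); pose proof (ln_le G (growth f t) ltac:(lra) HGg).
    apply Rabs_le; apply Rabs_le_between in HL; lra. }
(* Bazilevich's bound contributes - (ln alpha)/2 and the Cesaro mean about ln alpha; delta and the
   Tauberian error take at most tau/2 each. *)
eapply Rle_trans; [now apply coef_le_milin|]; apply Rmult_le_compat_l; [lra|].
pose proof (milin_le_radial a xi n _ Hxi HB) as HM.
apply Rabs_le_between in HCes; apply Rabs_le_between in HL.
apply exp_le; lra.
Qed.

Theorem theorem1
  (fs : nat -> C -> C) (a : nat -> nat -> C) (f : C -> C)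
  (alphas : nat -> R) (alpha : R) (eps : R) :
  0 < eps ->
  (forall m : nat, schlicht_coeffs (fs m) (a m)) ->
  schlicht f ->
  loc_unif_conv_disk fs f ->
  (forall m : nat, is_hayman_index (fs m) (alphas m)) ->
  is_hayman_index f alpha ->
  is_lim_seq alphas alpha ->
  exists N : nat, forall m n : nat, (N < m)%nat -> (N < n)%nat ->
    Cmod (a m n) / INR n < eps + sqrt (alphas m).
Proof.
intros Heps Ha [b Hb] Hconv Hhm Hh Hlim.
assert (Hu : forall m, univ (a m) /\ forall z, Cmod z < 1 -> fs m z = ev (a m) z)
  by (intros; now apply schlicht_coeffs_univ).
destruct (schlicht_coeffs_univ f b Hb) as [Hub Hf].
pose proof (hayman_ge0 b f alpha Hub Hf Hh) as Hal0.
apply is_lim_seq_spec in Hlim.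
destruct (Rle_lt_or_eq_dec 0 alpha Hal0) as [Hal|Hal].
(* exp tau exceeds 1 by so little that sqrt alpha_m (exp tau - 1) < eps whenever alpha_m <= alpha +
   1. *)
- set (tau := ln (1 + eps / (sqrt (alpha + 1) + 1))).
  assert (Hsq : 0 <= sqrt (alpha + 1)) by apply sqrt_pos.
  assert (Hq : 0 < eps / (sqrt (alpha + 1) + 1)) by (apply Rdiv_lt_0_compat; lra).
  assert (Htau : 0 < tau) by (unfold tau; rewrite <- ln_1; apply ln_increasing; lra).
  (* Eventually alpha_m >= alpha/2, so this constant bounds - 2 ln alpha_m for all large m. *)
  destruct (coef_le_positive (Rmax 0 (- 2 * ln (alpha / 2))) tau (Rmax_l _ _) Htau)
    as (J & delta & Hdelta & Hmain).
  destruct (growth_eventually fs a f b alpha (alpha * exp delta) Hu Hub Hf Hconv Hh)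
    as (r0 & N1 & Hr0 & Hgr).
  { rewrite <- (Rmult_1_r alpha) at 1; apply Rmult_lt_compat_l; auto.
    rewrite <- exp_0; now apply exp_increasing. }
  (* The three terms give alpha_m <= alpha + 1, alpha_m >= alpha/2 and alpha_m >= alpha exp (-
     delta). *)
  set (c := Rmin (Rmin 1 (alpha / 2)) (alpha * (1 - exp (- delta)))).
  assert (He1 : exp (- delta) < 1) by (rewrite <- exp_0; apply exp_increasing; lra).
  assert (Hc : 0 < c).
  { repeat apply Rmin_glb_lt; try lra; apply Rmult_lt_0_compat; lra. }
  destruct (Hlim (mkposreal c Hc)) as [N2 HN2]; simpl pos in HN2.
  destruct (INR_unbounded (INR J / (1 - r0))) as [N3 HN3].
  exists (N1 + N2 + N3)%nat; intros m n Hm Hn.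
  destruct n as [|n]; [lia|].
  destruct (Hu m) as [Hum Hfm]; specialize (HN2 m ltac:(lia)).
  apply Rabs_def2 in HN2.
  pose proof (Rmin_l (Rmin 1 (alpha / 2)) (alpha * (1 - exp (- delta)))) as Hc1.
  pose proof (Rmin_r (Rmin 1 (alpha / 2)) (alpha * (1 - exp (- delta)))) as Hc2.
  pose proof (Rmin_l 1 (alpha / 2)); pose proof (Rmin_r 1 (alpha / 2)).
  fold c in Hc1, Hc2.
  assert (Ham : alpha / 2 <= alphas m) by lra.
  assert (HN : 0 < INR (S n)) by (apply lt_0_INR; lia).
  (* The upper estimate comes from [growth], which dominates the Hayman index at every radius. *)
  assert (Hup : alphas m <= alpha * exp delta).
  { eapply Rle_trans; [apply (hayman_le_growth (a m) (fs m) _ r0); auto|]; apply Hgr; [lia|lra]. }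
  assert (Hlow : alpha * exp (- delta) <= alphas m) by lra.
  assert (Hlnx : forall d, ln (alpha * exp d) = ln alpha + d).
  { intros d; rewrite ln_mult, ln_exp; auto using exp_pos. }
  assert (Hbd : Cmod (a m (S n)) <= INR (S n) * exp (/ 2 * ln (alphas m) + tau)).
  { apply (Hmain (a m) (fs m) (alphas m) (ln alpha) n r0); auto; try lra.
    - eapply Rle_trans; [|apply Rmax_r]; pose proof (ln_le (alpha / 2) (alphas m)); lra.
    - pose proof (ln_le _ _ (Rlt_le_trans 0 (alpha / 2) (alphas m) ltac:(lra) Ham) Hup) as E1; rewrite Hlnx in E1.
      pose proof (ln_le _ _ (Rmult_lt_0_compat _ _ Hal (exp_pos (- delta))) Hlow) as E2.
      rewrite Hlnx in E2; apply Rabs_le; lra.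
    - intros t Ht; rewrite <- Hlnx; apply ln_le; [|apply Hgr; auto; lia].
      apply Rlt_le_trans with (alphas m); [lra|]; apply (hayman_le_growth (a m)); auto; lra.
    - assert (HSn : INR N3 <= INR (S n)) by (apply le_INR; lia).
      apply Rmult_le_reg_r with (/ (1 - r0)); [apply Rinv_0_lt_compat; lra|].
      replace ((1 - r0) * INR (S n) * / (1 - r0)) with (INR (S n)) by (field; lra).
      unfold Rdiv in HN3; lra. }
  assert (Hs : sqrt (alphas m) = exp (/ 2 * ln (alphas m))).
  { rewrite <- (Rpower_sqrt (alphas m)) by lra; unfold Rpower; f_equal; field. }
  rewrite exp_plus, <- Hs in Hbd; unfold tau in Hbd; rewrite exp_ln in Hbd by lra.
  apply Rle_lt_trans with (sqrt (alphas m) * (1 + eps / (sqrt (alpha + 1) + 1))).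
  + apply Rmult_le_reg_r with (INR (S n)); auto.
    unfold Rdiv at 1; rewrite Rmult_assoc, Rinv_l, Rmult_1_r by lra; lra.
  + assert (Hsm : sqrt (alphas m) <= sqrt (alpha + 1)) by (apply sqrt_le_1_alt; lra).
    assert (Hlt : sqrt (alphas m) * (eps / (sqrt (alpha + 1) + 1)) < eps); [|lra].
    apply Rle_lt_trans with (sqrt (alpha + 1) * (eps / (sqrt (alpha + 1) + 1))).
    * apply Rmult_le_compat_r; lra.
    * replace eps with ((sqrt (alpha + 1) + 1) * (eps / (sqrt (alpha + 1) + 1))) at 2 by (field; lra).
      apply Rmult_lt_compat_r; lra.
- subst alpha.
  (* Chosen so that exp (1 + ln (8 eta)/2) = eps exp (- 1), which is below eps. *)
  set (eta := (eps * exp (- 2)) ^ 2 / 8).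
  assert (Hee : 0 < eps * exp (- 2)) by (apply Rmult_lt_0_compat; auto using exp_pos).
  assert (Heta : 0 < eta) by (unfold eta; pose proof (pow_lt _ 2 Hee); lra).
  destruct (growth_eventually fs a f b 0 eta Hu Hub Hf Hconv Hh Heta) as (r0 & N1 & Hr0 & Hgr).
  destruct (INR_unbounded (/ (1 - r0))) as [N3 HN3].
  exists (N1 + N3)%nat; intros m n Hm Hn.
  destruct n as [|n]; [lia|].
  destruct (Hu m) as [Hum Hfm].
  assert (HN : 0 < INR (S n)) by (apply lt_0_INR; lia).
  assert (Hrad : / (2 * INR (S n)) <= 1 - r0).
  { rewrite <- (Rinv_inv (1 - r0)); apply Rinv_le_contravar; [apply Rinv_0_lt_compat; lra|].
    assert (INR N3 <= INR (S n)) by (apply le_INR; lia); lra. }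
  assert (Hrad0 : 0 < / (2 * INR (S n))) by (apply Rinv_0_lt_compat; lra).
  assert (Hbd : Cmod (a m (S n)) <= INR (S n) * exp (1 + / 2 * ln (8 * eta))).
  { apply (coef_le_growth (a m) (fs m)); auto; apply Hgr; [lia|lra]. }
  replace (8 * eta) with ((eps * exp (- 2)) ^ 2) in Hbd by (unfold eta; field).
  rewrite ln_sq, ln_mult, ln_exp in Hbd by auto using exp_pos.
  replace (1 + / 2 * (2 * (ln eps + - 2))) with (ln eps + - 1) in Hbd by field.
  rewrite exp_plus, exp_ln in Hbd by auto.
  assert (Hx : exp (- 1) < 1) by (rewrite <- exp_0; apply exp_increasing; lra).
  pose proof (sqrt_pos (alphas m)) as Hsq.
  apply Rlt_le_trans with eps; [|lra].
  apply Rle_lt_trans with (eps * exp (- 1)).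
  + apply Rmult_le_reg_r with (INR (S n)); auto.
    unfold Rdiv; rewrite Rmult_assoc, Rinv_l, Rmult_1_r by lra; lra.
  + rewrite <- (Rmult_1_r eps) at 2; apply Rmult_lt_compat_l; auto.
Qed.
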